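(* For each $n\ge1$ let $\boldsymbol w=(w_i)_{i\in[n]}$ (depending on $n$) be nonnegative weights with $L_n=\sum_{i\in[n]}w_i=\omega(\log n)$. Let $\rho_n=\frac1{\sqrt{L_n}}\sum_{i\in[n]}\delta_{w_i/\sqrt{L_n}}$. Suppose that (i) $\rho_n$ converges vaguely to some measure $\rho_w$; (ii) $\lim_{\varepsilon\to0}\limsup_{n\to\infty}\int_0^\varepsilon x\rho_n(dx)=\lim_{\varepsilon\to0}\liminf_{n\to\infty}\int_0^\varepsilon x\rho_n(dx)=a$ for some constant $a$; (iii) $\liminf_{n\to\infty}\int_0^\infty\int_0^\infty\frac{xy}{1+xy}\rho_n(dx)\rho_n(dy)>0$. Then the limit of any a.s. $\mathbb P_{\mathrm{GRG}}$ (sampling) convergent subsequence of $\mathrm{GRG}_n(\boldsymbol w)$ is of the form $\mathcal W^C_{\mathrm{GRG}}$ for some constant $C>0$, where $\mathcal W^C_{\mathrm{GRG}}=(W^C_{\mathrm{GRG}},S^C_{\mathrm{GRG}},I^C_{\mathrm{GRG}})$ with $$W^C_{\mathrm{GRG}}(x,y)=\begin{cases}\dfrac{\bar\rho_w^{-1}(\sqrt C\,x)\bar\rho_w^{-1}(\sqrt C\,y)}{1+\bar\rho_w^{-1}(\sqrt C\,x)\bar\rho_w^{-1}(\sqrt C\,y)},&x\ne y\\0,&x=y,\end{cases}\qquad S^C_{\mathrm{GRG}}(x)=\frac a{\sqrt C}\bar\rho_w^{-1}(\sqrt C\,x),\qquad I^C_{\mathrm{GRG}}=\frac{a^2}{2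C}.$$
   Context: $\mathrm{GRG}_n(\boldsymbol w)$ is the random simple graph on $[n]$ in which each pair $i\ne j$ is connected independently with probability $p_{ij}=\frac{w_iw_j}{L_n+w_iw_j}$. $\mathbb P_{\mathrm{GRG}}$ is the joint law of the sequence, the graphs being independent for different $n$. $\rho_n,\rho_w$ are measures on $(0,\infty)$, vague convergence is on $(0,\infty)$. For a measure $\rho$ on $(0,\infty)$: $\bar\rho(x)=\int_x^\infty\rho(dy)$, $\bar\rho^{-1}(y)=\inf\{x\in\mathbb R_+:\bar\rho(x)\le y\}$ for $y>0$, $\bar\rho^{-1}(0)=0$. Sampling: $e(G)$ is the number of non-loop edges. $\mathrm{Smpl}(G,p)$ is the unlabeled random graph obtained by keeping each vertex independently with probability $p$, taking induced edges and deleting isolated vertices. $(G_n)$ is sampling convergent to a graphex $\mathcal W$ if for all $t>0$, $\mathrm{Smpl}(G_n,t/\sqrt{2e(G_n)})$ converges in distribution (in the countable discrete space of finite unlabeled graphs) to $\mathrm{GP}_t(\mathcal W)$. For random graphs, ''a.s.'' means for almost every realization of the graph sequence, the law of the sample being conditional on the graphs. A graphex is a triple $\mathcal W=(W,S,I)$ with $W:\mathbb R_+^2\to[0,1]$ symmetric measurable, $S:\mathbb R_+\to\mathbb R_+$ measurable, $I\ge0$, such that $\min\{S,1\}$ is integrable and, with $\mu_W(x)=\int W(x,y)dy$ and $\Lambda$ Lebesgue measure, (a) $\Lambda(\{\mu_W=\infty\})=0$, $\Lambda(\{\mu_W>1\})<\infty$; (b) $\int W(x,y)\mathbf 1\{\mu_W(x)\le1\}\mathbf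 1\{\mu_W(y)\le1\}dy\,dx<\infty$; (c) $\int W(x,x)dx<\infty$. $\mathrm{GP}_t(\mathcal W)$ has the law of the following random unlabeled graph: take a Poisson process $\{v_j\}$ of rate $t$ on $\mathbb R_+$ as vertices; independently, connect $v_i,v_j$ ($i\ne j$) with probability $W(v_i,v_j)$; put a loop at $v_j$ with probability $W(v_j,v_j)$; attach $\mathrm{Poisson}(tS(v_j))$ pendant edges to $v_j$; add $\mathrm{Poisson}(t^2I)$ isolated edges; discard isolated vertices and labels. *)

(* Defs.v *)
From HB Require Import structures.
From mathcomp Require Import all_boot all_order all_algebra.
From mathcomp Require Import all_classical all_reals all_analysis.
Set Implicit Arguments.
Unset Strict Implicit.
Unset Printing Implicit Defensive.
Import Order.TTheory GRing.Theory Num.Theory.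
Import numFieldNormedType.Exports.
Local Open Scope classical_set_scope.
Local Open Scope ring_scope.

Record fgraph := FGraph { fg_size : nat; fg_adj : rel 'I_fg_size }.

(* An unlabeled graph is an isomorphism class of finite labeled graphs. *)
Definition ugraph := set fgraph.

(* The unlabeled graph obtained from the (symmetric) adjacency relation [adj]
   by deleting isolated vertices and forgetting labels. A vertex is isolated
   when no edge and no loop is incident to it. If infinitely many vertices
   remain, the result is [set0], which is not the class of a finite graph. *)
Definition unlabel (V : Type) (adj : V -> V -> Prop) : ugraph :=
  [set g | exists f : 'I_(fg_size g) -> V,
     [/\ injective f,
         range f = [set x | exists y, adj x y] &
         forall i j, adj (f i) (f j) <-> fg_adj i j]].

Definition simple_graph n (g : rel 'I_n) := symmetric g /\ irreflexive g.

Definition num_edges n (g : rel 'I_n) : nat :=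
  #|[pred x : 'I_n * 'I_n | (x.1 < x.2)%N && g x.1 x.2]|.

(* [smpl_law g p A] is the probability that Smpl(g, p) belongs to [A]; the sum
   ranges over the set [V] of kept vertices. *)
Definition smpl_law (R : realType) n (g : rel 'I_n) (p : R) (A : set ugraph) : R :=
  \sum_(V : {set 'I_n})
     p ^+ #|V| * (1 - p) ^+ (n - #|V|) *
     \1_A (unlabel (fun x y : 'I_n => [/\ x \in V, y \in V & g x y])).

(* Truncated at 1 so as to be a probability for every [g]; when [g] has no
   edge the quotient is 0. *)
Definition smpl_prob (R : realType) n (g : rel 'I_n) (t : R) : R :=
  Num.min 1 (t / Num.sqrt (2 * (num_edges g)%:R)).

Record graphex_triple (R : realType) := GraphexTriple {
  gW : R -> R -> R;
  gS : R -> R;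
  gI : R }.

Section graphex.
Context (R : realType).
Local Notation Rplus := (`[0, +oo[%classic : set R).
Local Notation Lambda := (@lebesgue_measure R).

Definition mu_W (W : R -> R -> R) (x : R) : \bar R :=
  (\int[Lambda]_(y in Rplus) (W x y)%:E)%E.

Definition is_graphex (g : graphex_triple R) : Prop :=
  let W := gW g in let S := gS g in
  let low := \1_[set x | (mu_W W x <= 1)%E] : R -> R in
  [/\ (forall x y, 0 <= x -> 0 <= y -> 0 <= W x y <= 1 /\ W x y = W y x) /\
        measurable_fun (Rplus `*` Rplus) (fun z : R * R => W z.1 z.2),
      (forall x, 0 <= x -> 0 <= S x) /\ measurable_fun Rplus S /\ 0 <= gI g,
      (\int[Lambda]_(x in Rplus) (Num.min (S x) 1)%:E < +oo)%E,
      Lambda (Rplus `&` [set x | mu_W W x = +oo%E]) = 0%E /\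
        (Lambda (Rplus `&` [set x | (1 < mu_W W x)%E]) < +oo)%E &
      (\int[Lambda]_(x in Rplus) \int[Lambda]_(y in Rplus)
          (W x y * low x * low y)%:E < +oo)%E /\
        (\int[Lambda]_(x in Rplus) (W x x)%:E < +oo)%E].

End graphex.

(* The library's [poisson_pmf] has value 1 everywhere at rate 0. *)
Definition poisson_mass (R : realType) (r : R) (k : nat) : R :=
  r ^+ k / k`!%:R * expR (- r).

(* If [u] is uniform on [0, 1] and [N] is the Poisson([r]) quantile of [u],
   that is, the least [k] such that [u] is at most the distribution function
   at [k], then [poisson_exceeds r u k] says that [k < N]. *)
Definition poisson_exceeds (R : realType) (r u : R) (k : nat) : bool :=
  \sum_(i < k.+1) poisson_mass r i < u.

Definition mutually_independent d (T : measurableType d) (R : realType)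
    (P : probability T R) (I : Type) (F : I -> set (set T)) : Prop :=
  forall (n : nat) (i : 'I_n -> I) (E : 'I_n -> set T),
    injective i -> (forall k, F (i k) (E k)) ->
    P (\bigcap_k E k) = (\prod_(k < n) fine (P (E k)))%:E.

(* [v] enumerates the points of a Poisson process of rate [t] on [0, +oo[. *)
Definition poisson_process d (T : measurableType d) (R : realType)
    (P : probability T R) (t : R) (v : nat -> {RV P >-> R}) : Prop :=
  (forall j omega, 0 <= v j omega) /\
  forall (m : nat) (A : 'I_m -> set R) (k : 'I_m -> nat),
    (forall i, measurable (A i)) -> (forall i, A i `<=` `[0, +oo[) ->
    (forall i, (lebesgue_measure (A i) < +oo)%E) -> trivIset setT A ->
    P [set omega | forall i, ([set j | A i (v j omega)] #= `I_(k i))%card] =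
    (\prod_(i < m) poisson_mass (t * fine (lebesgue_measure (A i))) (k i))%:E.

Inductive mark := EdgeMark of nat & nat | PendantMark of nat | IsolatedMark.

(* The randomness driving a graphex process: the Poisson process of vertices,
   and independent uniform variables, independent of it, which decide the
   edges. They serve for all graphexes at once. *)
Record gp_noise d (T : measurableType d) (R : realType) (P : probability T R)
    (t : R) := GPNoise {
  gp_point : nat -> {RV P >-> R};
  gp_unif : mark -> {RV P >-> R};
  point_poisson : poisson_process t gp_point;
  unif_uniform : forall m x, 0 <= x <= 1 ->
    P [set omega | gp_unif m omega <= x] = x%:E;
  noise_independent : mutually_independent P (fun i : option mark =>
    match i with
    | None => <<s [set E | exists j B, measurable B /\ E = gp_point j @^-1` B] >>
    | Some m => [set E | exists B, measurable B /\ E = gp_unif m @^-1` B]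
    end) }.

(* [Leaf j k] is the end of the [k]-th pendant edge at [Point j], and
   [Isol k b], for [b : bool], are the two ends of the [k]-th isolated edge. *)
Inductive gp_vertex := Point of nat | Leaf of nat & nat | Isol of nat & bool.

Definition gp_adj d (T : measurableType d) (R : realType) (P : probability T R)
    (t : R) (X : gp_noise P t) (g : graphex_triple R) (omega : T)
    (x y : gp_vertex) : Prop :=
  let v j := gp_point X j omega in let u m := gp_unif X m omega in
  match x, y with
  | Point i, Point j => u (EdgeMark (minn i j) (maxn i j)) < gW g (v i) (v j)
  | Point i, Leaf j k | Leaf j k, Point i =>
      i = j /\ poisson_exceeds (t * gS g (v j)) (u (PendantMark j)) k
  | Isol k b, Isol l c =>
      [/\ k = l, b <> c & poisson_exceeds (t ^+ 2 * gI g) (u IsolatedMark) k]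
  | _, _ => False
  end.

(* [mu] is the law of GP_t(g). *)
Definition gp_law (R : realType) (t : R) (g : graphex_triple R)
    (mu : set ugraph -> \bar R) : Prop :=
  exists (d : measure_display) (T : measurableType d) (P : probability T R)
    (X : gp_noise P t),
    forall A : set ugraph, mu A = P [set omega | A (unlabel (gp_adj X g omega))].

(* The space of finite unlabeled graphs is countable and discrete, so every
   set of unlabeled graphs has empty boundary, and convergence in distribution
   is convergence of the probabilities of all sets. *)
Definition sampling_convergent (R : realType) (N : nat -> nat)
    (G : forall m, rel 'I_(N m)) (g : graphex_triple R) : Prop :=
  is_graphex g /\
  forall t : R, 0 < t -> exists mu, gp_law t g mu /\
    forall A : set ugraph,
      (smpl_law (G m) (smpl_prob (G m) t) A)%:E @[m --> \oo] --> mu A.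

(* A limit in the sense of [sampling_convergent] is determined only up to this
   relation. *)
Definition graphex_equiv (R : realType) (g g' : graphex_triple R) : Prop :=
  forall t : R, 0 < t -> exists mu, gp_law t g mu /\ gp_law t g' mu.

(* Weights form a triangular array: only [w n i] with [i < n] is relevant. *)
Definition total_weight (R : realType) (w : nat -> nat -> R) (n : nat) : R :=
  \sum_(i < n) w n i.

Definition grg_prob (R : realType) (w : nat -> nat -> R) (n i j : nat) : R :=
  w n i * w n j / (total_weight w n + w n i * w n j).

(* The probability that GRG_n(w) is the simple graph [g]. *)
Definition grg_pmf (R : realType) (w : nat -> nat -> R) (n : nat)
    (g : rel 'I_n) : R :=
  \prod_(i < n) \prod_(j < n | (i < j)%N)
    (if g i j then grg_prob w n i j else 1 - grg_prob w n i j).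

(* The graphs [G n] have the laws of GRG_n(w) and are independent. *)
Definition grg_sequence d (T : measurableType d) (R : realType)
    (P : probability T R) (w : nat -> nat -> R) (G : forall n, T -> rel 'I_n) :
    Prop :=
  [/\ forall n omega, simple_graph (G n omega),
      forall n (g : rel 'I_n), measurable [set omega | G n omega =2 g] &
      forall (N : nat) (g : forall n, rel 'I_n),
        (forall n, simple_graph (g n)) ->
        P [set omega | forall n, (n < N)%N -> G n omega =2 g n] =
        (\prod_(n < N) grg_pmf w (g n))%:E].

(* A measure on the open half-line is a measure on [R] without mass outside. *)
Definition rho (R : realType) (w : nat -> nat -> R) (n : nat) :
    set R -> \bar R :=
  mrestr
    (mscale ((Num.sqrt (total_weight w n))^-1)%:nng
       (msum (fun i => \d_(w n i / Num.sqrt (total_weight w n))) n))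
    (measurable_itv `]0, +oo[).

HB.instance Definition _ (R : realType) (w : nat -> nat -> R) (n : nat) :=
  Measure.on (rho w n).

Definition vague_cvg (R : realType) (m : nat -> {measure set R -> \bar R})
    (l : {measure set R -> \bar R}) : Prop :=
  forall f : R -> R, continuous f ->
    (exists b c : R, 0 < b /\ forall x, f x != 0 -> b <= x <= c) ->
    (\int[m n]_(x in `]0%R, +oo[) (f x)%:E)%E @[n --> \oo] -->
    (\int[l]_(x in `]0%R, +oo[) (f x)%:E)%E.

Definition tail (R : realType) (m : {measure set R -> \bar R}) (x : R) : \bar R :=
  m `]x, +oo[%classic.

Definition tail_inv (R : realType) (m : {measure set R -> \bar R}) (y : R) : R :=
  if y == 0 then 0 else inf [set x | 0 <= x /\ (tail m x <= y%:E)%E].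

Definition grg_graphex (R : realType) (m : {measure set R -> \bar R}) (a C : R) :
    graphex_triple R :=
  let q x := tail_inv m (Num.sqrt C * x) in
  {| gW := fun x y => if x == y then 0 else q x * q y / (1 + q x * q y);
     gS := fun x => a / Num.sqrt C * q x;
     gI := a ^+ 2 / (2 * C) |}.

(* Main.v *)
From HB Require Import structures.
Require Import Defs.
From mathcomp Require Import all_boot all_order all_algebra.
From mathcomp Require Import all_classical all_reals all_analysis.
From mathcomp Require Import measurable_realfun lra zify.
Set Implicit Arguments.
Unset Strict Implicit.
Unset Printing Implicit Defensive.
Import Order.TTheory GRing.Theory Num.Theory.
Import numFieldNormedType.Exports.
Local Open Scope classical_set_scope.
Local Open Scope ring_scope.

(** Let [x i = w n i / sqrt (L n)], so that the pair [i, j] is an edge with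
    probability [wf (x i * x j)], where [wf u = u / (1 + u)]. The mean of
    [wf (x i * x j)] in condition (iii), [double_mean], lies between a positive
    constant and [1], hence converges to some [C > 0] along a further subsequence.
    Along it the number of edges is close to [C * L n / 2], by Chebyshev's
    inequality, and the sampling law at time [t] changes little when the retention
    probability is replaced by [(t / sqrt C) / sqrt (L n)], because it is a
    Lipschitz function of the squared probability ([smpl_law_lip]).

    With this retention probability, the mean of the sampling law over the random
    graph converges to the law of the graphex process of [grg_graphex rho_w a C]
    ([annealed_cvg]). Let [tau = t / sqrt C]. The relative weights of the kept
    vertices, away from zero, approach a Poisson process of intensity
    [tau * rho_w], which is the image of the Poisson process of rate [t] under
    [vweight]. The remaining kept vertices are light, and their total weight is
    close to [s = tau * a]. As [wf u] is close to [u] for small [u], the number of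
    edges from a vertex of weight [y] to light vertices is nearly Poisson of mean
    [s * y], that of edges between light vertices nearly Poisson of mean
    [s ^+ 2 / 2], and no light vertex has two neighbours: these are the pendant
    and the isolated edges of the limit. To make this quantitative, the weights
    are rounded down to a geometric grid that avoids the atoms of [rho_w], and
    both processes are compared with the same star graphs, from below for the
    sample ([annealed_ge]) and from above for the graphex process
    ([graph_event_le]). These bounds hold for every event, so taking complements
    yields the limit.

    It remains to pass from the mean to almost every realization. The
    probabilities that the samples belong to a fixed event are independent for
    different [n]. If their means tend to [l], then for [del > 0] almost surely
    they do not eventually all exceed [l + del]: each does so with probability
    bounded away from [1], by Markov's inequality ([pr_all_exceed]). Hence a limit
    along a realization is at most [l], and, by the same bound for the
    complementary event, equal to it. Countably many events suffice: finite
    unlabeled graphs are countable, and rational times determine the others by the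
    Lipschitz bound ([smpl_at_lip]). *)

(** * Independent coins *)

Section coin.
Context (R : realType) (I : eqType).
Implicit Types (p : I -> R) (s : seq I) (F H : (I -> bool) -> R) (g : I -> bool).

Definition upd g (i : I) (b : bool) : I -> bool :=
  fun j => if j == i then b else g j.

(** Expectation of [F] when the coordinates in [s] are independent coins with
    success probabilities [p] and the other coordinates are those of [g]. The
    recursion reveals one coin at a time, so that independence, variances and
    union bounds are proved by induction on [s]. *)
Fixpoint coin p s F g : R :=
  if s is i :: s' then
    (1 - p i) * coin p s' F (upd g i false) + p i * coin p s' F (upd g i true)
  else F g.

Definition prob_vec p := forall i, 0 <= p i <= 1.

Lemma coin_ext p s F H g : (forall g', F g' = H g') -> coin p s F g = coin p s H g.
Proof. by move=> FH; congr coin; apply/funext. Qed.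

Lemma coinD p s F H g :
  coin p s (fun g => F g + H g) g = coin p s F g + coin p s H g.
Proof. by elim: s g => //= i s IH g; rewrite !IH; lra. Qed.

Lemma coinZ p s c F g : coin p s (fun g => c * F g) g = c * coin p s F g.
Proof. by elim: s g => //= i s IH g; rewrite !IH; lra. Qed.

Lemma coin_cst p s c g : coin p s (fun=> c) g = c.
Proof. by elim: s g => //= i s IH g; rewrite !IH; lra. Qed.

Lemma coin_sum (J : Type) (r : seq J) (Q : pred J) (F : J -> (I -> bool) -> R) p s g :
  coin p s (fun g => \sum_(j <- r | Q j) F j g) g =
  \sum_(j <- r | Q j) coin p s (F j) g.
Proof.
elim: r => [|j r IH].
  by rewrite big_nil -[RHS](coin_cst p s 0 g); apply: coin_ext => g'; rewrite big_nil.
rewrite big_cons -IH; case: ifPn => Qj.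
  by rewrite -coinD; apply: coin_ext => g'; rewrite big_cons Qj.
by apply: coin_ext => g'; rewrite big_cons (negbTE Qj).
Qed.

Lemma ler_coin p s F H g : prob_vec p ->
  (forall g', F g' <= H g') -> coin p s F g <= coin p s H g.
Proof.
move=> p01 FH; elim: s g => //= i s IH g.
by have /andP[p0 p1] := p01 i; rewrite lerD// ler_wpM2l// subr_ge0.
Qed.

Lemma eq_coin_reach p s F H g :
  (forall g', (forall j, j \notin s -> g' j = g j) -> F g' = H g') ->
  coin p s F g = coin p s H g.
Proof.
elim: s g => [|i s IH] g FH /=; first exact: FH.
congr (_ * _ + _ * _); apply: IH => g' gg'; apply: FH => j;
  rewrite in_cons negb_or => /andP[ji js]; rewrite gg'// /upd (negbTE ji)//.
Qed.

Lemma coin_ge0 p s F g : prob_vec p -> (forall g', 0 <= F g') -> 0 <= coin p s F g.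
Proof. by move=> p01 F0; rewrite -[leLHS](coin_cst p s 0 g); apply: ler_coin. Qed.

Lemma coin_norm p s F g : prob_vec p ->
  `|coin p s F g| <= coin p s (fun g => `|F g|) g.
Proof.
move=> p01; rewrite ler_norml -[X in X <= _]mulN1r -coinZ.
by apply/andP; split; apply: ler_coin => // g'; rewrite ?mulN1r ?ler_norm// lerNl -normrN ler_norm.
Qed.

Definition dep F (D : pred I) :=
  forall g g', (forall i, D i -> g i = g' i) -> F g = F g'.

(** By induction on [s]: the coin revealed first influences only one of the two
    factors. *)
Lemma coin_indep p s F H (D : pred I) g : dep F D -> dep H (predC D) ->
  coin p s (fun g => F g * H g) g = coin p s F g * coin p s H g.
Proof.
move=> FD HD; elim: s g => //= i s IH g; rewrite !IH.
have dF s' F' D' g1 g2 : dep F' D' -> (forall j, D' j -> g1 j = g2 j) ->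
    coin p s' F' g1 = coin p s' F' g2.
  move=> FD'; elim: s' g1 g2 => [|j s' IH'] g1 g2 g12 /=; first exact: FD'.
  by congr (_ * _ + _ * _); apply: IH' => k Dk; rewrite /upd; case: eqP => // _; apply: g12.
case: (boolP (D i)) => Di.
  rewrite (dF s H _ (upd g i false) (upd g i true) HD); first by lra.
  by move=> j /negP Dj; rewrite /upd; case: eqP => // ji; rewrite ji in Dj.
rewrite (dF s F _ (upd g i false) (upd g i true) FD); first by lra.
by move=> j Dj; rewrite /upd; case: eqP => // ji; rewrite -ji Dj in Di.
Qed.

(** The blocks are the fibres of [col]; they are separated one at a time by
    [coin_indep]. *)
Lemma coin_indep_prod (M : eqType) (col : I -> M) (ms : seq M)
    (F : M -> (I -> bool) -> R) p s g : uniq ms ->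
  (forall m, dep (F m) (fun i => col i == m)) ->
  coin p s (fun g => \prod_(m <- ms) F m g) g = \prod_(m <- ms) coin p s (F m) g.
Proof.
move=> + Fdep; elim: ms => [|m ms IH] /=.
  by move=> _; rewrite big_nil -[RHS](coin_cst p s 1 g); apply: coin_ext => g'; rewrite big_nil.
case/andP=> mms ums; rewrite big_cons -IH//.
rewrite -(@coin_indep _ _ _ _ (fun i => col i == m))//; last first.
  move=> g1 g2 g12; apply: eq_big_seq => m' m'ms; apply: Fdep => i /eqP im'.
  apply: g12 => /=; rewrite im'; apply: contraNN mms => /eqP <- //.
by apply: coin_ext => g'; rewrite big_cons.
Qed.

Lemma coin_notin p s F g i : i \notin s -> dep F (pred1 i) -> coin p s F g = F g.
Proof.
move=> + Fi; elim: s g => //= j s IH g; rewrite in_cons negb_or => /andP[ij si].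
rewrite !IH// !(Fi (upd g j _) g); first by lra.
all: by move=> k /eqP ->; rewrite /upd (negbTE ij).
Qed.

Lemma coin_coord p s g i (h : bool -> R) : uniq s -> i \in s ->
  coin p s (fun g => h (g i)) g = (1 - p i) * h false + p i * h true.
Proof.
have hd : dep (fun g => h (g i)) (pred1 i) by move=> g1 g2 /(_ i) -> //=.
elim: s g => //= j s IH g /andP[js us]; rewrite in_cons => /orP[/eqP ij|si].
  by rewrite ij in hd *; rewrite !(coin_notin _ _ js hd) /upd eqxx.
by rewrite !IH//; lra.
Qed.

Lemma coin_prod_coord p s g (h : I -> bool -> R) : uniq s ->
  coin p s (fun g => \prod_(i <- s) h i (g i)) g =
  \prod_(i <- s) ((1 - p i) * h i false + p i * h i true).
Proof.
move=> us; rewrite (@coin_indep_prod _ id s (fun i g => h i (g i)))//.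
  by apply: eq_big_seq => i si; rewrite (coin_coord _ _ (h i)).
by move=> m g1 g2 g12; rewrite g12.
Qed.

(** The cross terms vanish because distinct coins are uncorrelated. *)
Lemma coin_variance p s g (a : I -> R) (c : R) : uniq s ->
  coin p s (fun g => (c + \sum_(i <- s) a i * ((g i)%:R - p i)) ^+ 2) g =
  c ^+ 2 + \sum_(i <- s) a i ^+ 2 * (p i * (1 - p i)).
Proof.
elim: s g c => [|i s IH] g c /=; first by move=> _; rewrite !big_nil !addr0.
move=> /andP[si us]; rewrite big_cons.
have step b : coin p s (fun g => (c + \sum_(i <- i :: s) a i * ((g i)%:R - p i)) ^+ 2)
    (upd g i b) = (c + a i * (b%:R - p i)) ^+ 2 +
      \sum_(i <- s) a i ^+ 2 * (p i * (1 - p i)).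
  rewrite -(IH (upd g i b))//; apply: eq_coin_reach => g' /(_ _ si) g'i.
  by rewrite big_cons g'i /upd eqxx addrA.
rewrite !step /=; lra.
Qed.

End coin.

(** Connects the recursion with sums over subsets, the form in which [smpl_law]
    is defined. *)
Lemma coin_setE (R : realType) (I : finType) (p : I -> R) (F : (I -> bool) -> R) g0 :
  coin p (enum I) F g0 =
  \sum_(V : {set I}) (\prod_i (if i \in V then p i else 1 - p i)) *
     F (fun i => i \in V).
Proof.
transitivity (coin p (enum I) (fun g => \sum_(V : {set I})
    F (fun i => i \in V) * \prod_(i <- enum I) (g i == (i \in V))%:R) g0).
  apply: coin_ext => g; rewrite (bigD1 [set i | g i]%SET)//= [X in _ + X]big1 ?addr0.
    rewrite [X in _ * X]big1 ?mulr1; last by move=> i _; rewrite finset.in_set eqxx.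
    by congr F; apply/funext => i; rewrite finset.in_set.
  move=> V gV; have [i /negP giV] : exists i, ~ (g i == (i \in V)).
    apply/not_existsP => gE; move/eqP: gV; apply; apply/setP => i.
    by rewrite finset.in_set; have /contrapT/eqP := gE i.
  by rewrite (bigD1_seq i) ?mem_enum ?enum_uniq//= (negbTE giV) mul0r mulr0.
rewrite coin_sum; apply: eq_bigr => V _; rewrite coinZ mulrC; congr (_ * _).
rewrite (@coin_prod_coord _ _ _ _ _ (fun i b => (b == (i \in V))%:R)) ?enum_uniq//.
rewrite big_enum; apply: eq_bigr => i _.
by case: (i \in V) => /=; rewrite !(mulr0, mulr1, addr0, add0r).
Qed.

(** The hypothesis bounds the influence of a coin by the number of its
    neighbours, for the adjacency [a], among the other successful coins. When all
    coins have the same bias, the total influence is then quadratic in it: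
    exchanging the biases one coin at a time, the neighbours exchanged before
    contribute the new bias and the others the old one. *)
Lemma coin_lipschitz (R : realType) (I : finType) (a : I -> I -> R) (p p' : R)
    (F : (I -> bool) -> R) s g :
  uniq s -> 0 <= p <= 1 -> 0 <= p' <= 1 ->
  (forall i, a i i = 0) -> (forall i j, a i j = a j i) ->
  (forall g i, `|F (upd g i true) - F (upd g i false)| <=
     \sum_j a i j * (g j)%:R) ->
  `|coin (fun=> p') s F g - coin (fun=> p) s F g| <=
  `|p' - p| * (\sum_(i <- s) \sum_(j | j \notin s) a i j * (g j)%:R) +
  `|p' ^+ 2 - p ^+ 2| * ((\sum_(i <- s) \sum_(j <- s) a i j) / 2).
Proof.
move=> + p01 p'01 aii asym FL; have /andP[p0 p1] := p01; have /andP[p'0 p'1] := p'01.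
elim: s g => [|i s IH] g; first by rewrite /= subrr normr0 !big_nil mul0r !mulr0 addr0.
move=> /andP[si us] /=.
have updE b : coin (fun=> p) s F (upd g i b) =
    coin (fun=> p) s (fun g' => F (upd g' i b)) g.
  elim: s si us g {IH} => [//|k s IHs] /=; rewrite in_cons negb_or => /andP[ik si] /andP[_ us] g.
  congr (_ * _ + _ * _); rewrite -IHs//; congr (coin _ _ _ _); apply/funext => j;
    rewrite /upd; case: eqP => // ->; by rewrite eq_sym (negbTE ik).
have A10 : `|coin (fun=> p) s F (upd g i true) - coin (fun=> p) s F (upd g i false)| <=
    p * (\sum_(j <- s) a i j) + \sum_(j | j \notin s) a i j * (g j)%:R.
  rewrite !updE -mulN1r -coinZ -coinD.
  apply: le_trans (coin_norm _ _ _ _) _ => //.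
  apply: (@le_trans _ _ (coin (fun=> p) s (fun g => \sum_j a i j * (g j)%:R) g)).
    by apply: ler_coin => // g'; rewrite mulN1r.
  rewrite coin_sum (bigID (mem s))/= lerD//.
    rewrite mulr_sumr big_uniq//=; apply: ler_sum => j js; rewrite coinZ mulrC.
    by rewrite (coin_coord _ _ (fun b : bool => b%:R))// mulr0 add0r mulr1.
  apply: ler_sum => j js; rewrite coinZ (coin_notin _ _ js)//.
  by move=> g1 g2 /(_ j) ->//=.
have S1 b : \sum_(k <- s) \sum_(j | j \notin s) a k j * (upd g i b j)%:R =
    (\sum_(k <- s) a i k) * b%:R +
    \sum_(k <- s) \sum_(j | j \notin i :: s) a k j * (g j)%:R.
  rewrite mulr_suml -big_split; apply: eq_bigr => k _ /=.
  rewrite (bigD1 i)//= /upd eqxx asym; congr (_ + _).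
  apply: eq_big => [j|j /andP[_ /negbTE ->]//].
  by rewrite in_cons negb_or andbC.
have IH0 := IH (upd g i false) us; have IH1 := IH (upd g i true) us.
rewrite !S1 /= mulr0 mulr1 add0r in IH0 IH1.
have -> : \sum_(k <- i :: s) \sum_(j <- i :: s) a k j =
    2 * (\sum_(k <- s) a i k) + \sum_(k <- s) \sum_(j <- s) a k j.
  have E k : \sum_(j <- i :: s) a k j = a i k + \sum_(j <- s) a k j.
    by rewrite big_cons asym.
  rewrite big_cons big_cons aii add0r (eq_bigr _ (fun k _ => E k)).
  by rewrite big_split /= addrA; congr (_ + _); lra.
rewrite big_cons.
have S0 : \sum_(j | j \notin i :: s) a i j * (g j)%:R =
    \sum_(j | j \notin s) a i j * (g j)%:R.
  rewrite [RHS](bigD1 i)//= aii mul0r add0r; apply: eq_bigl => j.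
  by rewrite in_cons negb_or andbC.
rewrite S0.
move: IH0 IH1 A10; have -> : `|p' ^+ 2 - p ^+ 2| = `|p' - p| * (p' + p).
  by rewrite subr_sqr normrM (ger0_norm (addr_ge0 p'0 p0)).
set A'1 := coin (fun=> p') s F (upd g i true); set A'0 := coin (fun=> p') s F (upd g i false).
set A1 := coin (fun=> p) s F (upd g i true); set A0 := coin (fun=> p) s F (upd g i false).
set T1 := \sum_(k <- s) a i k; set T2 := \sum_(k <- s) \sum_(j <- s) _.
set T3 := \sum_(k <- s) _; set T4 := \sum_(j | _) _; set dp := `|p' - p|.
move=> IH0 IH1 A10.
have -> : (1 - p') * A'0 + p' * A'1 - ((1 - p) * A0 + p * A1) =
    (1 - p') * (A'0 - A0) + p' * (A'1 - A1) + (p' - p) * (A1 - A0) by lra.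
apply: le_trans (ler_normD _ _) _; apply: (@le_trans _ _
   ((1 - p') * `|A'0 - A0| + p' * `|A'1 - A1| + dp * `|A1 - A0|)).
  rewrite normrM -/dp lerD2r; apply: le_trans (ler_normD _ _) _.
  by rewrite !normrM (ger0_norm p'0) ger0_norm ?subr_ge0.
have h0 : (1 - p') * `|A'0 - A0| <= (1 - p') * (dp * T3 + dp * (p' + p) * (T2 / 2)).
  by rewrite ler_wpM2l ?subr_ge0.
have h1 := ler_wpM2l p'0 IH1.
have h2 := ler_wpM2l (normr_ge0 (p' - p)) A10.
apply: le_trans (lerD (lerD h0 h1) h2) _; rewrite -/dp.
suff : forall x y : R, x = y -> x <= y by apply; lra.
by move=> x y ->.
Qed.

(** * Poisson approximation *)

Section poisson_mass.
Context (R : realType).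
Implicit Types (r l m : R) (k : nat).

Lemma poisson_mass_ge0 r k : 0 <= r -> 0 <= poisson_mass r k.
Proof. by move=> r0; rewrite /poisson_mass !mulr_ge0 ?exprn_ge0 ?invr_ge0 ?expR_ge0. Qed.

Lemma poisson_mass0 k : poisson_mass (0 : R) k = (k == 0%N)%:R.
Proof.
rewrite /poisson_mass oppr0 expR0 mulr1; case: k => [|k]; last by rewrite expr0n mul0r.
by rewrite expr0 divr1.
Qed.

Lemma poisson_massS r k : k.+1%:R * poisson_mass r k.+1 = r * poisson_mass r k.
Proof.
rewrite /poisson_mass factS natrM exprS invfM.
have k0 : (k.+1%:R : R) != 0 by rewrite pnatr_eq0.
by rewrite !mulrA [k.+1%:R * r]mulrC -!mulrA; congr (_ * _); rewrite mulrCA mulVKf.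
Qed.

(** The binomial theorem. A sum of independent Poisson variables is thus
    Poisson. *)
Lemma poisson_massD l m k : poisson_mass (l + m) k =
  \sum_(i < k.+1) poisson_mass l i * poisson_mass m (k - i).
Proof.
rewrite /poisson_mass opprD expRD addrC exprDn !mulr_suml; apply: eq_bigr => i _.
have ik : (i <= k)%N by rewrite -ltnS.
have f0 j : (j`!%:R : R) != 0 by rewrite pnatr_eq0 -lt0n fact_gt0.
have : ('C(k, i))%:R = k`!%:R / (i`!%:R * (k - i)`!%:R) :> R.
  by rewrite -(bin_fact ik) !natrM mulfK// mulf_neq0.
move=> binE; rewrite -(mulr_natr (m ^+ (k - i) * l ^+ i)) binE.
rewrite invfM; have := mulfV (f0 k); have := f0 i; have := f0 (k - i)%N.
set A := m ^+ _; set B := l ^+ _; set a := (i`!%:R)^-1; set b := ((k-i)`!%:R)^-1.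
move=> _ _ kk.
transitivity (A * B * a * b * (expR (- l) * expR (- m)) * (k`!%:R / k`!%:R)); first by lra.
by rewrite kk; lra.
Qed.

Lemma sum_poisson_mass_le1 r k : 0 <= r -> \sum_(i < k) poisson_mass r i <= 1.
Proof.
move=> r0; rewrite /poisson_mass -mulr_suml -[leRHS](expRxMexpNx_1 r) ler_wpM2r ?expR_ge0//.
have := @nondecreasing_cvgn_le _ (series (exp_coeff r)).
have nd : nondecreasing_seq (series (exp_coeff r)).
  by apply: nondecreasing_series => i _ _; apply: exp_coeff_ge0.
move=> /(_ nd (is_cvg_series_exp_coeff r) k).
by rewrite seriesEnat/= big_mkord.
Qed.

Lemma sum_poisson_mass_cvg r : 0 <= r ->
  (fun k => \sum_(i < k) poisson_mass r i) @ \oo --> (1 : R).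
Proof.
move=> r0.
have -> : (fun k => \sum_(i < k) poisson_mass r i) =
    (fun k => series (exp_coeff r) k * expR (- r)).
  by apply/funext => k; rewrite seriesEnat/= big_mkord mulr_suml.
rewrite -[X in _ --> X](expRxMexpNx_1 r); apply: cvgM; last exact: cvg_cst.
exact: is_cvg_series_exp_coeff.
Qed.

Lemma poisson_mass_le1 r k : 0 <= r -> poisson_mass r k <= 1.
Proof.
move=> r0; apply: le_trans (sum_poisson_mass_le1 k.+1 r0).
by rewrite big_ord_recr/= lerDr sumr_ge0// => i _; apply: poisson_mass_ge0.
Qed.

Lemma poisson_mean_le r k : 0 <= r -> \sum_(i < k) i%:R * poisson_mass r i <= r.
Proof.
move=> r0; case: k => [|k]; first by rewrite big_ord0.
rewrite big_ord_recl/= mul0r add0r.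
rewrite (eq_bigr (fun i : 'I_k => r * poisson_mass r i)); last first.
  by move=> i _; rewrite -poisson_massS.
by rewrite -mulr_sumr ler_piMr// sum_poisson_mass_le1.
Qed.

Lemma poisson_factorial_moment_le r k : 0 <= r ->
  \sum_(i < k) (i * i.-1)%:R * poisson_mass r i <= r ^+ 2.
Proof.
move=> r0; case: k => [|k]; first by rewrite big_ord0 sqr_ge0.
rewrite big_ord_recl/= mul0n mul0r add0r.
rewrite (eq_bigr (fun i : 'I_k => r * (i%:R * poisson_mass r i))); last first.
  by move=> i _; rewrite natrM/= [LHS]mulrAC /bump/= add1n poisson_massS mulrAC mulrA.
by rewrite -mulr_sumr expr2 ler_wpM2l// poisson_mean_le.
Qed.

(** Markov's inequality. *)
Lemma poisson_tail_le r k : 0 <= r -> (0 < k)%N ->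
  1 - \sum_(i < k) poisson_mass r i <= r / k%:R.
Proof.
move=> r0 k0.
have cv : (fun n => k%:R * (\sum_(i < n) poisson_mass r i - \sum_(i < k) poisson_mass r i)) @ \oo
    --> k%:R * (1 - \sum_(i < k) poisson_mass r i).
  by apply: cvgM; [exact: cvg_cst|apply: cvgB]; [exact: sum_poisson_mass_cvg|exact: cvg_cst].
rewrite ler_pdivlMr ?ltr0n// mulrC.
rewrite -(cvg_lim _ cv)//; apply: limr_le; first by apply/cvg_ex; exists (k%:R * (1 - \sum_(i < k) poisson_mass r i)).
exists k => // n /= kn.
apply: le_trans (poisson_mean_le n r0).
rewrite -!(big_mkord xpredT (fun i => poisson_mass r i)) -(big_mkord xpredT (fun i => i%:R * poisson_mass r i)).
rewrite (big_cat_nat (leq0n k) kn)/= addrAC subrr add0r mulr_sumr.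
rewrite [leRHS](big_cat_nat (leq0n k) kn)/= -[leLHS]add0r lerD//.
  by apply: sumr_ge0 => i _; rewrite mulr_ge0 ?poisson_mass_ge0.
rewrite !big_nat; apply: ler_sum => i /andP[ki _].
by rewrite ler_wpM2r ?poisson_mass_ge0// ler_nat.
Qed.

End poisson_mass.

Section lecam.
Context (R : realType).
Implicit Types (p l m : R) (ps : seq R) (k : nat).

(** Expectation of [h] at the number of successes of independent trials with
    success probabilities [ps]. *)
Fixpoint bernE ps (h : nat -> R) : R :=
  if ps is p :: ps' then
    (1 - p) * bernE ps' h + p * bernE ps' (fun k => h k.+1)
  else h 0%N.

Definition bern_pmf ps k := bernE ps (fun j => (j == k)%:R).

Lemma bernE0 ps : bernE ps (fun=> 0) = 0.
Proof. by elim: ps => //= p ps ->; rewrite !mulr0 addr0. Qed.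

Lemma coin_count (I : eqType) (p : I -> R) (s : seq I) (Q : pred I) (h : nat -> R) g :
  uniq s ->
  coin p s (fun g => h (count (fun i => Q i && g i) s)) g =
  bernE [seq p i | i <- s & Q i] h.
Proof.
elim: s h g => //= i s IH h g /andP[si us].
have E b : coin p s (fun g => h (Q i && g i + count (fun i => Q i && g i) s)%N) (upd g i b) =
    bernE [seq p i | i <- s & Q i] (fun k => h (Q i && b + k)%N).
  rewrite -(IH _ (upd g i b) us); apply: eq_coin_reach => g' /(_ _ si).
  by rewrite /upd eqxx => ->.
rewrite !E andbF andbT; case: (Q i) => //=; lra.
Qed.

Lemma coin_count_pmf (I : eqType) (p : I -> R) (s : seq I) (Q : pred I) k g :
  uniq s ->
  coin p s (fun g => (count (fun i => Q i && g i) s == k)%:R) g =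
  bern_pmf [seq p i | i <- s & Q i] k.
Proof. by move=> us; rewrite (coin_count _ _ (fun j => (j == k)%:R)). Qed.

Definition pois_pred l k := if k is k'.+1 then poisson_mass l k' else 0.

Lemma bern_pmf_cons p ps k : bern_pmf (p :: ps) k =
  (1 - p) * bern_pmf ps k + p * (if k is k'.+1 then bern_pmf ps k' else 0).
Proof.
rewrite /bern_pmf /=; congr (_ + _ * _); case: k => [|k]; last by [].
exact: bernE0.
Qed.

(** Adding an independent trial of success probability [h] is compared with
    adding a Poisson variable of mean [h]: the two differ only when the latter
    exceeds [1] or through [expR (- h)] and [1 - h], both of order [h ^+ 2]. *)
Lemma poisson_massD_le l h k : 0 <= l -> 0 <= h ->
  `|poisson_mass (l + h) k - ((1 - h) * poisson_mass l k + h * pois_pred l k)|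
  <= h ^+ 2.
Proof.
move=> l0 h0; rewrite [l + h]addrC poisson_massD.
have pm0 j := poisson_mass_ge0 j l0; have ph0 j := poisson_mass_ge0 j h0.
have pm1 j := poisson_mass_le1 j l0.
have e1 : 1 - h <= expR (- h) by have := expR_ge1Dx (- h).
have e2 : expR (- h) <= 1 by rewrite expR_le1 oppr_le0.
have E0 : poisson_mass h 0 = expR (- h) by rewrite /poisson_mass expr0 fact0 divr1 mul1r.
have E1 : poisson_mass h 1 = h * expR (- h) by rewrite /poisson_mass expr1 divr1.
case: k => [|k].
  rewrite big_ord1 subn0 E0 /= mulr0 addr0 -mulrBl opprB addrC ger0_norm; last first.
    by rewrite mulr_ge0//; lra.
  have e3 : expR (- h) * (1 + h) <= 1.
    rewrite -[leRHS](expRxMexpNx_1 h) mulrC ler_wpM2r ?expR_ge0//; exact: expR_ge1Dx.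
  have e4 : expR (- h) <= 1 - h + h ^+ 2.
    have h1 : 0 < 1 + h by lra.
    rewrite -(ler_pM2r h1); apply: le_trans e3 _; have : 0 <= h ^+ 3 by rewrite exprn_ge0.
    by lra.
  have := pm1 0%N; have := pm0 0%N; set A := poisson_mass l 0 => A0 A1.
  apply: (@le_trans _ _ (h - 1 + expR (- h))); last by lra.
  by rewrite ler_piMr//; lra.
rewrite big_ord_recl big_ord_recl/= /bump/= !subn0 subSS subn0 E0 E1.
set T := \sum_(i < k) _.
have T0 : 0 <= T by apply: sumr_ge0 => i _; rewrite mulr_ge0.
have T1 : T <= 1 - expR (- h) - h * expR (- h).
  have := sum_poisson_mass_le1 k.+2 h0; rewrite 2!big_ord_recl/= E0 E1 => H.
  suff : T <= \sum_(i < k) poisson_mass h (bump 0 (bump 0 i)) by lra.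
  by apply: ler_sum => i _; rewrite ler_piMr.
have := pm0 k; have := pm0 k.+1; have := pm1 k; have := pm1 k.+1.
set A := poisson_mass l k.+1; set B := poisson_mass l k; set e := expR (- h) in e1 e2 T1 *.
move=> A1 B1 A0 B0; rewrite ler_norml; apply/andP; split; nra.
Qed.

(** Le Cam's inequality, for point probabilities: the trials are replaced one at
    a time. *)
Lemma bern_poisson_le ps k : (forall p, p \in ps -> 0 <= p <= 1) ->
  `|bern_pmf ps k - poisson_mass (\sum_(p <- ps) p) k| <= \sum_(p <- ps) p ^+ 2.
Proof.
elim: ps k => [|p ps IH] k p01.
  by rewrite !big_nil poisson_mass0 /bern_pmf /= eq_sym subrr normr0.
have /andP[p0 p1] := p01 p (mem_head _ _).
have IH' j : `|bern_pmf ps j - poisson_mass (\sum_(p <- ps) p) j| <= \sum_(p <- ps) p ^+ 2.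
  by apply: IH => q qps; apply: p01; rewrite in_cons qps orbT.
have S0 : 0 <= \sum_(p <- ps) p.
  rewrite big_seq sumr_ge0// => q qps.
  by have /andP[] : 0 <= q <= 1 by apply: p01; rewrite in_cons qps orbT.
have S2 : 0 <= \sum_(p <- ps) p ^+ 2 by apply: sumr_ge0 => q _; rewrite sqr_ge0.
have := poisson_massD_le k S0 p0.
rewrite !big_cons bern_pmf_cons [p + _]addrC.
set l := \sum_(p <- ps) p in IH' S0 *; set V := \sum_(p <- ps) p ^+ 2 in IH' S2 *.
have Hp : `|(if k is k'.+1 then bern_pmf ps k' else 0) - pois_pred l k| <= V.
  by case: k => [|k] /=; [rewrite subrr normr0|exact: IH'].
move: (IH' k) Hp; set X := (if k is _.+1 then _ else _).
rewrite !ler_norml => /andP[a1 a2] /andP[b1 b2] /andP[c1 c2]; apply/andP; split; nra.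
Qed.

Lemma poisson_mass_lip l m k : 0 <= l -> 0 <= m ->
  `|poisson_mass l k - poisson_mass m k| <= `|l - m|.
Proof.
wlog lm : l m / m <= l.
  move=> H l0 m0; have [/H|/ltW lm] := leP m l; first exact.
  by rewrite distrC [leRHS]distrC; apply: H.
move=> l0 m0; have h0 : 0 <= l - m by rewrite subr_ge0.
rewrite (ger0_norm h0).
have -> : poisson_mass l k = poisson_mass (l - m + m) k by rewrite subrK.
rewrite poisson_massD big_ord_recl/= subn0.
set h := l - m in h0 *; set T := \sum_(i < k) _.
have pm0 j := poisson_mass_ge0 j m0; have ph0 j := poisson_mass_ge0 j h0.
have pm1 j := poisson_mass_le1 j m0.
have e1 : 1 - h <= expR (- h) by have := expR_ge1Dx (- h).
have e2 : expR (- h) <= 1 by rewrite expR_le1 oppr_le0.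
have E0 : poisson_mass h 0 = expR (- h) by rewrite /poisson_mass expr0 fact0 divr1 mul1r.
have T0 : 0 <= T by apply: sumr_ge0 => i _; rewrite mulr_ge0.
have T1 : T <= 1 - expR (- h).
  have := sum_poisson_mass_le1 k.+1 h0; rewrite big_ord_recl/= E0 => H.
  suff : T <= \sum_(i < k) poisson_mass h (bump 0 i) by lra.
  by apply: ler_sum => i _; rewrite ler_piMr.
rewrite E0; have := pm0 k; have := pm1 k.
rewrite ler_norml => B1 B0; apply/andP; split; nra.
Qed.

(** A Poisson variable of mean [m] is the sum of one of mean [l] and of an
    independent nonnegative variable. *)
Lemma poisson_cdf_le l m k : 0 <= l -> l <= m ->
  \sum_(i < k) poisson_mass m i <= \sum_(i < k) poisson_mass l i.
Proof.
move=> l0 lm; have h0 : 0 <= m - l by rewrite subr_ge0.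
have pl0 j := poisson_mass_ge0 j l0; have ph0 j := poisson_mass_ge0 j h0.
have -> : m = (m - l) + l by rewrite subrK.
set h := m - l in h0 ph0 *.
rewrite (eq_bigr (fun j : 'I_k => \sum_(i < k | (i <= j)%N)
    poisson_mass h i * poisson_mass l (j - i))); last first.
  move=> j _; rewrite poisson_massD.
  by rewrite (big_ord_widen k (fun i => poisson_mass h i * poisson_mass l (j - i))).
rewrite (exchange_big_dep xpredT)//=.
apply: (@le_trans _ _ (\sum_(i < k) poisson_mass h i * \sum_(j < k) poisson_mass l j)).
  apply: ler_sum => i _; rewrite -mulr_sumr ler_wpM2l//.
  rewrite -(big_mkord (fun j => (i <= j)%N) (fun j => poisson_mass l (j - i))).
  have ik : (i <= k)%N by apply: ltnW.
  rewrite (big_cat_nat (leq0n i) ik)/= [X in X + _]big_nat_cond big_pred0 ?add0r; last first.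
    by move=> j; rewrite ltnNge; case: (i <= j)%N; rewrite ?andbF ?andbT.
  rewrite -{1}[nat_of_ord i]add0n big_addn big_mkord.
  rewrite -!(big_mkord xpredT (fun j => poisson_mass l j)).
  apply: (@le_trans _ _ (\sum_(0 <= j < k - i) poisson_mass l j)).
    rewrite big_mkord; under eq_bigr do rewrite addnK.
    by rewrite (eq_bigl xpredT)// => j; rewrite leq_addl.
  by rewrite [leRHS](big_cat_nat (leq0n (k - i)) (leq_subr _ _))/= lerDl sumr_ge0.
rewrite -mulr_suml ler_piMl ?sumr_ge0//; exact: sum_poisson_mass_le1.
Qed.

End lecam.

(** * Unlabeled graphs and star graphs *)

(** Isolated vertices are irrelevant: [h] need only be an isomorphism between
    the sets of vertices that have a neighbour. *)
Lemma unlabel_iso (X Y : Type) (adjX : X -> X -> Prop) (adjY : Y -> Y -> Prop)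
    (h : X -> Y) :
  (forall x x', adjX x x' -> adjX x' x) ->
  (forall x x', adjX x x' -> adjY (h x) (h x')) ->
  (forall y y', adjY y y' -> exists x x', [/\ h x = y, h x' = y' & adjX x x']) ->
  (forall x x' z z', adjX x z -> adjX x' z' -> h x = h x' -> x = x') ->
  unlabel adjX = unlabel adjY.
Proof.
move=> symX hadj hsurj hinj.
have adjXY x x' z z' : adjX x z -> adjX x' z' -> adjY (h x) (h x') -> adjX x x'.
  move=> xz xz' /hsurj[y [y' [yx yx' yy']]].
  by rewrite -(hinj _ _ _ _ yy' xz yx) -(hinj _ _ _ _ (symX _ _ yy') xz' yx').
apply/seteqP; split => g [f [finj frange fadj]].
  have fsupp i : exists z, adjX (f i) z.
    have : range f (f i) by exists i.
    by rewrite frange.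
  exists (h \o f); split.
  - move=> i j /= hij; apply: finj.
    by have [z iz] := fsupp i; have [z' jz'] := fsupp j; exact: hinj iz jz' hij.
  - apply/seteqP; split => [y [i _ <-]|y [y' /hsurj[x [x' [<- _ xx']]]]].
      by have [z iz] := fsupp i; exists (h z); apply: hadj.
    have : range f x by rewrite frange; exists x'.
    by case=> i _ <-; exists i.
  - move=> i j /=; rewrite -fadj; split; last exact: hadj.
    by have [z iz] := fsupp i; have [z' jz'] := fsupp j; exact: adjXY iz jz'.
have fpre i : exists x, h x = f i /\ exists z, adjX x z.
  have : range f (f i) by exists i.
  rewrite frange => -[y /hsurj[x [x' [xi _ xx']]]].
  by exists x; split=> //; exists x'.
have /choice[f' f'P] := fpre.
exists f'; split.
- by move=> i j ij; apply: finj; rewrite -(proj1 (f'P i)) -(proj1 (f'P j)) ij.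
- apply/seteqP; split => [x [i _ <-]|x [x' xx']]; first by have [_ [z iz]] := f'P i; exists z.
  have : range f (h x) by rewrite frange; exists (h x'); apply: hadj.
  case=> i _ fi; exists i => //; have [hi [z iz]] := f'P i.
  by apply: hinj iz xx' _; rewrite hi.
- move=> i j; rewrite -fadj -(proj1 (f'P i)) -(proj1 (f'P j)); split; first exact: hadj.
  by have [_ [z iz]] := f'P i; have [_ [z' jz']] := f'P j; exact: adjXY iz jz'.
Qed.

Inductive svertex (V : Type) :=
  SPoint of V | SLeaf of V & nat | SIsol of nat & bool.
Arguments SPoint {V}.
Arguments SLeaf {V}.
Arguments SIsol {V}.

(** A graph on [V] with pendant edges and isolated edges is encoded by the
    numbers [k m] for sets [m] of at most two vertices: the edge [m] is present
    when [0 < k m] if [m] is a pair, [k m] pendant edges are attached to [j] if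
    [m] is the singleton of [j], and [k m] isolated edges are added if [m] is
    empty. The three kinds of edges are thus treated alike. *)
Definition star_adj (V : finType) (k : {set V} -> nat) (x y : svertex V) : Prop :=
  match x, y with
  | SPoint i, SPoint j => i != j /\ (0 < k [set i; j]%SET)%N
  | SPoint i, SLeaf j l | SLeaf j l, SPoint i => i = j /\ (l < k [set j]%SET)%N
  | SIsol l b, SIsol l' c => [/\ l = l', b <> c & (l < k finset.set0)%N]
  | _, _ => False
  end.

Lemma star_adj_sym (V : finType) (k : {set V} -> nat) x y :
  star_adj k x y -> star_adj k y x.
Proof.
case: x y => [i|i l|l b] [j|j m|m c] //=.
- by rewrite eq_sym finset.setUC.
- by move=> [-> /nesym bc lk].
Qed.

Lemma star_adj_relabel (V V' : finType) (h : V -> V') (h' : V' -> V)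
    (k : {set V} -> nat) (k' : {set V'} -> nat) :
  cancel h h' -> cancel h' h -> (forall m : {set V}, k m = k' [set h x | x in m]%SET) ->
  unlabel (star_adj k) = unlabel (star_adj k').
Proof.
move=> hK h'K kk'.
have hinj : injective h := can_inj hK.
pose H (x : svertex V) : svertex V' := match x with
  SPoint i => SPoint (h i) | SLeaf i l => SLeaf (h i) l | SIsol l b => SIsol l b end.
have E2 i j : k' [set h i; h j]%SET = k [set i; j]%SET.
  by rewrite kk' imsetU1 imset_set1.
have E1 i : k' [set h i]%SET = k [set i]%SET by rewrite kk' imset_set1.
have E0 : k' finset.set0 = k finset.set0 by rewrite kk' imset0.
have Hadj x y : star_adj k x y <-> star_adj k' (H x) (H y).
  case: x y => [i|i l|l b] [j|j m|m c] //=; rewrite ?E0 ?E1 ?E2 ?(inj_eq hinj)//;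
    by split => -[]; [move=> ->|move/hinj => ->].
have Hinj : injective H.
  by move=> [i|i l|l b] [j|j m|m c] //= []; [move=> /hinj ->|move=> /hinj -> ->|move=> -> ->].
have Hsurj y : exists x, H x = y.
  by case: y => [i|i l|l b]; [exists (SPoint (h' i))|exists (SLeaf (h' i) l)|exists (SIsol l b)]; rewrite //= h'K.
apply: (@unlabel_iso _ _ _ _ H).
- exact: star_adj_sym.
- by move=> x y /Hadj.
- move=> y y'; have [x <-] := Hsurj y; have [x' <-] := Hsurj y'.
  by move=> /Hadj xx'; exists x, x'.
- by move=> x x' _ _ _ _ /Hinj.
Qed.

(** Only the values of [g] on increasing pairs matter, so that the pairs can be
    taken as independent coins. *)
Definition sgraph n (g : 'I_n * 'I_n -> bool) : rel 'I_n :=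
  fun i j => (i < j)%N && g (i, j) || (j < i)%N && g (j, i).

Section colored_graph.
Context (n r : nat) (s : 'I_r -> 'I_n) (K : pred 'I_n) (e0 : 'I_n * 'I_n).
Hypothesis s_inj : injective s.
Hypothesis sK : forall i, ~~ K (s i).
Implicit Types (g : 'I_n * 'I_n -> bool) (e : 'I_n * 'I_n) (m : {set 'I_r}).

Definition kept (x : 'I_n) := (x \in codom s) || K x.

Definition vgraph g (x y : 'I_n) : Prop := [/\ kept x, kept y & sgraph g x y].

Definition high_part (e : 'I_n * 'I_n) : {set 'I_r} :=
  [set i | (s i == e.1) || (s i == e.2)]%SET.

(** The vertices [s i] are high and those of [K] are low. The colour of an edge
    is the set of its high endpoints, and tells which number of the star graph
    the edge contributes to. *)
Definition edge_color (e : 'I_n * 'I_n) : option {set 'I_r} :=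
  if [&& (e.1 < e.2)%N, kept e.1 & kept e.2] then Some (high_part e) else None.

Definition color_count g m := count (fun e => (edge_color e == Some m) && g e) (enum {: 'I_n * 'I_n}).

Definition color_edges g m := [seq e <- enum {: 'I_n * 'I_n} | (edge_color e == Some m) && g e].

Definition incident (x : 'I_n) (e : 'I_n * 'I_n) := (x == e.1) || (x == e.2).

Definition low_deg_le1 g := forall e e' x, K x -> incident x e -> incident x e' ->
  edge_color e -> edge_color e' -> g e -> g e' -> e = e'.

Lemma mem_color_edges g m e :
  (e \in color_edges g m) = (edge_color e == Some m) && g e.
Proof. by rewrite mem_filter mem_enum andbT. Qed.

Lemma edge_colorE e m : edge_color e = Some m ->
  [/\ (e.1 < e.2)%N, kept e.1, kept e.2 & m = high_part e].
Proof. by rewrite /edge_color; case: and3P => // -[? ? ?] [<-]. Qed.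

Lemma keptP x : kept x -> (exists2 i, x = s i & ~~ K x) \/ K x.
Proof. by case/orP => [/codomP[i ->]|]; [left; exists i|right]. Qed.

Lemma high_part_low e i : K e.1 -> K e.2 -> i \notin high_part e.
Proof.
move=> k1 k2; rewrite finset.in_set; apply/negP => /orP[] /eqP si.
  by move: k1; rewrite -si (negbTE (sK i)).
by move: k2; rewrite -si (negbTE (sK i)).
Qed.

Lemma in_high_part e i : (i \in high_part e) = (s i == e.1) || (s i == e.2).
Proof. by rewrite finset.in_set. Qed.

Lemma edge_color0 e : edge_color e = Some finset.set0 <->
  [/\ K e.1, K e.2 & (e.1 < e.2)%N].
Proof.
split=> [/edge_colorE[lt k1 k2 hp]|[k1 k2 lt]]; last first.
  rewrite /edge_color lt /kept k1 k2 !orbT /=; congr Some; apply/setP => i.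
  by rewrite finset.in_set0; apply/negbTE/high_part_low.
split=> //; [case: (keptP k1)|case: (keptP k2)] => // -[j ej _];
  (have : j \in high_part e by rewrite in_high_part ej eqxx ?orbT);
  by rewrite -hp finset.in_set0.
Qed.

Lemma edge_color1 e i : edge_color e = Some [set i]%SET <->
  ((e.1 = s i /\ K e.2) \/ (K e.1 /\ e.2 = s i)) /\ (e.1 < e.2)%N.
Proof.
split=> [/edge_colorE[lt k1 k2 hp]|[H lt]].
  split=> //; have : i \in high_part e by rewrite -hp finset.in_set1.
  rewrite in_high_part; case/orP => /eqP si.
    left; split=> //; case: (keptP k2) => // -[j ej _].
    have : j \in high_part e by rewrite in_high_part ej eqxx orbT.
    by rewrite -hp finset.in_set1 => /eqP ji; move: lt; rewrite ej ji si ltnn.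
  right; split=> //; case: (keptP k1) => // -[j ej _].
  have : j \in high_part e by rewrite in_high_part ej eqxx.
  by rewrite -hp finset.in_set1 => /eqP ji; move: lt; rewrite ej ji si ltnn.
have k12 : kept e.1 && kept e.2.
  by rewrite /kept; case: H => -[-> ->]; rewrite codom_f ?orbT.
rewrite /edge_color lt k12; congr Some; apply/setP => j.
rewrite in_high_part finset.in_set1 -(inj_eq s_inj).
have lowF y : K y -> (s j == y) = false.
  by move=> Ky; apply/negP => /eqP sj; move: Ky; rewrite -sj (negbTE (sK j)).
by case: H => -[] => [-> /lowF ->|/lowF -> ->]; rewrite ?orbF.
Qed.

Lemma edge_color2 e i j : i != j -> edge_color e = Some [set i; j]%SET <->
  ((e.1 = s i /\ e.2 = s j) \/ (e.1 = s j /\ e.2 = s i)) /\ (e.1 < e.2)%N.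
Proof.
move=> ij; split=> [/edge_colorE[lt k1 k2 hp]|[H lt]].
  split=> //.
  have : i \in high_part e by rewrite -hp finset.in_set2 eqxx.
  have : j \in high_part e by rewrite -hp finset.in_set2 eqxx orbT.
  have sij : s i <> s j by move/s_inj => /eqP; rewrite (negbTE ij).
  rewrite !in_high_part => /orP[]/eqP sj /orP[]/eqP si.
  - by case: sij; rewrite si sj.
  - by right.
  - by left.
  - by case: sij; rewrite si sj.
have k12 : kept e.1 && kept e.2.
  by case: H => -[-> ->]; rewrite /kept !codom_f.
rewrite /edge_color lt k12; congr Some; apply/setP => k.
rewrite in_high_part finset.in_set2 -!(inj_eq s_inj).
by case: H => -[-> ->] //; rewrite orbC.
Qed.

Lemma card_edge_color e m : edge_color e = Some m -> (#|m| <= 2)%N.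
Proof.
move=> /edge_colorE[_ k1 k2 ->].
have -> : high_part e = ([set i | s i == e.1] :|: [set i | s i == e.2])%SET.
  by apply/setP => i; rewrite finset.in_setU !finset.in_set.
have le1 y : (#|[set i | s i == y]%SET| <= 1)%N.
  apply/card_le1P => i; rewrite finset.in_set => /eqP iy j; rewrite finset.in_set -iy.
  by rewrite (inj_eq s_inj).
by apply: (leq_trans (leq_card_setU _ _)); apply: (@leq_add _ _ 1 1).
Qed.

(** When low vertices have degree at most one, an edge between a high and a low
    vertex is pendant and an edge between two low vertices is isolated, so the
    graph is determined by its edges between high vertices and by the numbers of
    the other edges of each colour. The [l]-th leaf or isolated edge is sent to
    the [l]-th edge of its colour. *)
Lemma star_vgraph g : low_deg_le1 g ->
  unlabel (star_adj (color_count g)) = unlabel (vgraph g).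
Proof.
move=> good.
pose low e := if K e.1 then e.1 else e.2.
pose leaf_edge j l := nth e0 (color_edges g [set j]%SET) l.
pose isol_edge l := nth e0 (color_edges g finset.set0) l.
pose h x := match x with SPoint i => s i
  | SLeaf j l => low (leaf_edge j l)
  | SIsol l b => if b then (isol_edge l).1 else (isol_edge l).2 end.
have size_ce m : size (color_edges g m) = color_count g m by rewrite size_filter.
have ce_uniq m : uniq (color_edges g m) by rewrite filter_uniq// enum_uniq.
have keptS i : kept (s i) by rewrite /kept codom_f.
have hpE e i : (i \in high_part e) = (s i == e.1) || (s i == e.2) by rewrite finset.in_set.
have hp1 e i : edge_color e = Some [set i]%SET ->
    (e.1 = s i /\ K e.2) \/ (K e.1 /\ e.2 = s i) by move=> /edge_color1[].
have hp0 e : edge_color e = Some finset.set0 -> K e.1 /\ K e.2.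
  by move=> /edge_color0[].
have leafP j l : (l < color_count g [set j]%SET)%N -> let e := leaf_edge j l in
    [/\ edge_color e = Some [set j]%SET, g e, K (low e), incident (low e) e &
        (e.1 = s j /\ e.2 = low e) \/ (e.2 = s j /\ e.1 = low e)].
  rewrite -size_ce => /(mem_nth e0); rewrite mem_color_edges -/(leaf_edge j l) => /andP[/eqP ce ge] /=.
  have := hp1 _ _ ce; rewrite /low /incident; case: ifP => k1 [][].
  - by move=> e1; move: k1; rewrite e1 (negbTE (sK j)).
  - by move=> _ e2; split=> //; rewrite ?eqxx//; right.
  - by move=> e1 k2; split=> //; rewrite ?eqxx ?orbT//; left.
  - by [].
have isolP l : (l < color_count g finset.set0)%N -> let e := isol_edge l in
    [/\ edge_color e = Some finset.set0, g e, K e.1 & K e.2].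
  rewrite -size_ce => /(mem_nth e0); rewrite mem_color_edges -/(isol_edge l) => /andP[/eqP ce ge] /=.
  by have [] := hp0 _ ce.
have edge_vgraph e m : edge_color e = Some m -> g e ->
    vgraph g e.1 e.2 /\ vgraph g e.2 e.1.
  move=> ce ge; have [lt k1 k2 _] := edge_colorE ce.
  by move: ge; rewrite [e]surjective_pairing => ge; split; split=> //=; rewrite /sgraph lt ge ?orbT.
apply: (@unlabel_iso _ _ _ _ h).
- exact: star_adj_sym.
- case=> [i|i l|l b] [j|j m|m c] //=.
  + move=> [ij]; rewrite -size_ce; case E : (color_edges g _) => [//|e t] _.
    have : e \in color_edges g [set i; j]%SET by rewrite E mem_head.
    rewrite mem_color_edges => /andP[/eqP ce ge].
    have [v1 v2] := edge_vgraph e _ ce ge.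
    have [lt _ _ hp] := edge_colorE ce.
    have : i \in high_part e by rewrite -hp finset.in_set2 eqxx.
    have : j \in high_part e by rewrite -hp finset.in_set2 eqxx orbT.
    rewrite !hpE => /orP[]/eqP sj /orP[]/eqP si; rewrite ?si ?sj//.
      by move: ij; rewrite -(inj_eq s_inj) si sj eqxx.
    by move: ij; rewrite -(inj_eq s_inj) si sj eqxx.
  + move=> [-> /leafP[ce ge _ _ H]].
    have [v1 v2] := edge_vgraph _ _ ce ge.
    by move: v1 v2; case: H => -[-> ->].
  + move=> [<- /leafP[ce ge _ _ H]].
    have [v1 v2] := edge_vgraph _ _ ce ge.
    by move: v1 v2; case: H => -[-> ->].
  + move=> [<- bc /isolP[ce ge _ _]].
    have [v1 v2] := edge_vgraph _ _ ce ge.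
    by move: bc; case: b c => [] [].
- move=> y y' [ky ky' gyy'].
  wlog lt : y y' ky ky' gyy' / (y < y')%N.
    move=> H; case: (ltngtP y y') => yy'.
    - exact: H.
    - have gy'y : sgraph g y' y by rewrite /sgraph orbC.
      have [x [x' [xy xy' a]]] := H _ _ ky' ky gy'y yy'.
      by exists x', x; split=> //; apply: star_adj_sym.
    - by move: gyy'; rewrite /sgraph yy' ltnn.
  have ge : g (y, y') by move: gyy'; rewrite /sgraph lt ltnNge (ltnW lt) /= orbF.
  have ce : edge_color (y, y') = Some (high_part (y, y')) by rewrite /edge_color /= lt ky ky'.
  have mce : (y, y') \in color_edges g (high_part (y, y')) by rewrite mem_color_edges ce eqxx.
  have := mce; rewrite -index_mem size_ce => ltk.
  have nthE := nth_index e0 mce.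
  move: mce ltk nthE; set L := index _ _ => mce ltk nthE.
  case: (keptP ky) => [[i yi nK]|kyl]; case: (keptP ky') => [[j yj nK']|kyl'].
  + exists (SPoint i), (SPoint j); split=> //=.
    have hpij : high_part (y, y') = [set i; j]%SET.
      by apply/setP => k; rewrite hpE /= yi yj !(inj_eq s_inj) finset.in_set2.
    by split; [apply/eqP => ij; move: lt; rewrite yi yj ij ltnn|rewrite -hpij; apply: leq_ltn_trans ltk].
  + have hpi : high_part (y, y') = [set i]%SET.
      apply/setP => k; rewrite hpE /= yi (inj_eq s_inj) finset.in_set1 orb_idr//.
      by move=> /eqP sk; move: kyl'; rewrite -sk (negbTE (sK k)).
    exists (SPoint i), (SLeaf i L); split=> //=; last by rewrite -hpi.
    by rewrite /leaf_edge -hpi nthE /low /= (negbTE nK).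
  + have hpi : high_part (y, y') = [set j]%SET.
      apply/setP => k; rewrite hpE /= yj (inj_eq s_inj) finset.in_set1 orb_idl//.
      by move=> /eqP sk; move: kyl; rewrite -sk (negbTE (sK k)).
    exists (SLeaf j L), (SPoint j); split=> //=; last by rewrite -hpi.
    by rewrite /leaf_edge -hpi nthE /low /= kyl.
  + have hp : high_part (y, y') = finset.set0.
      by apply/setP => k; rewrite finset.in_set0; apply/negbTE/high_part_low.
    exists (SIsol L true), (SIsol L false); rewrite /= /isol_edge -hp nthE; split=> //.
- have supp x z : star_adj (color_count g) x z -> match x with SPoint _ => True
    | SLeaf j l => (l < color_count g [set j]%SET)%N
    | SIsol l b => (l < color_count g finset.set0)%N end.
    by case: x z => [i|i l|l b] [j|j m|m c] //= -[] //.
  have isol_inc l b : (l < color_count g finset.set0)%N ->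
      let x := if b then (isol_edge l).1 else (isol_edge l).2 in
      K x /\ incident x (isol_edge l).
    by move=> /isolP[_ _ k1 k2]; case: b; rewrite /incident eqxx ?orbT.
  move=> x x' z z' /supp sx /supp sx'; move: x x' sx sx' {z z'}.
  case=> [i|i l|l b] [j|j m|m c] //=.
  + by move=> _ _ /s_inj ->.
  + by move=> _ /leafP[_ _ kl _ _] si; move: kl; rewrite -si (negbTE (sK i)).
  + by move=> _ /isol_inc => /(_ c)[kl _] si; move: kl; rewrite -si (negbTE (sK i)).
  + by move=> /leafP[_ _ kl _ _] _ si; move: kl; rewrite si (negbTE (sK j)).
  + move=> lk mk; have [ce ge kl inc _] := leafP _ _ lk; have [ce' ge' kl' inc' _] := leafP _ _ mk.
    move=> E; have ee : leaf_edge i l = leaf_edge j m.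
      apply: (good _ _ _ kl inc) => //; rewrite ?ce ?ce'//.
      by rewrite E.
    have ij : i = j.
      by move: ce; rewrite ee ce' => -[] /setP/(_ i); rewrite !finset.in_set1 eqxx => /eqP.
    rewrite -ij; congr SLeaf; apply/eqP.
    move: ee; rewrite -ij /leaf_edge => /eqP.
    by rewrite nth_uniq ?size_ce// ij.
  + move=> lk mk; have [ce ge kl inc _] := leafP _ _ lk; have [ce' ge' _ _] := isolP _ mk.
    have [kl' inc'] := isol_inc _ c mk.
    move=> E; have ee : leaf_edge i l = isol_edge m.
      apply: (good _ _ _ kl inc) => //; rewrite ?ce ?ce'//.
      by rewrite E.
    by move: ce; rewrite ee ce' => -[] /setP/(_ i); rewrite finset.in_set1 finset.in_set0 eqxx.
  + by move=> /isol_inc => /(_ b)[kl _] _ si; move: kl; rewrite si (negbTE (sK j)).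
  + move=> lk mk; have [ce ge kl inc _] := leafP _ _ mk; have [ce' ge' _ _] := isolP _ lk.
    have [kl' inc'] := isol_inc _ b lk.
    move=> E; have ee : leaf_edge j m = isol_edge l.
      apply: (good _ _ _ kl inc) => //; rewrite ?ce ?ce'//.
      by rewrite -E.
    by move: ce; rewrite ee ce' => -[] /setP/(_ j); rewrite finset.in_set1 finset.in_set0 eqxx.
  + move=> lk mk; have [ce ge _ _] := isolP _ lk; have [ce' ge' _ _] := isolP _ mk.
    have [kl inc] := isol_inc _ b lk; have [kl' inc'] := isol_inc _ c mk.
    move=> E; have ee : isol_edge l = isol_edge m.
      apply: (good _ _ _ kl inc) => //; rewrite ?ce ?ce'//.
      by rewrite E.
    have lm : l = m.
      by apply/eqP; move/eqP: ee; rewrite /isol_edge nth_uniq ?size_ce.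
    move: E; rewrite -lm; have [lt _ _ _] := edge_colorE ce.
    by case: b c {kl inc kl' inc'} => [] [] // E; move: lt; rewrite E ltnn.
Qed.

End colored_graph.

(** * Laws of star graphs *)

Section product_laws.
Context (R : realType).

Lemma indic_ge0 (T : Type) (A : set T) x : 0 <= \1_A x :> R.
Proof. by rewrite indicE ler0n. Qed.

Lemma indic_le1 (T : Type) (A : set T) x : \1_A x <= 1 :> R.
Proof. by rewrite indicE lern1 leq_b1. Qed.

Lemma prod_diff_le (M : eqType) (ms : seq M) (a b : M -> R) :
  (forall m, 0 <= b m <= a m) -> (forall m, a m <= 1) ->
  \prod_(m <- ms) a m - \prod_(m <- ms) b m <= \sum_(m <- ms) (a m - b m).
Proof.
move=> ba a1; elim: ms => [|m ms IH]; first by rewrite !big_nil subrr.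
rewrite !big_cons.
have P0 (c : M -> R) : (forall m, 0 <= c m <= 1) -> 0 <= \prod_(m <- ms) c m <= 1.
  by move=> c01; rewrite prodr_ge0 ?prodr_ile1//= => i _; have /andP[] := c01 i.
have a01 i : 0 <= a i <= 1.
  by rewrite a1 andbT; have /andP[b0 /(le_trans b0)] := ba i.
have b01 i : 0 <= b i <= 1.
  by have /andP[-> /le_trans->] := ba i.
have /andP[A0 A1] := P0 a a01; have /andP[B0 B1] := P0 b b01.
have /andP[b0 b1] := b01 m; have /andP[b0' bam] := ba m; have := a1 m.
have S0 : 0 <= \sum_(m <- ms) (a m - b m).
  by apply: sumr_ge0 => i _; rewrite subr_ge0; have /andP[] := ba i.
move: A0 A1 B0 B1 IH b0 b1 bam S0.
set A := \prod_(m <- ms) a m; set B := \prod_(m <- ms) b m; set S := \sum_(m <- ms) _.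
set x := a m; set y := b m => A0 A1 B0 B1 AB y0 y1 yx S0 x1.
have -> : x * A - y * B = (x - y) * A + y * (A - B) by lra.
rewrite lerD//; first by rewrite ler_piMr// subr_ge0.
apply: le_trans (ler_wpM2l y0 AB) _; by rewrite ler_piMl.
Qed.

(** Replacing the subprobabilities [f' m] by their minima with [f m] can only
    decrease the left-hand side, and by at most the total lost mass. *)
Lemma product_law_ge (M : finType) (b : nat) (f f' : M -> 'I_b -> R)
    (chi : {ffun M -> 'I_b} -> R) :
  (forall m k, 0 <= f m k) -> (forall m k, 0 <= f' m k) ->
  (forall m, \sum_k f' m k <= 1) -> (forall k, 0 <= chi k <= 1) ->
  \sum_(k : {ffun M -> 'I_b}) (\prod_m f' m (k m)) * chi k -
    \sum_m \sum_k `|f' m k - f m k| <=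
  \sum_(k : {ffun M -> 'I_b}) (\prod_m f m (k m)) * chi k.
Proof.
move=> f0 f'0 f'1 chi01.
pose h m k := Num.min (f m k) (f' m k).
have h0 m k : 0 <= h m k by rewrite /h le_min f0 f'0.
have hf m k : h m k <= f m k by rewrite /h ge_min lexx.
have hf' m k : h m k <= f' m k by rewrite /h ge_min lexx orbT.
apply: (@le_trans _ _ (\sum_(k : {ffun M -> 'I_b}) (\prod_m h m (k m)) * chi k)); last first.
  apply: ler_sum => k _; have /andP[c0 _] := chi01 k.
  rewrite ler_wpM2r//; apply: ler_prod => m _; by rewrite h0 hf.
rewrite lerBlDr -lerBlDl -sumrB.
apply: (@le_trans _ _ (\sum_(k : {ffun M -> 'I_b}) (\prod_m f' m (k m) - \prod_m h m (k m)))).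
  apply: ler_sum => k _; rewrite -mulrBl ler_piMr//; last by have /andP[] := chi01 k.
  by rewrite subr_ge0; apply: ler_prod => m _; rewrite h0 hf'.
rewrite sumrB -!(bigA_distr_bigA (fun m k => _ m k)).
apply: (le_trans (prod_diff_le _ _ _)).
- by move=> m; rewrite sumr_ge0//= ler_sum.
- exact: f'1.
- apply: ler_sum => m _; rewrite -sumrB; apply: ler_sum => k _.
  rewrite /h /Num.min; case: ifP => _; last by rewrite subrr.
  exact: ler_norm.
Qed.

(** ** Laws of the marks *)

(** The limiting law of the number [k m] in the encoding of a star graph, when
    the vertices have weights [x]. *)
Definition star_pmf (V : finType) (t : R) (x : V -> R) (m : {set V}) (k : nat) : R :=
  let w := \prod_(i in m) x i in
  match #|m| with
  | 0 => poisson_mass (t ^+ 2 / 2) k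
  | 1 => poisson_mass (t * w) k
  | 2 => bern_pmf [:: w / (1 + w)] k
  | _ => bern_pmf [::] k
  end.

Definition star_prob (V : finType) (b : nat) (t : R) (x : V -> R) (A : set ugraph) : R :=
  \sum_(k : {ffun {set V} -> 'I_b}) (\prod_m star_pmf t x m (k m)) *
    \1_A (unlabel (star_adj (fun m => k m : nat))).

Lemma star_prob_relabel (V V' : finType) (h : V -> V') (h' : V' -> V) b t
    (x : V -> R) (x' : V' -> R) A :
  cancel h h' -> cancel h' h -> (forall i, x i = x' (h i)) ->
  star_prob b t x A = star_prob b t x' A.
Proof.
move=> hK h'K xx'; rewrite /star_prob.
have hinj := can_inj hK; have h'inj := can_inj h'K.
pose H (m : {set V}) : {set V'} := [set h i | i in m]%SET.
pose H' (m : {set V'}) : {set V} := [set h' i | i in m]%SET.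
have HK : cancel H H'.
  by move=> m; rewrite /H /H' -imset_comp (eq_imset (g := id)) ?imset_id// => i /=.
have H'K : cancel H' H.
  by move=> m; rewrite /H /H' -imset_comp (eq_imset (g := id)) ?imset_id// => i /=.
have pmfE m k : star_pmf t x m k = star_pmf t x' (H m) k.
  rewrite /star_pmf card_imset// big_imset/=; last by move=> ? ? _ _ /hinj.
  by rewrite (eq_bigr _ (fun i _ => xx' i)).
rewrite (reindex (fun k : {ffun {set V'} -> 'I_b} => [ffun m => k (H m)])); last first.
  exists (fun k : {ffun {set V} -> 'I_b} => [ffun m => k (H' m)]) => k _;
    by apply/ffunP => m; rewrite !ffunE ?HK ?H'K.
apply: eq_bigr => k _; congr (_ * _).
  rewrite [RHS](reindex H) /=; last by exists H' => ? _.
  by apply: eq_bigr => m _; rewrite ffunE pmfE.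
congr (\1_A _); apply: (star_adj_relabel hK h'K) => m; by rewrite ffunE.
Qed.

End product_laws.

Section vgraph_law.
Context (R : realType) (n r : nat) (s : 'I_r -> 'I_n) (K : pred 'I_n).
Hypothesis s_inj : injective s.
Hypothesis sK : forall i, ~~ K (s i).
Variables (p : 'I_n * 'I_n -> R) (e0 : 'I_n * 'I_n).
Hypothesis p01 : prob_vec p.

Let E := enum {: 'I_n * 'I_n}.
Let col := edge_color s K.

(** A union bound over the pairs of distinct edges that share a low vertex;
    distinct edges are independent. *)
Lemma edge_color_low_deg g0 :
  coin p E (fun g => (~~ `[< low_deg_le1 s K g >])%:R) g0 <=
  \sum_(y | K y) (\sum_(e | incident y e && col e) p e) ^+ 2.
Proof.
apply: (@le_trans _ _ (coin p E (fun g => \sum_(y | K y) \sum_(e | incident y e && col e)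
   \sum_(e' | incident y e' && col e') (e != e')%:R * ((g e)%:R * (g e')%:R)) g0)).
  apply: ler_coin => // g.
  have pos : forall (e : 'I_n * 'I_n) (e' : 'I_n * 'I_n), 0 <= (e != e')%:R * ((g e)%:R * (g e')%:R) :> R.
    by move=> e e'; rewrite !mulr_ge0 ?ler0n.
  case: asboolP => [_|]/=.
    by apply: sumr_ge0 => y _; apply: sumr_ge0 => e _; apply: sumr_ge0.
  move=> /existsNP[e /existsNP[e' /existsNP[y H]]].
  have [Ky ie ie' [ce ce' [ge ge' ee']]] : [/\ K y, incident y e, incident y e' &
      [/\ col e, col e' & [/\ g e, g e' & e <> e']]].
    by move: H => /not_implyP[? /not_implyP[? /not_implyP[? /not_implyP[? /not_implyP[?
      /not_implyP[? /not_implyP[? ?]]]]]]].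
  rewrite (bigD1 y)//= (bigD1 e) ?ie//= (bigD1 e') ?ie'//= (introN eqP ee') ge ge' !mulr1 -!addrA lerDl.
  rewrite !addr_ge0//; first by apply: sumr_ge0.
    by apply: sumr_ge0 => *; apply: sumr_ge0.
  by apply: sumr_ge0 => *; apply: sumr_ge0 => *; apply: sumr_ge0.
rewrite coin_sum; apply: ler_sum => y _; rewrite coin_sum expr2 mulr_suml.
apply: ler_sum => e _; rewrite coin_sum mulr_sumr; apply: ler_sum => e' _.
rewrite coinZ; have [->|ee'] := eqVneq e e'.
  by rewrite mul0r mulr_ge0//; have /andP[] := p01 e'.
rewrite mul1r (@coin_indep _ _ _ _ _ _ (pred1 e)).
- by rewrite !(coin_coord _ _ (fun b : bool => b%:R)) ?enum_uniq ?mem_enum// !mulr0 !add0r !mulr1.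
- by move=> g g' /(_ e) -> //=.
- by move=> g g' /(_ e') -> //=; rewrite eq_sym.
Qed.

Lemma color_count_law b (k : {ffun {set 'I_r} -> 'I_b}) g0 :
  coin p E (fun g => \prod_m (color_count s K g m == k m)%:R) g0 =
  \prod_m bern_pmf [seq p e | e <- E & col e == Some m] (k m).
Proof.
pose F (c : option {set 'I_r}) g : R :=
  if c is Some m then (color_count s K g m == k m)%:R else 1.
rewrite -[RHS]big_enum /= -[RHS](big_map Some xpredT
   (fun c => if c is Some m then bern_pmf [seq p e | e <- E & col e == Some m] (k m) else 1)).
transitivity (coin p E (fun g => \prod_(c <- [seq Some m | m <- enum {set 'I_r}]) F c g) g0).
  by apply: coin_ext => g; rewrite big_map /F big_enum.
rewrite (@coin_indep_prod _ _ _ col); last 2 first.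
- by rewrite map_inj_uniq ?enum_uniq// => ? ? [].
- case=> [m|] g g' gg' //=; rewrite /F /color_count; congr ((_ == _)%:R).
  by apply: eq_count => e; case: eqP => //= em; rewrite gg'//= /col em eqxx.
rewrite !big_map; apply: eq_bigr => m _; rewrite /F.
by rewrite -(coin_count_pmf p (fun e => col e == Some m) _ g0)// enum_uniq.
Qed.

(** Off the event that a low vertex has two neighbours, the graph on the kept
    vertices is the star graph of its colour counts, which are independent
    Bernoulli sums. *)
Lemma vgraph_prob_ge b (f : {set 'I_r} -> nat -> R) (A : set ugraph) g0 :
  (forall m k, 0 <= f m k) -> (forall m, \sum_(k < b) f m k <= 1) ->
  \sum_(k : {ffun {set 'I_r} -> 'I_b}) (\prod_m f m (k m)) *
      \1_A (unlabel (star_adj (fun m => k m : nat)))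
   - \sum_m \sum_(k < b) `|f m k - bern_pmf [seq p e | e <- E & col e == Some m] k|
   - \sum_(y | K y) (\sum_(e | incident y e && col e) p e) ^+ 2 <=
  coin p E (fun g => \1_A (unlabel (vgraph s K g))) g0.
Proof.
move=> f0 f1; rewrite lerBlDr.
apply: (le_trans (product_law_ge (f := fun m k => bern_pmf [seq p e | e <- E & col e == Some m] k) _ _ _ _)).
- by move=> m k; rewrite -(coin_count_pmf p (fun e => col e == Some m) _ g0) ?enum_uniq//
     coin_ge0.
- by move=> m k; apply: f0.
- by move=> m; apply: f1.
- by move=> k; rewrite indic_ge0 indic_le1.
apply: le_trans (lerD (lexx _) (edge_color_low_deg g0)).
under eq_bigr => k _ do rewrite -(color_count_law _ g0) mulrC -coinZ.
rewrite -coin_sum -coinD; apply: ler_coin => // g.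
have [[k0 k0E]|nk] := pselect (exists k0 : {ffun {set 'I_r} -> 'I_b},
    forall m, color_count s K g m = k0 m).
  rewrite (bigD1 k0)//= [X in _ + X]big1 ?addr0; last first.
    move=> k /eqP kk0; have [m km] : exists m, k0 m <> k m.
      by apply/not_existsP => H; apply: kk0; apply/ffunP => m; have /contrapT := H m.
    rewrite [X in _ * X](bigD1 m)//= k0E (introF eqP) ?mul0r ?mulr0// => /val_inj //.
  rewrite [X in _ * X]big1 ?mulr1; last by move=> m _; rewrite k0E eqxx.
  case: asboolP => [good|_] /=; last by rewrite ler_wpDl ?indic_le1// indic_ge0.
  rewrite -(star_vgraph e0 s_inj sK good) addr0.
  by have -> : color_count s K g = (fun m => k0 m : nat) by apply/funext.
rewrite big1 ?addr_ge0 ?indic_ge0// => k _.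
have [m km] : exists m, color_count s K g m <> k m.
  by apply/not_existsP => H; apply: nk; exists k => m; have /contrapT := H m.
by rewrite [X in _ * X](bigD1 m)//= (introF eqP km) mul0r mulr0.
Qed.

End vgraph_law.

(** ** Edge probabilities *)

Section edge_weight.
Context (R : realType).
Implicit Types u v : R.

Definition wf u : R := u / (1 + u).

Lemma wf_ge0 u : 0 <= u -> 0 <= wf u.
Proof. by move=> u0; rewrite /wf divr_ge0// addr_ge0. Qed.

Lemma wf_le u : 0 <= u -> wf u <= u.
Proof. by move=> u0; rewrite /wf ler_pdivrMr ?ltr_pwDl// ler_peMr// lerDl. Qed.

Lemma wf_le1 u : 0 <= u -> wf u <= 1.
Proof. by move=> u0; rewrite /wf ler_pdivrMr ?ltr_pwDl// mul1r lerDr. Qed.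

Lemma wf_lip u v : 0 <= v -> v <= u -> 0 <= wf u - wf v <= u - v.
Proof.
move=> v0 vu; have u0 := le_trans v0 vu.
have -> : wf u - wf v = (u - v) / ((1 + u) * (1 + v)).
  have u1 : 1 + u != 0 by rewrite gt_eqF// ltr_pwDl.
  have v1 : 1 + v != 0 by rewrite gt_eqF// ltr_pwDl.
  rewrite /wf -[u / _](mulfK v1) -[v / _](mulfK u1) invfM; lra.
have d1 : 1 <= (1 + u) * (1 + v) by rewrite mulr_ege1 ?lerDl.
have d0 : 0 < (1 + u) * (1 + v) by apply: lt_le_trans d1.
by rewrite divr_ge0 ?subr_ge0 ?(ltW d0)//= ler_pdivrMr// ler_peMr ?subr_ge0.
Qed.

Lemma wf_sqr u : 0 <= u -> 0 <= u - wf u <= u ^+ 2.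
Proof.
move=> u0; rewrite subr_ge0 wf_le//=.
have -> : u - wf u = u ^+ 2 / (1 + u).
  have u1 : 1 + u != 0 by rewrite gt_eqF// ltr_pwDl.
  by rewrite /wf -[X in X - _](mulfK u1); lra.
by rewrite ler_pdivrMr ?ltr_pwDl// ler_peMr ?sqr_ge0// lerDl.
Qed.

Lemma bern1_lip u v k : `|bern_pmf [:: u] k - bern_pmf [:: v] k| <= `|u - v|.
Proof.
rewrite /bern_pmf /=; case: k => [|[|k]] /=; rewrite ?mulr1 ?mulr0 ?addr0 ?add0r ?subrr ?normr0 ?oppr0 ?normr0//.
by rewrite opprB addrC addrA subrK distrC.
Qed.

Lemma bern1_ge0 u k : 0 <= u <= 1 -> 0 <= bern_pmf [:: u] k.
Proof.
move=> /andP[u0 u1]; rewrite /bern_pmf /=; case: k => [|[|k]] /=; rewrite ?mulr1 ?mulr0 ?addr0 ?add0r//.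
by rewrite subr_ge0.
Qed.

Lemma bern_pmf_sum_le1 (ps : seq R) b : (forall p, p \in ps -> 0 <= p <= 1) ->
  \sum_(k < b) bern_pmf ps k <= 1.
Proof.
move=> p01; have sumE (qs : seq R) (F : nat -> nat -> R) :
    \sum_(k < b) bernE qs (F^~ k) = bernE qs (fun j => \sum_(k < b) F j k).
  elim: qs F => //= q qs IH F.
  by rewrite big_split -!mulr_sumr (IH F) (IH (fun j => F j.+1)).
rewrite /bern_pmf (sumE ps (fun j k => (j == k)%:R)).
have : forall h, (forall j, h j <= 1) -> bernE ps h <= 1.
  elim: ps p01 => [|p ps IH] p01 h h1 //=.
  have /andP[p0 p1] := p01 p (mem_head _ _).
  have IH' h' : (forall j, h' j <= 1) -> bernE ps h' <= 1.
    by apply: IH => q qps; apply: p01; rewrite in_cons qps orbT.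
  apply: (@le_trans _ _ ((1 - p) * 1 + p * 1)); last by lra.
  by rewrite lerD// ler_wpM2l ?subr_ge0 ?IH'.
apply=> j; have [jb|bj] := ltnP j b.
  rewrite (bigD1 (Ordinal jb))//= eqxx big1 ?addr0// => k; rewrite -val_eqE /= => /negbTE.
  by rewrite eq_sym => ->.
rewrite big1// => k _; case: eqP => // jk; move: bj; rewrite jk leqNgt ltn_ord//.
Qed.

Section star_pmf.
Variables (V : finType) (t : R) (x : V -> R).
Hypotheses (t0 : 0 <= t) (x0 : forall i, 0 <= x i).

Lemma star_pmf_ge0 m k : 0 <= star_pmf t x m k.
Proof.
have w0 : 0 <= \prod_(i in m) x i by apply: prodr_ge0.
rewrite /star_pmf; case: #|m| => [|[|[|c]]].
- by rewrite poisson_mass_ge0// divr_ge0 ?sqr_ge0.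
- by rewrite poisson_mass_ge0// mulr_ge0.
- by rewrite bern1_ge0// wf_ge0 ?wf_le1.
- by rewrite /bern_pmf/= ler0n.
Qed.

Lemma star_pmf_le1 m b : \sum_(k < b) star_pmf t x m k <= 1.
Proof.
have w0 : 0 <= \prod_(i in m) x i by apply: prodr_ge0.
rewrite /star_pmf; case: #|m| => [|[|[|c]]].
- by rewrite sum_poisson_mass_le1// divr_ge0 ?sqr_ge0.
- by rewrite sum_poisson_mass_le1// mulr_ge0.
- by apply: bern_pmf_sum_le1 => p; rewrite mem_seq1 => /eqP ->; rewrite wf_ge0 ?wf_le1.
- exact: bern_pmf_sum_le1.
Qed.

End star_pmf.
End edge_weight.

(** Sets of more than two elements carry no mark. *)
Lemma sum_set_le2 (R : realType) (V : finType) (D : {set V} -> R) :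
  (forall m : {set V}, 0 <= D m) ->
  (forall m : {set V}, (2 < #|m|)%N -> D m = 0) ->
  \sum_m D m <= D finset.set0 + \sum_j D [set j]%SET +
    \sum_i \sum_(j | i != j) D [set i; j]%SET.
Proof.
move=> D0 D3.
have pt (m : {set V}) : D m <= (m == finset.set0)%:R * D finset.set0 +
    \sum_j (m == [set j]%SET)%:R * D [set j]%SET +
    \sum_i \sum_(j | i != j) (m == [set i; j]%SET)%:R * D [set i; j]%SET.
  have t1 : 0 <= (m == finset.set0)%:R * D finset.set0 by rewrite mulr_ge0.
  have t2 : 0 <= \sum_j (m == [set j]%SET)%:R * D [set j]%SET.
    by apply: sumr_ge0 => j _; rewrite mulr_ge0.
  have t3 : 0 <= \sum_i \sum_(j | i != j) (m == [set i; j]%SET)%:R * D [set i; j]%SET.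
    by apply: sumr_ge0 => i _; apply: sumr_ge0 => j _; rewrite mulr_ge0.
  case E : #|m| => [|[|[|c]]].
  - have /eqP -> : m == finset.set0 by rewrite -cards_eq0 E.
    rewrite eqxx mul1r -!addrA lerDl addr_ge0//.
      by apply: sumr_ge0 => j _; rewrite mulr_ge0.
    by apply: sumr_ge0 => i _; apply: sumr_ge0 => j _; rewrite mulr_ge0.
  - have /cards1P[j mj] : #|m| == 1%N by rewrite E.
    apply: le_trans (_ : \sum_j (m == [set j]%SET)%:R * D [set j]%SET <= _); last by lra.
    rewrite (bigD1 j)//= mj eqxx mul1r lerDl.
    by apply: sumr_ge0 => i _; rewrite mulr_ge0.
  - have /cards2P[i [j [ij mij]]] : #|m| == 2%N by rewrite E.
    apply: le_trans (_ : \sum_i \sum_(j | i != j) (m == [set i; j]%SET)%:R * D [set i; j]%SET <= _); last by lra.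
    rewrite (bigD1 i)//= (bigD1 j)//= mij eqxx mul1r -addrA lerDl addr_ge0//.
      by apply: sumr_ge0 => k _; rewrite mulr_ge0.
    by apply: sumr_ge0 => k _; apply: sumr_ge0 => l _; rewrite mulr_ge0.
  - by rewrite D3 ?E// !addr_ge0.
apply: le_trans (ler_sum _ (fun m _ => pt m)) _.
have one (S : {set V}) : \sum_m (m == S)%:R * D S = D S.
  by rewrite (bigD1 S)//= eqxx mul1r big1 ?addr0// => m /negbTE ->; rewrite mul0r.
rewrite !big_split /= one exchange_big /= (eq_bigr _ (fun j _ => one [set j]%SET)).
rewrite lerD2l exchange_big /=; apply: ler_sum => i _.
by rewrite exchange_big /=; apply: ler_sum => j _; rewrite one.
Qed.

(** * The sampled graph given the sampled vertices *)

Section given_vertices.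
Context (R : realType) (n r : nat) (s : 'I_r -> 'I_n) (K : pred 'I_n)
  (e0 : 'I_n * 'I_n).
Hypothesis s_inj : injective s.
Hypothesis sK : forall i, ~~ K (s i).
Variables (x : 'I_n -> R) (beta : 'I_r -> R) (eps eta B t rho : R).
Hypothesis x0 : forall i, 0 <= x i.
Hypothesis rho01 : 0 <= rho <= 1.
Hypothesis beta_lo : forall i, rho * x (s i) <= beta i.
Hypothesis beta_hi : forall i, beta i <= x (s i).
Hypothesis low_le : forall y, K y -> x y <= eps.
Hypothesis sum_le : \sum_(i < r) x (s i) + \sum_(y | K y) x y <= B.
Hypothesis low_sum : `|\sum_(y | K y) x y - t| <= eta.
Hypothesis t0 : 0 <= t.
Hypothesis eps0 : 0 <= eps.

Definition edge_prob (e : 'I_n * 'I_n) : R :=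
  if (e.1 < e.2)%N then wf (x e.1 * x e.2) else 0.

Let E := enum {: 'I_n * 'I_n}.
Let col := edge_color s K.
Let SK := \sum_(y | K y) x y.
Let SH := \sum_(i < r) x (s i).

Lemma edge_prob_vec : prob_vec edge_prob.
Proof.
move=> e; rewrite /edge_prob; case: ifP => _; last by rewrite lexx ler01.
by rewrite wf_ge0 ?wf_le1 ?mulr_ge0.
Qed.

Let SK0 : 0 <= SK. Proof. exact: sumr_ge0. Qed.
Let SH0 : 0 <= SH. Proof. exact: sumr_ge0. Qed.
Let SKB : SK <= B. Proof. by apply: le_trans sum_le; rewrite lerDr. Qed.
Let SHB : SH <= B. Proof. by apply: le_trans sum_le; rewrite lerDl. Qed.
Let B0 : 0 <= B. Proof. exact: le_trans SK0 SKB. Qed.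

Let SK2 : \sum_(y | K y) x y ^+ 2 <= eps * B.
Proof.
apply: (@le_trans _ _ (eps * SK)); last by rewrite ler_wpM2l.
by rewrite mulr_sumr; apply: ler_sum => y Ky; rewrite expr2 ler_wpM2r ?low_le.
Qed.

Let SK2_0 : 0 <= \sum_(y | K y) x y ^+ 2.
Proof. by apply: sumr_ge0 => y _; rewrite sqr_ge0. Qed.

Let SH2 : \sum_(i < r) x (s i) ^+ 2 <= B ^+ 2.
Proof.
apply: (@le_trans _ _ (SH * B)); last by rewrite expr2 ler_wpM2r.
rewrite mulr_suml; apply: ler_sum => i _; rewrite expr2 ler_wpM2l//.
by apply: le_trans SHB; rewrite /SH (bigD1 i)//= lerDl sumr_ge0.
Qed.

(** The pairs of colour [j] are those of [s j] and a low vertex. *)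
Lemma sum_color1 j (F : 'I_n -> 'I_n -> R) : (forall y z, F y z = F z y) ->
  \sum_(e <- E | col e == Some [set j]%SET) F e.1 e.2 = \sum_(y | K y) F (s j) y.
Proof.
move=> Fsym; rewrite big_enum_cond /=.
pose h (y : 'I_n) := if (s j < y)%N then (s j, y) else (y, s j).
pose h' (e : 'I_n * 'I_n) := if e.1 == s j then e.2 else e.1.
rewrite (reindex_onto h h') /=; last first.
  move=> e /eqP /(edge_color1 s_inj sK)[H lt]; rewrite /h /h'.
  case: H => -[] => [e1 Ke2|Ke1 e2].
    by rewrite e1 eqxx -e1 lt -surjective_pairing.
  have -> : e.1 == s j = false by apply/negP => /eqP e1; move: Ke1; rewrite e1 (negbTE (sK j)).
  by rewrite -e2 ltnNge (ltnW lt) /= -surjective_pairing.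
have hK y : (col (h y) == Some [set j]%SET) && (h' (h y) == y) = K y.
  apply/andP/idP => [[/eqP/(edge_color1 s_inj sK)[H lt] /eqP hy]|Ky].
    move: H hy lt; rewrite /h; case: ifP => _ /= [] [] //.
    - by move=> + jy; rewrite jy (negbTE (sK j)).
    - by move=> _ Ksj; move: (sK j); rewrite Ksj.
  have sjy : s j != y by apply/negP => /eqP sj; move: Ky; rewrite -sj (negbTE (sK j)).
  rewrite /h /h'; case: ltnP => lt /=.
    rewrite eqxx; split=> //; apply/eqP/(edge_color1 s_inj sK) => /=; split=> //.
    by left.
  rewrite [y == _]eq_sym (negbTE sjy) eqxx; split=> //; apply/eqP/(edge_color1 s_inj sK) => /=; split.
    by right.
  by rewrite ltn_neqAle lt andbT eq_sym.
by apply: eq_big => [y|y _]; [exact: hK|rewrite /h; case: ifP].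
Qed.

Lemma sum_color0 (F : 'I_n -> 'I_n -> R) : (forall y z, F y z = F z y) ->
  (\sum_(e <- E | col e == Some finset.set0) F e.1 e.2) * 2 =
  \sum_(y | K y) \sum_(z | K z) F y z - \sum_(y | K y) F y y.
Proof.
move=> Fsym; rewrite big_enum_cond /=.
have -> : \sum_(e | col e == Some finset.set0) F e.1 e.2 =
    \sum_(y | K y) \sum_(z | K z && (y < z)%N) F y z.
  rewrite pair_big_dep /=; apply: eq_bigl => e.
  by apply/eqP/and3P => /(edge_color0 sK).
pose T := \sum_(y | K y) \sum_(z | K z && (y < z)%N) F y z.
have T' : \sum_(y | K y) \sum_(z | K z && (z < y)%N) F y z = T.
  rewrite (exchange_big_dep K)/=; last by move=> y z _ /andP[].
  apply: eq_bigr => y Ky; apply: eq_big => [z|z _]; last exact: Fsym.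
  by rewrite Ky.
have -> : \sum_(y | K y) \sum_(z | K z) F y z = T + T + \sum_(y | K y) F y y.
  rewrite -{2}T' /T -!big_split; apply: eq_bigr => y Ky /=.
  rewrite (bigID (fun z : 'I_n => (y < z)%N))/= -addrA; congr (_ + _).
  rewrite (bigID (fun z : 'I_n => (z < y)%N))/=; congr (_ + _).
    by apply: eq_bigl => z; case: (ltngtP y z); rewrite ?andbF ?andbT.
  rewrite (bigD1 y) ?Ky ?ltnn//= big1 ?addr0// => z /andP[].
  by case: (ltngtP y z) => // yz; rewrite ?andbF//= => _ /eqP; case; apply/val_inj.
by rewrite -/T; lra.
Qed.

Lemma color2_edge i j : i != j -> exists e,
  [seq e' <- E | col e' == Some [set i; j]%SET] = [:: e] /\
  edge_prob e = wf (x (s i) * x (s j)).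
Proof.
move=> ij; have nij : s i != s j by rewrite (inj_eq s_inj).
wlog lt : i j ij nij / (s i < s j)%N.
  move=> H; case: (ltngtP (s i) (s j)) => sij; first exact: H.
    by have [e] := H j i (negbT (etrans (eq_sym _ _) (negbTE ij))) (negbT (etrans (eq_sym _ _) (negbTE nij))) sij;
      rewrite finset.setUC mulrC => He; exists e.
  by move: nij; rewrite (val_inj sij) eqxx.
exists (s i, s j); split; last by rewrite /edge_prob lt.
apply: perm_small_eq => //.
apply: uniq_perm => [|//|e]; first by rewrite filter_uniq// enum_uniq.
rewrite mem_filter mem_enum andbT mem_seq1; apply/eqP/eqP.
  move=> /(edge_color2 K s_inj _ ij)[H lt']; case: H => -[e1 e2].
    by rewrite [e]surjective_pairing e1 e2.
  by move: lt'; rewrite e1 e2 ltnNge (ltnW lt).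
by move=> ->; apply/(edge_color2 K s_inj _ ij); split=> //; left.
Qed.


Let W (y z : 'I_n) := wf (x y * x z).
Let Wsym y z : W y z = W z y. Proof. by rewrite /W mulrC. Qed.

Let psums m := [seq edge_prob e | e <- E & col e == Some m].

Let sum_psums m (h : R -> R) : h 0 = 0 ->
  \sum_(p <- psums m) h p =
  \sum_(e <- E | col e == Some m) h (W e.1 e.2).
Proof.
move=> h00; rewrite /psums big_map big_filter; apply: eq_bigr => e /eqP ce.
by rewrite /edge_prob; have [-> _ _ _] := edge_colorE ce.
Qed.

Let W_ge0 y z : 0 <= W y z. Proof. by rewrite /W wf_ge0 ?mulr_ge0. Qed.
Let W_le y z : W y z <= x y * x z. Proof. by rewrite /W wf_le ?mulr_ge0. Qed.
Let W_sq y z : W y z ^+ 2 <= x y ^+ 2 * x z ^+ 2.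
Proof.
have := W_ge0 y z; have := W_le y z; have := mulr_ge0 (x0 y) (x0 z).
by rewrite -exprMn => xx Wx W0; rewrite lerXn2r.
Qed.

(** Le Cam's inequality, after replacing the target mean by the sum of the edge
    probabilities. *)
Let poisson_err m (l : R) b : 0 <= l ->
  \sum_(k < b) `|poisson_mass l k - bern_pmf (psums m) k| <=
  b%:R * (`|l - \sum_(p <- psums m) p| + \sum_(p <- psums m) p ^+ 2).
Proof.
move=> l0; rewrite -[b in b%:R]card_ord -sum1_card natr_sum mulr_suml.
apply: ler_sum => k _; rewrite mul1r.
have ps01 p : p \in psums m -> 0 <= p <= 1 by case/mapP => e _ ->; apply: edge_prob_vec.
apply: le_trans (ler_distD (poisson_mass (\sum_(p <- psums m) p) k) _ _) _.
rewrite lerD ?poisson_mass_lip//; last by rewrite distrC bern_poisson_le.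
by rewrite big_seq sumr_ge0// => p /ps01/andP[].
Qed.

Let err1 j b : \sum_(k < b) `|star_pmf t beta [set j]%SET k - bern_pmf (psums [set j]%SET) k|
  <= b%:R * (2 * eps * B * x (s j) ^+ 2 + eta * x (s j) + t * (1 - rho) * x (s j)).
Proof.
have /andP[r0 r1] := rho01.
have xb := beta_hi j; have bx := beta_lo j; have xj := x0 (s j).
have b0 : 0 <= beta j by apply: le_trans bx; rewrite mulr_ge0.
rewrite /star_pmf cards1 big_set1.
apply: le_trans (poisson_err _ _ (mulr_ge0 t0 b0)) _; rewrite ler_wpM2l//.
rewrite (sum_psums _ (h := id))// (sum_psums _ (h := fun u => u ^+ 2)) ?expr0n//.
rewrite sum_color1// (sum_color1 j (F := fun y z => W y z ^+ 2)); last by move=> y z; rewrite Wsym.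
have S2 : \sum_(y | K y) W (s j) y ^+ 2 <= eps * B * x (s j) ^+ 2.
  apply: (@le_trans _ _ (x (s j) ^+ 2 * \sum_(y | K y) x y ^+ 2)).
    by rewrite mulr_sumr; apply: ler_sum => y _; exact: W_sq.
  by rewrite mulrC ler_wpM2r ?sqr_ge0.
have S1 : 0 <= x (s j) * SK - \sum_(y | K y) W (s j) y <= eps * B * x (s j) ^+ 2.
  rewrite mulr_sumr -sumrB; apply/andP; split.
    by apply: sumr_ge0 => y _; rewrite subr_ge0.
  apply: (@le_trans _ _ (x (s j) ^+ 2 * \sum_(y | K y) x y ^+ 2)); last first.
    by rewrite mulrC ler_wpM2r ?sqr_ge0.
  rewrite mulr_sumr; apply: ler_sum => y _; rewrite -exprMn.
  by have /andP[] := wf_sqr (mulr_ge0 xj (x0 y)).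
have S3 : `|x (s j) * SK - t * x (s j)| <= eta * x (s j).
  by rewrite [t * _]mulrC -mulrBr normrM ger0_norm// mulrC ler_wpM2r.
have S4 : 0 <= t * x (s j) - t * beta j <= t * (1 - rho) * x (s j).
  rewrite -mulrBr mulr_ge0 ?subr_ge0//= -mulrA ler_wpM2l//; lra.
move: S1 S2 S3 S4; set X1 := \sum_(y | _) _; set X2 := \sum_(y | _) _.
rewrite ler_norml => /andP[s1 s2] s3 /andP[s4 s5] /andP[s6 s7].
suff : `|t * beta j - X1| <= eps * B * x (s j) ^+ 2 + eta * x (s j) + t * (1 - rho) * x (s j) by lra.
rewrite ler_norml; apply/andP; split; lra.
Qed.

Let err0 b : \sum_(k < b) `|star_pmf t beta finset.set0 k - bern_pmf (psums finset.set0) k|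
  <= b%:R * (2 * eps * B ^+ 3 + eta * (B + t) + eps * B).
Proof.
rewrite /star_pmf cards0.
have t2 : 0 <= t ^+ 2 / 2 by rewrite divr_ge0 ?sqr_ge0.
apply: le_trans (poisson_err _ _ t2) _; rewrite ler_wpM2l//.
rewrite (sum_psums _ (h := id))// (sum_psums _ (h := fun u => u ^+ 2)) ?expr0n//.
have D2 : \sum_(y | K y) \sum_(z | K z) x y ^+ 2 * x z ^+ 2 <= eps * B ^+ 3.
  rewrite (_ : eps * B ^+ 3 = (eps * B) * (B ^+ 2)); last by lra.
  rewrite (eq_bigr (fun y => x y ^+ 2 * \sum_(z | K z) x z ^+ 2)); last by move=> y _; rewrite mulr_sumr.
  rewrite -mulr_suml; apply: ler_pM => //.
  apply: (@le_trans _ _ (SK * B)); last by rewrite expr2 ler_wpM2r.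
  rewrite mulr_suml; apply: ler_sum => y Ky; rewrite expr2 ler_wpM2l//.
  by apply: le_trans SKB; rewrite /SK (bigD1 y)//= lerDl sumr_ge0.
have C2 : (\sum_(e <- E | col e == Some finset.set0) W e.1 e.2 ^+ 2) * 2 <= eps * B ^+ 3.
  rewrite (sum_color0 (F := fun y z => W y z ^+ 2)); last by move=> y z; rewrite Wsym.
  apply: le_trans D2; rewrite lerBlDr; apply: ler_wpDr.
    by apply: sumr_ge0 => y _; rewrite sqr_ge0.
  by apply: ler_sum => y _; apply: ler_sum => z _; exact: W_sq.
have C1 : `|(\sum_(e <- E | col e == Some finset.set0) W e.1 e.2) * 2 - SK ^+ 2| <=
    eps * B ^+ 3 + eps * B.
  rewrite sum_color0//.
  have -> : SK ^+ 2 = \sum_(y | K y) \sum_(z | K z) x y * x z.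
    by rewrite expr2 mulr_suml; apply: eq_bigr => y _; rewrite mulr_sumr.
  have c1 : 0 <= \sum_(y | K y) W y y <= eps * B.
    rewrite sumr_ge0//=; apply: le_trans SK2; apply: ler_sum => y _.
    by rewrite expr2; exact: W_le.
  have c2 : 0 <= \sum_(y | K y) \sum_(z | K z) x y * x z -
      \sum_(y | K y) \sum_(z | K z) W y z <= eps * B ^+ 3.
    rewrite -sumrB; apply/andP; split.
      by apply: sumr_ge0 => y _; rewrite -sumrB; apply: sumr_ge0 => z _; rewrite subr_ge0.
    apply: le_trans D2; apply: ler_sum => y _; rewrite -sumrB; apply: ler_sum => z _.
    by have /andP[_] := wf_sqr (mulr_ge0 (x0 y) (x0 z)); rewrite exprMn.
  move: c1 c2 => /andP[c1 c1'] /andP[c2 c2']; rewrite ler_norml; apply/andP; split; lra.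
have C3 : `|SK ^+ 2 - t ^+ 2| <= eta * (B + t).
  rewrite subr_sqr normrM; apply: ler_pM => //.
  by rewrite ger0_norm ?addr_ge0// lerD2r.
have C4 : 0 <= \sum_(e <- E | col e == Some finset.set0) W e.1 e.2 ^+ 2.
  by apply: sumr_ge0 => e _; rewrite sqr_ge0.
move: C1 C2 C3 C4; set X1 := \sum_(e <- E | _) _; set X2 := \sum_(e <- E | _) _.
rewrite ler_norml => /andP[s1 s2] s3; rewrite ler_norml => /andP[s4 s5] s6.
have eB3 : 0 <= eps * B ^+ 3 by rewrite mulr_ge0// exprn_ge0.
have eB : 0 <= eps * B by rewrite mulr_ge0.
suff : `|t ^+ 2 / 2 - X1| <= eps * B ^+ 3 + eta * (B + t) + eps * B by lra.
rewrite ler_norml; apply/andP; split; lra.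
Qed.

Let err2 i j b : i != j ->
  \sum_(k < b) `|star_pmf t beta [set i; j]%SET k - bern_pmf (psums [set i; j]%SET) k|
  <= b%:R * (2 * (1 - rho) * x (s i) * x (s j)).
Proof.
move=> ij; have [e [ps pe]] := color2_edge ij.
have /andP[r0 r1] := rho01.
rewrite /star_pmf cards2 ij big_setU1 ?finset.in_set1//= big_set1 /psums ps /= pe.
rewrite -[b in b%:R]card_ord -sum1_card natr_sum mulr_suml.
apply: ler_sum => k _; rewrite mul1r; apply: le_trans (bern1_lip _ _ _) _.
have bi := beta_lo i; have bj := beta_lo j; have hi := beta_hi i; have hj := beta_hi j.
have xi := x0 (s i); have xj := x0 (s j).
have bi0 : 0 <= beta i by apply: le_trans bi; rewrite mulr_ge0.
have bj0 : 0 <= beta j by apply: le_trans bj; rewrite mulr_ge0.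
have bb : beta i * beta j <= x (s i) * x (s j) by rewrite ler_pM.
have bb' : (rho * x (s i)) * (rho * x (s j)) <= beta i * beta j.
  by rewrite ler_pM// mulr_ge0.
have := wf_lip (mulr_ge0 bi0 bj0) bb; rewrite -/(wf _) => /andP[w0 w1].
rewrite distrC ger0_norm//; apply: le_trans w1 _.
have xx := mulr_ge0 xi xj.
apply: (@le_trans _ _ (x (s i) * x (s j) * (1 - rho ^+ 2))); first by lra.
rewrite [leRHS](_ : _ = x (s i) * x (s j) * (2 * (1 - rho))); last by lra.
rewrite ler_wpM2l//; have : 0 <= (1 - rho) ^+ 2 by rewrite sqr_ge0.
by lra.
Qed.

Let kept_sum : \sum_(z | kept s K z) x z <= B.
Proof.
apply: le_trans sum_le.
rewrite (bigID K)/= addrC lerD//; last first.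
  by rewrite (eq_bigl K)// => z /=; rewrite /kept; case: (K z); rewrite ?orbT ?andbF.
rewrite (eq_bigl (mem (codom s))); last first.
  move=> z /=; rewrite /kept; case Kz : (K z); rewrite ?andbF ?andbT ?orbF//.
  by apply/esym/negP => /codomP[i zi]; move: (sK i); rewrite -zi Kz.
rewrite -big_uniq /=; last by rewrite map_inj_uniq ?enum_uniq.
by rewrite /codom /image_mem big_map big_enum.
Qed.

Let low_degree y : K y -> \sum_(e | incident y e && col e) edge_prob e <= x y * B.
Proof.
move=> Ky.
apply: (@le_trans _ _ (\sum_(z | kept s K z) (edge_prob (y, z) + edge_prob (z, y)))); last first.
  apply: le_trans (ler_wpM2l (x0 y) kept_sum); rewrite mulr_sumr; apply: ler_sum => z _.
  rewrite /edge_prob /=; case: ltngtP => _; rewrite ?addr0 ?add0r ?mulr_ge0//; first exact: W_le.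
  by rewrite mulrC; exact: W_le.
have p0 e : 0 <= edge_prob e by have /andP[] := edge_prob_vec e.
have -> : \sum_(e | incident y e && col e) edge_prob e =
    \sum_u \sum_v (incident y (u, v) && col (u, v))%:R * edge_prob (u, v).
  by rewrite pair_bigA /= big_mkcond; apply: eq_bigr => -[u v] _ /=; case: ifP; rewrite ?mul1r ?mul0r.
rewrite big_split /=.
have -> : \sum_(z | kept s K z) edge_prob (y, z) =
    \sum_u \sum_v ((u == y) && kept s K v)%:R * edge_prob (u, v).
  rewrite [RHS](bigD1 y)//= [X in _ + X]big1 ?addr0; last first.
    by move=> u /negbTE uy; rewrite big1// => v _; rewrite uy mul0r.
  by rewrite [LHS]big_mkcond; apply: eq_bigr => v _; rewrite eqxx /=; case: ifP; rewrite ?mul1r ?mul0r.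
have -> : \sum_(z | kept s K z) edge_prob (z, y) =
    \sum_u \sum_v ((v == y) && kept s K u)%:R * edge_prob (u, v).
  rewrite [LHS]big_mkcond; apply: eq_bigr => u _; rewrite [RHS](bigD1 y)//= big1 ?addr0 ?eqxx /=.
    by case: ifP; rewrite ?mul1r ?mul0r.
  by move=> v /negbTE vy; rewrite vy mul0r.
rewrite -big_split; apply: ler_sum => u _ /=; rewrite -big_split; apply: ler_sum => v _ /=.
rewrite -mulrDl ler_wpM2r// -natrD ler_nat /incident /= /col.
case ce : (edge_color s K (u, v)) => [m|]; rewrite ?andbF// andbT.
by have [_ -> -> _] := edge_colorE ce; rewrite !andbT ![y == _]eq_sym; do 2 case: eqP.
Qed.

(** The error is small when the low vertices are light, [eps], their total
    weight is close to [t], [eta], and the weights of the high vertices are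
    known up to a factor close to [1], [rho]. Indeed the expected number of
    edges between [s j] and the low vertices is then close to [t * beta j], and
    that of edges between low vertices to [t ^+ 2 / 2], since [wf u] is close to
    [u] for small [u]. *)
Lemma given_vertices_ge b (A : set ugraph) g0 :
  star_prob b t beta A -
   b%:R * (4 * eps * B ^+ 3 + eps * B + eta * (2 * B + t) + (1 - rho) * (t * B + 2 * B ^+ 2))
   - eps * B ^+ 3 <=
  coin edge_prob E (fun g => \1_A (unlabel (vgraph s K g))) g0.
Proof.
have /andP[r0 r1] := rho01.
have eB3 : 0 <= eps * B ^+ 3 by rewrite mulr_ge0// exprn_ge0.
have eta0 : 0 <= eta by apply: le_trans low_sum.
have beta0 i : 0 <= beta i by apply: le_trans (beta_lo i); rewrite mulr_ge0.
have := vgraph_prob_ge (b := b) s_inj sK e0 edge_prob_vec A g0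
  (star_pmf_ge0 t0 beta0) (fun m => star_pmf_le1 t0 beta0 m b).
apply: le_trans; rewrite -/(star_prob b t beta A) -/E -/col.
apply: lerB.
  rewrite lerD2l lerN2.
  apply: le_trans (sum_set_le2 _ _) _.
  - by move=> m; apply: sumr_ge0.
  - move=> m m2; apply: big1 => k _; rewrite /star_pmf.
    have -> : [seq edge_prob e | e <- E & col e == Some m] = [::].
      rewrite (eq_filter (a2 := pred0)) ?filter_pred0// => e /=.
      by apply/negP => /eqP /(card_edge_color s_inj); rewrite leqNgt m2.
    by move: m2; case: #|m| => [|[|[|c]]]//; rewrite subrr normr0.
  have H1 : \sum_j \sum_(k < b) `|star_pmf t beta [set j]%SET k - bern_pmf (psums [set j]%SET) k|
      <= b%:R * (2 * eps * B ^+ 3 + eta * B + t * (1 - rho) * B).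
    apply: le_trans (ler_sum _ (fun j _ => err1 j b)) _.
    rewrite -mulr_sumr ler_wpM2l// !big_split -!mulr_sumr /=.
    have k1 : 0 <= 2 * eps * B by rewrite !mulr_ge0.
    have k2 : 0 <= t * (1 - rho) by rewrite mulr_ge0 ?subr_ge0.
    have -> : 2 * eps * B ^+ 3 = 2 * eps * B * B ^+ 2 by lra.
    by rewrite !lerD// ler_wpM2l.
  have H2 : \sum_i \sum_(j | i != j) \sum_(k < b) `|star_pmf t beta [set i; j]%SET k
       - bern_pmf (psums [set i; j]%SET) k| <= b%:R * (2 * (1 - rho) * B ^+ 2).
    apply: (@le_trans _ _ (\sum_i \sum_j b%:R * (2 * (1 - rho) * x (s i) * x (s j)))).
      apply: ler_sum => i _; rewrite big_mkcond; apply: ler_sum => j _.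
      case: ifP => ij; first exact: err2.
      by rewrite !mulr_ge0 ?subr_ge0.
    have -> : \sum_i \sum_j b%:R * (2 * (1 - rho) * x (s i) * x (s j)) =
        b%:R * (2 * (1 - rho) * (SH * SH)).
      rewrite /SH big_distrl /= !mulr_sumr; apply: eq_bigr => i _.
      by rewrite big_distrr /= !mulr_sumr; apply: eq_bigr => j _; rewrite !mulrA.
    by rewrite !ler_wpM2l ?mulr_ge0 ?subr_ge0// expr2 ler_pM.
  apply: le_trans (lerD (lerD (err0 b) H1) H2) _.
  rewrite -!mulrDr ler_wpM2l//; lra.
apply: (@le_trans _ _ (\sum_(y | K y) (x y * B) ^+ 2)).
  apply: ler_sum => y Ky; rewrite lerXn2r ?nnegrE ?mulr_ge0 ?low_degree//.
  by apply: sumr_ge0 => e _; have /andP[] := edge_prob_vec e.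
rewrite (eq_bigr (fun y => x y ^+ 2 * B ^+ 2)); last by move=> y _; rewrite exprMn.
rewrite -mulr_suml (_ : eps * B ^+ 3 = eps * B * B ^+ 2); last by lra.
by rewrite ler_wpM2r ?sqr_ge0.
Qed.

End given_vertices.

(** * Sampling the vertices *)

Section grid.
Context (R : realType) (theta rho : R).
Hypothesis theta0 : 0 < theta.
Hypothesis rho01 : 0 < rho < 1.

Definition grid (l : nat) : R := theta * rho ^+ l.

Definition in_cell (l : nat) (y : R) : bool := grid l.+1 < y <= grid l.

(** The index below [m] of the cell of [y], and [m] if there is none. *)
Definition cell_index (m : nat) (y : R) : nat := find (in_cell^~ y) (iota 0 m).

Lemma grid_gt0 l : 0 < grid l.
Proof. by have /andP[r0 _] := rho01; rewrite mulr_gt0// exprn_gt0. Qed.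

Lemma gridS l : grid l.+1 = rho * grid l.
Proof. by rewrite /grid exprS mulrCA. Qed.

Lemma grid_le l l' : (l <= l')%N -> grid l' <= grid l.
Proof.
have /andP[r0 r1] := rho01.
by move=> ll'; rewrite ler_pM2l// ler_wiXn2l ?ltW.
Qed.

Lemma in_cell_inj l l' y : in_cell l y -> in_cell l' y -> l = l'.
Proof.
move=> /andP[a1 a2] /andP[b1 b2].
case: (ltngtP l l') => // ll'.
  by have := lt_le_trans a1 (le_trans b2 (grid_le ll')); rewrite ltxx.
by have := lt_le_trans b1 (le_trans a2 (grid_le ll')); rewrite ltxx.
Qed.

Lemma in_cell_ex m y : grid m < y <= theta -> exists2 l, (l < m)%N & in_cell l y.
Proof.
elim: m => [|m IH] /andP[my yt].
  by move: my; rewrite /grid expr0 mulr1 ltNge yt.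
have [ym|ym] := leP y (grid m).
  by exists m => //; rewrite /in_cell my ym.
by have [l lm ly] := IH (introT andP (conj ym yt)); exists l => //; apply: ltnW.
Qed.

Lemma cell_indexE m l y : (l < m)%N -> (cell_index m y == l) = in_cell l y.
Proof.
move=> lm; apply/eqP/idP => [E|ly].
  have : has (in_cell^~ y) (iota 0 m) by rewrite has_find size_iota -/(cell_index m y) E.
  by move/(nth_find 0%N); rewrite -/(cell_index m y) E nth_iota.
have h : has (in_cell^~ y) (iota 0 m) by apply/hasP; exists l; rewrite ?mem_iota.
have := nth_find 0%N h; rewrite -/(cell_index m y) nth_iota ?add0n; last first.
  by move: h; rewrite has_find size_iota.
by move=> /in_cell_inj; apply.
Qed.

Lemma cell_index_lt m y : grid m < y <= theta -> (cell_index m y < m)%N.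
Proof.
by move=> /in_cell_ex[l lm ly]; have := cell_indexE y lm; rewrite ly => /eqP ->.
Qed.

Lemma in_cell_index m y : (cell_index m y < m)%N -> in_cell (cell_index m y) y.
Proof. by move=> lm; rewrite -(cell_indexE y lm). Qed.

(** The weight of a vertex is rounded down to the lower end of its cell, so that
    only the types of the vertices matter. *)
Definition type_prob (b : nat) (t : R) (A : set ugraph) (cs : seq nat) : R :=
  star_prob b t (fun i : 'I_(size cs) => grid (nth 0%N cs i).+1) A.

Lemma type_probE b t A (V : finType) (f : V -> nat) cs :
  perm_eq [seq f i | i <- enum V] cs ->
  star_prob b t (fun i => grid (f i).+1) A = type_prob b t A cs.
Proof.
move=> fcs; have /(perm_iotaP 0%N)[Is pIs fE] := fcs.
have sz : size cs = #|V| by rewrite -(perm_size fcs) size_map cardE.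
have szI : size Is = #|V| by rewrite (perm_size pIs) size_iota.
have hlt v : (nth 0%N Is (index v (enum V)) < size cs)%N.
  have : nth 0%N Is (index v (enum V)) \in Is.
    by rewrite mem_nth// szI cardE index_mem mem_enum.
  by rewrite (perm_mem pIs) mem_iota add0n.
pose h v : 'I_(size cs) := Ordinal (hlt v).
have uI : uniq Is by rewrite (perm_uniq pIs) iota_uniq.
have hinj : injective h.
  move=> u v /(congr1 val) /eqP /=.
  rewrite nth_uniq ?szI ?cardE ?index_mem ?mem_enum// => /eqP uv.
  by rewrite -[u](nth_index u (mem_enum V u)) -[v in RHS](nth_index u (mem_enum V v)) uv.
have [h' hK h'K] : bijective h by apply: inj_card_bij => //; rewrite card_ord sz.
apply: (star_prob_relabel b t A hK h'K) => v /=.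
congr (grid _.+1); rewrite -(nth_map 0%N 0%N (nth 0%N cs)); last first.
  by rewrite szI cardE index_mem mem_enum.
by rewrite -fE (nth_map v) ?index_mem ?mem_enum// nth_index ?mem_enum.
Qed.

(** Relabelling the vertices does not change the unlabeled graph; the types may
    thus be replaced by their numbers of occurrences. *)
Lemma type_prob_perm b t A cs cs' : perm_eq cs cs' ->
  type_prob b t A cs = type_prob b t A cs'.
Proof.
move=> pcs; apply: type_probE.
have -> : [seq nth 0%N cs (nat_of_ord i) | i <- enum 'I_(size cs)] =
    [seq nth 0%N cs j | j <- [seq nat_of_ord i | i <- enum 'I_(size cs)]] by rewrite -map_comp.
by rewrite val_enum_ord map_nth_iota0// take_size.
Qed.

Definition counts_seq m (N : 'I_m -> nat) : seq nat :=
  flatten [seq nseq (N l) (val l) | l <- enum 'I_m].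

Lemma counts_seqP m (N : 'I_m -> nat) (cs : seq nat) :
  (forall c, c \in cs -> (c < m)%N) ->
  (forall l : 'I_m, count_mem (l : nat) cs = N l) -> perm_eq cs (counts_seq N).
Proof.
move=> csm csN; apply/allP => c _ /=; apply/eqP.
rewrite /counts_seq count_flatten -map_comp sumnE big_map.
have [cm|mc] := ltnP c m; last first.
  rewrite (count_memPn _) ?big1//; last by apply/negP => /csm; rewrite ltnNge mc.
  move=> l _ /=; rewrite count_nseq /=; case: eqP => // lc.
  by move: mc; rewrite -lc leqNgt ltn_ord.
rewrite big_enum (bigD1 (Ordinal cm))//= big1 ?addn0; last first.
  move=> l; rewrite -val_eqE /= count_nseq /= => /negbTE lc.
  by rewrite lc mul0n.
by rewrite count_nseq /= eqxx mul1n -csN.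
Qed.

End grid.

Section sampled_vertices.
Context (R : realType) (n : nat) (i0 : 'I_n) (x : 'I_n -> R) (p theta rho : R).
Variables (m b : nat) (B t eta : R) (A : set ugraph).
Hypothesis x0 : forall i, 0 <= x i.
Hypothesis p01 : 0 <= p <= 1.
Hypothesis theta0 : 0 < theta.
Hypothesis rho01 : 0 < rho < 1.
Hypothesis B0 : 0 < B.
Hypothesis Btheta : B <= theta.
Hypothesis t0 : 0 <= t.
Hypothesis eta0 : 0 < eta.

Definition sampled_adj (V : 'I_n -> bool) (g : 'I_n * 'I_n -> bool) (i j : 'I_n) : Prop :=
  [/\ V i, V j & sgraph g i j].

(** The mean over the random graph of the law of the sample; here both the kept
    vertices and the edges are random. *)
Definition annealed : R :=
  coin (fun=> p) (enum 'I_n) (fun V => coin (edge_prob x) (enum {: 'I_n * 'I_n})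
     (fun g => \1_A (unlabel (sampled_adj V g))) (fun=> false)) (fun=> false).

Let eps := grid theta rho m.
Let ix i := cell_index theta rho m (x i).

Definition good_sample (V : 'I_n -> bool) : bool :=
  (\sum_(i | V i) x i <= B) && (`|\sum_(i | V i && (x i <= eps)) x i - t| <= eta).

Definition given_error : R :=
  b%:R * (4 * eps * B ^+ 3 + eps * B + eta * (2 * B + t) +
    (1 - rho) * (t * B + 2 * B ^+ 2)) + eps * B ^+ 3.

Definition high_types (V : 'I_n -> bool) : seq nat :=
  [seq ix i | i <- [seq i <- enum 'I_n | V i && (ix i < m)%N]].

(** The vertices of weight above [eps] are the high vertices of
    [given_vertices_ge]; since the total weight is at most [theta], each of them
    lies in one of the [m] cells. *)
Lemma good_sample_ge V : good_sample V ->
  type_prob theta rho b t A (high_types V) - given_error <=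
  coin (edge_prob x) (enum {: 'I_n * 'I_n})
     (fun g => \1_A (unlabel (sampled_adj V g))) (fun=> false).
Proof.
move=> /andP[SB Slow].
pose hs := [seq i <- enum 'I_n | V i && (ix i < m)%N].
pose s (i : 'I_(size hs)) := tnth (in_tuple hs) i.
pose K (i : 'I_n) := V i && (x i <= eps).
have e0 : 0 < eps by apply: grid_gt0.
have hsP i : (i \in hs) = V i && (ix i < m)%N by rewrite mem_filter mem_enum andbT.
have uhs : uniq hs by rewrite filter_uniq// enum_uniq.
have sP i : V (s i) && (ix (s i) < m)%N by rewrite -hsP mem_tnth.
have scell i : in_cell theta rho (ix (s i)) (x (s i)).
  by apply: in_cell_index => //; have /andP[] := sP i.
have s_inj : injective s by apply/tuple_uniqP.
have sK i : ~~ K (s i).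
  rewrite negb_and -ltNge; apply/orP; right.
  have /andP[+ _] := scell i; apply: le_lt_trans; apply: grid_le => //.
  by have /andP[] := sP i.
have xle i : V i -> x i <= theta.
  move=> Vi; apply: le_trans Btheta; apply: le_trans SB.
  by rewrite (bigD1 i)//= lerDl sumr_ge0.
have keptE : kept s K = V.
  apply/funext => i; apply/orP/idP => [[/codomP[j ->]|/andP[]//]|Vi].
    by have /andP[] := sP j.
  have [xe|ex] := leP (x i) eps; first by right; rewrite /K Vi xe.
  left; have : i \in hs by rewrite hsP Vi cell_index_lt// ex xle.
  by move=> /seq_tnthP[j ->]; apply/codomP; exists j.
have sumE (F : 'I_n -> R) : \sum_i F (s i) + \sum_(y | K y) F y = \sum_(i | V i) F i.
  rewrite [RHS](bigID (fun i => ix i < m)%N)/=; congr (_ + _).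
    rewrite -(big_tnth _ _ hs xpredT) big_filter big_enum_cond /=.
    by apply: eq_bigl.
  apply: eq_bigl => i; rewrite /K; case Vi : (V i) => //=.
  rewrite -leqNgt; apply/idP/idP => [xe|mi].
    rewrite leqNgt; apply/negP => lm.
    have /andP[+ _] := in_cell_index theta0 rho01 lm.
    by apply/negP; rewrite -leNgt; apply: le_trans xe _; apply: grid_le.
  rewrite leNgt; apply/negP => ex; move: mi; rewrite leqNgt cell_index_lt//.
  by rewrite ex xle.
have r01 : 0 <= rho <= 1 by have /andP[/ltW -> /ltW ->] := rho01.
have H := @given_vertices_ge R n _ s K (i0, i0) s_inj sK x
  (fun i => grid theta rho (ix (s i)).+1) eps eta B t rho x0 r01.
have sampE : forall g, unlabel (vgraph s K g) = unlabel (sampled_adj V g).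
  by move=> g; rewrite /vgraph keptE.
have {}H := H _ _ _ _ _ t0 (ltW e0) b A (fun=> false).
have E : star_prob b t (fun i => grid theta rho (ix (s i)).+1) A =
    type_prob theta rho b t A (high_types V).
  apply: type_probE; rewrite /high_types -/hs.
  by rewrite (map_comp ix s) map_tnth_enum.
rewrite -E /given_error opprD addrA; apply: le_trans (H _ _ _ _ _) _.
- move=> i; rewrite gridS ler_pM2l; last by have /andP[] := rho01.
  by have /andP[] := scell i.
- by move=> i; have /andP[/ltW] := scell i.
- by move=> y /andP[].
- by rewrite sumE.
- exact: Slow.
- by apply: ler_coin; [exact: edge_prob_vec|move=> g; rewrite sampE].
Qed.

(** Markov's inequality for the total weight, and Chebyshev's for the weight of
    the low vertices. *)
Lemma bad_sample_le :
  coin (fun=> p) (enum 'I_n) (fun V => (~~ good_sample V)%:R) (fun=> false) <=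
  p * (\sum_i x i) / B +
  ((p * (\sum_(i | x i <= eps) x i) - t) ^+ 2 + eps * (p * \sum_i x i)) / eta ^+ 2.
Proof.
have p01' : prob_vec (fun _ : 'I_n => p) by move=> i; exact: p01.
have /andP[p0 p1] := p01.
have S0 (Q : pred 'I_n) : 0 <= \sum_(i | Q i) x i by apply: sumr_ge0.
apply: (@le_trans _ _ (coin (fun=> p) (enum 'I_n) (fun V =>
   B^-1 * (\sum_(i <- enum 'I_n) x i * (V i)%:R) +
   (eta ^+ 2)^-1 * ((p * (\sum_(i | x i <= eps) x i) - t) +
     \sum_(i <- enum 'I_n) (if x i <= eps then x i else 0) * ((V i)%:R - p)) ^+ 2)
   (fun=> false))).
  apply: ler_coin => // V.
  have SE : \sum_(i <- enum 'I_n) x i * (V i)%:R = \sum_(i | V i) x i.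
    by rewrite big_enum [RHS]big_mkcond; apply: eq_bigr => i _; case: (V i); rewrite ?mulr1 ?mulr0.
  have TE : (p * (\sum_(i | x i <= eps) x i) - t) +
     \sum_(i <- enum 'I_n) (if x i <= eps then x i else 0) * ((V i)%:R - p) =
     \sum_(i | V i && (x i <= eps)) x i - t.
    rewrite addrAC mulr_sumr big_enum big_mkcond -big_split /= [in RHS]big_mkcond; congr (_ - _).
    apply: eq_bigr => i _; case: (V i); case: ifP => _ /=; lra.
  rewrite SE TE /good_sample negb_and -!ltNge.
  set S := \sum_(i | V i) x i; set D := _ - t.
  have S1 : 0 <= B^-1 * S by rewrite mulr_ge0 ?invr_ge0 ?S0// ltW.
  have D1 : 0 <= (eta ^+ 2)^-1 * D ^+ 2 by rewrite mulr_ge0 ?invr_ge0 ?sqr_ge0.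
  case: ltP => [BS|_] /=.
    apply: (@le_trans _ _ (B^-1 * S)); last by rewrite lerDl.
    by rewrite mulrC ler_pdivlMr// mul1r ltW.
  case: ltP => [eD|_] /=; last by rewrite addr_ge0.
  apply: (@le_trans _ _ ((eta ^+ 2)^-1 * D ^+ 2)); last by rewrite lerDr.
  rewrite mulrC ler_pdivlMr ?exprn_gt0// mul1r -[D ^+ 2]real_normK ?num_real//.
  by rewrite lerXn2r ?nnegrE// ltW.
rewrite coinD !coinZ coin_sum coin_variance ?enum_uniq//.
rewrite lerD//.
  rewrite mulrC ler_wpM2r ?invr_ge0 ?(ltW B0)// big_enum mulr_sumr; apply: ler_sum => i _.
  by rewrite coinZ (coin_coord _ _ (fun b : bool => b%:R)) ?enum_uniq ?mem_enum//=; lra.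
rewrite mulrC ler_wpM2r ?invr_ge0 ?sqr_ge0// lerD2l big_enum !mulr_sumr.
apply: ler_sum => i _; case: ifP => xe; last first.
  have e0 : 0 <= eps by apply/ltW/grid_gt0.
  by rewrite expr0n /= mul0r; exact: mulr_ge0 e0 (mulr_ge0 p0 (x0 i)).
rewrite expr2 -mulrA; apply: ler_pM => //.
  by rewrite !mulr_ge0 ?subr_ge0.
by rewrite mulrCA ler_wpM2l// ler_piMr// lerBlDr lerDl.
Qed.

Lemma type_prob01 cs : 0 <= type_prob theta rho b t A cs <= 1.
Proof.
have g0 i : 0 <= grid theta rho i by apply/ltW/grid_gt0.
apply/andP; split.
  apply: sumr_ge0 => k _; rewrite mulr_ge0 ?indic_ge0//.
  by apply: prodr_ge0 => j _; apply: star_pmf_ge0.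
apply: (@le_trans _ _ (\sum_(k : {ffun {set 'I_(size cs)} -> 'I_b})
   \prod_(j : {set 'I_(size cs)}) star_pmf t (fun i : 'I_(size cs) => grid theta rho (nth 0%N cs i).+1) j (k j))).
  apply: ler_sum => k _; rewrite ler_piMr ?indic_le1//.
  by apply: prodr_ge0 => j _; apply: star_pmf_ge0.
rewrite -(bigA_distr_bigA (fun j (k : 'I_b) => star_pmf t (fun i : 'I_(size cs) => grid theta rho (nth 0%N cs i).+1) j k)).
apply: prodr_ile1 => j _; rewrite star_pmf_le1// andbT.
by apply: sumr_ge0 => k _; apply: star_pmf_ge0.
Qed.

(** A product form is obtained by [product_law_ge], because the numbers of kept
    vertices in the cells are independent sums of Bernoulli variables. *)
Lemma annealed_ge (c : nat) (lam : 'I_m -> R) : (forall l, 0 <= lam l) ->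
  \sum_(N : {ffun 'I_m -> 'I_c}) (\prod_(l < m) poisson_mass (lam l) (N l)) *
     type_prob theta rho b t A (counts_seq (fun l => N l : nat))
  - \sum_(l < m) \sum_(k < c) `|poisson_mass (lam l) k -
       bern_pmf [seq p | i <- enum 'I_n & ix i == l :> nat] k|
  - given_error
  - (p * (\sum_i x i) / B +
     ((p * (\sum_(i | x i <= eps) x i) - t) ^+ 2 + eps * (p * \sum_i x i)) / eta ^+ 2)
  <= annealed.
Proof.
move=> lam0; have p01' : prob_vec (fun _ : 'I_n => p) by move=> i; exact: p01.
have /andP[p0 p1] := p01.
have ge0' : 0 <= given_error.
  have e0 : 0 <= eps by apply/ltW/grid_gt0.
  have B0' := ltW B0; have /andP[r0 /ltW r1] := rho01; have h0 := ltW eta0.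
  have B3 : 0 <= eps * B ^+ 3 by rewrite mulr_ge0// exprn_ge0.
  have B2 : 0 <= B ^+ 2 by rewrite sqr_ge0.
  have eB : 0 <= eps * B by rewrite mulr_ge0.
  have T1 : 0 <= eta * (2 * B + t) by rewrite mulr_ge0 ?addr_ge0 ?mulr_ge0.
  have T2 : 0 <= (1 - rho) * (t * B + 2 * B ^+ 2).
    by rewrite mulr_ge0 ?subr_ge0// addr_ge0 ?mulr_ge0.
  by rewrite /given_error addr_ge0// mulr_ge0//; lra.
rewrite lerBlDr; apply: le_trans (lerD (lexx _) bad_sample_le).
rewrite lerBlDr.
apply: le_trans (product_law_ge (f := fun (l : 'I_m) (k : 'I_c) =>
    bern_pmf [seq p | i <- enum 'I_n & ix i == l :> nat] k) _ _ _ _) _.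
  - move=> l k; rewrite -(coin_count_pmf (fun=> p) (fun i => ix i == l :> nat) _ (fun=> false)) ?enum_uniq//.
    by rewrite coin_ge0.
  - by move=> l k; apply: poisson_mass_ge0.
  - by move=> l; apply: sum_poisson_mass_le1.
  - by move=> N; apply: type_prob01.
have lawE (N : {ffun 'I_m -> 'I_c}) :
    \prod_(l < m) bern_pmf [seq p | i <- enum 'I_n & ix i == l :> nat] (N l) =
    coin (fun=> p) (enum 'I_n) (fun V =>
      \prod_(l < m) (count (fun i => (ix i == l :> nat) && V i) (enum 'I_n) == N l :> nat)%:R) (fun=> false).
  pose F (l : option 'I_m) (V : 'I_n -> bool) : R :=
    if l is Some l then (count (fun i => (ix i == l :> nat) && V i) (enum 'I_n) == N l :> nat)%:R else 1.
  pose col i : option 'I_m := insub (ix i).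
  transitivity (coin (fun=> p) (enum 'I_n) (fun V => \prod_(l <- [seq Some l | l <- enum 'I_m]) F l V) (fun=> false)); last first.
    by apply: coin_ext => V; rewrite big_map big_enum.
  rewrite (@coin_indep_prod _ _ _ col); last 2 first.
  - by rewrite map_inj_uniq ?enum_uniq// => ? ? [].
  - case=> [l|] V V' VV' //; rewrite /F; congr ((_ == _)%:R); apply: eq_count => i.
    case: eqP => //= il; apply: VV'; rewrite /col; apply/eqP.
    by rewrite il valK.
  rewrite big_map big_enum; apply: eq_bigr => l _.
  by rewrite /F (coin_count_pmf (fun=> p) (fun i => ix i == l :> nat))// enum_uniq.
under eq_bigr => N _ do rewrite lawE mulrC -coinZ.
rewrite -coin_sum -[given_error](coin_cst (fun=> p) (enum 'I_n) _ (fun=> false)) -!coinD.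
apply: ler_coin => // V.
have an0 : 0 <= coin (edge_prob x) (enum {: 'I_n * 'I_n})
     (fun g => \1_A (unlabel (sampled_adj V g))) (fun=> false) :> R.
  by apply: coin_ge0 => [|g]; [exact: edge_prob_vec|exact: indic_ge0].
have LHS1 : \sum_(N : {ffun 'I_m -> 'I_c}) type_prob theta rho b t A (counts_seq (fun l => N l : nat)) *
    (\prod_(l < m) (count (fun i => (ix i == l :> nat) && V i) (enum 'I_n) == N l :> nat)%:R) <=
    type_prob theta rho b t A (high_types V).
  have [[N0 N0E]|nN] := pselect (exists N0 : {ffun 'I_m -> 'I_c}, forall l : 'I_m,
      count (fun i => (ix i == l :> nat) && V i) (enum 'I_n) = N0 l).
    rewrite (bigD1 N0)//= [X in _ + X]big1 ?addr0; last first.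
      move=> N /eqP NN0; have [l Nl] : exists l, N0 l <> N l.
        by apply/not_existsP => H; apply: NN0; apply/ffunP => l; have /contrapT := H l.
      rewrite [X in _ * X](bigD1 l)//= N0E (introF eqP) ?mul0r ?mulr0// => /val_inj //.
    rewrite [X in _ * X]big1 ?mulr1; last by move=> l _; rewrite N0E eqxx.
    rewrite (@type_prob_perm _ theta rho b t A (high_types V) (counts_seq (fun l => N0 l : nat)))//.
    apply: counts_seqP => [c'|l].
      by move=> /mapP[i]; rewrite mem_filter => /andP[/andP[_ im] _] ->.
    rewrite -N0E /high_types count_map count_filter; apply: eq_count => i /=.
    by case: eqP => // ->; rewrite ltn_ord andbT.
  rewrite big1; first by have /andP[] := type_prob01 (high_types V).
  move=> N _; have [l Nl] : exists l : 'I_m, count (fun i => (ix i == l :> nat) && V i) (enum 'I_n) <> N l.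
    by apply/not_existsP => H; apply: nN; exists N => l; have /contrapT := H l.
  by rewrite [X in _ * X](bigD1 l)//= (introF eqP Nl) mul0r mulr0.
apply: le_trans LHS1 _; case gV : (good_sample V) => /=.
  by rewrite addr0 -lerBlDr; apply: good_sample_ge.
have /andP[_ tp1] := type_prob01 (high_types V).
by apply: le_trans tp1 _; rewrite -addrA addrCA lerDl addr_ge0.
Qed.

End sampled_vertices.

(** * Real-valued probabilities *)

Section countable_sets.
Context d (T : measurableType d).

Lemma measurable_exists (I : countType) (F : I -> set T) :
  (forall i, measurable (F i)) -> measurable [set w | exists i, F i w].
Proof.
move=> mF; have -> : [set w | exists i, F i w] =
    \bigcup_n (if unpickle n is Some i then F i else set0).
  apply/seteqP; split => [w [i Fi]|w [n _]].
    by exists (pickle i); rewrite // pickleK.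
  by case: (unpickle n) => // i Fi; exists i.
by apply: bigcupT_measurable => n; case: (unpickle n).
Qed.

Lemma measurable_forall (I : countType) (F : I -> set T) :
  (forall i, measurable (F i)) -> measurable [set w | forall i, F i w].
Proof.
move=> mF; have -> : [set w | forall i, F i w] = ~` [set w | exists i, (~` F i) w].
  apply/seteqP; split => [w Fw [i]|w Fw i]; first exact.
  by apply: contrapT => nF; apply: Fw; exists i.
by apply: measurableC; apply: measurable_exists => i; apply: measurableC.
Qed.

Lemma measurable_cond (b : bool) (F : set T) :
  measurable F -> measurable [set w | b -> F w].
Proof.
move=> mF; case: b; first by rewrite (_ : [set _ | _] = F)//; apply/seteqP; split => w /=; exact.
by rewrite (_ : [set _ | _] = setT)//; apply/seteqP; split.
Qed.

Lemma measurable_pred (b : bool) : measurable [set w : T | b].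
Proof.
case: b; first by rewrite (_ : [set _ | _] = setT)//; apply/seteqP; split.
by rewrite (_ : [set _ | _] = set0)//; apply/seteqP; split.
Qed.

End countable_sets.

Section pr.
Context d (T : measurableType d) (R : realType) (P : probability T R).
Implicit Types E F : set T.

Definition pr E : R := fine (P E).

Lemma pr_fine E : pr E = fine (P E). Proof. by []. Qed.

Lemma prE E : measurable E -> P E = (pr E)%:E.
Proof. by move=> mE; rewrite /pr fineK// fin_num_measure. Qed.

Lemma pr_ge0 E : 0 <= pr E.
Proof. by rewrite /pr fine_ge0. Qed.

Lemma le_pr E F : measurable E -> measurable F -> E `<=` F -> pr E <= pr F.
Proof. by move=> mE mF EF; rewrite -lee_fin -!prE// le_measure ?inE. Qed.

Lemma pr_set0 : pr set0 = 0.
Proof. by rewrite /pr measure0. Qed.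

Lemma pr_setC E : measurable E -> pr (~` E) = 1 - pr E.
Proof.
move=> mE; apply: EFin_inj; rewrite -prE; last exact: measurableC.
by rewrite probability_setC// prE.
Qed.

Lemma pr_setU_le E F : measurable E -> measurable F -> pr (E `|` F) <= pr E + pr F.
Proof.
move=> mE mF; rewrite -lee_fin EFinD -!prE//; last exact: measurableU.
exact: measureU2.
Qed.

Lemma pr_setU E F : measurable E -> measurable F -> E `&` F = set0 ->
  pr (E `|` F) = pr E + pr F.
Proof.
move=> mE mF EF; apply: EFin_inj; rewrite EFinD -!prE//; last exact: measurableU.
by rewrite measureU.
Qed.

Lemma pr_setID E F : measurable E -> measurable F ->
  pr E = pr (E `&` F) + pr (E `&` ~` F).
Proof.
move=> mE mF; rewrite -pr_setU; first by rewrite -setIUr setUv setIT.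
- exact: measurableI.
- by apply: measurableI => //; apply: measurableC.
- by rewrite setIACA setICr setI0.
Qed.

Lemma pr_exists_fin (I : finType) (F : I -> set T) : (forall i, measurable (F i)) ->
  pr [set w | exists i, F i w] <= \sum_i pr (F i).
Proof.
move=> mF; pose U (s : seq I) := [set w | exists2 i, i \in s & F i w].
have US s : measurable (U s) /\ pr (U s) <= \sum_(i <- s) pr (F i).
  elim: s => [|i s [mU IH]].
    have -> : U [::] = set0 by apply/seteqP; split => w // [].
    by rewrite big_nil pr_set0; split.
  have -> : U (i :: s) = F i `|` U s.
    apply/seteqP; split => w; first case=> j; rewrite ?in_cons.
      by case/orP => [/eqP ->|js] Fj; [left|right; exists j].
    by case=> [Fi|[j js Fj]]; [exists i|exists j]; rewrite ?in_cons ?eqxx ?js ?orbT.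
  split; first exact: measurableU.
  by rewrite big_cons; apply: le_trans (pr_setU_le _ _) _ => //; rewrite lerD2l.
have -> : [set w | exists i, F i w] = U (enum I).
  apply/seteqP; split => w [i]; first by move=> Fi; exists i; rewrite ?mem_enum.
  by move=> _ Fi; exists i.
by have [_] := US (enum I); rewrite big_enum.
Qed.

(** Continuity from below. *)
Lemma pr_exists_nat (F : nat -> set T) (c : R) : (forall n, measurable (F n)) ->
  (forall n m, (n <= m)%N -> F n `<=` F m) -> (forall n, pr (F n) <= c) ->
  pr [set w | exists n, F n w] <= c.
Proof.
move=> mF ndF Fc.
have -> : [set w | exists n, F n w] = \bigcup_n F n.
  by apply/seteqP; split => w [n]; [exists n|exists n].
have mU : measurable (\bigcup_n F n) by apply: bigcupT_measurable.
have := @nondecreasing_cvg_mu _ _ _ P F mF mU.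
have nd : {homo F : n m / (n <= m)%N >-> (n <= m)%O}.
  by move=> n m nm; apply/subsetPset; apply: ndF.
move=> /(_ nd) cv; rewrite -lee_fin -prE//.
rewrite -(cvg_lim _ cv)//; apply: lime_le; first by apply/cvg_ex; exists (P (\bigcup_n F n)).
by near=> n; rewrite /= prE// lee_fin.
Unshelve. all: by end_near. Qed.

Lemma pr_null_exists (I : countType) (F : I -> set T) : (forall i, measurable (F i)) ->
  (forall i, pr (F i) = 0) -> pr [set w | exists i, F i w] = 0.
Proof.
move=> mF F0.
pose U n := [set w | exists i : 'I_n, (if unpickle i is Some j then F j else set0) w].
have mG n : measurable (if unpickle n is Some j then F j else set0) by case: (unpickle n).
have mU n : measurable (U n) by apply: measurable_exists.
apply/eqP; rewrite eq_le pr_ge0 andbT.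
have -> : [set w | exists i, F i w] = [set w | exists n, U n w].
  apply/seteqP; split => [w [i Fi]|w [n [k]]].
    by exists (pickle i).+1, (Ordinal (ltnSn _)); rewrite /= pickleK.
  by case: (unpickle _) => // j Fj; exists j.
apply: pr_exists_nat => // [n m nm w [k Fk]|n].
  by exists (widen_ord nm k).
apply: le_trans (pr_exists_fin _) _; first by move=> i; exact: mG.
by rewrite big1// => i _; case: (unpickle _) => [j|]; rewrite ?F0 ?pr_set0.
Qed.

(** The indicators of the events add up to at most [c] on [Z]. *)
Lemma pr_multiplicity (I : finType) (D : I -> set T) (Z : set T) (c : nat) :
  (forall i, measurable (D i)) -> measurable Z ->
  (forall w, Z w -> (#|[set i | `[< D i w >]]%SET| <= c)%N) ->
  \sum_i pr (D i `&` Z) <= c%:R * pr Z.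
Proof.
move=> mD mZ DZ.
have mDZ i : measurable (D i `&` Z) by apply: measurableI.
rewrite -lee_fin -sumEFin EFinM -prE//.
under eq_bigr => i _ do rewrite -prE//.
have -> : (\sum_i P (D i `&` Z))%E = (\int[P]_w (\sum_i (\1_(D i `&` Z) w)%:E))%E.
  rewrite ge0_integral_sum//.
  - by apply: eq_bigr => i _; rewrite integral_indic// setIT.
  - by move=> i; apply/measurable_EFinP; exact: measurable_indic.
have -> : (c%:R%:E * P Z)%E = (\int[P]_w (c%:R * \1_Z w)%:E)%E.
  under eq_integral => w _ do rewrite EFinM.
  rewrite ge0_integralZl_EFin//.
  - by rewrite integral_indic// setIT.
  - by apply/measurable_EFinP; exact: measurable_indic.
apply: ge0_le_integral => //.
- by move=> w _; apply: sume_ge0 => i _; rewrite lee_fin.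
- by apply: emeasurable_sum => i; apply/measurable_EFinP; exact: measurable_indic.
- by apply/measurable_EFinP; apply: measurable_funM => //; exact: measurable_indic.
move=> w _; rewrite sumEFin lee_fin.
have [Zw|nZ] := pselect (Z w); last first.
  by rewrite big1 ?mulr_ge0// => i _; rewrite indicE memNset// => -[].
rewrite [\1_Z w]indicE mem_set// mulr1; apply: le_trans (_ : _ <= #|[set i | `[< D i w >]]%SET|%:R) _; last first.
  by rewrite ler_nat; apply: DZ.
rewrite -sum1_card natr_sum [leRHS]big_mkcond; apply: ler_sum => i _.
rewrite finset.in_set indicE; case: asboolP => [Di|nD]; last by rewrite memNset// => -[].
by rewrite lern1 leq_b1.
Qed.

(** Summing a bound that holds conditionally on each of the disjoint events [E
    i]. *)
Lemma pr_sum_disjoint (I : countType) (E D : I -> set T) (phi : R) :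
  (forall i, measurable (E i)) -> (forall i, measurable (D i)) -> 0 <= phi ->
  (forall i j w, E i w -> E j w -> i = j) ->
  (forall i, pr (E i `&` D i) <= phi * pr (E i)) ->
  pr [set w | exists i, (E i `&` D i) w] <= phi * pr [set w | exists i, E i w].
Proof.
move=> mE mD phi0 disj H.
pose G n := if @pickle_inv I n is Some j then E j `&` D j else set0.
pose E' n := if @pickle_inv I n is Some j then E j else set0.
have mG n : measurable (G n) by rewrite /G; case: (@pickle_inv I n) => // j; apply: measurableI.
have mE' n : measurable (E' n) by rewrite /E'; case: (@pickle_inv I n).
have mEx : measurable [set w | exists i, E i w] by apply: measurable_exists.
pose U n := [set w | exists i : 'I_n, G i w].
have mU n : measurable (U n) by apply: measurable_exists.
have -> : [set w | exists i, (E i `&` D i) w] = [set w | exists n, U n w].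
  apply/seteqP; split => [w [i Fi]|w [n [k]]].
    by exists (pickle i).+1, (Ordinal (ltnSn _)); rewrite /= /G pickleK_inv.
  by rewrite /G; case: (@pickle_inv I _) => // j Fj; exists j.
apply: pr_exists_nat => // [n m nm w [k Fk]|n].
  by exists (widen_ord nm k).
apply: le_trans (pr_exists_fin _) _ => //.
apply: (@le_trans _ _ (\sum_(i < n) phi * pr (E' i))).
  apply: ler_sum => i _; rewrite /G /E'; case: (@pickle_inv I _) => [j|]; first exact: H.
  by rewrite pr_set0 mulr0.
rewrite -mulr_sumr ler_wpM2l//.
apply: le_trans (_ : _ <= \sum_(i < n) pr (E' i `&` [set w | exists i, E i w])) _.
  apply: ler_sum => i _; apply: le_pr => //; first exact: measurableI.
  by move=> w; rewrite /E'; case: (@pickle_inv I _) => // j Ej; split=> //; exists j.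
rewrite -[leRHS]mul1r; apply: (@pr_multiplicity _ (fun i : 'I_n => E' i) _ 1) => // w [i0 Ei0].
apply/card_le1P => i; rewrite finset.in_set => /asboolP Ei j; rewrite finset.in_set.
apply/asboolP/idP; last by rewrite inE => /eqP ->.
move: Ei; rewrite /E' inE.
have := @pickle_invK I i; have := @pickle_invK I j.
case: (@pickle_inv I i) => [u|]//=; case: (@pickle_inv I j) => [v|]//= vj ui Eu Ev.
by apply/eqP/val_inj; rewrite /= -vj -ui (disj _ _ _ Eu Ev).
Qed.

End pr.

(** * The noise of a graphex process *)

Section noise.
Context d (T : measurableType d) (R : realType) (P : probability T R) (t : R)
  (X : gp_noise P t).
Hypothesis t0 : 0 <= t.
Local Notation v := (gp_point X).
Local Notation u := (gp_unif X).
Local Notation pr := (pr P).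

Lemma measurable_unif m (B : set R) : measurable B -> measurable (u m @^-1` B).
Proof. by move=> mB; rewrite -[X in measurable X]setTI; apply: measurable_funPT. Qed.

Lemma measurable_point j (B : set R) : measurable B -> measurable (v j @^-1` B).
Proof. by move=> mB; rewrite -[X in measurable X]setTI; apply: measurable_funPT. Qed.

Lemma point_ge0 j w : 0 <= v j w.
Proof. exact: (point_poisson X).1. Qed.

Lemma unif_le m x : 0 <= x <= 1 -> pr (u m @^-1` [set y | y <= x]) = x.
Proof. by move=> x01; rewrite pr_fine (unif_uniform X m x01). Qed.

Let m_le (x : R) : measurable [set y : R | y <= x].
Proof. by rewrite -set_itvNyc. Qed.

Let m_lt (x : R) : measurable [set y : R | y < x].
Proof. by rewrite -set_itvNyo. Qed.

Lemma unif_lt m x : 0 <= x <= 1 -> pr (u m @^-1` [set y | y < x]) = x.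
Proof.
move=> /andP[x0 x1]; apply/eqP; rewrite eq_le; apply/andP; split.
  rewrite -[leRHS](unif_le m (x := x)) ?x0//; apply: le_pr; try exact: measurable_unif.
  by move=> w /= /ltW.
apply/ler_addgt0Pl => e e0; rewrite -lerBlDl.
have [xe|ex] := leP e x; last by apply: le_trans (pr_ge0 _ _); lra.
rewrite -[leLHS](unif_le m (x := x - e)); last by lra.
apply: le_pr; try exact: measurable_unif.
by move=> w /= /le_lt_trans; apply; lra.
Qed.

Lemma unif_window_lt m x y : 0 <= x -> x <= y -> y <= 1 ->
  pr (u m @^-1` [set z | x <= z < y]) = y - x.
Proof.
move=> x0 xy y1.
have E : u m @^-1` [set z | x <= z < y] =
    u m @^-1` [set z | z < y] `&` ~` (u m @^-1` [set z | z < x]).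
  apply/seteqP; split => w /=.
    by move=> /andP[a b]; split=> //; apply/negP; rewrite -leNgt.
  by move=> [a /negP]; rewrite -leNgt => b; apply/andP.
have m1 := measurable_unif m (m_lt y); have m2 := measurable_unif m (m_lt x).
have := pr_setID P m1 m2; rewrite -E !unif_lt ?x0 ?(le_trans x0) ?(le_trans xy)//.
have -> : u m @^-1` [set z | z < y] `&` u m @^-1` [set z | z < x] = u m @^-1` [set z | z < x].
  by apply/seteqP; split => w /= => [[]//|a]; split=> //; apply: lt_le_trans xy.
by rewrite unif_lt ?x0 ?(le_trans xy)//; lra.
Qed.

Lemma unif_window_le m x y : 0 <= x -> x <= y -> y <= 1 ->
  pr (u m @^-1` [set z | x < z <= y]) = y - x.
Proof.
move=> x0 xy y1.
have E : u m @^-1` [set z | x < z <= y] =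
    u m @^-1` [set z | z <= y] `&` ~` (u m @^-1` [set z | z <= x]).
  apply/seteqP; split => w /=.
    by move=> /andP[a b]; split=> //; apply/negP; rewrite -ltNge.
  by move=> [a /negP]; rewrite -ltNge => b; apply/andP.
have m1 := measurable_unif m (m_le y); have m2 := measurable_unif m (m_le x).
have := pr_setID P m1 m2; rewrite -E !unif_le ?x0 ?(le_trans x0) ?(le_trans xy)//.
have -> : u m @^-1` [set z | z <= y] `&` u m @^-1` [set z | z <= x] = u m @^-1` [set z | z <= x].
  by apply/seteqP; split => w /= => [[]//|a]; split=> //; apply: le_trans xy.
by rewrite unif_le ?x0 ?(le_trans xy)//; lra.
Qed.

Lemma unif_gt m x : 0 <= x <= 1 -> pr (u m @^-1` [set y | x < y]) = 1 - x.
Proof.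
move=> x01; rewrite -{2}(unif_le m x01) -pr_setC; last exact: measurable_unif.
congr (pr _); apply/seteqP; split => w /=; first by move=> xy; apply/negP; rewrite -ltNge.
by move=> /negP; rewrite -ltNge.
Qed.

Definition point_sigma : set (set T) :=
  <<s [set E | exists j B, measurable B /\ E = gp_point X j @^-1` B] >>.

Lemma point_sigma_measurable E : point_sigma E -> measurable E.
Proof.
apply: smallest_sub; first exact: sigma_algebra_measurable.
by move=> _ [j [B [mB ->]]]; apply: measurable_point.
Qed.

Lemma point_sigma_point j B : measurable B -> point_sigma (v j @^-1` B).
Proof. by move=> mB; apply: sub_sigma_algebra; exists j, B. Qed.

Lemma point_sigma_forall (I : countType) (F : I -> set T) :
  (forall i, point_sigma (F i)) -> point_sigma [set w | forall i, F i w].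
Proof.
move=> sF.
have sT : point_sigma setT.
  by rewrite -setC0; apply: sigma_algebraC; apply: sigma_algebra0.
have -> : [set w | forall i, F i w] =
    ~` \bigcup_n ~` (if unpickle n is Some i then F i else setT).
  apply/seteqP; split => [w Fw [n _]|w Fw i].
    by case: (unpickle n) => [i|] nF; [apply: nF; exact: Fw|apply: nF].
  by apply: contrapT => nF; apply: Fw; exists (pickle i); rewrite ?pickleK.
apply: sigma_algebraC; apply: sigma_algebra_bigcup => n; apply: sigma_algebraC.
by case: (unpickle n).
Qed.

Lemma noise_indep (I : finType) (mk : I -> mark) (B : I -> set R) (E : set T) :
  injective mk -> point_sigma E -> (forall i, measurable (B i)) ->
  pr (E `&` [set w | forall i, B i (u (mk i) w)]) =
  pr E * \prod_i pr (u (mk i) @^-1` B i).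
Proof.
move=> mk_inj sE mB.
pose n := #|I|.
pose idx (k : 'I_n.+1) : option mark := omap (fun k => mk (enum_val k)) (unlift ord0 k).
pose F (k : 'I_n.+1) : set T :=
  if unlift ord0 k is Some k then u (mk (enum_val k)) @^-1` B (enum_val k) else E.
have idx_inj : injective idx.
  move=> k l; rewrite /idx; case: unliftP => [k' ->|->]; case: unliftP => [l' ->|->] //= [].
  by move/mk_inj/enum_val_inj ->.
have := @noise_independent _ _ _ _ _ X n.+1 idx F idx_inj.
have H k : (match idx k with
  | Some m => [set E | exists B : set R, measurable B /\ E = gp_unif X m @^-1` B]
  | None => point_sigma end) (F k).
  rewrite /idx /F; case: unliftP => [k' _|_] //=.
  by exists (B (enum_val k')).
have F0 : F ord0 = E by rewrite /F unlift_none.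
have FS k : F (lift ord0 k) = u (mk (enum_val k)) @^-1` B (enum_val k).
  by rewrite /F liftK.
move=> /(_ H); rewrite big_ord_recl F0 (eq_bigr _ (fun k _ => congr1 (fine \o P) (FS k))).
have -> : \bigcap_k F k = E `&` [set w | forall i, B i (u (mk i) w)].
  apply/seteqP; split => [w Fw|w [Ew Bw] k _].
    split; first by have := Fw ord0 Logic.I; rewrite F0.
    by move=> i; have := Fw (lift ord0 (enum_rank i)) Logic.I; rewrite FS enum_rankK.
  by case: (unliftP ord0 k) => [k' ->|->]; rewrite ?F0 ?FS //; apply: Bw.
move=> Hp; apply: EFin_inj; rewrite -prE.
  rewrite Hp; congr (_%:E); congr (_ * _).
  by rewrite [RHS](reindex (@enum_val I predT))//=; by apply: onW_bij; exact: enum_val_bij.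
apply: measurableI; first exact: point_sigma_measurable.
by apply: measurable_forall => i; apply: measurable_unif.
Qed.

End noise.

(** * Configurations of points *)

Lemma cvg_prod_fin (R : realType) (I : finType) (f : I -> nat -> R) (a : I -> R) :
  (forall i, f i @ \oo --> a i) ->
  (fun n => \prod_i f i n) @ \oo --> \prod_i a i.
Proof.
move=> fa; elim: (index_enum I) => [|i s IH].
  by rewrite big_nil (_ : (fun n => _) = fun=> 1); [exact: cvg_cst|apply/funext => n; rewrite big_nil].
rewrite big_cons (_ : (fun n => _) = fun n => f i n * \prod_(i <- s) f i n).
  exact: cvgM.
by apply/funext => n; rewrite big_cons.
Qed.

Section configurations.
Context d (T : measurableType d) (R : realType) (P : probability T R) (t : R)
  (X : gp_noise P t).
Hypothesis t0 : 0 <= t.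
Local Notation v := (gp_point X).
Local Notation pr := (pr P).

(** The half-line is cut into the cells [cls y = l] for [l < m]; points [y] with
    [m <= cls y] are ignored. *)
Variables (m : nat) (cls : R -> nat).

Definition cls_cell (l : nat) : set R := [set y | 0 <= y /\ cls y = l].

Hypothesis mcls : forall l, (l < m)%N -> measurable (cls_cell l).
Hypothesis fcls : forall l, (l < m)%N -> (lebesgue_measure (cls_cell l) < +oo)%E.

Definition cell_rate l : R := t * fine (lebesgue_measure (cls_cell l)).

Lemma cell_rate_ge0 l : 0 <= cell_rate l.
Proof. by rewrite mulr_ge0// fine_ge0. Qed.

Lemma cls_cellE l j w : cls_cell l (v j w) <-> cls (v j w) = l.
Proof. by split => [[]//|<-]; split=> //; apply: point_ge0. Qed.

(** A configuration lists the points in the cells, as pairs of the index of a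
    point and of its cell. The order makes the list unique. *)
Definition config_ok (hs : seq (nat * nat)) :=
  sorted ltn [seq z.1 | z <- hs] && all (fun z => z.2 < m)%N hs.

Definition config (hs : seq (nat * nat)) : set T :=
  [set w | config_ok hs /\
    forall j (l : 'I_m), (cls (v j w) == l :> nat) = ((j, l : nat) \in hs)].

Definition config_count (hs : seq (nat * nat)) (l : nat) := count (fun z => z.2 == l) hs.

Lemma config_sigma hs : point_sigma X (config hs).
Proof.
have s0 : point_sigma X set0 by apply: sigma_algebra0.
have sT : point_sigma X setT by rewrite -setC0; apply: sigma_algebraC.
case ok : (config_ok hs); last first.
  by rewrite (_ : config hs = set0)//; apply/seteqP; split => w //; rewrite /config /= ok => -[].
have -> : config hs = [set w | forall z : nat * 'I_m,
    (if (z.1, z.2 : nat) \in hs then v z.1 @^-1` cls_cell z.2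
     else ~` (v z.1 @^-1` cls_cell z.2)) w].
  apply/seteqP; split => w.
    move=> [_ H] [j l] /=; have := H j l; case: ifP => _ /eqP.
      by move/eqP => /eqP /cls_cellE.
    by move=> E /cls_cellE.
  move=> H; split; first by rewrite ok.
  move=> j l; have := H (j, l) => /=; case: ifP => _.
    by move=> /cls_cellE ->; rewrite eqxx.
  by move=> nE; apply/negP => /eqP /cls_cellE.
apply: point_sigma_forall => z; have ms : point_sigma X (v z.1 @^-1` cls_cell z.2).
  by apply: point_sigma_point; apply: mcls.
by case: ifP => _; [exact: ms|apply: sigma_algebraC].
Qed.

Lemma measurable_config hs : measurable (config hs).
Proof. by apply: point_sigma_measurable; apply: config_sigma. Qed.

Lemma config_mem_lt hs z : config_ok hs -> z \in hs -> (z.2 < m)%N.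
Proof. by move=> /andP[_ /allP H] /H. Qed.

Lemma config_inj hs hs' w : config hs w -> config hs' w -> hs = hs'.
Proof.
move=> [ok H] [ok' H'].
have tr : transitive (fun z z' : nat * nat => z.1 < z'.1)%N.
  by move=> y x z /= ; apply: ltn_trans.
have ir : irreflexive (fun z z' : nat * nat => z.1 < z'.1)%N by move=> x; rewrite /= ltnn.
apply: (irr_sorted_eq tr ir).
- by have /andP[] := ok; rewrite sorted_map.
- by have /andP[] := ok'; rewrite sorted_map.
move=> [j l]; apply/idP/idP => jl.
  by have lm := config_mem_lt ok jl; rewrite -(H' j (Ordinal lm)) (H j (Ordinal lm)).
by have lm := config_mem_lt ok' jl; rewrite -(H j (Ordinal lm)) (H' j (Ordinal lm)).
Qed.

Lemma config_exists w :
  (forall l : 'I_m, finite_set [set j | cls_cell l (v j w)]) ->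
  exists hs, config hs w.
Proof.
move=> fin.
have fJ : finite_set [set j | (cls (v j w) < m)%N].
  rewrite (_ : [set _ | _] = \bigcup_(l in [set` 'I_m]) [set j | cls_cell l (v j w)]).
    by apply: bigcup_finite => // l _; apply: fin.
  apply/seteqP; split => j /=.
    by move=> lt; exists (Ordinal lt) => //; apply/cls_cellE.
  by move=> [l _ /cls_cellE ->].
have [M JM] : exists M, forall j, (cls (v j w) < m)%N -> (j < M)%N.
  have /finite_seqP[s sJ] := fJ; exists (\max_(j <- s) j).+1 => j jm.
  rewrite ltnS; have : [set` s] j by rewrite -sJ.
  by move=> /= js; apply: (@leq_bigmax_seq _ _ xpredT id).
pose f j := (j, cls (v j w)).
exists [seq f j | j <- [seq j <- iota 0 M | (cls (v j w) < m)%N]]; split.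
  apply/andP; split.
    rewrite -map_comp (eq_map (g := id))// map_id.
    by apply: sorted_filter; [exact: ltn_trans|exact: iota_ltn_sorted].
  by apply/allP => z /mapP[j]; rewrite mem_filter => /andP[jm _] ->.
move=> j l; apply/eqP/mapP => [E|[j' _ [-> ->]//]].
have jm : (cls (v j w) < m)%N by rewrite E.
by exists j; rewrite ?mem_filter ?mem_iota ?jm ?JM//= /f E.
Qed.

Lemma config_card hs w (l : 'I_m) : config hs w ->
  ([set j | cls_cell l (v j w)] #= `I_(config_count hs l))%card.
Proof.
move=> [ok H].
have -> : [set j | cls_cell l (v j w)] = [set` [seq z.1 | z <- hs & z.2 == l :> nat]].
  apply/seteqP; split => j /=.
    move=> /cls_cellE /eqP; rewrite H => jl; apply/mapP; exists (j, l : nat) => //.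
    by rewrite mem_filter /= eqxx.
  move=> /mapP[[j' l']]; rewrite mem_filter /= => /andP[/eqP -> jl] ->.
  by apply/cls_cellE/eqP; rewrite H.
have u1 : uniq [seq z.1 | z <- hs & z.2 == l :> nat].
  have /andP[so _] := ok; have : uniq [seq z.1 | z <- hs].
    by apply: (sorted_uniq ltn_trans ltnn).
  by apply: subseq_uniq; apply: map_subseq; apply: filter_subseq.
have -> : config_count hs l = size [seq z.1 | z <- hs & z.2 == l :> nat].
  by rewrite size_map size_filter.
move: u1; set s := map _ _ => us.
have -> : [set` s] = nth 0%N s @` `I_(size s).
  apply/seteqP; split => j /=.
    by move=> js; exists (index j s); rewrite /= ?index_mem ?nth_index.
  by move=> [k ks <-]; rewrite mem_nth.
apply: inj_card_eq => i j; rewrite !inE /= => ik jk /eqP; rewrite nth_uniq// => /eqP //.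
Qed.

Definition counts_event (N : 'I_m -> nat) : set T :=
  [set w | exists hs, ((fun hs => [set w | (forall l : 'I_m, config_count hs l = N l) /\
     config hs w]) hs) w].

Lemma measurable_counts_event N : measurable (counts_event N).
Proof.
apply: measurable_exists => hs; case: (pselect (forall l : 'I_m, config_count hs l = N l)) => H.
  rewrite (_ : [set _ | _] = config hs); first exact: measurable_config.
  by apply/seteqP; split => w // [].
by rewrite (_ : [set _ | _] = set0)//; apply/seteqP; split => w // [].
Qed.

(** The configurations refine the numbers of points in the cells, whose law is
    given by the definition of a Poisson process. *)
Lemma pr_counts_event N :
  pr (counts_event N) = \prod_(l < m) poisson_mass (cell_rate l) (N l).
Proof.
have := (point_poisson X).2 m (fun l => cls_cell l) N (fun l => mcls (ltn_ord l)).
move=> /(_ (fun l => fun y => _)) H.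
have {}H := H _ (fun l => fcls (ltn_ord l)).
rewrite pr_fine -[RHS]/(fine (\prod_(l < m) poisson_mass (cell_rate l) (N l))%:E) -H.
- congr (fine (P _)); apply/seteqP; split => w.
    by move=> [hs [hsN ch]] l; rewrite -hsN; apply: config_card.
  move=> wN; have [hs ch] : exists hs, config hs w.
    by apply: config_exists => l; apply/finite_setP; exists (N l).
  exists hs; split=> // l; apply/card_eq_II.
  by apply: card_eq_trans (wN l); rewrite card_eq_sym; apply: config_card.
- by move=> i y [y0 _] /=; rewrite in_itv/= y0.
- apply/trivIsetP => i j _ _ ij; apply/seteqP; split => // y [[_ yi] [_ yj]].
  by move: ij; rewrite -val_eqE /= -yi yj eqxx.
Qed.

Lemma counts_event_inj N N' w : counts_event N w -> counts_event N' w -> N =1 N'.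
Proof.
by move=> [hs [hN ch]] [hs' [hN' ch']] l; rewrite -hN -hN' (config_inj ch ch').
Qed.

Lemma pr_disjoint_fin (I : finType) (F : I -> set T) : (forall i, measurable (F i)) ->
  (forall i j w, F i w -> F j w -> i = j) ->
  pr [set w | exists i, F i w] = \sum_i pr (F i).
Proof.
move=> mF disj; pose U (s : seq I) := [set w | exists2 i, i \in s & F i w].
have US s : uniq s -> measurable (U s) /\ pr (U s) = \sum_(i <- s) pr (F i).
  elim: s => [_|i s IH /andP[si us]].
    have -> : U [::] = set0 by apply/seteqP; split => w // [].
    by rewrite big_nil pr_set0; split.
  have [mU E] := IH us.
  have -> : U (i :: s) = F i `|` U s.
    apply/seteqP; split => w; first case=> j; rewrite ?in_cons.
      by case/orP => [/eqP ->|js] Fj; [left|right; exists j].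
    by case=> [Fi|[j js Fj]]; [exists i|exists j]; rewrite ?in_cons ?eqxx ?js ?orbT.
  split; first exact: measurableU.
  rewrite big_cons pr_setU ?E//; apply/seteqP; split => // w [Fi [j js Fj]].
  by move: si; rewrite (disj _ _ _ Fi Fj) js.
have -> : [set w | exists i, F i w] = U (enum I).
  apply/seteqP; split => w [i]; first by move=> Fi; exists i; rewrite ?mem_enum.
  by move=> _ Fi; exists i.
by have [_ ->] := US (enum I) (enum_uniq _); rewrite big_enum.
Qed.

Definition overflow (K : nat) : set T :=
  ~` [set w | exists N : {ffun 'I_m -> 'I_K}, counts_event (fun l => N l : nat) w].

Lemma measurable_overflow K : measurable (overflow K).
Proof. by apply: measurableC; apply: measurable_exists => N; apply: measurable_counts_event. Qed.

Lemma pr_overflow K : pr (overflow K) =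
  1 - \prod_(l < m) \sum_(k < K) poisson_mass (cell_rate l) k.
Proof.
rewrite pr_setC; last by apply: measurable_exists => N; apply: measurable_counts_event.
congr (1 - _); rewrite pr_disjoint_fin.
- rewrite (bigA_distr_bigA (fun (l : 'I_m) (k : 'I_K) => poisson_mass (cell_rate l) k)) /=.
  by apply: eq_bigr => N _; rewrite pr_counts_event.
- by move=> N; apply: measurable_counts_event.
- move=> N N' w wN wN'; apply/ffunP => l; apply/val_inj.
  exact: (counts_event_inj wN wN').
Qed.

Lemma pr_overflow_cvg : pr (overflow K) @[K --> \oo] --> (0 : R).
Proof.
have -> : (fun K => pr (overflow K)) =
    (fun K => 1 - \prod_(l < m) \sum_(k < K) poisson_mass (cell_rate l) k).
  by apply/funext => K; rewrite pr_overflow.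
rewrite -[X in _ --> X](subrr 1); apply: cvgB; first exact: cvg_cst.
rewrite [X in _ --> X](_ : 1 = \prod_(l < m) 1); last by rewrite big1.
apply: (@cvg_prod_fin _ _ (fun (l : 'I_m) K => \sum_(k < K) poisson_mass (cell_rate l) k) (fun=> 1)) => l.
exact: sum_poisson_mass_cvg (cell_rate_ge0 l).
Qed.

(** Sums of probabilities are bounded by expected multiplicities. The bound is
    first proved when no count reaches [K]; the overflow vanishes as [K] grows,
    the number of events being fixed. *)
Lemma pr_sum_counts_le (I : finType) (D : I -> set T) (wt : 'I_m -> nat -> nat) (c : R) :
  (forall i, measurable (D i)) ->
  (forall N w, counts_event N w ->
     (#|[set i | `[< D i w >]]%SET| <= \prod_(l < m) wt l (N l))%N) ->
  (forall K, \prod_(l < m) \sum_(k < K) (wt l k)%:R * poisson_mass (cell_rate l) k <= c) ->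
  \sum_i pr (D i) <= c.
Proof.
move=> mD DN wc.
have le K : \sum_i pr (D i) <= c + #|I|%:R * pr (overflow K).
  pose Z (N : {ffun 'I_m -> 'I_K}) := counts_event (fun l => N l : nat).
  have mZ N : measurable (Z N) by apply: measurable_counts_event.
  have le1 i : pr (D i) <= \sum_N pr (D i `&` Z N) + pr (overflow K).
    have mU : measurable [set w | exists N, (D i `&` Z N) w].
      by apply: measurable_exists => N; apply: measurableI.
    apply: le_trans (_ : _ <= pr ([set w | exists N, (D i `&` Z N) w] `|` overflow K)) _.
      apply: le_pr => //; first by apply: measurableU => //; apply: measurable_overflow.
      move=> w Dw; case: (pselect (exists N, Z N w)) => [[N ZN]|nZ]; last by right.
      by left; exists N.
    apply: le_trans (pr_setU_le _ mU (measurable_overflow K)) _; rewrite lerD2r.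
    by apply: pr_exists_fin => N; apply: measurableI.
  apply: (@le_trans _ _ (\sum_i (\sum_N pr (D i `&` Z N) + pr (overflow K)))).
    by apply: ler_sum.
  rewrite big_split /= sumr_const -[X in _ + X]mulr_natl lerD2r exchange_big /=.
  apply: le_trans (wc K).
  rewrite (bigA_distr_bigA (fun (l : 'I_m) (k : 'I_K) => (wt l k)%:R * poisson_mass (cell_rate l) k)) /=.
  apply: ler_sum => N _; rewrite big_split /= -natr_prod -pr_counts_event.
  by apply: pr_multiplicity => // w /DN.
have cv : c + #|I|%:R * pr (overflow K) @[K --> \oo] --> c + #|I|%:R * 0.
  apply: cvgD; first exact: cvg_cst.
  by apply: cvgM; [exact: cvg_cst|exact: pr_overflow_cvg].
rewrite -[leRHS]addr0 -[X in _ + X](mulr0 #|I|%:R) -(cvg_lim _ cv)//.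
by apply: limr_ge; [apply/cvg_ex; eexists; exact: cv|exact: nearW].
Qed.

Lemma measurable_point_cell j l : (l < m)%N -> measurable (v j @^-1` cls_cell l).
Proof. by move=> lm; apply: measurable_point; apply: mcls. Qed.

Lemma counts_event_card N w (M : nat) (l : 'I_m) : counts_event N w ->
  (#|[set j : 'I_M | `[< cls_cell l (v j w) >]]%SET| <= N l)%N.
Proof.
move=> [hs [<- [ok H]]]; rewrite /config_count -size_filter.
rewrite cardE -(size_map (fun j : 'I_M => (j : nat, l : nat))); apply: uniq_leq_size.
  by rewrite map_inj_uniq ?enum_uniq// => i j [/val_inj].
move=> z /mapP[j]; rewrite mem_enum finset.in_set => /asboolP/cls_cellE jl ->.
by rewrite mem_filter /= eqxx -H jl eqxx.
Qed.

(** Campbell's formula, as an inequality. *)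
Lemma campbell1 M l : (l < m)%N ->
  \sum_(j < M) pr (v j @^-1` cls_cell l) <= cell_rate l.
Proof.
move=> lm; pose wt (k : 'I_m) n := if k == l :> nat then n else 1%N.
apply: (@pr_sum_counts_le _ _ wt).
- by move=> j; apply: measurable_point_cell.
- move=> N w wN; rewrite (bigD1 (Ordinal lm))//= big1 ?muln1.
    by rewrite /wt /= eqxx; apply: (counts_event_card M (Ordinal lm) wN).
  by move=> k; rewrite -val_eqE /wt /= => /negbTE ->.
- move=> K; rewrite (bigD1 (Ordinal lm))//=.
  apply: (@le_trans _ _ (\sum_(k < K) (wt (Ordinal lm) k)%:R * poisson_mass (cell_rate l) k)).
    rewrite ler_piMr ?sumr_ge0//; first by move=> k _; rewrite mulr_ge0 ?poisson_mass_ge0 ?cell_rate_ge0.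
    apply: prodr_ile1 => k; rewrite -val_eqE /wt /= => /negbTE ->; apply/andP; split.
      by apply: sumr_ge0 => i _; rewrite mul1r poisson_mass_ge0 ?cell_rate_ge0.
    under eq_bigr do rewrite mul1r.
    exact: sum_poisson_mass_le1 (cell_rate_ge0 k).
  by rewrite /wt /= eqxx; apply: poisson_mean_le (cell_rate_ge0 l).
Qed.

Lemma campbell2 M l l' : (l < m)%N -> (l' < m)%N ->
  \sum_(z : 'I_M * 'I_M | z.1 != z.2)
     pr (v z.1 @^-1` cls_cell l `&` v z.2 @^-1` cls_cell l') <= cell_rate l * cell_rate l'.
Proof.
move=> lm lm'; rewrite big_mkcond /=.
pose D (z : 'I_M * 'I_M) := if z.1 != z.2 then v z.1 @^-1` cls_cell l `&` v z.2 @^-1` cls_cell l' else set0.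
rewrite (eq_bigr (fun z => pr (D z))); last first.
  by move=> z _; rewrite /D; case: ifP => _ //; rewrite pr_set0.
have mD z : measurable (D z).
  by rewrite /D; case: ifP => // _; apply: measurableI; apply: measurable_point_cell.
have other K (wt : 'I_m -> nat -> nat) (k : 'I_m) : (forall n, wt k n = 1%N) ->
    0 <= \sum_(i < K) (wt k i)%:R * poisson_mass (cell_rate k) i <= 1.
  move=> wk; apply/andP; split.
    by apply: sumr_ge0 => i _; rewrite mulr_ge0 ?poisson_mass_ge0 ?cell_rate_ge0.
  under eq_bigr do rewrite wk mul1r.
  exact: sum_poisson_mass_le1 (cell_rate_ge0 k).
have [ll'|ll'] := eqVneq l l'.
  subst l'; pose wt (k : 'I_m) n := if k == l :> nat then (n * n.-1)%N else 1%N.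
  apply: (@pr_sum_counts_le _ _ wt) => //.
  - move=> N w wN; rewrite (bigD1 (Ordinal lm))//= big1 ?muln1; last first.
      by move=> k; rewrite -val_eqE /wt /= => /negbTE ->.
    rewrite /wt /= eqxx.
    have := counts_event_card M (Ordinal lm) wN; set S := [set j : 'I_M | _]%SET => SN.
    apply: (@leq_trans (#|S| * #|S|.-1)); last by rewrite leq_mul// -!subn1 leq_sub2r.
    set A := [set i | _]%SET; pose diag := [set (i, i) | i in S]%SET.
    have dS : #|diag| = #|S| by rewrite card_imset// => i j [].
    have Ad : (A :&: diag = finset.set0)%SET.
      apply/setP => z; rewrite finset.in_setI finset.in_set0; apply/negP => /andP[].
      by rewrite finset.in_set => /asboolP + /imsetP[i _ zi]; rewrite /D zi /= eqxx.
    have AS : ((A :|: diag) \subset finset.setX S S)%SET.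
      apply/fintype.subsetP => -[z z']; rewrite finset.in_setU finset.in_setX => /orP[].
        rewrite finset.in_set /D => /asboolP; case: ifP => // _ [za zb].
        by rewrite !finset.in_set; apply/andP; split; apply/asboolP.
      by case/imsetP => i iS [-> ->] /=; rewrite iS.
    have := cardsUI A diag; rewrite Ad cards0 addn0 dS => AU.
    have := subset_leq_card AS; rewrite cardsX AU.
    case: #|S| => [|k]; first by rewrite addn0.
    by rewrite /= -[X in (_ <= X)%N -> _]/(k.+1 * k.+1)%N mulnS [(k.+1 + _)%N]addnC leq_add2r.
  - move=> K; rewrite (bigD1 (Ordinal lm))//=.
    apply: (@le_trans _ _ (\sum_(k < K) (wt (Ordinal lm) k)%:R * poisson_mass (cell_rate l) k)).
      rewrite ler_piMr ?sumr_ge0//; first by move=> k _; rewrite mulr_ge0 ?poisson_mass_ge0 ?cell_rate_ge0.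
      apply: prodr_ile1 => k kl; apply: other => n.
      by move: kl; rewrite -val_eqE /wt /= => /negbTE ->.
    by rewrite /wt /= eqxx -expr2; apply: poisson_factorial_moment_le (cell_rate_ge0 l).
pose wt (k : 'I_m) n := if (k == l :> nat) || (k == l' :> nat) then n else 1%N.
apply: (@pr_sum_counts_le _ _ wt) => //.
- move=> N w wN; rewrite (bigD1 (Ordinal lm))//= (bigD1 (Ordinal lm'))//=; last first.
    by rewrite -val_eqE /= eq_sym.
  rewrite big1 ?muln1; last first.
    by move=> k; rewrite -!val_eqE /wt /= => /andP[/negbTE -> /negbTE ->].
  rewrite /wt /= !eqxx orbT.
  have := counts_event_card M (Ordinal lm) wN; have := counts_event_card M (Ordinal lm') wN.
  set S := [set j : 'I_M | _]%SET; set S' := [set j : 'I_M | _]%SET => SN SN'.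
  apply: leq_trans (leq_mul SN' SN); rewrite -cardsX; apply: subset_leq_card.
  apply/fintype.subsetP => z; rewrite finset.in_set finset.inE /D => /asboolP.
  by case: ifP => // _ [a b]; rewrite !finset.in_set; apply/andP; split; exact/asboolP.
- move=> K; rewrite (bigD1 (Ordinal lm))//= (bigD1 (Ordinal lm'))//=; last first.
    by rewrite -val_eqE /= eq_sym.
  rewrite mulrA; apply: (@le_trans _ _ ((\sum_(k < K) (wt (Ordinal lm) k)%:R * poisson_mass (cell_rate l) k) *
     (\sum_(k < K) (wt (Ordinal lm') k)%:R * poisson_mass (cell_rate l') k))).
    rewrite ler_piMr//.
      by rewrite mulr_ge0 ?sumr_ge0// => k _; rewrite mulr_ge0 ?poisson_mass_ge0 ?cell_rate_ge0.
    apply: prodr_ile1 => k kl; apply: other => n.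
    by move: kl; rewrite -!val_eqE /wt /= => /andP[/negbTE -> /negbTE ->].
  rewrite /wt /= !eqxx orbT ler_pM//; try exact: poisson_mean_le (cell_rate_ge0 _);
    by apply: sumr_ge0 => k _; rewrite mulr_ge0 ?poisson_mass_ge0 ?cell_rate_ge0.
Qed.

End configurations.

Section distinct_points.
Context d (T : measurableType d) (R : realType) (P : probability T R) (t : R)
  (X : gp_noise P t).
Hypothesis t0 : 0 <= t.
Local Notation v := (gp_point X).
Local Notation pr := (pr P).

(** A bounded interval is cut into [M] equal pieces: by [campbell2] the expected
    number of pairs of points in the same piece is of order [1 / M]. *)
Lemma points_distinct i j (V : R) : i != j -> 0 < V ->
  pr [set w | v i w = v j w /\ v i w < V] = 0.
Proof.
move=> ij V0; set E := [set w | _].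
have mE : measurable E.
  rewrite (_ : E = (fun w => v i w - v j w) @^-1` [set 0] `&` v i @^-1` [set y | y < V]).
    apply: measurableI; last by apply: measurable_point; rewrite -set_itvNyo.
    rewrite -[X in measurable X]setTI; apply: (measurable_funB (measurable_funPT (v i)) (measurable_funPT (v j))) => //.
  apply/seteqP; split => w /= [a b]; split=> //; first by rewrite a subrr.
  by apply/eqP; rewrite -subr_eq0 a.
have bound M : (0 < M)%N -> pr E <= (t * V) ^+ 2 / M%:R.
  move=> M0; have M0' : 0 < M%:R :> R by rewrite ltr0n.
  pose del := V / M%:R; have del0 : 0 < del by rewrite divr_gt0.
  pose cls y := find (fun k => y < k.+1%:R * del) (iota 0 M).
  have cellE k : (k < M)%N -> cls_cell cls k = `[k%:R * del, k.+1%:R * del[%classic.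
    move=> kM; apply/seteqP; split => y /=; rewrite in_itv /=.
      move=> [y0 yk]; have h : has (fun k => y < k.+1%:R * del) (iota 0 M).
        by rewrite has_find size_iota -/(cls y) yk.
      have := nth_find 0%N h; rewrite -/(cls y) yk nth_iota// add0n => ->; rewrite andbT.
      case: k kM yk => [|k] kM yk; first by rewrite mul0r.
      have := @before_find _ 0%N (fun k => y < k.+1%:R * del) (iota 0 M) k.
      rewrite -/(cls y) yk ltnSn nth_iota ?(ltn_trans _ kM)// add0n => /(_ isT) /negbT.
      by rewrite -leNgt.
    move=> /andP[a b]; split; first by apply: le_trans a; rewrite mulr_ge0// ltW.
    have h : has (fun k => y < k.+1%:R * del) (iota 0 M).
      by apply/hasP; exists k; rewrite ?mem_iota.
    have := nth_find 0%N h; have := h; rewrite has_find size_iota -/(cls y) => cM.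
    rewrite nth_iota// add0n => yc.
    apply/eqP; rewrite eqn_leq; apply/andP; split.
      rewrite leqNgt; apply/negP => kc.
      have := @before_find _ 0%N (fun k => y < k.+1%:R * del) (iota 0 M) k.
      by rewrite -/(cls y) kc nth_iota// add0n b => /(_ isT).
    rewrite leqNgt; apply/negP => ck.
    have ck' : (cls y).+1%:R * del <= k%:R * del by rewrite ler_pM2r// ler_nat.
    by have := lt_le_trans yc (le_trans ck' a); rewrite ltxx.
  have measE k : (k < M)%N -> lebesgue_measure (cls_cell cls k) = del%:E.
    move=> kM; rewrite cellE// lebesgue_measure_itv /= lte_fin ltr_pM2r// ltr_nat ltnSn.
    by rewrite -EFinB; congr (_%:E); rewrite -mulrBl -natrB// subSnn mul1r.
  have mc k : (k < M)%N -> measurable (cls_cell cls k) by move=> kM; rewrite cellE.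
  have fc k : (k < M)%N -> (lebesgue_measure (cls_cell cls k) < +oo)%E.
    by move=> kM; rewrite measE// ltry.
  have rE k : (k < M)%N -> cell_rate t cls k = t * del by move=> kM; rewrite /cell_rate measE.
  have mF (k : 'I_M) : measurable (v i @^-1` cls_cell cls k `&` v j @^-1` cls_cell cls k).
    by apply: measurableI; apply: measurable_point; apply: mc.
  apply: le_trans (_ : _ <= pr [set w | exists k : 'I_M, (v i @^-1` cls_cell cls k `&` v j @^-1` cls_cell cls k) w]) _.
    apply: le_pr => //; first by apply: measurable_exists.
    move=> w [vv vV].
    have cM : (cls (v i w) < M)%N.
      rewrite -[X in (_ < X)%N](size_iota 0 M) /cls -has_find; apply/hasP; exists M.-1.
        by rewrite mem_iota add0n prednK/=.
      by rewrite prednK// mulrC divfK// gt_eqF.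
    by exists (Ordinal cM); split; [|rewrite /= -vv]; split=> //; apply: point_ge0.
  apply: le_trans (pr_exists_fin _ mF) _.
  apply: (@le_trans _ _ (\sum_(k < M) (t * del) ^+ 2)); last first.
    have dM : del * M%:R = V by rewrite divfK// gt_eqF.
    rewrite sumr_const card_ord -(mulr_natr ((t * del) ^+ 2)).
    have -> : (t * del) ^+ 2 * M%:R = t * del * (t * (del * M%:R)) by lra.
    by rewrite dM /del; lra.
  apply: ler_sum => k _.
  pose L := (maxn i j).+1.
  have iL : (i < L)%N by rewrite ltnS leq_maxl.
  have jL : (j < L)%N by rewrite ltnS leq_maxr.
  have := campbell2 X t0 mc fc L (ltn_ord k) (ltn_ord k); rewrite !rE// -expr2; apply: le_trans.
  rewrite (bigD1 (Ordinal iL, Ordinal jL))//= lerDl.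
  by apply: sumr_ge0 => z _; apply: pr_ge0.
apply/eqP; rewrite eq_le pr_ge0 andbT.
apply/ler_addgt0Pl => e e0; rewrite addr0.
have q0 : 0 <= (t * V) ^+ 2 / e by rewrite divr_ge0 ?sqr_ge0// ltW.
have [M Me] : exists M, (t * V) ^+ 2 / e < M%:R.
  by exists (Num.bound ((t * V) ^+ 2 / e)); apply: le_lt_trans (archi_boundP q0); rewrite ?lexx.
apply: le_trans (bound M.+1 isT) _; rewrite ler_pdivrMr ?ltr0n// [e * _]mulrC -ler_pdivrMr//.
by apply/ltW; apply: lt_trans Me _; rewrite ltr_nat.
Qed.

End distinct_points.

(** * The marks of a graphex process *)

Lemma enum_set_sorted r (x : {set 'I_r}) : sorted (fun i j : 'I_r => i < j)%N (enum x).
Proof.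
have -> : enum x = [seq i <- enum 'I_r | i \in x] by rewrite enumT.
apply: sorted_filter; first by move=> i j k; apply: ltn_trans.
by have := iota_ltn_sorted 0 r; rewrite -val_enum_ord sorted_map.
Qed.

Lemma enum_set2_ord r (i j : 'I_r) : (i < j)%N -> enum [set i; j]%SET = [:: i; j].
Proof.
move=> ij; apply: (@irr_sorted_eq _ (fun i j : 'I_r => i < j)%N).
- by move=> x y z; apply: ltn_trans.
- by move=> x; rewrite ltnn.
- exact: enum_set_sorted.
- by rewrite /= ij.
- by move=> x; rewrite mem_enum finset.in_set2 !inE.
Qed.

Lemma enum_set1_ord r (i : 'I_r) : enum [set i]%SET = [:: i].
Proof. by rewrite -[RHS]enum1; apply: eq_enum => x; rewrite finset.in_set1. Qed.

(** The range of the uniform variable of a mark for which the mark takes the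
    value [k]: for [m] of two elements the variable decides an edge, and
    otherwise it is a Poisson quantile. *)
Definition mark_range (R : realType) (V : finType) (t : R) (x : V -> R) (m : {set V})
    (k : nat) : set R :=
  let w := \prod_(i in m) x i in
  let quantile r := [set u : R | (forall l, (l < k)%N -> poisson_exceeds r u l) /\
                                 ~~ poisson_exceeds r u k] in
  match #|m| with
  | 0 => quantile (t ^+ 2 / 2)
  | 1 => quantile (t * w)
  | _ => match k with 0 => [set u | w / (1 + w) <= u]
                    | 1 => [set u | u < w / (1 + w)] | _ => set0 end
  end.

Section quantile.
Context (R : realType).
Implicit Types (r u : R) (k : nat).

Definition pcdf r k : R := \sum_(i < k) poisson_mass r i.

Lemma pcdf_ge0 r k : 0 <= r -> 0 <= pcdf r k.
Proof. by move=> r0; apply: sumr_ge0 => i _; apply: poisson_mass_ge0. Qed.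

Lemma pcdf_le r k l : 0 <= r -> (k <= l)%N -> pcdf r k <= pcdf r l.
Proof.
move=> r0 kl; rewrite /pcdf -!(big_mkord xpredT (poisson_mass r)).
rewrite [leRHS](big_cat_nat (leq0n k) kl)/= lerDl; apply: sumr_ge0 => i _.
exact: poisson_mass_ge0.
Qed.

Lemma pcdf0 k : pcdf (0 : R) k.+1 = 1.
Proof.
rewrite /pcdf big_ord_recl poisson_mass0 /= big1 ?addr0// => i _.
by rewrite poisson_mass0.
Qed.

Lemma poisson_exceedsE r u k : poisson_exceeds r u k = (pcdf r k.+1 < u).
Proof. by []. Qed.

Lemma poisson_exceeds_mono r r' u k : 0 <= r -> r <= r' ->
  poisson_exceeds r u k -> poisson_exceeds r' u k.
Proof. by move=> r0 rr'; rewrite !poisson_exceedsE; apply: le_lt_trans; apply: poisson_cdf_le. Qed.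

Lemma poisson_exceeds_leq r u k l : 0 <= r -> (k <= l)%N ->
  poisson_exceeds r u l -> poisson_exceeds r u k.
Proof. by move=> r0 kl; rewrite !poisson_exceedsE; apply: le_lt_trans; apply: pcdf_le. Qed.

Lemma quantileE r k : 0 <= r ->
  [set u : R | (forall l, (l < k)%N -> poisson_exceeds r u l) /\ ~~ poisson_exceeds r u k] =
  if k is k'.+1 then [set u | pcdf r k < u <= pcdf r k.+1] else [set u | u <= pcdf r 1].
Proof.
move=> r0; apply/seteqP; case: k => [|k]; split => u /=.
- by move=> [_]; rewrite poisson_exceedsE -leNgt.
- by move=> u1; split=> //; rewrite poisson_exceedsE -leNgt.
- move=> [ex]; rewrite poisson_exceedsE -leNgt => ->; rewrite andbT.
  by have := ex k (ltnSn _).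
- move=> /andP[u1 u2]; split; last by rewrite poisson_exceedsE -leNgt.
  by move=> l lk; apply: (poisson_exceeds_leq r0 _ u1); rewrite -ltnS.
Qed.

Lemma measurable_mark_range (V : finType) t (x : V -> R) m k :
  0 <= t -> (forall i, 0 <= x i) -> measurable (mark_range t x m k).
Proof.
move=> t0 x0; have w0 : 0 <= \prod_(i in m) x i by apply: prodr_ge0.
have mle (y : R) : measurable [set u : R | u <= y] by rewrite -set_itvNyc.
have mq r : 0 <= r -> measurable [set u : R | (forall l, (l < k)%N -> poisson_exceeds r u l) /\ ~~ poisson_exceeds r u k].
  move=> r0; rewrite quantileE//; case: k => [|k]; first exact: mle.
  have -> : [set u | pcdf r k.+1 < u <= pcdf r k.+2] = `]pcdf r k.+1, pcdf r k.+2]%classic.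
    by apply/seteqP; split => u /=; rewrite in_itv.
  exact: measurable_itv.
rewrite /mark_range; case: #|m| => [|[|c]].
- by apply: mq; rewrite divr_ge0 ?sqr_ge0.
- by apply: mq; rewrite mulr_ge0.
- case: k {mq} => [|[|k]]; [by rewrite -set_itvcy|by rewrite -set_itvNyo|exact: measurable0].
Qed.

Lemma pr_mark_range d (T : measurableType d) (P : probability T R) t0 (X : gp_noise P t0)
    (V : finType) t (x : V -> R) (m : {set V}) k mk :
  0 <= t -> (forall i, 0 <= x i) -> (#|m| <= 2)%N ->
  pr P (gp_unif X mk @^-1` mark_range t x m k) = star_pmf t x m k.
Proof.
move=> tt0 x0; have w0 : 0 <= \prod_(i in m) x i by apply: prodr_ge0.
have mq r : 0 <= r -> pr P (gp_unif X mk @^-1` [set u : R |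
    (forall l, (l < k)%N -> poisson_exceeds r u l) /\ ~~ poisson_exceeds r u k]) =
    poisson_mass r k.
  move=> r0; rewrite quantileE//; case: k => [|k].
    rewrite unif_le /pcdf ?big_ord1// poisson_mass_ge0 ?poisson_mass_le1//.
  rewrite unif_window_le ?pcdf_ge0 ?pcdf_le ?sum_poisson_mass_le1//.
  by rewrite /pcdf [X in X - _]big_ord_recr /= addrAC subrr add0r.
rewrite /mark_range /star_pmf; case: #|m| => [|[|[|//]]] _.
- by apply: mq; rewrite divr_ge0 ?sqr_ge0.
- by apply: mq; rewrite mulr_ge0.
- have w1 : 0 <= wf (\prod_(i in m) x i) <= 1 by rewrite wf_ge0 ?wf_le1.
  rewrite -/(wf _); case: k {mq} => [|[|k]]; rewrite /bern_pmf /=; last first.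
  + by rewrite preimage_set0 pr_set0; lra.
  + by rewrite unif_lt//; lra.
  have -> : gp_unif X mk @^-1` [set u | wf (\prod_(i in m) x i) <= u] =
      ~` (gp_unif X mk @^-1` [set u | u < wf (\prod_(i in m) x i)]).
    by apply/seteqP; split => w /=; [move=> H; apply/negP; rewrite -leNgt|move=> /negP; rewrite -leNgt].
  rewrite pr_setC ?unif_lt//; first by lra.
  by apply: measurable_unif; rewrite -set_itvNyo.
Qed.

End quantile.

Section marks_of_config.
Context d (T : measurableType d) (R : realType) (P : probability T R) (t : R)
  (X : gp_noise P t).
Variables (r : nat) (s : 'I_r -> nat).
Hypothesis s_mono : forall i j : 'I_r, (i < j)%N -> (s i < s j)%N.

Definition mark_of (x : {set 'I_r}) : mark :=
  match [seq s i | i <- enum x] with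
  | [::] => IsolatedMark
  | [:: a] => PendantMark a
  | a :: b :: _ => EdgeMark a b
  end.

Lemma s_inj : injective s.
Proof.
move=> i j sij; apply/val_inj; case: (ltngtP i j) => // /s_mono; rewrite sij ltnn//.
Qed.

Lemma mark_of_inj (x y : {set 'I_r}) : (#|x| <= 2)%N -> (#|y| <= 2)%N ->
  mark_of x = mark_of y -> x = y.
Proof.
rewrite !cardE -(size_map s (enum x)) -(size_map s (enum y)) /mark_of => sx sy E.
suff : [seq s i | i <- enum x] = [seq s i | i <- enum y].
  move/(inj_map s_inj) => exy; apply/setP => i.
  by rewrite -(mem_enum (mem x)) -(mem_enum (mem y)) exy.
move: sx sy E; case: [seq s i | i <- enum x] => [|a [|a' [|a'' lx]]];
  case: [seq s i | i <- enum y] => [|b [|b' [|b'' ly]]] // _ _ [] *; subst; by [].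
Qed.

Lemma mark_of2 (i j : 'I_r) : (i < j)%N -> mark_of [set i; j]%SET = EdgeMark (s i) (s j).
Proof. by move=> ij; rewrite /mark_of enum_set2_ord. Qed.

Lemma mark_of1 (i : 'I_r) : mark_of [set i]%SET = PendantMark (s i).
Proof. by rewrite /mark_of enum_set1_ord. Qed.

Lemma mark_of0 : mark_of finset.set0 = IsolatedMark.
Proof. by rewrite /mark_of enum_set0. Qed.

(** Only sets of at most two vertices carry a mark. *)
Definition marks_event (b : nat) (tau : R) (x : 'I_r -> R) (k : {ffun {set 'I_r} -> 'I_b}) : set T :=
  [set w | forall m : {m : {set 'I_r} | (#|m| <= 2)%N},
     mark_range tau x (val m) (k (val m)) (gp_unif X (mark_of (val m)) w)].

Lemma measurable_marks_event b tau x k : 0 <= tau -> (forall i, 0 <= x i) ->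
  measurable (@marks_event b tau x k).
Proof.
move=> tau0 x0; apply: measurable_forall => m.
by apply: measurable_unif; apply: measurable_mark_range.
Qed.

(** Distinct sets carry distinct marks, which are independent of each other and
    of the points; hence the product of the laws in [star_pmf]. *)
Lemma pr_marks_event b tau x (k : {ffun {set 'I_r} -> 'I_b}) E :
  0 <= tau -> (forall i, 0 <= x i) -> point_sigma X E ->
  (forall m : {set 'I_r}, (2 < #|m|)%N -> k m = 0%N :> nat) ->
  pr P (E `&` marks_event tau x k) = pr P E * \prod_m star_pmf tau x m (k m).
Proof.
move=> tau0 x0 sE k0; rewrite (@noise_indep _ _ _ _ _ X _
   (fun m : {m : {set 'I_r} | (#|m| <= 2)%N} => mark_of (val m))
   (fun m => mark_range tau x (val m) (k (val m))) E).
- congr (_ * _); rewrite [RHS](bigID (fun m : {set 'I_r} => #|m| <= 2)%N)/=.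
  rewrite [X in _ = _ * X]big1 ?mulr1; last first.
    move=> m; rewrite -ltnNge => m2; rewrite k0// /star_pmf.
    by move: m2; case: #|m| => [|[|[|c]]].
  rewrite (eq_bigr (fun m : {m : {set 'I_r} | (#|m| <= 2)%N} => star_pmf tau x (val m) (k (val m)))).
    rewrite [RHS](reindex_omap (val : {m : {set 'I_r} | (#|m| <= 2)%N} -> _) insub) /=; last first.
      by move=> m m2; rewrite insubT.
    by apply: eq_bigl => m; rewrite valK (valP m) eqxx.
  by move=> m _; apply: pr_mark_range => //; exact: (valP m).
- by move=> m m' /(mark_of_inj (valP m) (valP m')) /val_inj.
- exact: sE.
- by move=> m; apply: measurable_mark_range.
Qed.

End marks_of_config.

(** * Measurability of events on unlabeled graphs *)

Definition iso_class (g : Defs.fgraph) : ugraph :=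
  [set g' | exists h : 'I_(fg_size g') -> 'I_(fg_size g),
     bijective h /\ forall i j, fg_adj (h i) (h j) = fg_adj i j].

Lemma unlabel_class (V : Type) (adj : V -> V -> Prop) g :
  unlabel adj g -> unlabel adj = iso_class g.
Proof.
move=> [f [finj frange fadj]]; apply/seteqP; split => g'.
  move=> [f' [f'inj f'range f'adj]].
  have ex i : exists j, f j = f' i.
    have : range f (f' i) by rewrite frange -f'range; exists i.
    by case=> j _ <-; exists j.
  have ex' i : exists j, f' j = f i.
    have : range f' (f i) by rewrite f'range -frange; exists i.
    by case=> j _ <-; exists j.
  have /choice[h hP] := ex; have /choice[h' h'P] := ex'.
  exists h; split.
    exists h' => i; first by apply: f'inj; rewrite h'P hP.
    by apply: finj; rewrite hP h'P.
  by move=> i j; apply/idP/idP; rewrite -fadj !hP f'adj.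
move=> [h [[h' hK h'K] hadj]]; exists (f \o h); split.
- by move=> i j /finj /(can_inj hK).
- rewrite -frange; apply/seteqP; split => x [i _ <-]; first by exists (h i).
  by exists (h' i); rewrite //= h'K.
- by move=> i j; rewrite /= fadj hadj.
Qed.

Lemma iso_class_refl g : iso_class g g.
Proof. by exists id; split=> //; exists id. Qed.

(** A countable type that represents all finite graphs; [fgraph] itself contains
    functions. *)
Definition graph_code := {n : nat & {ffun 'I_n * 'I_n -> bool}}.

Definition code_graph (c : graph_code) : Defs.fgraph :=
  FGraph (fun i j : 'I_(tag c) => tagged c (i, j)).

Lemma code_graphP (V : Type) (adj : V -> V -> Prop) g : unlabel adj g ->
  exists c, unlabel adj (code_graph c).
Proof.
case: g => n e [f [finj frange fadj]].
exists (Tagged (fun n => {ffun 'I_n * 'I_n -> bool}) [ffun z : 'I_n * 'I_n => e z.1 z.2]).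
by exists f; split=> // i j; rewrite /= ffunE /= fadj.
Qed.

(** Either infinitely many vertices are not isolated, or the unlabeled graph is
    one of countably many classes. *)
Lemma unlabel_cases (V : Type) (adj : V -> V -> Prop) (A : set ugraph) :
  A (unlabel adj) <->
  (exists c, A (iso_class (code_graph c)) /\ unlabel adj (code_graph c)) \/
  (A set0 /\ forall c, ~ unlabel adj (code_graph c)).
Proof.
case: (pselect (exists c, unlabel adj (code_graph c))) => [[c cadj]|none].
  rewrite (unlabel_class cadj); split=> [Ac|[[c' [Ac' cc']]|[_ /(_ c)]]].
  - by left; exists c; split=> //; apply: iso_class_refl.
  - by rewrite (_ : iso_class (code_graph c) = iso_class (code_graph c'))//;
      rewrite -(unlabel_class cadj); apply: unlabel_class; rewrite (unlabel_class cadj).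
  - by case; apply: iso_class_refl.
have E : unlabel adj = set0.
  by apply/seteqP; split => // g /code_graphP.
rewrite E; split=> [A0|[[c [_ []]]|[]//]].
by right; split=> // c [].
Qed.

(** For a fixed finite graph, an isomorphism onto the graph without isolated
    vertices ranges over a countable set of injections, and the conditions on it
    are countable conjunctions of conditions on adjacencies. *)
Lemma measurable_unlabel d (T : measurableType d) (V : countType)
    (adj : T -> V -> V -> Prop) (A : set ugraph) :
  (forall x y, measurable [set w | adj w x y]) ->
  measurable [set w | A (unlabel (adj w))].
Proof.
move=> madj.
have mc c : measurable [set w | unlabel (adj w) (code_graph c)].
  pose n := tag c.
  have -> : [set w | unlabel (adj w) (code_graph c)] = [set w | exists f : {ffun 'I_n -> V},
      ([set _ | injectiveb f] `&`
      ([set w | forall x : V, (if x \in codom f then [set w | exists y, adj w x y]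
         else ~` [set w | exists y, adj w x y]) w] `&`
      [set w | forall z : 'I_n * 'I_n, (if tagged c z then [set w | adj w (f z.1) (f z.2)]
         else ~` [set w | adj w (f z.1) (f z.2)]) w])) w].
    apply/seteqP; split => w.
      move=> [f [finj frange fadj]]; exists [ffun i => f i]; split; last split.
      - by apply/injectiveP => i j; rewrite !ffunE => /finj.
      - move=> x; case: ifP => [/codomP[i ->]|/negP nx].
          rewrite /= ffunE; have : range f (f i) by exists i.
          by rewrite frange.
        move=> /= xy; apply: nx; have : range f x by rewrite frange.
        by case=> i _ <-; apply/codomP; exists i; rewrite ffunE.
      - move=> [i j] /=; rewrite !ffunE; have := fadj i j; rewrite /= => -[H1 H2].
        by case: ifP => [/H2//|/negP nt /H1].
    move=> [f [/injectiveP finj [frange fadj]]]; exists f; split=> //.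
      apply/seteqP; split => [_ [i _ <-]|x xy].
        by have := frange (f i); rewrite codom_f.
      have := frange x; case: ifP => [/codomP[i ->] _|_ /(_ xy)//].
      by exists i.
    move=> i j; have := fadj (i, j); rewrite /=; case: ifP => //= _ H; split=> //.
  apply: measurable_exists => f; apply: measurableI; first exact: measurable_pred.
  apply: measurableI.
    apply: measurable_forall => x; have mx : measurable [set w | exists y, adj w x y].
      by apply: (@measurable_exists _ _ _ (fun y => [set w | adj w x y])) => y.
    by case: ifP => _ //; apply: measurableC.
  by apply: measurable_forall => z; case: ifP => _ //; apply: measurableC.
rewrite (_ : [set w | _] =
   [set w | exists c, ([set _ | `[< A (iso_class (code_graph c)) >]] `&`
      [set w | unlabel (adj w) (code_graph c)]) w] `|`
   ([set _ | `[< A set0 >]] `&` [set w | forall c, (~` [set w | unlabel (adj w) (code_graph c)]) w])).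
  apply: measurableU.
    by apply: measurable_exists => c; apply: measurableI => //; apply: measurable_pred.
  apply: measurableI; first exact: measurable_pred.
  by apply: measurable_forall => c; apply: measurableC.
apply/seteqP; split => w /=.
  move=> /unlabel_cases[[c [Ac wc]]|[A0 H]]; [left|right].
    by exists c; split=> //; apply/asboolP.
  by split=> //; apply/asboolP.
move=> H; apply/unlabel_cases; case: H => [[c [/asboolP Ac wc]]|[/asboolP A0 H]]; [left|right].
  by exists c.
by split.
Qed.

Definition gp_vertex_code (x : gp_vertex) : nat + nat * nat + nat * bool :=
  match x with Point i => inl (inl i) | Leaf i k => inl (inr (i, k)) | Isol k b => inr (k, b) end.

Definition gp_vertex_decode (c : nat + nat * nat + nat * bool) : gp_vertex :=
  match c with inl (inl i) => Point i | inl (inr (i, k)) => Leaf i k | inr (k, b) => Isol k b end.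

Lemma gp_vertex_codeK : cancel gp_vertex_code gp_vertex_decode.
Proof. by case. Qed.

HB.instance Definition _ := Countable.copy gp_vertex (can_type gp_vertex_codeK).

Lemma ex_above4 i j k l : exists M, [/\ i < M, j < M, k < M & l < M]%N.
Proof. by exists (i + j + k + l).+1; split; lia. Qed.

(** * Upper bound for the graphex process *)

Section graphex_upper_bound.
Context d (T : measurableType d) (R : realType) (P : probability T R) (t : R)
  (X : gp_noise P t).
Local Notation v := (gp_point X).
Local Notation u := (gp_unif X).
Local Notation pr := (pr P).
Variables (theta rho s : R) (m b : nat) (q : R -> R).
Hypothesis t0 : 0 <= t.
Hypothesis s0 : 0 <= s.
Hypothesis theta0 : 0 < theta.
Hypothesis rho01 : 0 < rho < 1.
Hypothesis q0 : forall y, 0 <= y -> 0 <= q y.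

(** Here [q y] is the weight of a vertex at [y]. *)
Definition weight_cell (l : nat) : set R := [set y | 0 <= y /\ in_cell theta rho l (q y)].
Definition weight_top : set R := [set y | 0 <= y /\ theta < q y].

Hypothesis mcell : forall l, measurable (weight_cell l).
Hypothesis fcell : forall l, (lebesgue_measure (weight_cell l) < +oo)%E.
Hypothesis mtop : measurable weight_top.
Hypothesis ftop : (lebesgue_measure weight_top < +oo)%E.
Hypothesis cell_bounded : forall l, exists2 V, 0 < V & forall y, weight_cell l y -> y < V.

Definition weight_rate l : R := t * fine (lebesgue_measure (weight_cell l)).
Definition top_rate : R := t * fine (lebesgue_measure weight_top).

Let gam l := grid theta rho l.
(** With weight zero beyond the first [m] cells, only finitely many points
    matter. *)
Definition lower_weight l := if (l < m)%N then grid theta rho l.+1 else 0.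
Let bet := lower_weight.

Variables (Gam eta : R).
Hypothesis Gam_le : forall M, \sum_(l < M) weight_rate l * gam l <= Gam.
Hypothesis eta_le : forall M, \sum_(l < M) weight_rate l * (gam l - bet l) <= eta.

Let gam0 l : 0 <= gam l. Proof. exact/ltW/grid_gt0. Qed.
Let bet0 l : 0 <= bet l.
Proof. by rewrite /bet /lower_weight; case: ifP => // _; apply/ltW/grid_gt0. Qed.
Let bet_gam l : bet l <= gam l.
Proof. by rewrite /bet /lower_weight; case: ifP => // _; apply: grid_le. Qed.
Let lam0 l : 0 <= weight_rate l.
Proof. by rewrite mulr_ge0// fine_ge0. Qed.

Let cls M y := cell_index theta rho M (q y).

Lemma cls_weight_cell M l : (l < M)%N -> cls_cell (cls M) l = weight_cell l.
Proof.
move=> lM; apply/seteqP; split => y [y0 yl]; split=> //.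
  by rewrite -(cell_indexE theta0 rho01 (q y) lM); apply/eqP.
by apply/eqP; rewrite cell_indexE.
Qed.

Lemma cls_weight_rate M l : (l < M)%N -> cell_rate t (cls M) l = weight_rate l.
Proof. by move=> lM; rewrite /cell_rate cls_weight_cell. Qed.

Let mcls M l : (l < M)%N -> measurable (cls_cell (cls M) l).
Proof. by move=> lM; rewrite cls_weight_cell. Qed.
Let fcls M l : (l < M)%N -> (lebesgue_measure (cls_cell (cls M) l) < +oo)%E.
Proof. by move=> lM; rewrite cls_weight_cell. Qed.

Lemma weight_campbell1 M l : \sum_(j < M) pr (v j @^-1` weight_cell l) <= weight_rate l.
Proof.
have := @campbell1 _ _ _ _ _ X t0 l.+1 (cls l.+1) (@mcls _) (@fcls _) M l (ltnSn l).
by rewrite cls_weight_rate// cls_weight_cell.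
Qed.

Lemma weight_campbell2 M l l' :
  \sum_(z : 'I_M * 'I_M | z.1 != z.2) pr (v z.1 @^-1` weight_cell l `&` v z.2 @^-1` weight_cell l')
  <= weight_rate l * weight_rate l'.
Proof.
pose L := (maxn l l').+1.
have lL : (l < L)%N by rewrite ltnS leq_maxl.
have lL' : (l' < L)%N by rewrite ltnS leq_maxr.
have := @campbell2 _ _ _ _ _ X t0 L (cls L) (@mcls _) (@fcls _) M l l' lL lL'.
by rewrite !cls_weight_rate// !cls_weight_cell.
Qed.

(** ** Exceptional events *)

Definition mark_code (z : nat * nat + option nat) : mark :=
  match z with inl (i, j) => EdgeMark i j | inr (Some j) => PendantMark j
             | inr None => IsolatedMark end.

Definition degenerate_mark : set T :=
  [set w | exists z, (u (mark_code z) @^-1` [set y | y <= 0] `|` u (mark_code z) @^-1` [set y | 1 < y]) w].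

Let m_le (x : R) : measurable [set y : R | y <= x].
Proof. by rewrite -set_itvNyc. Qed.
Let m_lt (x : R) : measurable [set y : R | y < x].
Proof. by rewrite -set_itvNyo. Qed.
Let m_gt (x : R) : measurable [set y : R | x < y].
Proof. by rewrite -set_itvoy. Qed.

Let mdeg z : measurable (u (mark_code z) @^-1` [set y | y <= 0] `|` u (mark_code z) @^-1` [set y | 1 < y]).
Proof. by apply: measurableU; apply: measurable_unif. Qed.

Lemma measurable_degenerate : measurable degenerate_mark.
Proof. exact: measurable_exists. Qed.

Lemma pr_degenerate : pr degenerate_mark = 0.
Proof.
apply: pr_null_exists => // z; apply/eqP; rewrite eq_le pr_ge0 andbT.
apply: le_trans (pr_setU_le P _ _) _; try exact: measurable_unif.
by rewrite unif_le ?unif_gt ?lexx ?ler01//; lra.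
Qed.

Definition top_point : set T := [set w | exists M : nat, exists j : 'I_M, (v j @^-1` weight_top) w].

Let mtopj j : measurable (v j @^-1` weight_top).
Proof. exact: measurable_point. Qed.

Lemma measurable_top_point : measurable top_point.
Proof. by apply: measurable_exists => M; apply: measurable_exists => j. Qed.

Lemma pr_top_point : pr top_point <= top_rate.
Proof.
apply: pr_exists_nat => [M|M M' MM' w [j Hj]|M].
- exact: measurable_exists.
- by exists (widen_ord MM' j).
- apply: le_trans (pr_exists_fin _ _) _ => //.
  pose cl (y : R) : nat := if theta < q y then 0%N else 1%N.
  have clE : cls_cell cl 0 = weight_top.
    apply/seteqP; split => y; first by move=> [y0]; rewrite /cl; case: ifP.
    by move=> [y0 ty]; split=> //; rewrite /cl ty.
  have := @campbell1 _ _ _ _ _ X t0 1 cl _ _ M 0 (ltnSn 0).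
  by rewrite /cell_rate clE; apply => -[|//] _; rewrite clE.
Qed.

(** Rounding down the weights changes the edge between two points only if its
    uniform variable falls into the window between the two edge probabilities.
    The components of [z] are a pair of points and the pair of their cells. *)
Definition edge_window : set T := [set w | exists M : nat,
  exists z : ('I_M * 'I_M) * ('I_M * 'I_M),
   (if (z.1.1 < z.1.2)%N then
     (v z.1.1 @^-1` weight_cell z.2.1 `&` v z.1.2 @^-1` weight_cell z.2.2) `&`
     u (EdgeMark z.1.1 z.1.2) @^-1` [set y | wf (bet z.2.1 * bet z.2.2) <= y < wf (gam z.2.1 * gam z.2.2)]
    else set0) w].

Let mwin x y : measurable [set z : R | x <= z < y].
Proof.
have -> : [set z | x <= z < y] = `[x, y[%classic by apply/seteqP; split => z /=; rewrite in_itv.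
exact: measurable_itv.
Qed.

Let mwin' x y : measurable [set z : R | x < z <= y].
Proof.
have -> : [set z | x < z <= y] = `]x, y]%classic by apply/seteqP; split => z /=; rewrite in_itv.
exact: measurable_itv.
Qed.

Let medge M (z : ('I_M * 'I_M) * ('I_M * 'I_M)) : measurable (if (z.1.1 < z.1.2)%N then
     (v z.1.1 @^-1` weight_cell z.2.1 `&` v z.1.2 @^-1` weight_cell z.2.2) `&`
     u (EdgeMark z.1.1 z.1.2) @^-1` [set y | wf (bet z.2.1 * bet z.2.2) <= y < wf (gam z.2.1 * gam z.2.2)]
    else set0).
Proof.
case: ifP => // _; apply: measurableI; last by apply: measurable_unif; exact: mwin.
by apply: measurableI; apply: measurable_point.
Qed.

Lemma measurable_edge_window : measurable edge_window.
Proof. by apply: measurable_exists => M; apply: measurable_exists => z; exact: medge. Qed.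

Lemma pr_one_mark mk (B : set R) E : point_sigma X E -> measurable B ->
  pr (E `&` u mk @^-1` B) = pr E * pr (u mk @^-1` B).
Proof.
move=> sE mB; have := @noise_indep _ _ _ _ _ X unit (fun=> mk) (fun=> B) E.
rewrite (eq_bigr (fun=> pr (u mk @^-1` B)))// big_const card_unit /= mulr1 => H.
rewrite -H//; last by move=> [] [].
by congr (pr (_ `&` _)); apply/seteqP; split => w /= => [//|]; apply; exact: tt.
Qed.

Let point_sigmaI (E F : set T) : point_sigma X E -> point_sigma X F -> point_sigma X (E `&` F).
Proof.
move=> sE sF; rewrite (_ : E `&` F = [set w | forall c : bool, (if c then E else F) w]).
  by apply: point_sigma_forall => -[].
by apply/seteqP; split => [w [Ew Fw] []//|w H]; split; [apply: (H true)|apply: (H false)].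
Qed.

Lemma eta_ge0 : 0 <= eta.
Proof. by apply: le_trans (eta_le 0); rewrite big_ord0. Qed.

Lemma Gam_ge0 : 0 <= Gam.
Proof. by apply: le_trans (Gam_le 0); rewrite big_ord0. Qed.

(** By Campbell's formula the probability is at most the sum over pairs of cells
    of the product of their rates and of the length of the window. *)
Lemma pr_edge_window : pr edge_window <= 2 * eta * Gam.
Proof.
apply: pr_exists_nat => [M|M M' MM' w [[[i j] [l l']] Hz]|M].
- exact: measurable_exists.
- by exists ((widen_ord MM' i, widen_ord MM' j), (widen_ord MM' l, widen_ord MM' l')).
apply: le_trans (pr_exists_fin _ (@medge M)) _.
rewrite -(pair_bigA _ (fun z1 z2 : 'I_M * 'I_M => pr (if (z1.1 < z1.2)%N then
     (v z1.1 @^-1` weight_cell z2.1 `&` v z1.2 @^-1` weight_cell z2.2) `&`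
     u (EdgeMark z1.1 z1.2) @^-1` [set y | wf (bet z2.1 * bet z2.2) <= y < wf (gam z2.1 * gam z2.2)]
    else set0)))/= exchange_big /=.
have bg l l' : bet l * bet l' <= gam l * gam l' by rewrite ler_pM.
apply: (@le_trans _ _ (\sum_(z2 : 'I_M * 'I_M) (gam z2.1 * gam z2.2 - bet z2.1 * bet z2.2) *
   (weight_rate z2.1 * weight_rate z2.2))).
  apply: ler_sum => -[l l'] _ /=.
  apply: le_trans (_ : _ <= (gam l * gam l' - bet l * bet l') *
    \sum_(z : 'I_M * 'I_M | z.1 != z.2) pr (v z.1 @^-1` weight_cell l `&` v z.2 @^-1` weight_cell l')) _; last first.
    by rewrite ler_wpM2l ?subr_ge0// weight_campbell2.
  rewrite [in leRHS]big_mkcond mulr_sumr; apply: ler_sum => -[i j] _ /=.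
  case: ifP => [ij|_]; last first.
    by rewrite pr_set0; case: ifP => _; rewrite ?mulr0// mulr_ge0 ?subr_ge0 ?pr_ge0.
  have -> : i != j by apply/negP => /eqP E; move: ij; rewrite E ltnn.
  rewrite pr_one_mark//; last by apply: point_sigmaI; apply: point_sigma_point.
  have g0 : 0 <= gam l * gam l' by rewrite mulr_ge0.
  have b0 : 0 <= bet l * bet l' by rewrite mulr_ge0.
  have /andP[w1 w2] := wf_lip b0 (bg l l').
  rewrite unif_window_lt ?wf_ge0 ?wf_le1//; last by rewrite -subr_ge0.
  by rewrite mulrC ler_wpM2r ?pr_ge0.
rewrite -(pair_bigA _ (fun l l' : 'I_M => (gam l * gam l' - bet l * bet l') * (weight_rate l * weight_rate l'))) /=.
have -> : \sum_(i < M) \sum_(j < M) (gam i * gam j - bet i * bet j) * (weight_rate i * weight_rate j) =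
   (\sum_(l < M) weight_rate l * gam l) ^+ 2 - (\sum_(l < M) weight_rate l * bet l) ^+ 2.
  rewrite !expr2 !big_distrl /= -sumrB; apply: eq_bigr => i _.
  rewrite !big_distrr /= -sumrB; apply: eq_bigr => j _; lra.
have E := eta_le M; have G := Gam_le M.
rewrite (eq_bigr (fun l : 'I_M => weight_rate l * gam l - weight_rate l * bet l)) in E; last first.
  by move=> l _; rewrite mulrBr.
rewrite sumrB in E; move: E G.
have B0 : 0 <= \sum_(l < M) weight_rate l * bet l by apply: sumr_ge0 => l _; rewrite mulr_ge0.
have BG : \sum_(l < M) weight_rate l * bet l <= \sum_(l < M) weight_rate l * gam l.
  by apply: ler_sum => l _; rewrite ler_wpM2l.
move: B0 BG; set S1 := \sum_(l < M) weight_rate l * gam l; set S2 := \sum_(l < M) _ => B0 BG E G.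
rewrite subr_sqr; have := eta_ge0; have := Gam_ge0 => G0 e0.
rewrite (_ : 2 * eta * Gam = eta * (2 * Gam)); last by lra.
by rewrite ler_pM ?subr_ge0 ?addr_ge0//; lra.
Qed.

(** The edge function vanishes on the diagonal, so distinct points at the same
    place would lack their edge. *)
Definition coincident : set T := [set w | exists z : (nat * nat) * nat,
  (if (z.1.1 < z.1.2)%N then [set w | v z.1.1 w = v z.1.2 w] `&` v z.1.1 @^-1` weight_cell z.2
   else set0) w].

Let mcoin (z : (nat * nat) * nat) : measurable (if (z.1.1 < z.1.2)%N
  then [set w | v z.1.1 w = v z.1.2 w] `&` v z.1.1 @^-1` weight_cell z.2 else set0).
Proof.
case: ifP => // _; apply: measurableI; last exact: measurable_point.
rewrite (_ : [set w | _] = (fun w => v z.1.1 w - v z.1.2 w) @^-1` [set 0]).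
  rewrite -[X in measurable X]setTI.
  exact: (measurable_funB (measurable_funPT (v z.1.1)) (measurable_funPT (v z.1.2))).
by apply/seteqP; split => w /= => [->|/eqP]; rewrite ?subrr// subr_eq0 => /eqP.
Qed.

Lemma measurable_coincident : measurable coincident.
Proof. exact: measurable_exists. Qed.

Lemma pr_coincident : pr coincident = 0.
Proof.
apply: pr_null_exists => // -[[i j] l] /=; case: ifP => [ij|_]; last exact: pr_set0.
have [V V0 cV] := cell_bounded l.
apply/eqP; rewrite eq_le pr_ge0 andbT -(points_distinct X t0 (negbT (ltn_eqF ij)) V0).
apply: le_pr; first by have := mcoin ((i, j), l); rewrite /= ij.
  rewrite (_ : [set w | _] = [set w | v i w = v j w] `&` v i @^-1` [set y | y < V]).
    apply: measurableI; last exact: measurable_point.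
    rewrite (_ : [set w | _] = (fun w => v i w - v j w) @^-1` [set 0]).
      rewrite -[X in measurable X]setTI.
      exact: (measurable_funB (measurable_funPT (v i)) (measurable_funPT (v j))).
    by apply/seteqP; split => w /= => [->|/eqP]; rewrite ?subrr// subr_eq0 => /eqP.
  by apply/seteqP; split.
by move=> w [vv cl]; split=> //; apply: cV.
Qed.

(** The analogue of [edge_window] for numbers of pendant edges below [b]. *)
Definition pendant_window : set T := [set w | exists M : nat, exists z : ('I_M * 'I_M) * 'I_b,
  (v z.1.1 @^-1` weight_cell z.1.2 `&` u (PendantMark z.1.1) @^-1`
     [set y | pcdf (s * gam z.1.2) z.2.+1 < y <= pcdf (s * bet z.1.2) z.2.+1]) w].

Let mpend M (z : ('I_M * 'I_M) * 'I_b) : measurable (v z.1.1 @^-1` weight_cell z.1.2 `&`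
  u (PendantMark z.1.1) @^-1` [set y | pcdf (s * gam z.1.2) z.2.+1 < y <= pcdf (s * bet z.1.2) z.2.+1]).
Proof. by apply: measurableI; [exact: measurable_point|apply: measurable_unif; exact: mwin']. Qed.

Lemma measurable_pendant_window : measurable pendant_window.
Proof. by apply: measurable_exists => M; apply: measurable_exists => z; exact: mpend. Qed.

Lemma pr_pendant_window : pr pendant_window <= b%:R * b%:R * s * eta.
Proof.
apply: pr_exists_nat => [M|M M' MM' w [[[j l] k] Hz]|M].
- exact: measurable_exists.
- by exists ((widen_ord MM' j, widen_ord MM' l), k).
apply: le_trans (pr_exists_fin _ (@mpend M)) _.
apply: (@le_trans _ _ (\sum_(z : ('I_M * 'I_M) * 'I_b) pr (v z.1.1 @^-1` weight_cell z.1.2) *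
   (b%:R * (s * (gam z.1.2 - bet z.1.2))))).
  apply: ler_sum => -[[j l] k] _ /=; rewrite pr_one_mark//; last exact: point_sigma_point.
  rewrite ler_wpM2l ?pr_ge0//.
  have sg : s * bet l <= s * gam l by rewrite ler_wpM2l.
  have sg0 : 0 <= s * gam l by rewrite mulr_ge0.
  have sb0 : 0 <= s * bet l by rewrite mulr_ge0.
  rewrite unif_window_le ?pcdf_ge0 ?poisson_cdf_le ?sum_poisson_mass_le1//.
  rewrite /pcdf -sumrB mulrBr.
  apply: (@le_trans _ _ (\sum_(i < k.+1) (s * gam l - s * bet l))).
    apply: ler_sum => i _; apply: le_trans (ler_norm _) _.
    apply: le_trans (poisson_mass_lip _ sb0 sg0) _.
    by rewrite distrC ger0_norm// subr_ge0.
  rewrite sumr_const card_ord -[X in X <= _]mulr_natl ler_wpM2r ?subr_ge0// ler_nat.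
  exact: ltn_ord.
rewrite -(pair_bigA _ (fun (z : 'I_M * 'I_M) (k : 'I_b) => pr (v z.1 @^-1` weight_cell z.2) *
   (b%:R * (s * (gam z.2 - bet z.2))))) /=.
rewrite (eq_bigr (fun z : 'I_M * 'I_M => b%:R * (pr (v z.1 @^-1` weight_cell z.2) *
   (b%:R * (s * (gam z.2 - bet z.2)))))); last first.
  by move=> z _; rewrite sumr_const card_ord -[LHS]mulr_natl.
rewrite -mulr_sumr -(pair_bigA _ (fun j l : 'I_M => pr (v j @^-1` weight_cell l) *
   (b%:R * (s * (gam l - bet l))))) /= exchange_big /=.
rewrite -!mulrA ler_wpM2l// mulrA.
apply: (@le_trans _ _ (\sum_(l < M) (b%:R * s) * (weight_rate l * (gam l - bet l)))).
  apply: ler_sum => l _; rewrite -mulr_suml.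
  rewrite mulrC (_ : b%:R * s * (weight_rate l * (gam l - bet l)) = (b%:R * (s * (gam l - bet l))) * weight_rate l); last by lra.
  by rewrite ler_wpM2l ?weight_campbell1// !mulr_ge0 ?subr_ge0.
by rewrite -mulr_sumr ler_wpM2l// mulr_ge0.
Qed.


Definition pendant_overflow : set T := [set w | exists M : nat, exists z : 'I_M * 'I_M,
  (v z.1 @^-1` weight_cell z.2 `&` u (PendantMark z.1) @^-1` [set y | pcdf (s * gam z.2) b < y]) w].

Let mpover M (z : 'I_M * 'I_M) : measurable (v z.1 @^-1` weight_cell z.2 `&`
  u (PendantMark z.1) @^-1` [set y | pcdf (s * gam z.2) b < y]).
Proof. by apply: measurableI; [exact: measurable_point|exact: measurable_unif]. Qed.

Lemma measurable_pendant_overflow : measurable pendant_overflow.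
Proof. by apply: measurable_exists => M; apply: measurable_exists => z; exact: mpover. Qed.

Lemma pr_pendant_overflow : (0 < b)%N -> pr pendant_overflow <= s * Gam / b%:R.
Proof.
move=> b0; apply: pr_exists_nat => [M|M M' MM' w [[j l] Hz]|M].
- exact: measurable_exists.
- by exists (widen_ord MM' j, widen_ord MM' l).
apply: le_trans (pr_exists_fin _ (@mpover M)) _.
apply: (@le_trans _ _ (\sum_(z : 'I_M * 'I_M) (s * gam z.2 / b%:R) * pr (v z.1 @^-1` weight_cell z.2))).
  apply: ler_sum => -[j l] _ /=; rewrite pr_one_mark//; last exact: point_sigma_point.
  have sg0 : 0 <= s * gam l by rewrite mulr_ge0.
  rewrite unif_gt ?pcdf_ge0 ?sum_poisson_mass_le1//.
  by rewrite mulrC ler_wpM2r ?pr_ge0// poisson_tail_le.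
rewrite -(pair_bigA _ (fun j l : 'I_M => (s * gam l / b%:R) * pr (v j @^-1` weight_cell l))) /=.
rewrite exchange_big /=.
apply: (@le_trans _ _ (\sum_(l < M) (s / b%:R) * (weight_rate l * gam l))).
  apply: ler_sum => l _; rewrite -mulr_sumr.
  rewrite (_ : s / b%:R * (weight_rate l * gam l) = (s * gam l / b%:R) * weight_rate l); last by lra.
  by rewrite ler_wpM2l ?weight_campbell1// divr_ge0// mulr_ge0.
rewrite -mulr_sumr [leRHS]mulrAC; apply: ler_wpM2l; first by rewrite divr_ge0.
exact: Gam_le.
Qed.

Definition isolated_overflow : set T := u IsolatedMark @^-1` [set y | pcdf (s ^+ 2 / 2) b < y].

Lemma measurable_isolated_overflow : measurable isolated_overflow.
Proof. exact: measurable_unif. Qed.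

Lemma pr_isolated_overflow : (0 < b)%N -> pr isolated_overflow <= s ^+ 2 / 2 / b%:R.
Proof.
move=> b0; have r0 : 0 <= s ^+ 2 / 2 by rewrite divr_ge0 ?sqr_ge0.
by rewrite unif_gt ?pcdf_ge0 ?sum_poisson_mass_le1// poisson_tail_le.
Qed.

(** ** The graph outside the exceptional events *)

Variable g : graphex_triple R.
Hypothesis gWE : forall x y, 0 <= x -> 0 <= y ->
  gW g x y = if x == y then 0 else wf (q x * q y).
Hypothesis gSE : forall x, 0 <= x -> t * gS g x = s * q x.
Hypothesis gIE : t ^+ 2 * gI g = s ^+ 2 / 2.
Hypothesis b1 : (1 < b)%N.

Definition regular (w : T) := [/\ ~ degenerate_mark w, ~ top_point w & ~ edge_window w] /\
  [/\ ~ coincident w, ~ pendant_window w, ~ pendant_overflow w & ~ isolated_overflow w].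

Let v0 j w : 0 <= v j w. Proof. exact: point_ge0. Qed.

Lemma regular_unif w z : regular w -> 0 < u (mark_code z) w <= 1.
Proof.
move=> [[nd _ _] _]; rewrite !ltNge; apply/andP; split; apply/negP => H; apply: nd; exists z.
  by left.
by right; move: H; rewrite /= ltNge => /negP.
Qed.


Lemma regular_cell w j : regular w -> 0 < q (v j w) -> exists l, weight_cell l (v j w).
Proof.
move=> [[_ nt _] _] qj.
have qt : q (v j w) <= theta.
  rewrite leNgt; apply/negP => tq; apply: nt; exists j.+1, ord_max => /=; split=> //.
have [M Mq] : exists M, grid theta rho M < q (v j w).
  have /andP[r0 r1] := rho01.
  have cv : (fun M => grid theta rho M) @ \oo --> (0 : R).
    rewrite -[X in _ --> X](mulr0 theta); apply: cvgM; first exact: cvg_cst.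
    by apply: cvg_expr; rewrite ger0_norm// ltW.
  have /cvgrPdist_lt/(_ _ qj)[M _ /(_ M (leqnn M))] := cv.
  rewrite /= sub0r normrN ger0_norm; first by exists M.
  exact/ltW/grid_gt0.
have [l _ lq] := in_cell_ex (introT andP (conj Mq qt)).
by exists l; split.
Qed.

(** The strict inequalities that hold outside the windows allow to replace the
    weights by the lower ends of their cells. *)
Lemma regular_edge w i j : regular w -> (i < j)%N ->
  u (EdgeMark i j) w < gW g (v i w) (v j w) <->
  exists l l', [/\ (l < m)%N, (l' < m)%N, weight_cell l (v i w), weight_cell l' (v j w) &
     u (EdgeMark i j) w < wf (grid theta rho l.+1 * grid theta rho l'.+1)].
Proof.
move=> rw ij; have := regular_unif (inl (i, j)) rw => /= /andP[u0 u1].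
have [[_ _ ne] [nc _ _ _]] := rw.
rewrite gWE//; split; last first.
  move=> [l [l' [lm lm' cl cl' uw]]].
  have [E|_] := eqVneq (v i w) (v j w).
    by case: nc; exists ((i, j), l); rewrite /= ij; split.
  apply: lt_le_trans uw _.
  have [_ /andP[/ltW a _]] := cl; have [_ /andP[/ltW a' _]] := cl'.
  have g0 k : 0 <= grid theta rho k by apply/ltW/grid_gt0.
  have p0 : 0 <= grid theta rho l.+1 * grid theta rho l'.+1 by exact: mulr_ge0.
  have pp : grid theta rho l.+1 * grid theta rho l'.+1 <= q (v i w) * q (v j w) by rewrite ler_pM.
  by have /andP[] := wf_lip p0 pp; rewrite subr_ge0.
case: eqP => [_|_ uw]; first by move=> /(lt_trans u0); rewrite ltxx.
have qi0 := q0 (v0 i w); have qj0 := q0 (v0 j w).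
have wf0 : wf 0 = 0 :> R by rewrite /wf mul0r.
have qi : 0 < q (v i w).
  rewrite lt_neqAle qi0 andbT; apply/eqP => E; move: uw; rewrite -E mul0r wf0.
  by move=> /(lt_trans u0); rewrite ltxx.
have qj : 0 < q (v j w).
  rewrite lt_neqAle qj0 andbT; apply/eqP => E; move: uw; rewrite -E mulr0 wf0.
  by move=> /(lt_trans u0); rewrite ltxx.
have [l cl] := regular_cell rw qi; have [l' cl'] := regular_cell rw qj.
have ub : u (EdgeMark i j) w < wf (bet l * bet l').
  rewrite ltNge; apply/negP => bu; apply: ne.
  have [M [iM jM lM lM']] := ex_above4 i j l l'.
  exists M, ((Ordinal iM, Ordinal jM), (Ordinal lM, Ordinal lM')).
  rewrite /= ij; split; first by split.
  rewrite /= bu /=; apply: lt_le_trans uw _.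
  have [_ /andP[_ a]] := cl; have [_ /andP[_ a']] := cl'.
  have p0 : 0 <= q (v i w) * q (v j w) by exact: mulr_ge0.
  have pp : q (v i w) * q (v j w) <= gam l * gam l' by rewrite ler_pM.
  by have /andP[] := wf_lip p0 pp; rewrite subr_ge0.
exists l, l'; move: ub; rewrite /bet /lower_weight.
case: ifP => lm; last by rewrite mul0r wf0 => /(lt_trans u0); rewrite ltxx.
by case: ifP => lm'; last by rewrite mulr0 wf0 => /(lt_trans u0); rewrite ltxx.
Qed.

Lemma regular_pendant w j k : regular w ->
  poisson_exceeds (t * gS g (v j w)) (u (PendantMark j) w) k <->
  exists l, [/\ (l < m)%N, weight_cell l (v j w) &
     poisson_exceeds (s * grid theta rho l.+1) (u (PendantMark j) w) k].
Proof.
move=> rw; have := regular_unif (inr (Some j)) rw => /= /andP[u0 u1].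
have [[_ _ _] [_ nw no _]] := rw.
have ex0 l : ~ poisson_exceeds 0 (u (PendantMark j) w) l.
  by rewrite poisson_exceedsE pcdf0 ltNge u1.
rewrite gSE//; split; last first.
  move=> [l [lm [_ /andP[a _]]]]; apply: poisson_exceeds_mono.
    by rewrite mulr_ge0//; apply/ltW/grid_gt0.
  by rewrite ler_wpM2l// ltW.
move=> ex; have qj : 0 < q (v j w).
  rewrite lt_neqAle q0// andbT; apply/eqP => E.
  by move: ex; rewrite -E mulr0; apply: ex0.
have [l cl] := regular_cell rw qj; exists l.
have [_ /andP[_ qg]] := cl.
have exg : poisson_exceeds (s * gam l) (u (PendantMark j) w) k.
  by apply: poisson_exceeds_mono ex; rewrite ?mulr_ge0 ?ler_wpM2l ?q0.
have [M [jM _ lM _]] := ex_above4 j j l l.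
have exb : poisson_exceeds (s * bet l) (u (PendantMark j) w) k.
  have [kb|bk] := ltnP k b.
    rewrite poisson_exceedsE ltNge; apply/negP => ub; apply: nw.
    by exists M, ((Ordinal jM, Ordinal lM), Ordinal kb); split=> //=; rewrite ub andbT.
  exfalso; apply: no; exists M, (Ordinal jM, Ordinal lM); split=> //=.
  apply: le_lt_trans exg; apply: pcdf_le; first by rewrite mulr_ge0.
  exact: leqW.
move: exb; rewrite /bet /lower_weight; case: ifP => // lm.
by rewrite mulr0 => /ex0.
Qed.

Lemma regular_isolated w k : regular w ->
  poisson_exceeds (s ^+ 2 / 2) (u IsolatedMark w) k -> (k.+1 < b)%N.
Proof.
move=> [_ [_ _ _ no]] ex; rewrite ltnNge; apply/negP => bk; apply: no.
by apply: le_lt_trans ex; apply: pcdf_le; first by rewrite divr_ge0 ?sqr_ge0.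
Qed.

Lemma regular_pendant_lt w j l k : regular w -> weight_cell l (v j w) ->
  poisson_exceeds (s * grid theta rho l.+1) (u (PendantMark j) w) k -> (k.+1 < b)%N.
Proof.
move=> [_ [_ _ no _]] cl ex; rewrite ltnNge; apply/negP => bk; apply: no.
have [M [jM _ lM _]] := ex_above4 j j l l.
exists M, (Ordinal jM, Ordinal lM); split=> //=.
apply: (@le_lt_trans _ _ (pcdf (s * gam l) k.+1)); first by apply: pcdf_le => //; rewrite mulr_ge0.
apply: poisson_exceeds_mono ex; first by rewrite mulr_ge0//; apply/ltW/grid_gt0.
by rewrite ler_wpM2l// grid_le.
Qed.


(** ** The configuration determines the law of the graph *)

Definition point_index (hs : seq (nat * nat)) (i : 'I_(size hs)) : nat := (nth (0, 0)%N hs i).1.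
Definition point_type (hs : seq (nat * nat)) (i : 'I_(size hs)) : nat := (nth (0, 0)%N hs i).2.

Lemma point_index_mono hs : config_ok m hs -> forall i j : 'I_(size hs), (i < j)%N ->
  (point_index i < point_index j)%N.
Proof.
move=> /andP[so _] i j ij.
have := sorted_ltn_nth ltn_trans 0%N so; move=> /(_ i j).
by rewrite !inE !size_map !ltn_ord => /(_ isT isT ij); rewrite !(nth_map (0, 0)%N).
Qed.

Let cfg := config X m (cls m).

Lemma config_cell hs w (i : 'I_(size hs)) : cfg hs w ->
  (point_type i < m)%N /\ weight_cell (point_type i) (v (point_index i) w).
Proof.
move=> [ok H]; have mem : (point_index i, point_type i) \in hs.
  by rewrite /point_index /point_type -surjective_pairing mem_nth.
have tm : (point_type i < m)%N := config_mem_lt ok mem; split=> //.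
have := H (point_index i) (Ordinal tm); rewrite mem /= => cE; split=> //.
by rewrite -(cell_indexE theta0 rho01 _ tm).
Qed.

Lemma config_point hs w j l : cfg hs w -> (l < m)%N -> weight_cell l (v j w) ->
  exists i : 'I_(size hs), point_index i = j /\ point_type i = l.
Proof.
move=> [ok H] lm [_ cl]; have := H j (Ordinal lm); rewrite /cls cell_indexE// cl => /esym jl.
have ih : (index (j, l) hs < size hs)%N by rewrite index_mem.
by exists (Ordinal ih); rewrite /point_index /point_type /= nth_index.
Qed.

Definition type_weight hs (i : 'I_(size hs)) : R := grid theta rho (point_type i).+1.

Let tw0 hs (i : 'I_(size hs)) : 0 <= type_weight i.
Proof. exact/ltW/grid_gt0. Qed.

Lemma quantile_exceeds (r y : R) k l : 0 <= r ->
  (forall l, (l < k)%N -> poisson_exceeds r y l) /\ ~~ poisson_exceeds r y k ->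
  (l < k)%N = poisson_exceeds r y l.
Proof.
move=> r0 [ex nex]; apply/idP/idP; first exact: ex.
rewrite ltnNge; apply: contraL => kl; apply: contra nex.
exact: poisson_exceeds_leq.
Qed.

Section marks.
Variables (hs : seq (nat * nat)) (k : {ffun {set 'I_(size hs)} -> 'I_b}) (w : T).
Hypothesis cw : cfg hs w.
Hypothesis kw : marks_event X (@point_index hs) s (@type_weight hs) k w.

Let mono : forall i j : 'I_(size hs), (i < j)%N -> (point_index i < point_index j)%N.
Proof. by apply: point_index_mono; case: cw. Qed.

Lemma mark_pair (i j : 'I_(size hs)) : (i < j)%N -> (0 < k [set i; j]%SET)%N =
  (u (EdgeMark (point_index i) (point_index j)) w < wf (type_weight i * type_weight j)).
Proof.
move=> ij; have ij' : i != j by apply/negP => /eqP E; move: ij; rewrite E ltnn.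
have c2 : #|[set i; j]%SET| = 2 by rewrite cards2 ij'.
have := kw (exist _ [set i; j]%SET (eq_leq c2)); rewrite /= mark_of2// /mark_range c2.
rewrite big_setU1 ?finset.in_set1//= finset.big_set1 -/(wf _).
by case: (nat_of_ord (k _)) => [|[|//]] /=; [rewrite leNgt => /negbTE ->|move=> ->].
Qed.

Lemma mark_single (i : 'I_(size hs)) l : (l < k [set i]%SET)%N =
  poisson_exceeds (s * type_weight i) (u (PendantMark (point_index i)) w) l.
Proof.
have c1 : #|[set i]%SET| = 1%N by rewrite cards1.
have h : (#|[set i]%SET| <= 2)%N by rewrite c1.
have := kw (exist _ [set i]%SET h); rewrite /= mark_of1 /mark_range c1 finset.big_set1.
by move=> H; apply: (quantile_exceeds _ _ H); rewrite mulr_ge0.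
Qed.

Lemma mark_none l : (l < k finset.set0)%N = poisson_exceeds (s ^+ 2 / 2) (u IsolatedMark w) l.
Proof.
have h : (#|@finset.set0 'I_(size hs)| <= 2)%N by rewrite cards0.
have := kw (exist _ finset.set0 h); rewrite /= mark_of0 /mark_range cards0.
by move=> H; apply: (quantile_exceeds _ _ H); rewrite divr_ge0 ?sqr_ge0.
Qed.

(** Outside the exceptional events the graph is the star graph whose vertices
    are the points in the first [m] cells; the other points are isolated. *)
Lemma config_unlabel : regular w ->
  unlabel (star_adj (fun x => k x : nat)) = unlabel (gp_adj X g w).
Proof.
move=> rw.
have inj : injective (@point_index hs) := s_inj mono.
pose h (x : svertex 'I_(size hs)) := match x with
  SPoint i => Point (point_index i) | SLeaf i l => Leaf (point_index i) l | SIsol l c => Isol l c end.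
have hinj : injective h.
  by move=> [i|i l|l c] [j|j l'|l' c'] //= []; [move=> /inj ->|move=> /inj -> ->|move=> -> ->].
have gsym x y : gW g (v x w) (v y w) = gW g (v y w) (v x w).
  by rewrite !gWE// eq_sym mulrC.
have edgeE (i j : 'I_(size hs)) : (i < j)%N -> (0 < k [set i; j]%SET)%N ->
    u (EdgeMark (point_index i) (point_index j)) w < gW g (v (point_index i) w) (v (point_index j) w).
  move=> ij; rewrite mark_pair// => uw; apply/(regular_edge rw); first exact: mono.
  have [mi ci] := config_cell i cw; have [mj cj] := config_cell j cw.
  by exists (point_type i), (point_type j).
have Eedge (i j : nat) : (i < j)%N -> u (EdgeMark i j) w < gW g (v i w) (v j w) ->
    exists i' j' : 'I_(size hs), [/\ point_index i' = i, point_index j' = j, i' != j' &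
      (0 < k [set i'; j']%SET)%N].
  move=> ij /(regular_edge rw ij)[l [l' [lm lm' cl cl' uw]]].
  have [i' [ii li]] := config_point cw lm cl; have [j' [jj lj]] := config_point cw lm' cl'.
  have ij' : (i' < j')%N.
    rewrite ltnNge; apply/negP; rewrite leq_eqVlt => /orP[/eqP/val_inj E|/mono].
      by move: ij; rewrite -ii -jj E ltnn.
    by rewrite ii jj ltnNge (ltnW ij).
  exists i', j'; split=> //; first by apply/negP => /eqP E; move: ij'; rewrite E ltnn.
  by rewrite mark_pair// /type_weight ii jj li lj.
have pendE (i : 'I_(size hs)) l : (l < k [set i]%SET)%N ->
    poisson_exceeds (t * gS g (v (point_index i) w)) (u (PendantMark (point_index i)) w) l.
  rewrite mark_single => ex; apply/(regular_pendant _ _ rw).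
  by have [mi ci] := config_cell i cw; exists (point_type i).
have Epend j l : poisson_exceeds (t * gS g (v j w)) (u (PendantMark j) w) l ->
    exists i : 'I_(size hs), point_index i = j /\ (l < k [set i]%SET)%N.
  move=> /(regular_pendant _ _ rw)[c [cm cc ex]].
  have [i [ij ic]] := config_point cw cm cc; exists i; split=> //.
  by rewrite mark_single /type_weight ij ic.
apply: (@unlabel_iso _ _ _ _ h).
- exact: star_adj_sym.
- case=> [i|i l|l c] [j|j l'|l' c'] //=.
  + move=> [ij]; case: (ltngtP i j) => [lt|gt|/val_inj E]; last by rewrite E eqxx in ij.
      by move=> /(edgeE _ _ lt); have := mono lt => lt'; rewrite (minn_idPl (ltnW lt')) (maxn_idPr (ltnW lt')).
    rewrite finset.setUC => /(edgeE _ _ gt); have := mono gt => lt'.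
    by rewrite (minn_idPr (ltnW lt')) (maxn_idPl (ltnW lt')) gsym.
  + by move=> [-> /pendE].
  + by move=> [-> /pendE].
  + by rewrite mark_none gIE.
- case=> [i|i l|l c] [j|j l'|l' c'] //=.
  + case: (ltngtP i j) => [lt|gt|<-].
    * move=> /(Eedge _ _ lt)[i' [j' [<- <- ij kk]]].
      by exists (SPoint i'), (SPoint j').
    * rewrite gsym => /(Eedge _ _ gt)[i' [j' [<- <- ij kk]]].
      by exists (SPoint j'), (SPoint i'); split=> //; rewrite /= finset.setUC eq_sym.
    * rewrite gWE// eqxx => /(lt_trans _).
      have /andP[u0 _] := regular_unif (inl (i, i)) rw.
      by move=> /(_ _ u0); rewrite ltxx.
  + by move=> [-> /Epend[i' [<- kk]]]; exists (SPoint i'), (SLeaf i' l').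
  + by move=> [<- /Epend[i' [<- kk]]]; exists (SLeaf i' l), (SPoint i').
  + by rewrite gIE -mark_none => H; exists (SIsol l c), (SIsol l' c').
- by move=> x x' _ _ _ _ /hinj.
Qed.

End marks.

(** Outside the overflow events the Poisson quantiles are below [b]. *)
Lemma marks_exist hs w : regular w -> cfg hs w ->
  exists k : {ffun {set 'I_(size hs)} -> 'I_b},
    (forall x : {set 'I_(size hs)}, (2 < #|x|)%N -> k x = 0%N :> nat) /\
    marks_event X (@point_index hs) s (@type_weight hs) k w.
Proof.
move=> rw cw; have b0 := ltnW b1.
have mono : forall i j : 'I_(size hs), (i < j)%N -> (point_index i < point_index j)%N.
  by apply: point_index_mono; case: cw.
have qex (r y : R) : (forall l, poisson_exceeds r y l -> (l.+1 < b)%N) -> exists k : 'I_b,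
    (forall l, (l < k)%N -> poisson_exceeds r y l) /\ ~~ poisson_exceeds r y k.
  move=> lb; have ex : exists l, ~~ poisson_exceeds r y l.
    by exists b; apply/negP => /lb/ltnW; rewrite ltnn.
  have [nk kmin] : ~~ poisson_exceeds r y (ex_minn ex) /\
      forall l, ~~ poisson_exceeds r y l -> (ex_minn ex <= l)%N by case: ex_minnP.
  have kex l : (l < ex_minn ex)%N -> poisson_exceeds r y l.
    by move=> lk; apply: contraLR lk => /kmin; rewrite -leqNgt.
  have kb : (ex_minn ex < b)%N.
    by case: (ex_minn ex) kex => [//|k] kex; apply: lb; apply: kex.
  by exists (Ordinal kb).
have each (x : {set 'I_(size hs)}) : exists k : 'I_b, ((2 < #|x|)%N -> k = 0%N :> nat) /\
    ((#|x| <= 2)%N -> mark_range s (@type_weight hs) x k (u (mark_of (@point_index hs) x) w)).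
  case cx: #|x| => [|[|[|c]]].
  - have [k kP] := qex (s ^+ 2 / 2) (u IsolatedMark w) (fun l => @regular_isolated w l rw).
    exists k; split=> // _; have -> : x = finset.set0 by apply: cards0_eq.
    by rewrite mark_of0 /mark_range cards0.
  - have /eqP/cards1P[i ->] := cx; have [mi ci] := config_cell i cw.
    have [k kP] := qex (s * type_weight i) (u (PendantMark (point_index i)) w)
      (fun l => @regular_pendant_lt w _ _ l rw ci).
    by exists k; split=> // _; rewrite mark_of1 /mark_range cards1 finset.big_set1.
  - have /eqP/cards2P[i [j [ij xij]]] := cx.
    wlog lt : i j ij xij / (i < j)%N.
      move=> H; case: (ltngtP i j) => [|gt|/val_inj E]; first exact: H.
        by apply: (H j i) => //; [rewrite eq_sym|rewrite finset.setUC].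
      by rewrite E eqxx in ij.
    rewrite /mark_range cx.
    have [uw|uw] := ltP (u (mark_of (@point_index hs) x) w)
      (\prod_(i in x) type_weight i / (1 + \prod_(i in x) type_weight i)).
      by exists (Ordinal b1).
    by exists (Ordinal b0).
  - by exists (Ordinal b0).
have [k kP] := fin_all_exists each.
exists [ffun x => k x]; split=> [x|[x x2]]; rewrite /= ffunE.
  by case: (kP x).
by case: (kP x) => _; apply.
Qed.

(** ** The bound *)

Definition graph_event (A : set ugraph) : set T := [set w | A (unlabel (gp_adj X g w))].

(** The last event discards configurations with many points, to make the sum
    over the counts finite. *)
Definition exceptional (c : nat) : set T :=
  degenerate_mark `|` (top_point `|` (edge_window `|` (coincident `|` (pendant_window `|`
  (pendant_overflow `|` (isolated_overflow `|` overflow X m (cls m) c)))))).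

Let mcm l : (l < m)%N -> measurable (cls_cell (cls m) l).
Proof. exact: mcls. Qed.
Let fcm l : (l < m)%N -> (lebesgue_measure (cls_cell (cls m) l) < +oo)%E.
Proof. exact: fcls. Qed.

Lemma measurable_exceptional c : measurable (exceptional c).
Proof.
repeat apply: measurableU.
- exact: measurable_degenerate.
- exact: measurable_top_point.
- exact: measurable_edge_window.
- exact: measurable_coincident.
- exact: measurable_pendant_window.
- exact: measurable_pendant_overflow.
- exact: measurable_isolated_overflow.
- exact: measurable_overflow.
Qed.

Lemma pr_exceptional c : pr (exceptional c) <=
  top_rate + 2 * eta * Gam + b%:R * b%:R * s * eta + (s * Gam + s ^+ 2 / 2) / b%:R +
  pr (overflow X m (cls m) c).
Proof.
have b0 := ltnW b1.
have U (E F : set T) (e f : R) : measurable E -> pr E <= e -> measurable F /\ pr F <= f ->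
    measurable (E `|` F) /\ pr (E `|` F) <= e + f.
  move=> mE Ee [mF Ff]; split; first exact: measurableU.
  by apply: le_trans (pr_setU_le P mE mF) _; apply: lerD.
have eq_le1 (x y : R) : x = y -> x <= y by move=> ->.
have := U _ _ _ _ measurable_degenerate (eq_le1 _ _ pr_degenerate)
  (U _ _ _ _ measurable_top_point pr_top_point
  (U _ _ _ _ measurable_edge_window pr_edge_window
  (U _ _ _ _ measurable_coincident (eq_le1 _ _ pr_coincident)
  (U _ _ _ _ measurable_pendant_window pr_pendant_window
  (U _ _ _ _ measurable_pendant_overflow (pr_pendant_overflow b0)
  (U _ _ _ _ measurable_isolated_overflow (pr_isolated_overflow b0)
  (conj (measurable_overflow X mcm c) (lexx (pr (overflow X m (cls m) c)))))))))).
by move=> [_]; rewrite -/(exceptional c) => /le_trans; apply; lra.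
Qed.

Hypothesis mgraph : forall A, measurable (graph_event A).

(** The event is split according to the configuration. Given it, the marks are
    independent with laws [star_pmf], and the probability of [A] depends on the
    numbers of points in the cells only, by [type_probE]. *)
Lemma graph_event_le A c : pr (graph_event A) <=
  \sum_(N : {ffun 'I_m -> 'I_c}) (\prod_(l < m) poisson_mass (weight_rate l) (N l)) *
     type_prob theta rho b s A (counts_seq (fun l => N l : nat)) + pr (exceptional c).
Proof.
have b0 := ltnW b1.
pose E (N : {ffun 'I_m -> 'I_c}) (hs : seq (nat * nat)) : set T :=
  if [forall l : 'I_m, config_count hs l == N l] then cfg hs else set0.
pose D (hs : seq (nat * nat)) : set T := [set w | exists k : {ffun {set 'I_(size hs)} -> 'I_b},
  ([set _ | [forall x : {set 'I_(size hs)}, (2 < #|x|)%N ==> (k x == 0%N :> nat)] &&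
      `[< A (unlabel (star_adj (fun x => k x : nat))) >]] `&`
   marks_event X (@point_index hs) s (@type_weight hs) k) w].
have mE N hs : measurable (E N hs).
  by rewrite /E; case: ifP => // _; apply: measurable_config.
have mD hs : measurable (D hs).
  apply: measurable_exists => k; apply: measurableI; first exact: measurable_pred.
  by apply: measurable_marks_event.
pose F N : set T := [set w | exists hs, (E N hs `&` D hs) w].
have mF N : measurable (F N) by apply: measurable_exists => hs; apply: measurableI.
have sub : graph_event A `<=` [set w | exists N, F N w] `|` exceptional c.
  move=> w Aw; case: (pselect (exceptional c w)) => [|nex]; [by right|left].
  have rw : regular w.
    split; split => H; apply: nex; [by left|by right; left|by do 2 right; left|
     by do 3 right; left|by do 4 right; left|by do 5 right; left|by do 6 right; left].
  have [N NP] : exists N : {ffun 'I_m -> 'I_c}, counts_event X (cls m) (fun l => N l : nat) w.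
    by apply: contrapT => H; apply: nex; do 7 right.
  have [hs [hsN ch]] := NP; have [k [k0 kw]] := marks_exist rw ch.
  exists N, hs; split.
    by rewrite /E (_ : [forall l, _])//; apply/forallP => l; apply/eqP.
  exists k; split=> //; apply/andP; split.
    by apply/forallP => x; apply/implyP => /k0 ->.
  by apply/asboolP; rewrite (config_unlabel ch kw rw).
have mU : measurable [set w | exists N, F N w] by apply: measurable_exists.
apply: (@le_trans _ _ (pr ([set w | exists N, F N w] `|` exceptional c))).
  by apply: le_pr => //; apply: measurableU => //; apply: measurable_exceptional.
apply: le_trans (pr_setU_le P mU (measurable_exceptional c)) _; rewrite lerD2r.
apply: le_trans (pr_exists_fin _ mF) _; apply: ler_sum => N _.
pose phi := type_prob theta rho b s A (counts_seq (fun l => N l : nat)).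
have phi0 : 0 <= phi.
  by have /andP[] := type_prob01 b A theta0 rho01 s0 (counts_seq (fun l => N l : nat)).
rewrite -/phi mulrC.
have -> : \prod_(l < m) poisson_mass (weight_rate l) (N l) =
    pr (counts_event X (cls m) (fun l => N l : nat)).
  rewrite pr_counts_event//; apply: eq_bigr => l _.
  by rewrite cls_weight_rate.
apply: (@le_trans _ _ (phi * pr [set w | exists hs, E N hs w])); last first.
  apply: ler_wpM2l => //; apply: le_pr; first exact: measurable_exists.
    exact: measurable_counts_event.
  move=> w [hs]; rewrite /E; case: ifP => // /forallP H ch; exists hs; split=> // l.
  exact/eqP.
apply: pr_sum_disjoint => //.
  by move=> hs hs' w; rewrite /E; case: ifP => // _ ch; case: ifP => // _ ch'; apply: config_inj ch ch'.
move=> hs; rewrite /E; case: ifP => [/forallP cN|_]; last by rewrite set0I pr_set0 mulr0.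
case ok : (config_ok m hs); last first.
  rewrite (_ : cfg hs = set0); first by rewrite set0I pr_set0 mulr0.
  by apply/seteqP; split => w //; rewrite /cfg /config /= ok => -[].
have mono := point_index_mono ok.
have -> : phi = star_prob b s (@type_weight hs) A.
  symmetry; apply: (@type_probE _ theta rho b s A _ (@point_type hs)).
  apply: counts_seqP.
    move=> l /mapP[i _ ->]; have := mem_nth (0, 0)%N (ltn_ord i).
    exact: config_mem_lt ok.
  move=> l; rewrite -(eqP (cN l)) /config_count.
  have -> : [seq point_type i | i <- enum 'I_(size hs)] = [seq z.2 | z <- hs].
    apply: (@eq_from_nth _ 0%N); first by rewrite (size_map (@point_type hs)) size_enum_ord size_map.
    move=> i; rewrite (size_map (@point_type hs)) size_enum_ord => ih.
    rewrite (nth_map (Ordinal ih)) ?size_enum_ord// (nth_map (0, 0)%N)//.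
    by rewrite /point_type nth_enum_ord.
  by rewrite count_map.
rewrite setIC (_ : D hs `&` cfg hs = [set w | exists k : {ffun {set 'I_(size hs)} -> 'I_b},
  (if [forall x : {set 'I_(size hs)}, (2 < #|x|)%N ==> (k x == 0%N :> nat)] &&
      `[< A (unlabel (star_adj (fun x => k x : nat))) >] then
   cfg hs `&` marks_event X (@point_index hs) s (@type_weight hs) k else set0) w]); last first.
  apply/seteqP; split => w.
    by move=> [[k [/= H kw]] cw]; exists k; rewrite H.
  by move=> [k]; case: ifP => // H [cw kw]; split=> //; exists k.
have mk (k : {ffun {set 'I_(size hs)} -> 'I_b}) : measurable (if [forall x : {set 'I_(size hs)}, (2 < #|x|)%N ==> (k x == 0%N :> nat)] &&
      `[< A (unlabel (star_adj (fun x => k x : nat))) >] then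
   cfg hs `&` marks_event X (@point_index hs) s (@type_weight hs) k else set0).
  by case: ifP => // _; apply: measurableI; [exact: measurable_config|exact: measurable_marks_event].
apply: le_trans (pr_exists_fin _ mk) _; rewrite /star_prob mulr_suml; apply: ler_sum => k _.
have pos : 0 <= \prod_x star_pmf s (@type_weight hs) x (k x).
  by apply: prodr_ge0 => x _; apply: star_pmf_ge0.
case: ifP => [/andP[/forallP k0 /asboolP Ak]|_]; last first.
  by rewrite pr_set0 !mulr_ge0 ?pr_ge0 ?indic_ge0.
rewrite pr_marks_event//; last 2 first.
- exact: config_sigma.
- by move=> x x2; apply/eqP; exact: (implyP (k0 x) x2).
by rewrite indicE mem_set// mulr1 mulrC.
Qed.

End graphex_upper_bound.

Lemma measurable_graph_event (R : realType) d (T : measurableType d) (P : probability T R)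
    (t : R) (X : gp_noise P t) (g : graphex_triple R) (A : set ugraph) :
  let Rplus := `[0, +oo[%classic : set R in
  measurable_fun (Rplus `*` Rplus) (fun z : R * R => gW g z.1 z.2) ->
  measurable_fun Rplus (gS g) -> measurable (graph_event X g A).
Proof.
move=> Rplus mW mS.
have point_in j w : Rplus (gp_point X j w) by rewrite /Rplus /= in_itv /= andbT point_ge0.
have mp j : measurable_fun setT (gp_point X j) by exact: measurable_funPT.
have mSv j : measurable_fun setT (fun w => gS g (gp_point X j w)).
  apply: (measurable_comp (F := Rplus)) => //; first exact: measurable_itv.
  by move=> _ [w _ <-].
have mWv i j : measurable_fun setT (fun w => gW g (gp_point X i w) (gp_point X j w)).
  have h : measurable_fun setT ((fun z : R * R => gW g z.1 z.2) \o
      (fun w => (gp_point X i w, gp_point X j w))); last exact: h.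
  apply: (@measurable_comp _ _ _ _ _ _ (Rplus `*` Rplus)) => //.
  - by apply: measurableX; exact: measurable_itv.
  - by move=> _ [w _ <-]; split; exact: point_in.
  - exact: measurable_fun_pair.
have mlt (f h : T -> R) : measurable_fun setT f -> measurable_fun setT h -> measurable [set w | f w < h w].
  by move=> mf mh; rewrite -[X in measurable X]setTI; apply: measurable_fun_ltr.
have mex (r : T -> R) (mk : mark) k : measurable_fun setT r ->
    measurable [set w | poisson_exceeds (r w) (gp_unif X mk w) k].
  move=> mr; apply: mlt; last exact: measurable_funPT.
  apply: measurable_sum => i; rewrite /poisson_mass; apply: measurable_funM.
    by apply: measurable_funM => //; apply: measurable_funX.
  have mN : measurable_fun setT (fun x => - r x) by apply: measurableT_comp.
  exact: (measurableT_comp (@measurable_expR R) mN).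
have mpend i j k (Q : Prop) : measurable [set w |
    Q /\ poisson_exceeds (t * gS g (gp_point X j w)) (gp_unif X (PendantMark i) w) k].
  rewrite (_ : [set w | _] = [set _ | `[< Q >]] `&`
     [set w | poisson_exceeds (t * gS g (gp_point X j w)) (gp_unif X (PendantMark i) w) k]).
    apply: measurableI; first exact: measurable_pred.
    by apply: mex; apply: measurable_funM.
  by apply/seteqP; split => y /= [/asboolP].
apply: measurable_unlabel => -[i|i l|l b] [j|j l'|l' b'] /=; try exact: measurable0.
- by apply: mlt => //; exact: measurable_funPT.
- exact: mpend.
- exact: mpend.
- rewrite (_ : [set w | _] = [set _ | `[< l = l' /\ b <> b' >]] `&`
     [set w | poisson_exceeds (t ^+ 2 * gI g) (gp_unif X IsolatedMark w) l]).
    apply: measurableI; first exact: measurable_pred.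
    by apply: mex.
  apply/seteqP; split => y /=; first by move=> [ll bb ex]; split=> //; apply/asboolP.
  by move=> [/asboolP[ll bb] ex].
Qed.

(** * The weight measures *)

Section weights.
Context (R : realType) (w : nat -> nat -> R).
Local Notation L := (total_weight w).

Definition rel_weight n i : R := w n i / Num.sqrt (L n).

Section one_index.
Variable n : nat.
Hypothesis w_ge0 : forall i, (i < n)%N -> 0 <= w n i.
Hypothesis L0 : 0 < L n.
Local Notation x := (rel_weight n).
Local Notation sL := (Num.sqrt (L n)).

Lemma sqrtL_gt0 : 0 < sL. Proof. by rewrite sqrtr_gt0. Qed.

Lemma rel_weight_ge0 i : (i < n)%N -> 0 <= x i.
Proof. by move=> i_n; rewrite divr_ge0 ?w_ge0// sqrtr_ge0. Qed.

Lemma sum_rel_weight : \sum_(i < n) x i = sL.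
Proof.
rewrite -mulr_suml -/(L n) -{1}(sqr_sqrtr (ltW L0)) expr2 mulfK//.
by rewrite gt_eqF// sqrtL_gt0.
Qed.

Lemma rho_integral (D : set R) (f : R -> R) : measurable D -> D `<=` `]0, +oo[ ->
  measurable_fun D f -> (forall y, D y -> 0 <= f y) ->
  (\int[rho w n]_(y in D) (f y)%:E)%E = (sL^-1 * \sum_(i < n) \1_D (x i) * f (x i))%:E.
Proof.
move=> mD D0 mf f0.
have mf' : measurable_fun D (EFin \o f) by exact/measurable_EFinP.
have f0' y : D y -> (0 <= (f y)%:E)%E by move=> /f0; rewrite lee_fin.
rewrite (@eq_measure_integral _ _ _ D (mscale (Num.sqrt (total_weight w n))^-1%:nng
     (msum (fun i => \d_(w n i / Num.sqrt (total_weight w n))) n))).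
  rewrite ge0_integral_mscale//= EFinM; congr (_ * _)%E.
  rewrite ge0_integral_measure_sum// -sumEFin; apply: eq_bigr => i _.
  by rewrite integral_dirac// diracE indicE EFinM /rel_weight.
by move=> A mA AD; rewrite -[LHS]/(rho w n A) /rho /mrestr setIidl//; apply: subset_trans D0.
Qed.

Lemma rho_mean_small eps : (\int[rho w n]_(y in `]0%R, eps]) y%:E)%E =
  (sL^-1 * \sum_(i < n | x i <= eps) x i)%:E.
Proof.
rewrite (@rho_integral _ id)//.
- congr (_ * _)%:E; rewrite [RHS]big_mkcond; apply: eq_bigr => i _.
  have xi := rel_weight_ge0 (ltn_ord i).
  rewrite indicE; case: (ltP 0 (x i)) => [xp|xn]; last first.
    have -> : x i = 0 by apply/eqP; rewrite eq_le xi xn.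
    by rewrite mulr0; case: ifP.
  case: ifP => xe; first by rewrite mem_set ?mul1r//= in_itv /= xp xe.
  by rewrite memNset ?mul0r//= in_itv /= xp xe.
- by move=> y /=; rewrite !in_itv /= => /andP[-> _].
- by move=> y /=; rewrite in_itv /= => /andP[/ltW].
Qed.

Lemma rho_double_integral :
  (\int[rho w n]_(y in `]0%R, +oo[) \int[rho w n]_(z in `]0%R, +oo[) (y * z / (1 + y * z))%:E)%E =
  ((L n)^-1 * \sum_(i < n) \sum_(j < n) wf (x i * x j))%:E.
Proof.
have mwf c : measurable_fun setT (fun y : R => c * y / (1 + `|c * y|)).
  apply: continuous_measurable_fun => y.
  apply: cvgM; first by apply: cvgM; [exact: cvg_cst|exact: cvg_id].
  apply: cvgV; first by rewrite gt_eqF// ltr_pwDl.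
  apply: cvgD; first exact: cvg_cst.
  by apply: cvg_norm; apply: cvgM; [exact: cvg_cst|exact: cvg_id].
have sub : `]0%R, +oo[ `<=` (`]0, +oo[ : set R) by [].
have wf0' : wf 0 = 0 :> R by rewrite /wf mul0r.
have inner y : 0 < y -> (\int[rho w n]_(z in `]0%R, +oo[) (y * z / (1 + y * z))%:E)%E =
    (sL^-1 * \sum_(j < n) y * x j / (1 + `|y * x j|))%:E.
  move=> y0; rewrite (eq_integral (fun z => (y * z / (1 + `|y * z|))%:E)); last first.
    move=> z; rewrite inE /= in_itv /= andbT => z0.
    by rewrite ger0_norm// mulr_ge0 ?ltW.
  rewrite rho_integral//.
  - congr (_ * _)%:E; apply: eq_bigr => j _; have xj := rel_weight_ge0 (ltn_ord j).
    rewrite indicE; case: (ltP 0 (x j)) => [xp|xn]; last first.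
      have -> : x j = 0 by apply/eqP; rewrite eq_le xj xn.
      by rewrite mulr0 !mul0r mulr0.
    by rewrite mem_set ?mul1r//= in_itv /= xp.
  - exact: measurable_funTS.
  - move=> z /=; rewrite in_itv /= andbT => z0.
    by rewrite divr_ge0 ?addr_ge0 ?mulr_ge0// ltW.
rewrite (eq_integral (fun y : R => (sL^-1 * \sum_(j < n) y * x j / (1 + `|y * x j|))%:E)); last first.
  by move=> y; rewrite inE /= in_itv /= andbT => /inner.
have pos y (j : 'I_n) : 0 <= y -> 0 <= y * x j / (1 + `|y * x j|).
  move=> y0; have yx : 0 <= y * x j by apply: mulr_ge0 => //; apply: rel_weight_ge0.
  by apply: divr_ge0 => //; apply: addr_ge0.
rewrite (@rho_integral _ (fun y => sL^-1 * \sum_(j < n) y * x j / (1 + `|y * x j|)))//.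
- congr (_ %:E); rewrite !mulr_sumr; apply: eq_bigr => i _.
  have xi := rel_weight_ge0 (ltn_ord i).
  rewrite indicE; case: (ltP 0 (x i)) => [xp|xn]; last first.
    have -> : x i = 0 by apply/eqP; rewrite eq_le xi xn.
    rewrite !big1 ?mulr0// => j _; first by rewrite mul0r wf0'.
    by rewrite !mul0r.
  rewrite mem_set ?mul1r/=; last by rewrite in_itv /= xp.
  have LE : (L n)^-1 = sL^-1 * sL^-1 by rewrite -invfM -expr2 sqr_sqrtr// ltW.
  rewrite LE -mulrA; congr (_ * (_ * _)).
  by apply: eq_bigr => j _; rewrite ger0_norm// mulr_ge0// rel_weight_ge0.
- apply: measurable_funTS; apply: measurable_funM => //.
  apply: measurable_sum => j; rewrite (_ : (fun y => _) = (fun y => x j * y / (1 + `|x j * y|)))//.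
  by apply/funext => y; rewrite [y * x j]mulrC.
- move=> y /=; rewrite in_itv /= andbT => /ltW y0; rewrite mulr_ge0 ?invr_ge0 ?sqrtr_ge0//.
  by apply: sumr_ge0 => j _; apply: pos.
Qed.

End one_index.
End weights.

(** * Consequences of vague convergence *)

Section trapezoid.
Context (R : realType).

(** A continuous function between the indicators of [[c, d]] and of [[c', d']]. *)
Definition trapezoid (c' c d d' y : R) : R :=
  Num.max 0 (Num.min 1 (Num.min ((y - c') / (c - c')) ((d' - y) / (d' - d)))).

Variables c' c d d' : R.
Hypothesis cc : c' < c.
Hypothesis dd : d < d'.
Local Notation f := (trapezoid c' c d d').

Lemma trapezoid_continuous : continuous f.
Proof.
pose A (y : R) := (y - c') / (c - c'); pose B (y : R) := (d' - y) / (d' - d).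
have cA : continuous A.
  by move=> y; apply: cvgM; [apply: cvgB; [exact: cvg_id|exact: cvg_cst]|exact: cvg_cst].
have cB : continuous B.
  by move=> y; apply: cvgM; [apply: cvgB; [exact: cvg_cst|exact: cvg_id]|exact: cvg_cst].
move=> y.
apply: (@normed_module.continuous_max R R (fun=> 0) (fun y => Num.min 1 (Num.min (A y) (B y)))).
  exact: cvg_cst.
apply: (@normed_module.continuous_min R R (fun=> 1) (fun y => Num.min (A y) (B y))).
  exact: cvg_cst.
apply: (@normed_module.continuous_min R R A B); [exact: cA|exact: cB].
Qed.

Lemma trapezoid_ge0 y : 0 <= f y.
Proof. by rewrite /trapezoid le_max lexx. Qed.

Lemma trapezoid_le1 y : f y <= 1.
Proof. by rewrite /trapezoid ge_max ler01 ge_min lexx. Qed.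

Lemma trapezoid_eq1 y : c <= y <= d -> f y = 1.
Proof.
move=> /andP[cy yd]; have a : 1 <= (y - c') / (c - c') by rewrite ler_pdivlMr ?subr_gt0// mul1r lerD2r.
have b : 1 <= (d' - y) / (d' - d) by rewrite ler_pdivlMr ?subr_gt0// mul1r lerD2l lerN2.
rewrite /trapezoid (min_idPl _); first by rewrite max_r.
by rewrite le_min a b.
Qed.

Lemma trapezoid_eq0 y : ~~ (c' < y < d') -> f y = 0.
Proof.
rewrite negb_and -!leNgt => yc; apply/max_idPl; rewrite ge_min; apply/orP; right.
rewrite ge_min; apply/orP; case/orP: yc => h; [left|right].
  by rewrite pmulr_lle0 ?invr_gt0 ?subr_gt0// subr_le0.
by rewrite pmulr_lle0 ?invr_gt0 ?subr_gt0// subr_le0.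
Qed.

Lemma trapezoid_supp y : f y != 0 -> c' < y < d'.
Proof. by apply: contraNT => /trapezoid_eq0 ->. Qed.

End trapezoid.

Section vague.
Context (R : realType) (w : nat -> nat -> R) (rho_w : {measure set R -> \bar R}).
Hypothesis w_ge0 : forall n i : nat, (i < n)%N -> 0 <= w n i.
Hypothesis L_gt0 : \forall n \near \oo, 0 < total_weight w n.
Hypothesis rho_vague : vague_cvg (rho w) rho_w.
Local Notation x := (rel_weight w).
Local Notation sL n := (Num.sqrt (total_weight w n)).

(** The integral of [f] against [rho w n], if [f 0 = 0]. *)
Definition emp n (f : R -> R) : R := (sL n)^-1 * \sum_(i < n) f (x n i).

Lemma ler_emp n (f g : R -> R) : (forall y, 0 <= y -> f y <= g y) -> emp n f <= emp n g.
Proof.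
move=> fg; rewrite ler_wpM2l ?invr_ge0 ?sqrtr_ge0//; apply: ler_sum => i _.
by apply: fg; rewrite divr_ge0 ?sqrtr_ge0 ?w_ge0.
Qed.

Lemma emp_id n : 0 < total_weight w n -> emp n id = 1.
Proof. by move=> L0; rewrite /emp sum_rel_weight// mulVf// gt_eqF// sqrtL_gt0. Qed.

Definition trapezoid_mean c' c d d' : \bar R :=
  (\int[rho_w]_(y in `]0%R, +oo[) (trapezoid c' c d d' y)%:E)%E.

Lemma emp_trapezoid c' c d d' : 0 < c' -> c' < c -> d < d' ->
  (emp n (trapezoid c' c d d'))%:E @[n --> \oo] --> trapezoid_mean c' c d d'.
Proof.
move=> c0 cc dd; have := rho_vague (@trapezoid_continuous R c' c d d'); rewrite -/(trapezoid_mean c' c d d').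
have H : exists b e : R, 0 < b /\ (forall y, trapezoid c' c d d' y != 0 -> b <= y <= e).
  by exists c', d'; split=> // y /(trapezoid_supp cc dd)/andP[/ltW -> /ltW ->].
move=> /(_ H); apply: cvg_trans; apply: near_eq_cvg; near=> n.
have L0 : 0 < total_weight w n by near: n.
rewrite rho_integral//.
- congr (_ * _)%:E; apply: eq_bigr => i _; rewrite indicE.
  have xi := rel_weight_ge0 (w_ge0 (n := n)) (ltn_ord i).
  case: (ltP 0 (x n i)) => xn; first by rewrite mem_set ?mul1r//= in_itv /= xn.
  rewrite (@trapezoid_eq0 _ _ _ _ _ cc dd) ?mulr0// negb_and -leNgt.
  by rewrite (le_trans xn (ltW c0)).
- by apply: measurable_funTS; apply: continuous_measurable_fun; exact: trapezoid_continuous.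
- by move=> y _; apply: trapezoid_ge0.
Unshelve. all: by end_near. Qed.

Let sub_pos (b c : R) : 0 < b -> `[b, c] `<=` (`]0, +oo[ : set R).
Proof.
by move=> b0 y /=; rewrite !in_itv /= andbT => /andP[by_ _]; apply: lt_le_trans by_.
Qed.

Lemma trapezoid_mean_ge c' c d d' : 0 < c' -> c' < c -> d < d' ->
  (rho_w `[c, d]%classic <= trapezoid_mean c' c d d')%E.
Proof.
move=> c0 cc dd; rewrite -[leLHS](mul1e) -integral_cst//= .
apply: (@le_trans _ _ (\int[rho_w]_(y in `[c, d]) (trapezoid c' c d d' y)%:E)%E).
  apply: ge0_le_integral => //=.
  - apply/measurable_EFinP; apply: measurable_funTS; apply: continuous_measurable_fun.
    exact: trapezoid_continuous.
  - by move=> y; rewrite in_itv /= => /(trapezoid_eq1 cc dd) ->.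
apply: ge0_subset_integral => //=.
- apply/measurable_EFinP; apply: measurable_funTS; apply: continuous_measurable_fun.
  exact: trapezoid_continuous.
- by move=> y _; rewrite lee_fin trapezoid_ge0.
- by apply: sub_pos; apply: lt_trans cc.
Qed.

Lemma trapezoid_mean_le c' c d d' : 0 < c' -> c' < c -> d < d' ->
  (trapezoid_mean c' c d d' <= rho_w `[c', d']%classic)%E.
Proof.
move=> c0 cc dd; rewrite -[leRHS](mul1e) -integral_cst//=.
rewrite /trapezoid_mean integral_mkcond [leRHS]integral_mkcond; apply: ge0_le_integral => //=.
- by move=> y _; rewrite patchE; case: ifP => // _; rewrite lee_fin trapezoid_ge0.
- apply: (measurable_restrictT _ _).1 => //; apply/measurable_EFinP; apply: measurable_funTS; apply: continuous_measurable_fun.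
  exact: trapezoid_continuous.
- by apply: (measurable_restrictT _ _).1.
move=> y _; rewrite !patchE; have [yc|yc] := boolP (c' < y < d').
  rewrite [X in (_ <= (if X then _ else _))%E]mem_set.
    by case: ifP => _; rewrite lee_fin ?ler01 ?trapezoid_le1.
  by move: yc; rewrite /= in_itv /= => /andP[/ltW -> /ltW ->].
rewrite (trapezoid_eq0 cc dd yc); case: ifP => _; case: ifP => _ //.
Qed.

(** The weight has integral one against [rho w n], whence a bound of Markov type
    for the mass away from zero, which passes to the limit. It makes the tails
    of [rho_w] finite. *)
Lemma trapezoid_mean_le_inv c' c d d' : 0 < c' -> c' < c -> d < d' ->
  (trapezoid_mean c' c d d' <= (c'^-1)%:E)%E.
Proof.
move=> c0 cc dd; apply: (cvge_le _ (emp_trapezoid c0 cc dd)); near=> n.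
have L0 : 0 < total_weight w n by near: n.
rewrite lee_fin -[leRHS]mulr1 -(emp_id L0).
rewrite /emp mulrCA ler_wpM2l ?invr_ge0 ?sqrtr_ge0// mulr_sumr; apply: ler_sum => i _.
have xi := rel_weight_ge0 (w_ge0 (n := n)) (ltn_ord i).
have [/andP[h _]|nh] := boolP (c' < x n i < d').
  by rewrite mulrC; apply: le_trans (trapezoid_le1 _ _ _ _ _) _; rewrite ler_pdivlMr// mul1r ltW.
by rewrite (trapezoid_eq0 cc dd nh) mulr_ge0// invr_ge0 ltW.
Unshelve. all: by end_near. Qed.

Lemma rho_closed_le c d : 0 < c -> (rho_w `[c, d]%classic <= (c^-1)%:E)%E.
Proof.
move=> c0; apply/lee_addgt0Pr => e e0.
have ce0 : 0 < c^-1 + e by rewrite addr_gt0 ?invr_gt0.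
have h : (c^-1 + e)^-1 < c by rewrite -[ltRHS]invrK ltf_pV2 ?posrE ?invr_gt0// ltrDl.
have h0 : 0 < (c^-1 + e)^-1 by rewrite invr_gt0.
have dd : d < d + 1 by rewrite ltrDl.
apply: le_trans (trapezoid_mean_ge h0 h dd) _.
by apply: le_trans (trapezoid_mean_le_inv h0 h dd) _; rewrite invrK -EFinD.
Qed.

Lemma rho_tail_le c : 0 < c -> (rho_w `[c, +oo[%classic <= (c^-1)%:E)%E.
Proof.
move=> c0; pose F (k : nat) : set R := `[c, k%:R]%classic.
have -> : `[c, +oo[%classic = \bigcup_k F k.
  apply/seteqP; split => [y|y [k _]]; rewrite /F /= !in_itv /= ?andbT; last by case/andP.
  move=> cy; exists (Num.bound y) => //; rewrite /F /= in_itv /= cy /=.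
  by apply/ltW/archi_boundP; apply: le_trans cy; apply: ltW.
have cv : rho_w \o F @ \oo --> rho_w (\bigcup_k F k).
  apply: nondecreasing_cvg_mu => [k||].
  - exact: measurable_itv.
  - by apply: bigcup_measurable => k _; apply: measurable_itv.
  - move=> k l kl; apply/subsetPset => y; rewrite /F /= !in_itv /= => /andP[-> yk] /=.
    by apply: le_trans yk _; rewrite ler_nat.
by apply: cvge_le cv; apply: nearW => k; apply: rho_closed_le.
Qed.

Lemma rho_fin_num c (E : set R) : 0 < c -> measurable E -> E `<=` `[c, +oo[ ->
  rho_w E \is a fin_num.
Proof.
move=> c0 mE Ec; rewrite ge0_fin_numE//; apply: (@le_lt_trans _ _ (c^-1)%:E); last exact: ltry.
by apply: le_trans (rho_tail_le c0); apply: le_measure; rewrite ?inE.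
Qed.

Let inv_seq (a : R) : (fun k : nat => a * harmonic k) @ \oo --> (0 : R).
Proof.
rewrite -[X in _ --> X](mulr0 a); apply: cvgM; first exact: cvg_cst.
exact: cvg_harmonic.
Qed.

Let inv_small (a e : R) : 0 < a -> 0 < e -> exists k : nat, a * harmonic k < e.
Proof.
move=> a0 e0; have /cvgrPdist_lt/(_ _ e0)[k _ /(_ k (leqnn k))] := inv_seq a.
rewrite /= sub0r normrN ger0_norm; last by rewrite mulr_ge0 ?harmonic_ge0// ltW.
by exists k.
Qed.

(** Continuity from above along shrinking intervals. *)
Lemma rho_outer c d e : 0 < c -> c <= d -> 0 < e -> exists c' d',
  [/\ 0 < c', c' < c, d < d' & (rho_w `[c', d']%classic <= rho_w `[c, d]%classic + e%:E)%E].
Proof.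
move=> c0 cd e0.
pose c_ (k : nat) := c - (c / 2) * harmonic k; pose d_ (k : nat) := d + 1 * harmonic k.
pose F (k : nat) : set R := `[c_ k, d_ k]%classic.
have k1 k : 0 < (harmonic k : R) <= 1.
  by rewrite harmonic_gt0 /= invf_le1 ?ltr0n// ler1n.
have c_0 k : 0 < c_ k.
  have /andP[a b] := k1 k; rewrite subr_gt0; apply: (@le_lt_trans _ _ (c / 2)); last by lra.
  by rewrite ler_piMr//; lra.
have cF : \bigcap_k F k = `[c, d]%classic.
  apply/seteqP; split => y; last first.
    rewrite /= in_itv /= => /andP[cy yd] k _; rewrite /F /= in_itv /=; have /andP[a b] := k1 k.
    by rewrite (le_trans _ cy) ?(le_trans yd)// /c_ /d_ ?lerDl ?mul1r ?gerDl ?oppr_le0 ?mulr_ge0 ?ltW// divr_gt0.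
  move=> Fy; rewrite /= in_itv /= !leNgt; apply/andP; split; apply/negP => h.
    have c2 : 0 < c / 2 by lra.
    have yc : 0 < c - y by lra.
    have [k kh] := inv_small c2 yc.
    have := Fy k I; rewrite /F /= in_itv /= => /andP[+ _]; rewrite leNgt => /negP; apply.
    by rewrite /c_; lra.
  have dy : 0 < y - d by lra.
  have [k kh] := inv_small ltr01 dy.
  have := Fy k I; rewrite /F /= in_itv /= => /andP[_ +]; rewrite leNgt => /negP; apply.
  by rewrite /d_; lra.
have mono k l : (k <= l)%N -> harmonic l <= (harmonic k : R).
  by move=> kl; rewrite lef_pV2 ?posrE ?ltr0n// ler_nat.
have cv : rho_w \o F @ \oo --> rho_w `[c, d]%classic.
  rewrite -cF; apply: nonincreasing_cvg_mu.
  - rewrite -ge0_fin_numE//; apply: (rho_fin_num (c_0 0%N)); first exact: measurable_itv.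
    by move=> y; rewrite /F /= !in_itv /= andbT => /andP[].
  - by move=> k; apply: measurable_itv.
  - by rewrite cF; apply: measurable_itv.
  - move=> k l kl; apply/subsetPset => y; rewrite /F /= !in_itv /= => /andP[a b].
    have h := mono _ _ kl; apply/andP; split; [apply: le_trans a|apply: le_trans b _].
      by rewrite lerD2l lerN2 ler_wpM2l// divr_ge0// ltW.
    by rewrite lerD2l !mul1r.
have fn : rho_w `[c, d]%classic \is a fin_num.
  apply: (rho_fin_num c0); first exact: measurable_itv.
  by move=> y; rewrite /= !in_itv /= andbT => /andP[].
move: cv; rewrite -(fineK fn) => /fine_cvgP[finF /cvgrPdist_lt/(_ _ e0) H].
have [k [fk dk]] : exists k, rho_w (F k) \is a fin_num /\ `|fine (rho_w `[c, d]%classic) - fine (rho_w (F k))| < e.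
  have [k _ kP] : \forall k \near \oo, rho_w (F k) \is a fin_num /\ `|fine (rho_w `[c, d]%classic) - fine (rho_w (F k))| < e.
    by near=> k; split; near: k; [exact: finF|exact: H].
  by exists k; apply: kP => /=.
have /andP[a b] := k1 k.
exists (c_ k), (d_ k); split=> //.
- by rewrite /c_ gtrDl oppr_lt0 mulr_gt0// divr_gt0.
- by rewrite /d_ ltrDl mul1r.
- rewrite -/(F k) -(fineK fk) -EFinD lee_fin -lerBlDl.
  by rewrite distrC in dk; apply: le_trans (ler_norm _) (ltW dk).
Unshelve. all: by end_near. Qed.

(** Continuity from below along growing intervals. *)
Lemma rho_inner c d e : 0 < c -> c < d -> 0 < e -> exists c' d',
  [/\ c < c', c' <= d', d' < d & (rho_w `]c, d[%classic <= rho_w `[c', d']%classic + e%:E)%E].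
Proof.
move=> c0 cd e0; pose h := (d - c) / 3; have h0 : 0 < h by rewrite divr_gt0 ?subr_gt0.
pose c_ (k : nat) := c + h * harmonic k; pose d_ (k : nat) := d - h * harmonic k.
pose F (k : nat) : set R := `[c_ k, d_ k]%classic.
have k1 k : 0 < (harmonic k : R) <= 1.
  by rewrite harmonic_gt0 /= invf_le1 ?ltr0n// ler1n.
have hk k : 0 < h * harmonic k <= h.
  by have /andP[a b] := k1 k; rewrite mulr_gt0//= ler_piMr// ltW.
have cF : \bigcup_k F k = `]c, d[%classic.
  apply/seteqP; split => y.
    move=> [k _]; rewrite /F /= !in_itv /= /c_ /d_; have /andP[a b] := hk k.
    by move=> /andP[u v]; apply/andP; split; lra.
  rewrite /= in_itv /= => /andP[cy yd].
  have m0 : 0 < Num.min (y - c) (d - y) by rewrite lt_min !subr_gt0 cy.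
  have [k] := inv_small h0 m0; rewrite lt_min => /andP[u v].
  by exists k => //; rewrite /F /= in_itv /= /c_ /d_; apply/andP; split; lra.
have mono k l : (k <= l)%N -> h * harmonic l <= h * harmonic k :> R.
  by move=> kl; apply: ler_wpM2l; [exact: ltW|]; rewrite /harmonic lef_pV2 ?posrE ?ltr0n// ler_nat.
have cv : rho_w \o F @ \oo --> rho_w `]c, d[%classic.
  rewrite -cF; apply: nondecreasing_cvg_mu.
  - by move=> k; apply: measurable_itv.
  - by rewrite cF; apply: measurable_itv.
  - move=> k l kl; apply/subsetPset => y; rewrite /F /= !in_itv /= /c_ /d_ => /andP[a b].
    by have := mono _ _ kl; move=> u; apply/andP; split; lra.
have fn : rho_w `]c, d[%classic \is a fin_num.
  apply: (rho_fin_num c0); first exact: measurable_itv.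
  by move=> y; rewrite /= !in_itv /= andbT => /andP[/ltW].
move: cv; rewrite -(fineK fn) => /fine_cvgP[finF /cvgrPdist_lt/(_ _ e0) H].
have [k [fk dk]] : exists k, rho_w (F k) \is a fin_num /\ `|fine (rho_w `]c, d[%classic) - fine (rho_w (F k))| < e.
  have [k _ kP] : \forall k \near \oo, rho_w (F k) \is a fin_num /\ `|fine (rho_w `]c, d[%classic) - fine (rho_w (F k))| < e.
    by near=> k; split; near: k; [exact: finF|exact: H].
  by exists k; apply: kP => /=.
have /andP[a b] := hk k.
exists (c_ k), (d_ k); split.
- by rewrite /c_; lra.
- by rewrite /c_ /d_; move: b; rewrite /h; lra.
- by rewrite /d_; lra.
- rewrite -/(F k) -(fineK fk) -EFinD lee_fin -lerBlDl.
  by apply: le_trans (ler_norm _) (ltW dk).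
Unshelve. all: by end_near. Qed.

(** The indicator is squeezed between trapezoids whose limiting integrals are
    close, because the end points are not atoms. *)
Lemma emp_itv_cvg c d : 0 < c -> c < d ->
  rho_w [set c] = 0%E -> rho_w [set d] = 0%E ->
  emp n \1_(`]c, d]%classic) @[n --> \oo] --> fine (rho_w `]c, d]%classic).
Proof.
move=> c0 cd ac ad.
have E1 : rho_w `[c, d]%classic = rho_w `]c, d]%classic.
  have -> : `[c, d]%classic = [set c] `|` `]c, d]%classic.
    apply/seteqP; split => y; rewrite /= !in_itv /=.
      by move=> /andP[]; rewrite le_eqVlt => /orP[/eqP ->|cy yd]; [left|right; rewrite cy].
    by move=> [->|/andP[/ltW -> ->]//]; rewrite lexx ltW.
  rewrite measureU//; first by rewrite [X in (X + _)%E]ac add0e.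
  by apply/seteqP; split => // y [-> /=]; rewrite in_itv /= ltxx.
have E2 : rho_w `]c, d[%classic = rho_w `]c, d]%classic.
  have -> : `]c, d]%classic = [set d] `|` `]c, d[%classic.
    apply/seteqP; split => y; rewrite /= !in_itv /=.
      by move=> /andP[cy]; rewrite le_eqVlt => /orP[/eqP ->|yd]; [left|right; rewrite cy].
    by move=> [->|/andP[-> /ltW ->]//]; rewrite lexx cd.
  rewrite measureU//; first by rewrite [X in _ = (X + _)%E]ad add0e.
  by apply/seteqP; split => // y [-> /=]; rewrite in_itv /= ltxx andbF.
have fn : rho_w `]c, d]%classic \is a fin_num.
  apply: (rho_fin_num c0); first exact: measurable_itv.
  by move=> y; rewrite /= !in_itv /= andbT => /andP[/ltW].
have trap_fin c' c1 d1 d' : 0 < c' -> c' < c1 -> d1 < d' ->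
    trapezoid_mean c' c1 d1 d' \is a fin_num /\
    emp n (trapezoid c' c1 d1 d') @[n --> \oo] --> fine (trapezoid_mean c' c1 d1 d').
  move=> h1 h2 h3; have tf : trapezoid_mean c' c1 d1 d' \is a fin_num.
    rewrite ge0_fin_numE; last by apply: integral_ge0 => y _; rewrite lee_fin trapezoid_ge0.
    by apply: le_lt_trans (trapezoid_mean_le_inv h1 h2 h3) _; rewrite ltry.
  split=> //; have := emp_trapezoid h1 h2 h3; rewrite -{1}(fineK tf) => /fine_cvgP[_].
  by apply: cvg_trans.
apply/cvgrPdist_le => e e0; have e20 : 0 < e / 2 by lra.
have [c' [d' [c'0 cc dd out]]] := rho_outer c0 (ltW cd) e20.
have [c1 [d1 [cc1 cd1 dd1 inn]]] := rho_inner c0 cd e20.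
have [f1 /cvgrPdist_le/(_ _ e20) v1] := trap_fin _ _ _ _ c'0 cc dd.
have [f2 /cvgrPdist_le/(_ _ e20) v2] := trap_fin _ _ _ _ c0 cc1 dd1.
have u1 : fine (trapezoid_mean c' c d d') <= fine (rho_w `]c, d]%classic) + e / 2.
  rewrite -lee_fin EFinD !fineK//; apply: le_trans (trapezoid_mean_le c'0 cc dd) _.
  by rewrite -E1.
have u2 : fine (rho_w `]c, d]%classic) <= fine (trapezoid_mean c c1 d1 d) + e / 2.
  rewrite -lee_fin EFinD !fineK// -E2; apply: le_trans inn _.
  by rewrite leeD2r// trapezoid_mean_ge.
near=> n.
have U1 : emp n \1_(`]c, d]%classic) <= emp n (trapezoid c' c d d').
  apply: ler_emp => y _; rewrite indicE; case: (boolP (y \in _)) => [|_]; last exact: trapezoid_ge0.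
  by rewrite inE /= in_itv /= => /andP[/ltW a b]; rewrite trapezoid_eq1// a.
have U2 : emp n (trapezoid c c1 d1 d) <= emp n \1_(`]c, d]%classic).
  apply: ler_emp => y _; have [yc|yc] := boolP (c < y < d); last first.
    by rewrite (trapezoid_eq0 cc1 dd1 yc) indic_ge0.
  rewrite indicE mem_set ?trapezoid_le1//= in_itv /=.
  by have /andP[-> /ltW] := yc.
have V1 : `|fine (trapezoid_mean c' c d d') - emp n (trapezoid c' c d d')| <= e / 2 by near: n.
have V2 : `|fine (trapezoid_mean c c1 d1 d) - emp n (trapezoid c c1 d1 d)| <= e / 2 by near: n.
by move: V1 V2; rewrite !ler_norml => /andP[a1 a2] /andP[a3 a4]; apply/andP; split; lra.
Unshelve. all: by end_near. Qed.

(** ** Atoms *)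

Let atoms (k : nat) : set R := [set y | k.+1%:R^-1 <= y /\ ((k.+1%:R^-1)%:E <= rho_w [set y])%E].

Let measurable_seq (s : seq R) : measurable [set` s].
Proof.
elim: s => [|y s IH]; first by rewrite (_ : [set` [::]] = set0)//; apply/seteqP; split.
have -> : [set` y :: s] = [set y] `|` [set` s].
  apply/seteqP; split => z /=; rewrite in_cons; first by case/orP => [/eqP ->|]; [left|right].
  by case=> [->|zs]; rewrite ?eqxx ?zs ?orbT.
exact: measurableU.
Qed.

Let seq_mass k (s : seq R) : uniq s -> (forall y, y \in s -> atoms k y) ->
  (((size s)%:R * k.+1%:R^-1)%:E <= rho_w [set` s])%E.
Proof.
elim: s => [|y s IH] /=; first by move=> _ _; rewrite mul0r measure_ge0.
move=> /andP[ys us] sA.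
have -> : [set` y :: s] = [set y] `|` [set` s].
  apply/seteqP; split => z /=; rewrite in_cons; first by case/orP => [/eqP ->|]; [left|right].
  by case=> [->|zs]; rewrite ?eqxx ?zs ?orbT.
have ms : measurable [set` s] by exact: measurable_seq.
rewrite measureU//; last first.
  by apply/seteqP; split => // z [-> /= zs]; rewrite zs in ys.
rewrite -natr1 mulrDl mul1r addrC EFinD; apply: leeD.
  by have [] := sA y (mem_head _ _).
by apply: IH => // z zs; apply: sA; rewrite in_cons zs orbT.
Qed.

Let finite_atoms k : finite_set (atoms k).
Proof.
apply: contrapT => inf.
have [B BA BK] := infinite_set_fset (k.+1 * k.+1).+1 inf.
have k0 : 0 < (k.+1%:R^-1 : R) by rewrite invr_gt0.
have mB : measurable [set` finmap.enum_fset B] by exact: measurable_seq.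
have H := seq_mass (finmap.fset_uniq B) (fun y yB => BA y yB).
have H2 : (rho_w [set` finmap.enum_fset B] <= (k.+1%:R)%:E)%E.
  rewrite -[k.+1%:R]invrK; apply: le_trans (rho_tail_le k0).
  apply: le_measure; rewrite ?inE//.
  by move=> y /BA [ky _]; rewrite /= in_itv /= ky.
have := le_trans H H2; rewrite lee_fin ler_pdivrMr ?ltr0n// -natrM ler_nat leqNgt => /negP; apply.
exact: BK.
Qed.

(** Only countably many points are atoms, hence most geometric progressions avoid
    them. *)
Lemma exists_grid_no_atom (B r : R) : 0 < B -> 0 < r -> exists theta,
  [/\ B < theta, theta < 2 * B & forall l, rho_w [set theta * r ^+ l] = 0%E].
Proof.
move=> B0 r0.
pose bad : set R := \bigcup_(z in [set: nat * nat]) ((fun y => y / r ^+ z.2) @` atoms z.1).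
have cbad : countable bad.
  apply: bigcup_countable => [|z _]; first exact: countableP.
  apply: finite_set_countable; apply: finite_image; exact: finite_atoms.
have [theta Btheta nbad] : exists2 theta, `]B, (2 * B)[%classic theta & ~ bad theta.
  apply: contrapT => H.
  have sub : `]B, (2 * B)[%classic `<=` bad.
    by move=> y By; apply: contrapT => nb; apply: H; exists y.
  have c0 := countable_lebesgue_measure0 (sub_countable (subset_card_le sub) cbad).
  have := lebesgue_measure_itv (`]B, (2 * B)[%R); rewrite c0 /= lte_fin.
  rewrite (_ : B < 2 * B); last by lra.
  by rewrite -EFinB => -[]; lra.
move: Btheta; rewrite /= in_itv /= => /andP[Bt tB].
exists theta; split=> // l; apply/eqP; rewrite eq_le measure_ge0 andbT leNgt; apply/negP => pos.
have t0 : 0 < theta by apply: lt_trans B0 Bt.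
have y0 : 0 < theta * r ^+ l by rewrite mulr_gt0// exprn_gt0.
have fn : rho_w [set theta * r ^+ l] \is a fin_num.
  by apply: (rho_fin_num y0) => // y ->; rewrite /= in_itv /= lexx.
have f0 : 0 < fine (rho_w [set theta * r ^+ l]).
  by rewrite -lte_fin fineK.
have m0 : 0 < Num.min (theta * r ^+ l) (fine (rho_w [set theta * r ^+ l])) by rewrite lt_min y0.
have [k] := inv_small ltr01 m0; rewrite mul1r lt_min => /andP[/ltW a /ltW b].
apply: nbad; exists (k, l) => //; exists (theta * r ^+ l); last first.
  by rewrite /= mulfK// gt_eqF// exprn_gt0.
by split=> //; rewrite -(fineK fn) lee_fin.
Qed.

(** ** The generalized inverse of the tail *)

Lemma tail_le c : 0 < c -> (tail rho_w c <= (c^-1)%:E)%E.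
Proof.
move=> c0; apply: le_trans (rho_tail_le c0); apply: le_measure; rewrite ?inE//=.
by move=> y /=; rewrite !in_itv /= !andbT => /ltW.
Qed.

Lemma tail_ni b c : b <= c -> (tail rho_w c <= tail rho_w b)%E.
Proof.
move=> bc; apply: le_measure; rewrite ?inE//=.
by move=> y /=; rewrite !in_itv /= !andbT; apply: le_lt_trans.
Qed.

Lemma tail_right b (y : \bar R) : (y < tail rho_w b)%E -> exists2 c, b < c & (y < tail rho_w c)%E.
Proof.
move=> yb; pose F k : set R := `]b + harmonic k, +oo[%classic.
have FE : \bigcup_k F k = `]b, +oo[%classic.
  apply/seteqP; split => z.
    move=> [k _]; rewrite /F [X in X -> _]/= [X in _ -> X]/= !in_itv [X in X -> _]/= !andbT.
    by apply: lt_trans; rewrite ltrDl harmonic_gt0.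
  rewrite /= in_itv /= andbT => bz.
  have zb : 0 < z - b by lra.
  have [k] := inv_small ltr01 zb; rewrite mul1r => kz.
  by exists k => //; rewrite /F set_itvoy; change (b + harmonic k < z); lra.
have cv : rho_w \o F @ \oo --> tail rho_w b.
  rewrite /tail -FE; apply: nondecreasing_cvg_mu.
  - by move=> k; apply: measurable_itv.
  - by rewrite FE; apply: measurable_itv.
  - move=> k l kl; apply/subsetPset => z; rewrite /F [X in X -> _]/= [X in _ -> X]/= !in_itv [X in X -> _]/= [X in _ -> X]/= !andbT.
    by apply: le_lt_trans; rewrite lerD2l /harmonic lef_pV2 ?posrE ?ltr0n// ler_nat.
apply: contrapT => H; move: yb; rewrite ltNge => /negP; apply; apply: cvge_le cv.
apply: nearW => k; rewrite leNgt; apply/negP => yF; apply: H.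
by exists (b + harmonic k); rewrite // ltrDl harmonic_gt0.
Qed.

Lemma tail_inv_ge0 y : 0 <= tail_inv rho_w y.
Proof.
rewrite /tail_inv; case: eqP => // _; case: (pselect ([set x | 0 <= x /\ (tail rho_w x <= y%:E)%E] !=set0)) => [[z Sz]|/set0P/negP]; last first.
  by rewrite negbK => /eqP ->; rewrite inf0.
by apply: lb_le_inf => [|z' []//]; exists z.
Qed.

(** The Galois connection between a right-continuous nonincreasing function and
    its generalized inverse. *)
Lemma tail_inv_gt y b : 0 <= b -> (b < tail_inv rho_w y) = (0 < y) && (y%:E < tail rho_w b)%E.
Proof.
move=> b0; case: (ltgtP y 0) => [y0|y0|->]; last by rewrite /tail_inv eqxx ltNge b0.
  rewrite /tail_inv lt_eqF// (_ : [set x | _] = set0) ?inf0 ?ltNge ?b0//.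
  apply/seteqP; split => // z [_]; rewrite leNgt => /negP; apply.
  by apply: (@lt_le_trans _ _ 0%E); rewrite ?lte_fin ?measure_ge0.
have inf_y : has_inf [set x | 0 <= x /\ (tail rho_w x <= y%:E)%E].
  split; last by exists 0 => z [].
  exists (y^-1); split; first by rewrite invr_ge0 ltW.
  by apply: le_trans (tail_le _) _; rewrite ?invr_gt0// invrK.
rewrite /tail_inv gt_eqF// andTb; apply/idP/idP => [bi|/tail_right[c bc yc]].
  rewrite ltNge; apply/negP => tb; move: bi; rewrite ltNge => /negP; apply.
  by apply: ge_inf; [case: inf_y|split].
apply: lt_le_trans bc _; apply: lb_le_inf; first by case: inf_y.
move=> z [z0 zy]; rewrite leNgt; apply/negP => zc.
by have := lt_le_trans yc (le_trans (tail_ni (ltW zc)) zy); rewrite ltxx.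
Qed.

End vague.

(** * Convergence of the annealed sampling law *)

Lemma cvg_sum_fin (R : realType) (I : finType) (f : I -> nat -> R) (a : I -> R) :
  (forall i, f i @ \oo --> a i) ->
  (fun n => \sum_i f i n) @ \oo --> \sum_i a i.
Proof.
move=> fa; elim: (index_enum I) => [|i s IH].
  by rewrite big_nil (_ : (fun n => _) = fun=> 0); [exact: cvg_cst|apply/funext => n; rewrite big_nil].
rewrite big_cons (_ : (fun n => _) = fun n => f i n + \sum_(i <- s) f i n).
  exact: cvgD.
by apply/funext => n; rewrite big_cons.
Qed.

Section arithmetic.
Context (R : realType).

Lemma half_le1 (x : R) : x <= 1 / 2 -> x <= 1. Proof. lra. Qed.

Lemma sum2_le (e x y : R) : x <= e -> y <= e -> x + y <= 2 * e. Proof. lra. Qed.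

Lemma sum3_le (e x y z : R) : x <= e -> y <= e -> z <= e -> x + y + z <= 3 * e.
Proof. lra. Qed.

Lemma given_error_split (b ep B eta s r1 : R) :
  b * (4 * ep * B ^+ 3 + ep * B + eta * (2 * B + s) + (1 - (1 - r1)) * (s * B + 2 * B ^+ 2)) +
    ep * B ^+ 3 =
  ep * (b * (4 * B ^+ 3 + B) + B ^+ 3) + eta * (b * (2 * B + s)) + r1 * (b * (s * B + 2 * B ^+ 2)).
Proof. lra. Qed.

Lemma total_error (e Q1 S1 Q2 S2 G1 Z AA top x1 x2 x3 Q3 x4 : R) :
  Q1 <= S1 + Q2 -> Q2 <= top + x1 + x2 + x3 + Q3 -> S1 - S2 - G1 - (x4 + Z) <= AA ->
  S2 <= e -> Q3 <= e -> G1 <= 3 * e -> Z <= 2 * e -> top <= e -> x1 + x2 <= 2 * e ->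
  x3 <= e -> x4 <= e -> Q1 <= AA + 12 * e.
Proof. lra. Qed.

End arithmetic.

Section limit_graphex.
Context (R : realType) (w : nat -> nat -> R) (rho_w : {measure set R -> \bar R}).
Hypothesis w_ge0 : forall n i : nat, (i < n)%N -> 0 <= w n i.
Hypothesis L_gt0 : \forall n \near \oo, 0 < total_weight w n.
Hypothesis rho_vague : vague_cvg (rho w) rho_w.
Variables (a C : R).
Hypothesis C0 : 0 < C.
Local Notation sC := (Num.sqrt C).

Let sC0 : 0 < sC. Proof. by rewrite sqrtr_gt0. Qed.

(** By [vweight_gt], the image of the Lebesgue measure under [vweight], away
    from zero, is [rho_w] divided by [sqrt C]: the weights of a Poisson process
    of rate [t] have intensity [t / sqrt C] times [rho_w]. *)
Definition vweight (y : R) : R := tail_inv rho_w (sC * y).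

Lemma vweight_ge0 y : 0 <= vweight y. Proof. exact: tail_inv_ge0. Qed.

Lemma vweight_gt y b : 0 <= b -> (b < vweight y) = (0 < y) && ((sC * y)%:E < tail rho_w b)%E.
Proof.
by move=> b0; rewrite /vweight (tail_inv_gt w_ge0 L_gt0 rho_vague _ b0) pmulr_rgt0.
Qed.

Lemma measurable_vweight : measurable_fun setT vweight.
Proof.
apply: (measurability _ (RGenOInfty.measurableE R)) => _ [_ [b ->] <-]; rewrite setTI.
rewrite set_itvoy; have [b0|b0] := leP 0 b; last first.
  rewrite (_ : _ @^-1` _ = setT)//; apply/seteqP; split => // y _ /=.
  exact: lt_le_trans b0 (vweight_ge0 y).
have -> : vweight @^-1` [set y | b < y] = `]0, +oo[ `&` [set y | ((sC * y)%:E < tail rho_w b)%E].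
  apply/seteqP; split => y /=; rewrite (vweight_gt _ b0) in_itv /= andbT.
    by move=> /andP[].
  by move=> [-> ->].
apply: measurableI; first exact: measurable_itv.
have tb0 : (0 <= tail rho_w b)%E by apply: measure_ge0.
move: tb0; case: (tail rho_w b) => [r r0||//].
- have -> : [set y | ((sC * y)%:E < r%:E)%E] = `]-oo, r / sC[%classic.
    by apply/seteqP; split => y /=; rewrite in_itv /= lte_fin ltr_pdivlMr// mulrC.
  exact: measurable_itv.
- by move=> _; rewrite (_ : [set y | _] = setT)//; apply/seteqP; split => // y _ /=; rewrite ltry.
Qed.

Local Notation g := (grg_graphex rho_w a C).

Lemma measurable_grg_W : measurable_fun setT (fun z : R * R => gW g z.1 z.2).
Proof.
have mdiv : measurable_fun setT (fun y : R => y / (1 + `|y|)).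
  apply: continuous_measurable_fun => y; apply: cvgM; first exact: cvg_id.
  apply: cvgV; first by rewrite gt_eqF// ltr_pwDl.
  by apply: cvgD; [exact: cvg_cst|apply: cvg_norm; exact: cvg_id].
rewrite (_ : (fun z => _) = fun z : R * R => if z.1 == z.2 then 0 else
    (vweight z.1 * vweight z.2) / (1 + `|vweight z.1 * vweight z.2|)); last first.
  by apply/funext => z; rewrite ger0_norm ?mulr_ge0 ?vweight_ge0.
apply: measurable_fun_ifT => //; first exact: measurable_fun_eqr.
apply: (measurableT_comp mdiv); apply: measurable_funM.
  exact: (measurableT_comp measurable_vweight measurable_fst).
exact: (measurableT_comp measurable_vweight measurable_snd).
Qed.

Lemma measurable_grg_event d (T : measurableType d) (P : probability T R) (t : R)
  (X : gp_noise P t) A : measurable (graph_event X g A).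
Proof.
apply: measurable_graph_event; apply: measurable_funTS; first exact: measurable_grg_W.
apply: measurable_funM => //; exact: measurable_vweight.
Qed.

(** ** The cells of the half-line *)

Section cells.
Variables (theta r : R).
Hypothesis theta0 : 0 < theta.
Hypothesis r01 : 0 < r < 1.
Local Notation grid := (grid theta r).

Let grid0 l : 0 < grid l. Proof. exact: grid_gt0. Qed.

Definition tailr b : R := fine (tail rho_w b).

Lemma tailrE b : 0 < b -> tail rho_w b = (tailr b)%:E.
Proof.
move=> b0; rewrite /tailr fineK// ge0_fin_numE ?measure_ge0//.
by apply: le_lt_trans (tail_le w_ge0 L_gt0 rho_vague b0) _; rewrite ltry.
Qed.

Lemma tailr_le b : 0 < b -> tailr b <= b^-1.
Proof. by move=> b0; rewrite -lee_fin -tailrE// (tail_le w_ge0 L_gt0 rho_vague). Qed.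

Lemma tailr_ge0 b : 0 <= tailr b. Proof. by rewrite fine_ge0. Qed.

Lemma tailr_ni b c : 0 < b -> b <= c -> tailr c <= tailr b.
Proof.
by move=> b0 bc; rewrite -lee_fin -!tailrE ?(lt_le_trans b0)//; apply: tail_ni.
Qed.

Lemma vweight_gtE y b : 0 < b -> (b < vweight y) = (0 < y) && (sC * y < tailr b).
Proof. by move=> b0; rewrite vweight_gt ?(ltW b0)// tailrE// lte_fin. Qed.

Definition mass l : R := fine (rho_w `]grid l.+1, grid l]%classic).

Lemma massE l : mass l = tailr (grid l.+1) - tailr (grid l).
Proof.
apply/eqP; rewrite eq_sym subr_eq; apply/eqP; apply: EFin_inj.
have gl : grid l.+1 <= grid l by apply: grid_le.
rewrite EFinD -!tailrE// /tail -(_ : `]grid l.+1, grid l] `|` `]grid l, +oo[ = `]grid l.+1, +oo[%classic).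
  rewrite measureU//; last first.
    apply/seteqP; split => // y [] /=; rewrite !in_itv /= andbT => /andP[_ yl] ly.
    by have := le_lt_trans yl ly; rewrite ltxx.
  congr (_ + _)%E; rewrite /mass fineK//.
  apply: (rho_fin_num w_ge0 L_gt0 rho_vague (grid0 l.+1)) => //.
  by move=> y; rewrite /= !in_itv /= andbT => /andP[/ltW].
apply/seteqP; split => y /=; rewrite !in_itv /= !andbT.
  by case=> [/andP[]//|]; apply: le_lt_trans.
by move=> ->; have [yl|ly] := leP y (grid l); [left|right].
Qed.

Lemma mass_ge0 l : 0 <= mass l. Proof. by rewrite fine_ge0. Qed.

Let itvE (c e : R) : 0 <= c -> c <= e ->
  lebesgue_measure (`]0%R, +oo[ `&` `[c, e[) = (e - c)%:E.
Proof.
move=> c0 ce; have [->|cp] := eqVneq c 0.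
  rewrite (_ : _ `&` _ = `]0, e[%classic).
    rewrite lebesgue_measure_itv /= lte_fin; case: ltP => [_|e0]; first by rewrite -EFinB subr0.
    by have -> : e = 0; [apply/eqP; rewrite eq_le e0 (le_trans c0 ce)|rewrite subrr].
  apply/seteqP; split => y /=; rewrite !in_itv /= andbT.
    by move=> [-> /andP[]].
  by move=> /andP[y0 ->]; rewrite y0 ltW.
have c0' : 0 < c by rewrite lt_neqAle eq_sym cp.
rewrite (_ : _ `&` _ = `[c, e[%classic).
  rewrite lebesgue_measure_itv /= lte_fin; case: ltP => [_|e0]; first by rewrite -EFinB.
  by have -> : e = c; [apply/eqP; rewrite eq_le e0 ce|rewrite subrr].
apply/seteqP; split => y /=; rewrite !in_itv /= andbT; first by case.
by move=> /andP[cy ->]; rewrite cy (lt_le_trans c0' cy).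
Qed.

Lemma weight_cellE l : weight_cell theta r vweight l =
  `]0, +oo[ `&` `[tailr (grid l) / sC, tailr (grid l.+1) / sC[%classic.
Proof.
apply/seteqP; split => y /=; rewrite /weight_cell /in_cell !in_itv /= andbT.
  move=> [y0]; rewrite leNgt !vweight_gtE// => /andP[/andP[yp yl]].
  by rewrite yp /= -leNgt => ly; rewrite ler_pdivrMr// ltr_pdivlMr// ![y * _]mulrC ly.
move=> [yp]; rewrite ler_pdivrMr// ltr_pdivlMr// ![y * _]mulrC => /andP[ly yl].
split; first exact: ltW.
by rewrite leNgt !vweight_gtE// yp yl /= -leNgt.
Qed.

Lemma weight_topE : weight_top theta vweight = `]0, +oo[ `&` `[0, tailr theta / sC[%classic.
Proof.
apply/seteqP; split => y /=; rewrite /weight_top !in_itv /= andbT.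
  move=> [y0]; rewrite vweight_gtE// => /andP[yp yl].
  by rewrite yp y0 ltr_pdivlMr// mulrC.
move=> [yp /andP[y0]]; rewrite ltr_pdivlMr// => yl; split=> //.
by rewrite vweight_gtE// yp mulrC.
Qed.

Lemma measurable_weight_cell l : measurable (weight_cell theta r vweight l).
Proof. by rewrite weight_cellE; apply: measurableI; apply: measurable_itv. Qed.

Lemma measurable_weight_top : measurable (weight_top theta vweight).
Proof. by rewrite weight_topE; apply: measurableI; apply: measurable_itv. Qed.

Lemma weight_cell_measure l :
  lebesgue_measure (weight_cell theta r vweight l) = (mass l / sC)%:E.
Proof.
rewrite weight_cellE itvE ?divr_ge0 ?tailr_ge0//; first by rewrite -mulrBl -massE.
by rewrite ler_pM2r ?invr_gt0// tailr_ni// grid_le.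
Qed.

Lemma weight_top_measure :
  lebesgue_measure (weight_top theta vweight) = (tailr theta / sC)%:E.
Proof. by rewrite weight_topE itvE ?subr0// divr_ge0 ?tailr_ge0. Qed.

Lemma weight_cell_bounded l : exists2 V, 0 < V & forall y, weight_cell theta r vweight l y -> y < V.
Proof.
exists (tailr (grid l.+1) / sC + 1); first by rewrite ltr_wpDl// divr_ge0 ?tailr_ge0.
move=> y; rewrite weight_cellE /= => -[_]; rewrite in_itv /= => /andP[_ h].
by apply: lt_le_trans h _; rewrite lerDl.
Qed.

Lemma weight_rateE t l : weight_rate t theta r vweight l = t / sC * mass l.
Proof. by rewrite /weight_rate weight_cell_measure /= mulrCA mulrC. Qed.

Lemma top_rateE t : top_rate t theta vweight = t / sC * tailr theta.
Proof. by rewrite /top_rate weight_top_measure /= mulrCA mulrC. Qed.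

Hypothesis no_atom : forall l, rho_w [set grid l] = 0%E.

Lemma emp_cell_cvg l : emp w n \1_(`]grid l.+1, grid l]%classic) @[n --> \oo] --> mass l.
Proof.
apply: (emp_itv_cvg w_ge0 L_gt0 rho_vague) => //.
by have /andP[r0 r1] := r01; rewrite gridS gtr_pMl.
Qed.

Lemma indic_cell l y : \1_(`]grid l.+1, grid l]%classic) y = (in_cell theta r l y)%:R :> R.
Proof.
rewrite indicE; case: (boolP (in_cell theta r l y)) => [h|/negP h].
  by rewrite mem_set//= in_itv.
by rewrite memNset//= in_itv.
Qed.

(** The weight has integral one against [rho w n]; part of it may be lost in the
    limit. *)
Lemma mass_sum_le M : \sum_(l < M) mass l * grid l.+1 <= 1.
Proof.
have cv : (\sum_(l < M) emp w n \1_(`]grid l.+1, grid l]%classic) * grid l.+1) @[n --> \oo] -->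
    \sum_(l < M) mass l * grid l.+1.
  apply: (@cvg_sum_fin _ _ (fun (l : 'I_M) n => emp w n \1_(`]grid l.+1, grid l]%classic) * grid l.+1)
     (fun l : 'I_M => mass l * grid l.+1)) => l.
  by apply: cvgM; [exact: emp_cell_cvg|exact: cvg_cst].
apply: (cvgr_to_le cv); near=> n.
have L0 : 0 < total_weight w n by near: n.
rewrite -(emp_id L0) /emp.
rewrite (eq_bigr (fun l : 'I_M => (Num.sqrt (total_weight w n))^-1 *
   \sum_(i < n) \1_(`]grid l.+1, grid l]%classic) (rel_weight w n i) * grid l.+1)); last first.
  by move=> l _; rewrite -mulrA mulr_suml.
rewrite -mulr_sumr ler_wpM2l ?invr_ge0 ?sqrtr_ge0// exchange_big /=; apply: ler_sum => i _.
have xi := rel_weight_ge0 (w_ge0 (n := n)) (ltn_ord i).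
set y := rel_weight w n i in xi *.
under eq_bigr do rewrite indic_cell.
case: (pselect (exists l : 'I_M, in_cell theta r l y)) => [[l ly]|none].
  rewrite (bigD1 l)//= big1 ?addr0.
    by rewrite ly mul1r; have /andP[/ltW] := ly.
  move=> l' ll'; case ly' : (in_cell theta r l' y); last by rewrite mul0r.
  have E : l' = l by apply/val_inj; exact: (in_cell_inj theta0 r01 ly' ly).
  by rewrite E eqxx in ll'.
rewrite big1// => l _; case ly : (in_cell theta r l y); last by rewrite mul0r.
by case: none; exists l.
Unshelve. all: by end_near. Qed.

(** ** Numbers of sampled vertices in the cells *)

Section counts.
Variables (tau : R).
Hypothesis tau0 : 0 <= tau.
Local Notation x := (rel_weight w).
Local Notation p n := (tau / Num.sqrt (total_weight w n)).
Local Notation E l n := (emp w n \1_(`]grid l.+1, grid l]%classic)).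

(** Le Cam's inequality: the expected number of kept vertices in the cell is
    [tau] times its mass under [rho w n]. *)
Lemma cell_count_le n m l k : (l < m)%N -> p n <= 1 ->
  `|poisson_mass (tau * mass l) k -
     bern_pmf [seq p n | i : 'I_n <- enum 'I_n & cell_index theta r m (x n i) == l] k| <=
  `|tau * mass l - tau * E l n| + p n * (tau * E l n).
Proof.
move=> lm p1; have p0 : 0 <= p n by rewrite divr_ge0 ?sqrtr_ge0.
pose ps := [seq p n | i : 'I_n <- enum 'I_n & cell_index theta r m (x n i) == l].
have E0 : 0 <= E l n.
  by rewrite mulr_ge0 ?invr_ge0 ?sqrtr_ge0// sumr_ge0// => i _; apply: indic_ge0.
have sumE : \sum_(q <- ps) q = tau * E l n.
  rewrite big_map big_filter big_enum_cond /= big_mkcond /emp mulrA mulr_sumr.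
  apply: eq_bigr => i _; rewrite cell_indexE// indic_cell.
  by case: ifP => _; rewrite ?mulr1 ?mulr0.
have sum2E : \sum_(q <- ps) q ^+ 2 = p n * (tau * E l n).
  by rewrite -sumE mulr_sumr !big_map; apply: eq_bigr => i _; rewrite expr2.
have ps01 q : q \in ps -> 0 <= q <= 1 by move=> /mapP[i _ ->]; rewrite p0.
have := bern_poisson_le k ps01; rewrite sum2E sumE => le1.
have m0 := mass_ge0 l.
have le2 := @poisson_mass_lip R (tau * mass l) (tau * E l n) k (mulr_ge0 tau0 m0) (mulr_ge0 tau0 E0).
rewrite -(subrKA (poisson_mass (tau * E l n) k)).
by apply: le_trans (ler_normD _ _) _; apply: lerD => //; rewrite distrC.
Qed.

Hypothesis p_cvg : (Num.sqrt (total_weight w n))^-1 @[n --> \oo] --> (0 : R).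

Lemma cell_counts_cvg m c e : 0 < e -> \forall n \near \oo,
  \sum_(l < m) \sum_(k < c) `|poisson_mass (tau * mass l) k -
     bern_pmf [seq p n | i : 'I_n <- enum 'I_n & cell_index theta r m (x n i) == l] k| <= e.
Proof.
move=> e0.
have pn : p n @[n --> \oo] --> (0 : R).
  by rewrite -[X in _ --> X](mulr0 tau); apply: cvgM => //; apply: cvg_cst.
have cv : (\sum_(l < m) \sum_(k < c) (`|tau * mass l - tau * E l n| + p n * (tau * E l n)))
     @[n --> \oo] --> (0 : R).
  suff cv : (\sum_(l < m) \sum_(k < c) (`|tau * mass l - tau * E l n| + p n * (tau * E l n)))
     @[n --> \oo] --> \sum_(l < m) \sum_(k < c) (`|tau * mass l - tau * mass l| + 0 * (tau * mass l)).
    have E0 : \sum_(l < m) \sum_(k < c) (`|tau * mass l - tau * mass l| + 0 * (tau * mass l)) = 0.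
      by rewrite big1// => l _; rewrite big1// => k _; rewrite subrr normr0 mul0r addr0.
    by rewrite E0 in cv.
  apply: (@cvg_sum_fin _ _ (fun (l : 'I_m) n => \sum_(k < c) (`|tau * mass l - tau * E l n| + p n * (tau * E l n)))
     (fun l : 'I_m => \sum_(k < c) (`|tau * mass l - tau * mass l| + 0 * (tau * mass l)))) => l.
  apply: (@cvg_sum_fin _ _ (fun (k : 'I_c) n => (`|tau * mass l - tau * E l n| + p n * (tau * E l n)))
     (fun k : 'I_c => (`|tau * mass l - tau * mass l| + 0 * (tau * mass l)))) => k.
  have tE : (tau * E l n) @[n --> \oo] --> tau * mass l.
    by apply: cvgM; [exact: cvg_cst|exact: emp_cell_cvg].
  apply: cvgD; last exact: cvgM.
  by apply: cvg_norm; apply: cvgB => //; apply: cvg_cst.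
near=> n.
have p1 : p n <= 1.
  by near: n; apply: (cvgr_le _ pn); exact: ltr01.
apply: (@le_trans _ _ (\sum_(l < m) \sum_(k < c) (`|tau * mass l - tau * E l n| + p n * (tau * E l n)))).
  by apply: ler_sum => l _; apply: ler_sum => k _; apply: cell_count_le.
by near: n; apply: (cvgr_le _ cv).
Unshelve. all: by end_near. Qed.

End counts.

Lemma mass_grid_le M : \sum_(l < M) mass l * grid l <= r^-1.
Proof.
have /andP[r0 r1] := r01.
rewrite -[leRHS]mulr1 -ler_pdivrMl ?invr_gt0// invrK mulr_sumr.
apply: le_trans (mass_sum_le M); apply: ler_sum => l _.
by rewrite gridS mulrCA.
Qed.

(** The partial sums are bounded by [mass_grid_le], so the tails of the series
    vanish. *)
Lemma mass_grid_tail e : 0 < e -> exists m0, forall m M, (m0 <= m)%N ->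
  \sum_(l < M | (m <= l)%N) mass l * grid l <= e.
Proof.
move=> e0; pose S M := \sum_(l < M) mass l * grid l.
have g0 l : 0 <= mass l * grid l by rewrite mulr_ge0 ?mass_ge0 ?ltW.
have mono : nondecreasing_seq S.
  move=> M N MN; rewrite /S -!(big_mkord xpredT (fun l => mass l * grid l)).
  by rewrite [leRHS](big_cat_nat (leq0n M) MN)/= lerDl sumr_ge0.
have Scv : cvgn S by apply: nondecreasing_is_cvgn => //; exists r^-1 => _ [M _ <-]; apply: mass_grid_le.
have Sle M : S M <= limn S by apply: nondecreasing_cvgn_le.
have /cvgrPdist_le/(_ _ e0)[m0 _ H] : S @ \oo --> limn S by [].
exists m0 => m M mm; have [Mm|mM] := leqP M m.
  rewrite big1 ?ltW// => l ml; have := ltn_ord l; rewrite ltnNge (leq_trans _ ml)//.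
have -> : \sum_(l < M | (m <= l)%N) mass l * grid l = S M - S m.
  rewrite /S -(big_mkord (fun l => m <= l)%N (fun l => mass l * grid l)).
  rewrite -!(big_mkord xpredT (fun l => mass l * grid l)).
  rewrite (big_cat_nat (leq0n m) (ltnW mM))/= big_nat_cond big1 ?add0r; last first.
    by move=> l /andP[/andP[_ lm]]; rewrite leqNgt lm.
  rewrite [in RHS](big_cat_nat (leq0n m) (ltnW mM))/= addrAC subrr add0r.
  rewrite big_nat_cond [RHS]big_nat_cond; apply: eq_bigl => l.
  by case: (m <= l)%N; rewrite ?andbT ?andbF.
have := H m mm; rewrite /= => h; apply: le_trans h; apply: le_trans (ler_norm _).
by rewrite lerD2r.
Qed.

End cells.

(** ** The limit *)

Hypothesis sqrtL_infty : (Num.sqrt (total_weight w n))^-1 @[n --> \oo] --> (0 : R).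
Hypothesis a0 : 0 <= a.
Local Notation low_mean n eps :=
  ((Num.sqrt (total_weight w n))^-1 * \sum_(i < n | rel_weight w n i <= eps) rel_weight w n i).
Hypothesis low_small : forall e, 0 < e -> exists2 del, 0 < del &
  forall eps, 0 < eps < del -> \forall n \near \oo, `|low_mean n eps - a| <= e.

Lemma small_factor (K e : R) : 0 < e -> exists x, [/\ 0 < x, x <= 1 / 2 & x * K <= e].
Proof.
move=> e0; pose K' := Num.max K 1.
have K'0 : 0 < K' by rewrite lt_max ltr01 orbT.
exists (Num.min (1 / 2) (e / K')); split.
- by rewrite lt_min divr_gt0//= divr_gt0.
- by rewrite ge_min lexx.
have [K0|K0] := leP K 0.
  apply: le_trans (ltW e0); rewrite mulr_ge0_le0// le_min divr_ge0//= divr_ge0// ltW//.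
apply: (@le_trans _ _ (e / K' * K)).
  by apply: ler_wpM2r; [exact: ltW|rewrite ge_min lexx orbT].
by rewrite mulrAC ler_pdivrMr// ler_pM2l// le_max lexx.
Qed.

Section annealed_limit.
Context d (T : measurableType d) (P : probability T R) (t : R) (X : gp_noise P t).
Hypothesis t0 : 0 < t.
Let tau := t / sC.
Let s := tau * a.
Local Notation p n := (tau / Num.sqrt (total_weight w n)).

(** Both sides are compared with the same sum over the counts of the cells: the
    left one by [graph_event_le], the right one by [annealed_ge]. *)
Lemma annealed_lower e (A : set ugraph) : 0 < e -> \forall n \near \oo,
  pr P (graph_event X g A) <= annealed (fun i : 'I_n => rel_weight w n i) (p n) A + 12 * e.
Proof.
move=> e0.
have tau0 : 0 < tau by rewrite divr_gt0.
have s0 : 0 <= s by rewrite mulr_ge0// ltW.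
(* Each parameter may depend on the previous ones: the bound [B] on the weight of
   the sample, the bound [b] on the numbers of edges, the tolerance [eta] for the
   weight of the low vertices, the ratio [r] and the top [theta] of the grid, the
   number [m] of its cells, and the bound [c] on the numbers of points in them. *)
pose B := tau / e + 1.
have B0 : 0 < B by rewrite ltr_wpDl// divr_ge0 ?ltW.
have tauB : tau / B <= e.
  by rewrite ler_pdivrMr// /B mulrDr mulr1 mulrC divfK ?gt_eqF// lerDl ltW.
have [b b1 bP] : exists2 b : nat, (1 < b)%N & (s * (2 * tau) + s ^+ 2 / 2) / b%:R <= e.
  pose K := (s * (2 * tau) + s ^+ 2 / 2) / e.
  have K0 : 0 <= K.
    apply: divr_ge0; last exact: ltW.
    apply: addr_ge0; first by apply: mulr_ge0 => //; lra.
    by rewrite divr_ge0 ?sqr_ge0.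
  exists (Num.bound K).+2 => //.
  rewrite ler_pdivrMr ?ltr0n// [leRHS]mulrC -ler_pdivrMr//.
  apply: le_trans (ltW (archi_boundP K0)) _; rewrite ler_nat; exact: leqW.
have [eta [eta0 _ etaP]] := small_factor (b%:R * (2 * B + s)) e0.
have [r1 [r10 r1h r1P]] := small_factor
  (b%:R * (s * B + 2 * B ^+ 2) + (2 * tau) * (4 * tau + b%:R * b%:R * s)) e0.
pose r := 1 - r1.
have r0 : 0 < r by rewrite /r; lra.
have r01 : 0 < r < 1 by rewrite r0 /r; lra.
have [theta [Bt tB no_atom]] := exists_grid_no_atom w_ge0 L_gt0 rho_vague B0 r0.
have theta0 : 0 < theta by apply: lt_trans Bt.
pose Y := 4 * tau + b%:R * b%:R * s.
have Y0 : 0 <= Y by rewrite addr_ge0 ?mulr_ge0// ltW.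
have [e' [e'0 _ e'P]] := small_factor (tau * Y) e0.
have [m0 m0P] := mass_grid_tail theta0 r01 no_atom e'0.
pose K1 := b%:R * (4 * B ^+ 3 + B) + B ^+ 3.
have [x1 [x10 _ x1P]] := small_factor K1 e0.
have [x2 [x20 _ x2P]] := small_factor (tau / eta ^+ 2) e0.
have [eta2 [eta20 eta2h eta2P]] := small_factor (tau ^+ 2 / eta ^+ 2) e0.
have [del del0 delP] := low_small eta20.
have [m [mm0 gx1 gx2 gdel]] : exists m, [/\ (m0 <= m)%N, grid theta r m <= x1,
    grid theta r m <= x2 & grid theta r m < del].
  have cv : (fun M => grid theta r M) @ \oo --> (0 : R).
    rewrite -[X in _ --> X](mulr0 theta); apply: cvgM; first exact: cvg_cst.
    by apply: cvg_expr; rewrite ger0_norm ?ltW//; have /andP[] := r01.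
  have min0 : 0 < Num.min x1 (Num.min x2 del) by rewrite !lt_min x10 x20.
  have /cvgrPdist_lt/(_ _ min0)[m1 _ /(_ m1 (leqnn m1))] := cv.
  rewrite /= sub0r normrN ger0_norm; last exact/ltW/grid_gt0.
  rewrite !lt_min => /and3P[h1 h2 h3]; exists (maxn m0 m1); rewrite leq_maxl.
  have h : grid theta r (maxn m0 m1) <= grid theta r m1 by apply: grid_le; rewrite ?leq_maxr.
  by split=> //; [apply: le_trans (ltW h1)|apply: le_trans (ltW h2)|apply: le_lt_trans h3].
pose ep := grid theta r m.
have ep0 : 0 < ep by apply: grid_gt0.
have mcell := measurable_weight_cell theta0 r01.
have fcell l : (lebesgue_measure (weight_cell theta r vweight l) < +oo)%E.
  by rewrite weight_cell_measure// ltry.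
have mtop := measurable_weight_top theta0.
have ftop : (lebesgue_measure (weight_top theta vweight) < +oo)%E.
  by rewrite weight_top_measure// ltry.
have [c cP] : exists c, pr P (overflow X m (fun y => cell_index theta r m (vweight y)) c) <= e.
  have cv := @pr_overflow_cvg _ _ _ _ _ X (ltW t0) m (fun y => cell_index theta r m (vweight y)).
  have [c _ cP] : \forall c \near \oo, pr P (overflow X m (fun y => cell_index theta r m (vweight y)) c) <= e.
    apply: (cvgr_le _ (cv _ _)) => // l lm; by rewrite (cls_weight_cell _ theta0 r01).
  by exists c; apply: cP => /=.
(* The sum over the cells of the weight lost by rounding. *)
pose etot := r1 * (2 * tau) + e' * tau.
have rinv : r^-1 <= 2.
  by rewrite -[leRHS]invrK lef_pV2 ?posrE ?invr_gt0// /r; lra.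
have Gam_le M : \sum_(l < M) weight_rate t theta r vweight l * grid theta r l <= 2 * tau.
  rewrite (eq_bigr (fun l : 'I_M => tau * (mass theta r l * grid theta r l))); last first.
    by move=> l _; rewrite weight_rateE// mulrA.
  rewrite -mulr_sumr mulrC; apply: ler_wpM2r; first exact: ltW.
  by apply: le_trans rinv; apply: mass_grid_le.
have eta_le M : \sum_(l < M) weight_rate t theta r vweight l *
    (grid theta r l - lower_weight theta r m l) <= etot.
  apply: (@le_trans _ _ (\sum_(l < M) (r1 * (weight_rate t theta r vweight l * grid theta r l) +
      (if (m <= l)%N then tau * (mass theta r l * grid theta r l) else 0)))).
    apply: ler_sum => l _; rewrite /lower_weight weight_rateE//.
    have W0 : 0 <= tau * mass theta r l by rewrite mulr_ge0 ?mass_ge0// ltW.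
    have g0 : 0 <= grid theta r l by apply/ltW/grid_gt0.
    have Wg : 0 <= tau * mass theta r l * grid theta r l by exact: mulr_ge0.
    case: ltnP => ml.
      rewrite addr0 gridS /r -/tau; set z := grid theta r l; lra.
    rewrite subr0 -/tau mulrA lerDr; apply: mulr_ge0 => //; exact: ltW.
  rewrite big_split /= -mulr_sumr; apply: lerD; first by apply: ler_wpM2l (Gam_le M); exact: ltW.
  rewrite -big_mkcond /= -mulr_sumr mulrC; apply: ler_wpM2r; first exact: ltW.
  exact: m0P.
have ge := graph_event_le m s0 theta0 r01 (fun y _ => vweight_ge0 y) mcell fcell mtop
  (g := g) _ _ _ b1 (measurable_grg_event X) A c.
have {ge}ge := ge (fun y z _ _ => erefl) _ _.
have gS_ y : 0 <= y -> t * gS g y = s * vweight y.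
  by move=> _; rewrite /s /tau /= -/(vweight y); lra.
have gI_ : t ^+ 2 * gI g = s ^+ 2 / 2.
  rewrite /s /tau /= !exprMn exprVn sqr_sqrtr ?ltW// invfM; lra.
have {ge}ge := ge gS_ gI_.
have ex := pr_exceptional X (ltW t0) s0 theta0 r01 mcell fcell mtop ftop
  (weight_cell_bounded theta0 r01) Gam_le eta_le b1 c.
have top_le : top_rate t theta vweight <= e.
  rewrite top_rateE//; apply: le_trans tauB; rewrite -/tau; apply: ler_wpM2l; first exact: ltW.
  apply: le_trans (tailr_le theta0) _; rewrite lef_pV2 ?posrE//; exact: ltW.
have r1X : r1 * (b%:R * (s * B + 2 * B ^+ 2)) <= e.
  apply: le_trans r1P; rewrite [leRHS]mulrDr lerDl; apply: mulr_ge0; first exact: ltW.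
  by apply: mulr_ge0 => //; lra.
have r1Y : r1 * ((2 * tau) * Y) <= e.
  apply: le_trans r1P; rewrite [leRHS]mulrDr lerDr; apply: mulr_ge0; first exact: ltW.
  apply: mulr_ge0 => //; apply: addr_ge0; first by rewrite mulr_ge0// ltW.
  by rewrite mulr_ge0// sqr_ge0.
have etotY : 2 * etot * (2 * tau) + b%:R * b%:R * s * etot <= 2 * e.
  have -> : 2 * etot * (2 * tau) + b%:R * b%:R * s * etot = r1 * ((2 * tau) * Y) + e' * (tau * Y).
    by rewrite /etot /Y; lra.
  lra.
near=> n.
have L0 : 0 < total_weight w n by near: n.
have sL0 : 0 < Num.sqrt (total_weight w n) by rewrite sqrtr_gt0.
have n0 : (0 < n)%N by near: n; exists 1%N.
have p01 : 0 <= p n <= 1.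
  apply/andP; split; first by rewrite divr_ge0// ltW.
  near: n; apply: (cvgr_le (0 : R)); last exact: ltr01.
  by rewrite -[X in _ --> X](mulr0 tau); apply: cvgM => //; apply: cvg_cst.
have counts : \sum_(l < m) \sum_(k < c) `|poisson_mass (tau * mass theta r l) k -
     bern_pmf [seq p n | i : 'I_n <- enum 'I_n & cell_index theta r m (rel_weight w n i) == l] k| <= e.
  by near: n; apply: cell_counts_cvg => //; exact: ltW.
have low : `|low_mean n ep - a| <= eta2.
  by near: n; apply: delP; rewrite ep0.
have an := @annealed_ge R n (Ordinal n0) (fun i : 'I_n => rel_weight w n i) (p n) theta r m b B s eta A
  (fun i => rel_weight_ge0 (w_ge0 (n := n)) (ltn_ord i)) p01 theta0 r01 B0 (ltW Bt) s0 eta0 c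
  (fun l => tau * mass theta r l) (fun l => mulr_ge0 (ltW tau0) (mass_ge0 theta r l)).
have psum : p n * \sum_(i < n) rel_weight w n i = tau.
  by rewrite sum_rel_weight// divfK// gt_eqF.
rewrite psum in an.
have E2 : eta ^+ 2 != 0 by rewrite expf_neq0// gt_eqF.
have lowP : (p n * (\sum_(i < n | rel_weight w n i <= ep) rel_weight w n i) - s) ^+ 2 / eta ^+ 2 <= e.
  have -> : p n * (\sum_(i < n | rel_weight w n i <= ep) rel_weight w n i) - s =
      tau * (low_mean n ep - a) by rewrite /s mulrBr mulrA.
  rewrite exprMn mulrAC; apply: (@le_trans _ _ (eta2 * (tau ^+ 2 / eta ^+ 2))) => //.
  rewrite mulrC; apply: ler_wpM2r; first by rewrite divr_ge0 ?sqr_ge0.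
  rewrite -real_normK ?num_real//; apply: (@le_trans _ _ (eta2 ^+ 2)).
    by rewrite lerXn2r// ?nnegrE// ltW.
  by rewrite expr2 ler_piMl ?half_le1//; exact: ltW.
have epP : ep * tau / eta ^+ 2 <= e.
  apply: le_trans x2P; rewrite -mulrA; apply: ler_wpM2r => //.
  by rewrite divr_ge0 ?sqr_ge0// ltW.
have epK : ep * K1 <= e.
  apply: le_trans x1P; apply: ler_wpM2r => //.
  have B30 : 0 <= B ^+ 3 by rewrite exprn_ge0// ltW.
  rewrite /K1; apply: addr_ge0 => //; apply: mulr_ge0 => //.
  by apply: addr_ge0; [exact: mulr_ge0|exact: ltW].
have gE : given_error theta r m b B s eta <= 3 * e.
  by rewrite /given_error -/ep given_error_split -/K1; apply: sum3_le.
have split2 : ((p n * (\sum_(i < n | rel_weight w n i <= ep) rel_weight w n i) - s) ^+ 2 + ep * tau) / eta ^+ 2 <= 2 * e.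
  by rewrite mulrDl; apply: sum2_le.
rewrite -/ep in an.
have rateE : \sum_(N : {ffun 'I_m -> 'I_c}) (\prod_(l < m) poisson_mass (weight_rate t theta r vweight l) (N l)) *
     type_prob theta r b s A (counts_seq (fun l => N l : nat)) =
   \sum_(N : {ffun 'I_m -> 'I_c}) (\prod_(l < m) poisson_mass (tau * mass theta r l) (N l)) *
     type_prob theta r b s A (counts_seq (fun l => N l : nat)).
  apply: eq_bigr => N _; congr (_ * _); apply: eq_bigr => l _; congr (poisson_mass _ _).
  exact: weight_rateE.
rewrite rateE in ge.
exact: (total_error ge ex an counts cP gE split2 top_le etotY bP tauB).
Unshelve. all: by end_near. Qed.

Lemma annealed_setC n (x : 'I_n -> R) q (A : set ugraph) :
  annealed x q (~` A) = 1 - annealed x q A.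
Proof.
apply/eqP; rewrite eq_sym subr_eq eq_sym; apply/eqP; rewrite /annealed -coinD.
rewrite -[RHS](coin_cst (fun=> q) (enum 'I_n) 1 (fun=> false)); apply: coin_ext => V.
rewrite -coinD -[RHS](coin_cst (edge_prob x) (enum {: 'I_n * 'I_n}) 1 (fun=> false)).
by apply: coin_ext => h; rewrite !indicE in_setC; case: (_ \in _); rewrite /= ?addr0 ?add0r.
Qed.

(** The lower bound for [A] and for its complement gives both inequalities. *)
Theorem annealed_cvg (A : set ugraph) :
  annealed (fun i : 'I_n => rel_weight w n i) (p n) A @[n --> \oo] --> pr P (graph_event X g A).
Proof.
apply/cvgrPdist_le => e e0; have e12 : 0 < e / 12 by rewrite divr_gt0.
have mA := measurable_grg_event X.
have prC : pr P (graph_event X g (~` A)) = 1 - pr P (graph_event X g A) by rewrite -pr_setC.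
have h1 := annealed_lower A e12; have h2 := annealed_lower (~` A) e12.
near=> n.
have H1 : pr P (graph_event X g A) <= annealed (fun i : 'I_n => rel_weight w n i) (p n) A + 12 * (e / 12).
  by near: n.
have H2 : pr P (graph_event X g (~` A)) <= annealed (fun i : 'I_n => rel_weight w n i) (p n) (~` A) + 12 * (e / 12).
  by near: n.
rewrite annealed_setC prC in H2; rewrite ler_norml; apply/andP; split; lra.
Unshelve. all: by end_near. Qed.

End annealed_limit.
End limit_graphex.

(** * Sampling from a fixed graph *)

Section sampling.
Context (R : realType).

Lemma coin_swap (I J : finType) (p : I -> R) (q : J -> R) (F : (I -> bool) -> (J -> bool) -> R) g0 h0 :
  coin p (enum I) (fun g => coin q (enum J) (F g) h0) g0 =
  coin q (enum J) (fun h => coin p (enum I) (F^~ h) g0) h0.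
Proof.
transitivity (coin p (enum I) (fun g => \sum_(U : {set J})
   (\prod_j (if j \in U then q j else 1 - q j)) * F g (fun j => j \in U)) g0).
  by apply: coin_ext => g; rewrite coin_setE.
by rewrite coin_sum [RHS]coin_setE; apply: eq_bigr => U _; rewrite coinZ.
Qed.

Section one_graph.
Variables (n : nat) (e : rel 'I_n).

Definition induced (V : 'I_n -> bool) (x y : 'I_n) : Prop := [/\ V x, V y & e x y].

Lemma smpl_lawE (p : R) (A : set ugraph) :
  smpl_law e p A = coin (fun=> p) (enum 'I_n) (fun V => \1_A (unlabel (induced V))) (fun=> false).
Proof.
rewrite coin_setE /smpl_law; apply: eq_bigr => V _; congr (_ * _).
rewrite (bigID (mem V))/=; congr (_ * _).
  rewrite (eq_bigr (fun=> p)); last by move=> i ->.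
  by rewrite prodr_const.
rewrite (eq_bigr (fun=> 1 - p)); last by move=> i /negbTE ->.
rewrite prodr_const; congr (_ ^+ _).
have E := etrans (cardC (mem V)) (card_ord n).
transitivity (#|V| + #|[predC (mem V)]| - #|V|)%N; first by congr (_ - _)%N.
by rewrite addKn; apply: eq_card.
Qed.

Hypothesis simple : simple_graph e.

Lemma sum_adj : \sum_i \sum_j (e i j)%:R = 2 * (num_edges e)%:R :> R.
Proof.
have [sym irr] := simple.
have E : (num_edges e)%:R = \sum_(i < n) \sum_(j < n | (i < j)%N) (e i j)%:R :> R.
  rewrite pair_big_dep /= /num_edges -sum1_card natr_sum big_mkcond [RHS]big_mkcond /=.
  by apply: eq_bigr => -[i j] _; rewrite inE /=; case: (i < j)%N; case: (e i j).
have E' : (num_edges e)%:R = \sum_(i < n) \sum_(j < n | (j < i)%N) (e i j)%:R :> R.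
  rewrite E (exchange_big_dep xpredT)//=; apply: eq_bigr => i _; apply: eq_bigr => j _.
  by rewrite sym.
rewrite (_ : 2 * _ = (num_edges e)%:R + (num_edges e)%:R); last by lra.
rewrite {1}E E' -big_split; apply: eq_bigr => i _ /=.
rewrite (bigID (fun j : 'I_n => i < j)%N)/=; congr (_ + _).
rewrite (bigID (fun j : 'I_n => j < i)%N)/= [X in _ + X]big1 ?addr0.
  by apply: eq_bigl => j; rewrite -leqNgt; case: ltngtP.
move=> j; rewrite -!leqNgt => /andP[ji ij].
have -> : j = i by apply/val_inj/eqP; rewrite eqn_leq ji ij.
by rewrite irr.
Qed.

(** The sample changes at [i] only if some neighbour of [i] is kept, as
    [coin_lipschitz] requires. *)
Lemma smpl_law_lip (p p' : R) (A : set ugraph) : 0 <= p <= 1 -> 0 <= p' <= 1 ->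
  `|smpl_law e p' A - smpl_law e p A| <= `|p' ^+ 2 - p ^+ 2| * (num_edges e)%:R.
Proof.
move=> p01 p'01; have [sym irr] := simple; rewrite !smpl_lawE.
have H := @coin_lipschitz R 'I_n (fun i j => (e i j)%:R) p p'
  (fun V => \1_A (unlabel (induced V))) (enum 'I_n) (fun=> false) (enum_uniq _) p01 p'01.
apply: le_trans (H _ _ _) _.
- by move=> i; rewrite irr.
- by move=> i j; rewrite sym.
- move=> V i; case: (pselect (exists j, e i j && V j)) => [[j /andP[ij Vj]]|none].
    apply: (@le_trans _ _ 1).
      by rewrite ler_norml !indicE; do 2 case: (_ \in _) => /=; apply/andP; split; lra.
    rewrite (bigD1 j)//= ij Vj mulr1 lerDl sumr_ge0// => k _; exact: mulr_ge0.
  rewrite (_ : induced (upd V i true) = induced (upd V i false)).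
    by rewrite subrr normr0 sumr_ge0// => k _; rewrite mulr_ge0.
  have no y : ~ (e i y && V y) by move=> iy; apply: none; exists y.
  apply/funext => x; apply/funext => y; apply/propext; rewrite /induced /upd.
  case: eqP => [->|xi]; case: eqP => [->|yi]; rewrite ?irr; split; move=> [h1 h2 h3] //.
    by case: (no y); rewrite h3 h2.
  by case: (no x); rewrite sym h3 h1.
rewrite big1 ?mulr0 ?add0r; last first.
  by move=> i _; rewrite big1// => j; rewrite mem_enum.
rewrite !big_enum /=; under eq_bigr do rewrite big_enum /=.
by rewrite sum_adj (_ : 2 * _ / 2 = (num_edges e)%:R)//; lra.
Qed.

Lemma smpl_prob01 (t : R) : 0 <= t -> 0 <= smpl_prob e t <= 1.
Proof.
move=> t0; rewrite /smpl_prob ge_min lexx andbT le_min ler01 /=.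
by rewrite divr_ge0// sqrtr_ge0.
Qed.

Lemma smpl_law01 (p : R) A : 0 <= p <= 1 -> 0 <= smpl_law e p A <= 1.
Proof.
move=> p01; rewrite smpl_lawE; apply/andP; split.
  by apply: coin_ge0 => // V; apply: indic_ge0.
rewrite -[leRHS](coin_cst (fun=> p) (enum 'I_n) 1 (fun=> false)).
by apply: ler_coin => // V; apply: indic_le1.
Qed.

Lemma smpl_law_setC (p : R) A : smpl_law e p (~` A) = 1 - smpl_law e p A.
Proof.
apply/eqP; rewrite eq_sym subr_eq eq_sym; apply/eqP; rewrite !smpl_lawE -coinD.
rewrite -[RHS](coin_cst (fun=> p) (enum 'I_n) 1 (fun=> false)).
by apply: coin_ext => h; rewrite !indicE in_setC; case: (_ \in _); rewrite /= ?addr0 ?add0r.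
Qed.

Definition smpl_at t A : R := smpl_law e (smpl_prob e t) A.

Lemma smpl_prob_edges t : 0 <= t ->
  (smpl_prob e t) ^+ 2 * (num_edges e)%:R =
  Num.min (num_edges e)%:R (if num_edges e == 0 then 0 else t ^+ 2 / 2) :> R.
Proof.
move=> t0; rewrite /smpl_prob; case: eqP => [->|/eqP ne0].
  by rewrite mulr0 minxx.
have e0 : 0 < (num_edges e)%:R :> R by rewrite ltr0n lt0n.
set m : R := (num_edges e)%:R in e0 *.
have s0 : 0 < Num.sqrt (2 * m) by rewrite sqrtr_gt0 mulr_gt0.
have q0 : 0 <= t / Num.sqrt (2 * m) by rewrite divr_ge0// ltW.
have q2 : (t / Num.sqrt (2 * m)) ^+ 2 * m = t ^+ 2 / 2.
  rewrite exprMn exprVn sqr_sqrtr; last by rewrite mulr_ge0// ltW.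
  by rewrite invfM -!mulrA mulVf ?mulr1// gt_eqF.
have [h|h] := leP 1 (t / Num.sqrt (2 * m)).
  rewrite expr1n mul1r (min_idPl _)// -q2; apply: ler_peMl; first exact: ltW.
  exact: exprn_ege1.
rewrite q2 (min_idPr _)// -q2; apply: ler_piMl; first exact: ltW.
by apply: exprn_ile1 => //; exact: ltW.
Qed.

(** The Lipschitz constant of [smpl_law_lip] is proportional to the number of
    edges, and the retention probability to the inverse of its square root. *)
Lemma smpl_at_lip t t' A : 0 <= t -> 0 <= t' ->
  `|smpl_at t' A - smpl_at t A| <= `|t' ^+ 2 - t ^+ 2| / 2.
Proof.
move=> t0 t'0; apply: le_trans (smpl_law_lip _ (smpl_prob01 t0) (smpl_prob01 t'0)) _.
rewrite -[X in _ * X]ger0_norm// -normrM mulrBl !smpl_prob_edges//.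
case: eqP => [->|_]; first by rewrite !minxx subrr normr0 divr_ge0.
set m : R := (num_edges e)%:R.
rewrite (_ : `|t' ^+ 2 - t ^+ 2| / 2 = `|t' ^+ 2 / 2 - t ^+ 2 / 2|); last first.
  by rewrite -mulrBl normrM [X in _ = _ * X]ger0_norm.
set y := t' ^+ 2 / 2; set z := t ^+ 2 / 2.
have := ler_norm (y - z); have := ler_norm (z - y); rewrite (distrC z y) => h1 h2.
by rewrite ler_norml /Num.min; case: ltP => a1; case: ltP => a2; apply/andP; split; lra.
Qed.

(** The two retention probabilities agree if the number of edges is [c / 2]; the
    difference of their squares is controlled by [smpl_law_lip]. *)
Lemma smpl_at_fixed t (c : R) A : 0 <= t -> 0 < c -> 2 * t ^+ 2 <= c ->
  `|smpl_at t A - smpl_law e (t / Num.sqrt c) A| <= t ^+ 2 * `|1 - 2 / c * (num_edges e)%:R|.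
Proof.
move=> t0 c0 tc.
have p01 : 0 <= t / Num.sqrt c <= 1.
  rewrite divr_ge0 ?sqrtr_ge0//= ler_pdivrMr ?sqrtr_gt0// mul1r.
  rewrite -[t]ger0_norm// -sqrtr_sqr ler_sqrt//; have := sqr_ge0 t; lra.
apply: le_trans (smpl_law_lip _ p01 (smpl_prob01 t0)) _.
rewrite -[X in _ * X]ger0_norm// -normrM mulrBl smpl_prob_edges//.
rewrite exprMn exprVn sqr_sqrtr; last exact: ltW.
case: eqP => [->|_]; first by rewrite minxx !mulr0 !subrr normr0 mulr_ge0 ?sqr_ge0.
set m : R := (num_edges e)%:R; have m0 : 0 <= m by rewrite ler0n.
have t20 := sqr_ge0 t.
have ic : 0 < c^-1 by rewrite invr_gt0.
rewrite /Num.min; case: ltP => mt; last first.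
  rewrite (_ : t ^+ 2 / 2 - t ^+ 2 / c * m = (t ^+ 2 / 2) * (1 - 2 / c * m)); last by lra.
  rewrite normrM ger0_norm ?divr_ge0//; apply: ler_wpM2r => //; lra.
have mc : c^-1 * m <= 1 / 4.
  by rewrite mulrC ler_pdivrMr//; lra.
have tc1 : t ^+ 2 / c <= 1 by rewrite ler_pdivrMr//; lra.
have tc2 : 0 <= t ^+ 2 / c by rewrite divr_ge0// ltW.
have mm : t ^+ 2 / c * m <= m by rewrite -[leRHS]mul1r ler_wpM2r.
have mm0 : 0 <= t ^+ 2 / c * m by rewrite mulr_ge0.
apply: (@le_trans _ _ (t ^+ 2 * (1 / 2))).
  by rewrite ger0_norm; lra.
by apply: ler_wpM2l => //; apply: le_trans (ler_norm _); lra.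
Qed.

End one_graph.
End sampling.

(** * The random graph *)

Section random_graph.
Context (R : realType) (n : nat).
Local Notation pairs := (enum {: 'I_n * 'I_n}).
Variable x : 'I_n -> R.
Hypothesis x0 : forall i, 0 <= x i.
Local Notation q := (edge_prob x).

Lemma sgraph_simple (g : 'I_n * 'I_n -> bool) : simple_graph (sgraph g).
Proof.
split; first by move=> i j; rewrite /sgraph orbC.
by move=> i; rewrite /sgraph ltnn.
Qed.

Definition emean (F : rel 'I_n -> R) : R := coin q pairs (fun g => F (sgraph g)) (fun=> false).

Let q01 : prob_vec q. Proof. exact: edge_prob_vec. Qed.

Lemma ler_emean F H : (forall e, simple_graph e -> F e <= H e) -> emean F <= emean H.
Proof. by move=> FH; apply: ler_coin => // g; apply: FH; apply: sgraph_simple. Qed.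

Lemma emean_cst c : emean (fun=> c) = c. Proof. exact: coin_cst. Qed.

Lemma emeanD F H : emean (fun e => F e + H e) = emean F + emean H.
Proof. exact: coinD. Qed.

Lemma emeanZ c F : emean (fun e => c * F e) = c * emean F.
Proof. exact: coinZ. Qed.

Lemma emean_norm F : `|emean F| <= emean (fun e => `|F e|).
Proof. exact: coin_norm. Qed.

Lemma emean_ge0 F : (forall e, simple_graph e -> 0 <= F e) -> 0 <= emean F.
Proof. by move=> F0; rewrite -[leLHS](emean_cst 0); apply: ler_emean. Qed.

Lemma emean_smpl (p : R) A : emean (fun e => smpl_law e p A) = annealed x p A.
Proof.
rewrite /annealed coin_swap; apply: coin_ext => g.
by rewrite smpl_lawE.
Qed.

Lemma num_edges_sgraph g : (num_edges (sgraph g))%:R =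
  \sum_(z <- pairs | (z.1 < z.2)%N) (g z)%:R :> R.
Proof.
rewrite big_enum_cond /num_edges -sum1_card natr_sum big_mkcond [RHS]big_mkcond /=.
apply: eq_bigr => -[i j] _; rewrite inE /sgraph /=.
by case: ltngtP => //= _; rewrite ?orbF; case: (g _).
Qed.

Definition mean_edges : R := \sum_(z : 'I_n * 'I_n | (z.1 < z.2)%N) wf (x z.1 * x z.2).

(** The edges are independent, so the variance of their number is at most the
    mean. *)
Lemma edges_second_moment (c : R) :
  emean (fun e => (1 - 2 / c * (num_edges e)%:R) ^+ 2) <=
  (1 - 2 / c * mean_edges) ^+ 2 + 4 / c ^+ 2 * mean_edges.
Proof.
pose a (z : 'I_n * 'I_n) : R := if (z.1 < z.2)%N then - (2 / c) else 0.
have E g : (1 - 2 / c * (num_edges (sgraph g))%:R) =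
    (1 - 2 / c * mean_edges) + \sum_(z <- pairs) a z * ((g z)%:R - q z).
  have -> : \sum_(z <- pairs) a z * ((g z)%:R - q z) =
      - (2 / c) * (num_edges (sgraph g))%:R + 2 / c * mean_edges.
    rewrite big_enum num_edges_sgraph big_enum_cond /mean_edges /= !mulr_sumr.
    rewrite [X in _ = X + _]big_mkcond [X in _ = _ + X]big_mkcond /= -big_split.
    apply: eq_bigr => z _ /=; rewrite /a /edge_prob; case: ifP => _; last by rewrite mul0r addr0.
    by rewrite !mulNr mulrBr opprB addrC.
  by rewrite mulNr; lra.
rewrite /emean (_ : coin _ _ _ _ = coin q pairs (fun g => ((1 - 2 / c * mean_edges) +
    \sum_(z <- pairs) a z * ((g z)%:R - q z)) ^+ 2) (fun=> false)); last first.
  by apply: coin_ext => g; rewrite E.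
rewrite coin_variance ?enum_uniq// lerD2l big_enum /= /mean_edges mulr_sumr [leRHS]big_mkcond /=.
apply: ler_sum => z _; rewrite /a /edge_prob; case: ifP => _; last by rewrite expr0n mul0r.
have w0 : 0 <= wf (x z.1 * x z.2) by rewrite wf_ge0// mulr_ge0.
rewrite sqrrN exprMn exprVn (_ : 2 ^+ 2 = 4 :> R); last by lra.
apply: ler_wpM2l; first by rewrite divr_ge0 ?sqr_ge0.
by rewrite ler_piMr// lerBlDr lerDl.
Qed.

(** Combines [smpl_at_fixed] with Chebyshev's inequality: an absolute value [z]
    is at most [e + z ^+ 2 / e], whose mean involves only the second moment. *)
Lemma emean_smpl_at t (c e : R) A : 0 <= t -> 0 < c -> 2 * t ^+ 2 <= c -> 0 < e ->
  `|emean (fun h => smpl_at h t A) - annealed x (t / Num.sqrt c) A| <=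
  t ^+ 2 * (e + ((1 - 2 / c * mean_edges) ^+ 2 + 4 / c ^+ 2 * mean_edges) / e).
Proof.
move=> t0 c0 tc e0; have t20 := sqr_ge0 t.
rewrite -emean_smpl -[X in _ - X]mul1r -mulNr -emeanZ -emeanD.
apply: le_trans (emean_norm _) _.
apply: (@le_trans _ _ (emean (fun h => t ^+ 2 * (e + (1 - 2 / c * (num_edges h)%:R) ^+ 2 / e)))).
  apply: ler_emean => h sh; rewrite mulN1r; apply: le_trans (smpl_at_fixed sh A t0 c0 tc) _.
  apply: ler_wpM2l => //; set y := 1 - _; set z := `|y|.
  have z0 : 0 <= z by apply: normr_ge0.
  rewrite -[y ^+ 2]real_normK ?num_real// -/z.
  have [ze|ez] := leP z e; first by rewrite (le_trans ze)// lerDl divr_ge0 ?sqr_ge0// ltW.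
  apply: (@le_trans _ _ (z ^+ 2 / e)); last by rewrite lerDr ltW.
  by rewrite ler_pdivlMr// expr2 ler_wpM2l// ltW.
rewrite emeanZ ler_wpM2l// (_ : (fun h => _) = fun h => e + e^-1 * (1 - 2 / c * (num_edges h)%:R) ^+ 2).
  rewrite emeanD emean_cst emeanZ lerD2l mulrC ler_wpM2r ?invr_ge0 ?(ltW e0)//.
  exact: edges_second_moment.
by apply/funext => h; rewrite mulrC.
Qed.

End random_graph.

(** ** The limit of the mean *)

Section mean_limit.
Context (R : realType) (w : nat -> nat -> R).
Hypothesis w_ge0 : forall n i : nat, (i < n)%N -> 0 <= w n i.
Hypothesis L_gt0 : \forall n \near \oo, 0 < total_weight w n.
Hypothesis sqrtL_infty : (Num.sqrt (total_weight w n))^-1 @[n --> \oo] --> (0 : R).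
Local Notation L := (total_weight w).
Local Notation x n := (fun i : 'I_n => rel_weight w n i).

Definition double_mean n : R := (L n)^-1 * \sum_(i < n) \sum_(j < n) wf (rel_weight w n i * rel_weight w n j).

Let x0 n (i : 'I_n) : 0 <= rel_weight w n i.
Proof. by apply: rel_weight_ge0 => // j; apply: w_ge0. Qed.

Lemma double_mean_le1 n : 0 < L n -> double_mean n <= 1.
Proof.
move=> L0; rewrite /double_mean mulrC ler_pdivrMr// mul1r.
rewrite -[leRHS](sqr_sqrtr (ltW L0)) -(sum_rel_weight L0) expr2 big_distrl /=.
apply: ler_sum => i _; rewrite big_distrr /=; apply: ler_sum => j _.
by apply: wf_le; rewrite mulr_ge0.
Qed.

(** The double sum counts each pair twice, and in addition the diagonal, whose
    contribution vanishes in the limit. *)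
Lemma mean_edges_double n : 0 < L n ->
  `|2 / L n * mean_edges (x n) - double_mean n| <= (Num.sqrt (L n))^-1.
Proof.
move=> L0; have sL0 := sqrtL_gt0 L0.
have E : \sum_(i < n) \sum_(j < n) wf (rel_weight w n i * rel_weight w n j) =
    2 * mean_edges (x n) + \sum_(i < n) wf (rel_weight w n i * rel_weight w n i).
  pose F (i j : 'I_n) := wf (rel_weight w n i * rel_weight w n j).
  have M : mean_edges (x n) = \sum_(i < n) \sum_(j < n | (i < j)%N) F i j.
    by rewrite /mean_edges pair_big_dep.
  have M' : mean_edges (x n) = \sum_(i < n) \sum_(j < n | (j < i)%N) F i j.
    rewrite M (exchange_big_dep xpredT)//=; apply: eq_bigr => i _; apply: eq_bigr => j _.
    by rewrite /F mulrC.
  rewrite (_ : 2 * _ = mean_edges (x n) + mean_edges (x n)); last by lra.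
  rewrite {1}M M' -!big_split; apply: eq_bigr => i _ /=.
  rewrite (bigID (fun j : 'I_n => i < j)%N)/= -addrA; congr (_ + _).
  rewrite (bigID (fun j : 'I_n => j < i)%N)/=; congr (_ + _).
    by apply: eq_bigl => j; rewrite -leqNgt; case: ltngtP.
  rewrite (bigD1 i)/= ?ltnn// big1 ?addr0// => j /andP[]; rewrite -!leqNgt => /andP[ji ij].
  have -> : j = i by apply/val_inj/eqP; rewrite eqn_leq ji ij.
  by rewrite eqxx.
rewrite /double_mean E mulrDr opprD addrA.
have -> : 2 / L n * mean_edges (x n) - (L n)^-1 * (2 * mean_edges (x n)) = 0 by lra.
rewrite add0r normrN ger0_norm; last first.
  by rewrite mulr_ge0 ?invr_ge0 ?(ltW L0)// sumr_ge0// => i _; rewrite wf_ge0// mulr_ge0.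
apply: (@le_trans _ _ ((L n)^-1 * \sum_(i < n) rel_weight w n i)).
  apply: ler_wpM2l; first by rewrite invr_ge0 ltW.
  apply: ler_sum => i _; have y0 := x0 i; set y := rel_weight w n i in y0 *.
  have [y1|y1] := leP y 1.
    by apply: le_trans (wf_le (mulr_ge0 y0 y0)) _; rewrite ler_piMl.
  by apply: le_trans (wf_le1 (mulr_ge0 y0 y0)) _; rewrite ltW.
rewrite sum_rel_weight// mulrC ler_pdivrMr// -[leRHS]mulr1 -[X in _ <= _ * X * _](sqr_sqrtr (ltW L0)).
by rewrite expr2 mulrA mulVf ?gt_eqF// mul1r mulr1.
Qed.

Section subsequence.
Variables (N : nat -> nat) (C t : R).
Hypothesis N_infty : N @ \oo --> \oo.
Hypothesis C0 : 0 < C.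
Hypothesis t0 : 0 < t.
Hypothesis double_cvg : double_mean (N j) @[j --> \oo] --> C.

(** With [c = C * L n], the number of edges concentrates around [c / 2] by
    [edges_second_moment]. *)
Lemma emean_cvg (A : set ugraph) (l : R) :
  annealed (x n) (t / Num.sqrt C / Num.sqrt (L n)) A @[n --> \oo] --> l ->
  emean (x (N j)) (fun e => smpl_at e t A) @[j --> \oo] --> l.
Proof.
move=> al.
have sL : (Num.sqrt (L (N j)))^-1 @[j --> \oo] --> (0 : R).
  exact: (cvg_comp _ _ N_infty sqrtL_infty).
have Lj : \forall j \near \oo, 0 < L (N j) by exact: (N_infty L_gt0).
have iL : (L (N j))^-1 @[j --> \oo] --> (0 : R).
  rewrite -[X in _ --> X](mulr0 (0 : R)); apply: cvg_trans; last exact: (cvgM sL sL).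
  apply: near_eq_cvg; near=> j.
  have L0 : 0 < L (N j) by near: j.
  by rewrite /= -invfM -expr2 sqr_sqrtr// ltW.
have al' : annealed (x (N j)) (t / Num.sqrt C / Num.sqrt (L (N j))) A @[j --> \oo] --> l.
  exact: (cvg_comp _ _ N_infty al).
have mc : 2 / L (N j) * mean_edges (x (N j)) @[j --> \oo] --> C.
  rewrite -[X in _ --> X](addr0 C) (_ : (fun j => _) = fun j => double_mean (N j) +
     (2 / L (N j) * mean_edges (x (N j)) - double_mean (N j))); last first.
    by apply/funext => j; rewrite addrC subrK.
  apply: cvgD => //; apply/cvgrPdist_le => e e0.
  have h := cvgr_le _ sL _ e0; near=> j.
  have L0 : 0 < L (N j) by near: j.
  rewrite sub0r normrN; apply: le_trans (mean_edges_double L0) _.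
  near: j; exact: h.
pose V j := (1 - 2 / (C * L (N j)) * mean_edges (x (N j))) ^+ 2 + 4 / (C * L (N j)) ^+ 2 * mean_edges (x (N j)).
have Vc : V j @[j --> \oo] --> (0 : R).
  have -> : V = fun j => (1 - C^-1 * (2 / L (N j) * mean_edges (x (N j)))) ^+ 2 +
      (2 / C ^+ 2) * (L (N j))^-1 * (2 / L (N j) * mean_edges (x (N j))).
    apply/funext => j; rewrite /V invfM exprMn invfM expr2 invfM; lra.
  have -> : (0 : R) = (1 - C^-1 * C) ^+ 2 + (2 / C ^+ 2) * 0 * C.
    by rewrite mulVf ?gt_eqF// subrr expr0n /= mulr0 mul0r addr0.
  apply: cvgD; last by apply: cvgM => //; apply: cvgM => //; exact: cvg_cst.
  rewrite expr2 (_ : (fun j => _ ^+ 2) = fun j => (1 - C^-1 * (2 / L (N j) * mean_edges (x (N j)))) *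
     (1 - C^-1 * (2 / L (N j) * mean_edges (x (N j))))); last by apply/funext => j; rewrite expr2.
  by apply: cvgM; (apply: cvgB; [exact: cvg_cst|apply: cvgM => //; exact: cvg_cst]).
rewrite -[l](addr0 l).
rewrite (_ : (fun j => _) = fun j => annealed (x (N j)) (t / Num.sqrt C / Num.sqrt (L (N j))) A +
  (emean (x (N j)) (fun e => smpl_at e t A) - annealed (x (N j)) (t / Num.sqrt C / Num.sqrt (L (N j))) A)); last first.
  by apply/funext => j; rewrite addrC subrK.
apply: cvgD => //; apply/cvgrPdist_le => e e0.
have t20 : 0 < t ^+ 2 by rewrite exprn_gt0.
pose e1 := e / (2 * t ^+ 2); have e10 : 0 < e1 by rewrite divr_gt0// mulr_gt0.
have hV : \forall j \near \oo, V j <= e1 * e1 by apply: (cvgr_le _ Vc); rewrite mulr_gt0.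
have hL : \forall j \near \oo, (L (N j))^-1 <= C / (2 * t ^+ 2).
  by apply: (cvgr_le _ iL); rewrite divr_gt0// mulr_gt0.
near=> j.
have L0 : 0 < L (N j) by near: j.
have CL : 0 < C * L (N j) by rewrite mulr_gt0.
have tc : 2 * t ^+ 2 <= C * L (N j).
  have : (L (N j))^-1 <= C / (2 * t ^+ 2) by near: j.
  by rewrite ler_pdivlMr ?mulr_gt0// mulrC ler_pdivrMr.
have V1 : V j <= e1 * e1 by near: j.
have sE : t / Num.sqrt (C * L (N j)) = t / Num.sqrt C / Num.sqrt (L (N j)).
  by rewrite sqrtrM ?(ltW C0)// invfM mulrA.
have := emean_smpl_at (@x0 (N j)) A (ltW t0) CL tc e10.
rewrite sE sub0r normrN => /le_trans; apply.
rewrite -/(V j); apply: (@le_trans _ _ (t ^+ 2 * (e1 + e1 * e1 / e1))).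
  by apply: ler_wpM2l; [exact: ltW|rewrite lerD2l ler_wpM2r// invr_ge0 ltW].
have E : e1 * (2 * t ^+ 2) = e by rewrite divfK// gt_eqF// mulr_gt0.
have D : e1 + e1 = e1 * 2 by rewrite mulr_natr mulr2n.
by rewrite mulfK ?gt_eqF// D -[leRHS]E [leLHS]mulrC [leRHS]mulrA.
Unshelve. all: by end_near. Qed.

End subsequence.
End mean_limit.

(** * The sequence of graphs *)

Section graph_sequence.
Context d (T : measurableType d) (R : realType) (P : probability T R)
  (w : nat -> nat -> R) (G : forall n, T -> rel 'I_n).
Arguments G : clear implicits.
Hypothesis w_ge0 : forall n i : nat, (i < n)%N -> 0 <= w n i.
Hypothesis G_grg : grg_sequence P w G.
Local Notation pr := (pr P).
Local Notation x n := (fun i : 'I_n => rel_weight w n i).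

Let x0 n (i : 'I_n) : 0 <= rel_weight w n i.
Proof. by apply: rel_weight_ge0 => // j; apply: w_ge0. Qed.

Lemma grg_probE n (i j : 'I_n) : grg_prob w n i j = wf (rel_weight w n i * rel_weight w n j).
Proof.
rewrite /grg_prob; have L0 : 0 <= total_weight w n.
  by apply: sumr_ge0 => k _; apply: w_ge0.
have [LE|L1] := eqVneq (total_weight w n) 0.
  have /eqP : \sum_(k < n) w n k = 0 by [].
  rewrite psumr_eq0; last by move=> k _; apply: w_ge0.
  move=> /allP/(_ i (mem_index_enum _)) /= /eqP wi.
  by rewrite /rel_weight wi !mul0r /wf mul0r.
have Lp : 0 < total_weight w n by rewrite lt_neqAle eq_sym L1.
have sL := sqrtL_gt0 Lp.
have -> : rel_weight w n i * rel_weight w n j = w n i * w n j / total_weight w n.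
  by rewrite /rel_weight mulrACA -invfM -expr2 sqr_sqrtr.
rewrite /wf; set z := w n i * w n j; have z0 : 0 <= z by rewrite mulr_ge0// w_ge0.
have h : 1 + z / total_weight w n = (total_weight w n + z) / total_weight w n.
  by rewrite mulrDl divff.
by rewrite h invf_div mulrA divfK.
Qed.

(** The sets of pairs [i < j] enumerate the simple graphs without repetition. *)
Definition canonical n (U : {set 'I_n * 'I_n}) : bool := [forall z in U, z.1 < z.2]%N.

Definition set_graph n (U : {set 'I_n * 'I_n}) : rel 'I_n := sgraph (fun z => z \in U).

Definition set_weight n (U : {set 'I_n * 'I_n}) : R :=
  \prod_z (if z \in U then edge_prob (x n) z else 1 - edge_prob (x n) z).

Lemma emean_sum n (F : rel 'I_n -> R) :
  emean (x n) F = \sum_(U : {set 'I_n * 'I_n}) set_weight U * F (set_graph U).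
Proof. exact: coin_setE. Qed.

Lemma set_weightE n (U : {set 'I_n * 'I_n}) :
  set_weight U = if canonical U then grg_pmf w (set_graph U) else 0.
Proof.
case: ifP => [/forall_inP cU|/negbT]; last first.
  rewrite negb_forall_in => /exists_inP[z zU nz]; rewrite /set_weight (bigD1 z)//= zU.
  by rewrite /edge_prob (negbTE nz) mul0r.
rewrite /grg_pmf pair_big_dep /= /set_weight [RHS]big_mkcond; apply: eq_bigr => -[i j] _ /=.
rewrite /set_graph /sgraph /edge_prob /=; case: ltngtP => [ij|ij|ij] /=.
- by rewrite orbF grg_probE.
- case: ifP => [/cU /=|_]; last by rewrite subr0.
  by rewrite ltnNge (ltnW ij).
- case: ifP => [/cU /=|_]; last by rewrite subr0.
  by rewrite ij ltnn.
Qed.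

Lemma graph_set n (e : rel 'I_n) : simple_graph e ->
  exists2 U, canonical U & e =2 set_graph U.
Proof.
move=> [sym irr]; exists [set z : 'I_n * 'I_n | (z.1 < z.2)%N && e z.1 z.2]%SET.
  by apply/forall_inP => z; rewrite finset.in_set => /andP[].
move=> i j; rewrite /set_graph /sgraph !finset.in_set /=.
case: ltngtP => [ij|ij|/val_inj ij] //=; first by rewrite orbF.
by rewrite ij irr.
Qed.

Lemma set_graph_inj n (U V : {set 'I_n * 'I_n}) : canonical U -> canonical V ->
  set_graph U =2 set_graph V -> U = V.
Proof.
move=> /forall_inP cU /forall_inP cV UV; apply/setP => -[i j].
have := UV i j; rewrite /set_graph /sgraph; case: ltngtP => [ij|ij|ij] /=.
- by rewrite !orbF.
- by move=> _; apply/idP/idP => [/cU|/cV] /=; rewrite ltnNge (ltnW ij).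
- by move=> _; apply/idP/idP => [/cU|/cV] /=; rewrite ij ltnn.
Qed.

Definition ext_pred (S : forall n, rel 'I_n -> bool) :=
  forall n (e e' : rel 'I_n), e =2 e' -> S n e = S n e'.

(** Interpolates between the event that the graphs are given ones, whose
    probability is known, and the event that they satisfy [S]: the graphs are
    released one at a time by summing over their values. *)
Definition mixed_event (S : forall n, rel 'I_n -> bool) (g : forall n, rel 'I_n) m N : set T :=
  [set om | forall n, (n < N)%N -> if (n < m)%N then S n (G n om) else `[< G n om =2 g n >]].

Lemma measurable_graph n (e : rel 'I_n) : measurable [set om | G n om =2 e].
Proof. by case: G_grg. Qed.

Lemma measurable_graph_pred S n : ext_pred S -> measurable [set om | S n (G n om)].
Proof.
move=> eS; have [sG _ _] := G_grg.
rewrite (_ : [set om | _] = [set om | exists U : {set 'I_n * 'I_n},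
   ([set _ | S n (set_graph U)] `&` [set om | G n om =2 set_graph U]) om]).
  apply: measurable_exists => U; apply: measurableI; first exact: measurable_pred.
  exact: measurable_graph.
apply/seteqP; split => om /=; last by move=> [U [SU /eS ->]].
by have [U _ GU] := graph_set (sG n om); exists U; rewrite -(eS _ _ _ GU).
Qed.

Lemma measurable_mixed S g m N : ext_pred S -> measurable (mixed_event S g m N).
Proof.
move=> eS; apply: (@measurable_forall _ _ _ (fun n => [set om | (n < N)%N ->
   if (n < m)%N then S n (G n om) else `[< G n om =2 g n >]])) => n.
apply: measurable_cond; case: (n < m)%N; first exact: measurable_graph_pred.
suff -> : (fun om : T => is_true `[< G n om =2 g n >]) = [set om | G n om =2 g n] by exact: measurable_graph.
by apply/seteqP; split => om /=; move/asboolP.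
Qed.

Lemma pr_mixed S g m N : ext_pred S -> (m <= N)%N -> (forall n, simple_graph (g n)) ->
  pr (mixed_event S g m N) =
  (\prod_(n < m) emean (x n) (fun e => (S n e)%:R)) * \prod_(m <= n < N) grg_pmf w (g n).
Proof.
move=> eS; elim: m g => [|m IH] g mN sg.
  rewrite big_ord0 mul1r big_mkord; have [_ _ H] := G_grg.
  rewrite pr_fine -[RHS]/(fine (\prod_(n < N) grg_pmf w (g n))%:E) -H//; congr (fine (P _)).
  by apply/seteqP; split => om /= H' n nN; have := H' n nN; rewrite ltn0 => /asboolP.
pose D (U : {set 'I_m * 'I_m}) : forall n, rel 'I_n :=
  fun n => match m =P n with
    | ReflectT E => eq_rect m (fun k => rel 'I_k) (set_graph U) n E
    | ReflectF _ => g n end.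
have DE U : D U m = set_graph U.
  by rewrite /D; case: eqP => // E; rewrite (eq_irrelevance E (erefl m)).
have DN U n : n != m -> D U n = g n.
  by rewrite /D => nm; case: eqP => // E; rewrite E eqxx in nm.
have sD U n : simple_graph (D U n).
  have [->|nm] := eqVneq n m; first by rewrite DE; apply: sgraph_simple.
  by rewrite DN.
pose F (U : {set 'I_m * 'I_m}) : set T :=
  if canonical U && S m (set_graph U) then mixed_event S (D U) m N else set0.
have mF U : measurable (F U).
  by rewrite /F; case: ifP => // _; apply: measurable_mixed.
have [sG _ _] := G_grg.
have -> : mixed_event S g m.+1 N = [set om | exists U, F U om].
  apply/seteqP; split => om.
    move=> H; have [U cU GU] := graph_set (sG m om); exists U.
    have := H m mN; rewrite ltnSn (eS _ _ _ GU) => SU.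
    rewrite /F cU SU /= => n nN; have := H n nN; rewrite ltnS leq_eqVlt.
    have [->|nm] := eqVneq n m; first by rewrite ltnn /= => _; apply/asboolP; rewrite DE.
    by rewrite /= DN.
  move=> [U]; rewrite /F; case: ifP => // /andP[cU SU] H n nN.
  have := H n nN; rewrite ltnS [(n <= m)%N]leq_eqVlt; have [->|nm] := eqVneq n m; last by rewrite /= DN.
  by rewrite ltnn /= DE => /asboolP/eS ->.
rewrite pr_disjoint_fin//; last first.
  move=> U V om; rewrite /F; case: ifP => // /andP[cU _] HU; case: ifP => // /andP[cV _] HV.
  apply: set_graph_inj => // i j.
  have := HU m mN; have := HV m mN; rewrite ltnn !DE => /asboolP EV /asboolP EU.
  by rewrite -EU EV.
rewrite big_ord_recr /= emean_sum mulr_sumr mulr_suml; apply: eq_bigr => U _.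
rewrite /F set_weightE; case cU : (canonical U) => /=; last by rewrite pr_set0 mul0r mulr0 mul0r.
case SU : (S m (set_graph U)); last by rewrite pr_set0 !mulr0 mul0r.
rewrite IH//; last exact: ltnW.
rewrite mulr1 -mulrA; congr (_ * _); rewrite big_ltn// DE; congr (_ * _).
rewrite big_nat_cond [RHS]big_nat_cond; apply: eq_bigr => n /andP[/andP[mn _] _].
by rewrite DN// gtn_eqF.
Qed.

Theorem grg_independent S N : ext_pred S ->
  pr [set om | forall n, (n < N)%N -> S n (G n om)] =
  \prod_(n < N) emean (x n) (fun e => (S n e)%:R).
Proof.
move=> eS; pose g n : rel 'I_n := fun _ _ => false.
have := @pr_mixed S g N N eS (leqnn N) (fun n => conj (fun _ _ => erefl) (fun _ => erefl)).
rewrite big_geq// mulr1 => <-; congr (pr _); apply/seteqP; split => om /= H n nN.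
  by rewrite nN; apply: H.
by have := H n nN; rewrite nN.
Qed.

(** Markov's inequality bounds the probability of each excess by a constant
    below [1], and by [grg_independent] these probabilities multiply. *)
Lemma pr_all_exceed (N : nat -> nat) (X : forall n, rel 'I_n -> R) (l del : R) (J : nat) :
  (forall j, N j < N j.+1)%N ->
  (forall n (e e' : rel 'I_n), e =2 e' -> X n e = X n e') ->
  (forall n (e : rel 'I_n), simple_graph e -> 0 <= X n e) ->
  0 <= l -> 0 < del -> emean (x (N j)) (X (N j)) @[j --> \oo] --> l ->
  pr [set om | forall j, (J <= j)%N -> l + del < X (N j) (G (N j) om)] = 0.
Proof.
move=> Nmono eX X0 l0 del0 cv.
pose kap := (l + del / 2) / (l + del).
have ld : 0 < l + del by rewrite ltr_wpDl.
have kap0 : 0 <= kap by rewrite divr_ge0 ?addr_ge0 ?divr_ge0 ?(ltW del0)// ltW.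
have kap1 : kap < 1 by rewrite ltr_pdivrMr// mul1r ltrD2l; lra.
have [J1 JJ1 Jk] : exists2 J1, (J <= J1)%N & forall j, (J1 <= j)%N -> emean (x (N j)) (X (N j)) <= l + del / 2.
  have [J0 _ H] : \forall j \near \oo, emean (x (N j)) (X (N j)) <= l + del / 2.
    by apply: (cvgr_le _ cv); rewrite ltrDl divr_gt0.
  by exists (maxn J J0); rewrite ?leq_maxl// => j h; apply: H; apply: leq_trans h; rewrite leq_maxr.
pose S n (e : rel 'I_n) : bool := `[< forall j, (J1 <= j)%N -> N j = n -> l + del < X n e >].
have eS : ext_pred S.
  by move=> n e e' ee; rewrite /S (eX n e e' ee).
have muS01 n : 0 <= emean (x n) (fun e => (S n e)%:R) <= 1.
  apply/andP; split; first by apply: emean_ge0 => [i|e _]; [exact: x0|exact: ler0n].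
  rewrite -[leRHS](emean_cst (x n) 1); apply: ler_emean => [i|e _]; first exact: x0.
  by rewrite lern1 leq_b1.
have muk j : (J1 <= j)%N -> emean (x (N j)) (fun e => (S (N j) e)%:R) <= kap.
  move=> Jj; apply: (@le_trans _ _ (emean (x (N j)) (fun e => (l + del)^-1 * X (N j) e))).
    apply: ler_emean => [i|e se]; first exact: x0.
    rewrite mulrC /S; case: asboolP => [/(_ j Jj erefl) h|_] /=.
      by rewrite ler_pdivlMr// mul1r ltW.
    by rewrite divr_ge0 ?X0// ltW.
  by rewrite emeanZ /kap mulrC ler_wpM2r ?invr_ge0 ?(ltW ld)// Jk.
pose Q M := \prod_(n < M) emean (x n) (fun e => (S n e)%:R).
have Q0 M : 0 <= Q M by apply: prodr_ge0 => n _; have /andP[] := muS01 n.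
have QK K : Q (N (J1 + K)%N) <= kap ^+ K.
  elim: K => [|K IH].
    rewrite expr0; apply: prodr_ile1 => n _; exact: muS01.
  rewrite addnS; have lt := Nmono (J1 + K)%N.
  rewrite /Q -(big_mkord xpredT (fun n => emean (x n) (fun e => (S n e)%:R))).
  rewrite (big_cat_nat (leq0n _) (ltnW lt))/= big_mkord -/(Q _) exprSr.
  rewrite big_ltn// ler_pM//.
    apply: mulr_ge0; first by have /andP[] := muS01 (N (J1 + K)%N).
    by apply: prodr_ge0 => n _; have /andP[] := muS01 n.
  rewrite -[leRHS]mulr1 ler_pM ?muk ?leq_addr//; last by apply: prodr_ile1 => n _; apply: muS01.
    by have /andP[] := muS01 (N (J1 + K)%N).
  by apply: prodr_ge0 => n _; have /andP[] := muS01 n.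
have mE M : measurable [set om | forall n, (n < M)%N -> S n (G n om)].
  apply: (@measurable_forall _ _ _ (fun n => [set om | (n < M)%N -> S n (G n om)])) => n.
  by apply: measurable_cond; apply: measurable_graph_pred.
have mX : measurable [set om | forall j, (J <= j)%N -> l + del < X (N j) (G (N j) om)].
  apply: (@measurable_forall _ _ _ (fun j => [set om | (J <= j)%N -> l + del < X (N j) (G (N j) om)])) => j.
  apply: measurable_cond.
  apply: (@measurable_graph_pred (fun n e => l + del < X n e)).
  by move=> n e e' ee; rewrite (eX n e e' ee).
apply/eqP; rewrite eq_le pr_ge0 andbT.
have kc : kap ^+ K @[K --> \oo] --> (0 : R) by apply: cvg_expr; rewrite ger0_norm.
apply: (cvgr_to_ge kc); apply: nearW => K; apply: le_trans (QK K).
rewrite /Q -grg_independent//; apply: le_pr => // om H n _; apply/asboolP => j Jj jn.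
by move: (H j (leq_trans JJ1 Jj)); rewrite -jn.
Qed.

End graph_sequence.

(** * The limit is a graphex *)

(** Monotonicity holds without measurability because the integral is a supremum
    over simple functions. *)
Lemma ge0_integral_mono d (T : measurableType d) (R : realType)
    (mu : {measure set T -> \bar R}) (D : set T) (f g : T -> \bar R) :
  (forall x, D x -> 0 <= f x)%E -> (forall x, D x -> f x <= g x)%E ->
  (\int[mu]_(x in D) f x <= \int[mu]_(x in D) g x)%E.
Proof.
move=> f0 fg; have g0 x : D x -> (0 <= g x)%E by move=> Dx; apply: le_trans (fg _ Dx); apply: f0.
rewrite !ge0_integralE//; apply: le_ereal_sup => _ [h /= hf <-]; exists h => //= x.
apply: le_trans (hf x) _; rewrite !patchE; case: ifP => // /set_mem Dx; exact: fg.
Qed.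

Lemma mulr3_le (R : numDomainType) (x y z : R) :
  0 <= x -> 0 <= y -> y <= 1 -> 0 <= z -> z <= 1 -> 0 <= x * y * z <= x.
Proof.
move=> x0 y0 y1 z0 z1; rewrite !mulr_ge0//= -mulrA ler_piMr//.
exact: mulr_ile1.
Qed.

Section graphex.
Context (R : realType) (w : nat -> nat -> R) (rho_w : {measure set R -> \bar R}).
Hypothesis w_ge0 : forall n i : nat, (i < n)%N -> 0 <= w n i.
Hypothesis L_gt0 : \forall n \near \oo, 0 < total_weight w n.
Hypothesis rho_vague : vague_cvg (rho w) rho_w.
Variables (a C : R).
Hypothesis C0 : 0 < C.
Hypothesis a0 : 0 <= a.
Local Notation sC := (Num.sqrt C).
Local Notation q := (vweight rho_w C).
Local Notation Rplus := (`[0, +oo[%classic : set R).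
Local Notation Lambda := (@lebesgue_measure R).

Let sC0 : 0 < sC. Proof. by rewrite sqrtr_gt0. Qed.

Let mq : measurable_fun setT q.
Proof. exact: (measurable_vweight w_ge0 L_gt0 rho_vague C0). Qed.

Let q0 y : 0 <= q y. Proof. exact: vweight_ge0. Qed.

Let f (k : nat) (y : R) : R := if 2 ^- k < q y <= 2 ^+ k then q y else 0.

Let mf k : measurable_fun setT (f k).
Proof.
apply: measurable_fun_ifT => //.
apply: measurable_and; first exact: measurable_fun_ltr.
exact: measurable_fun_ler.
Qed.

Let pow_inv k : 2 ^- k = (2^-1) ^+ k :> R. Proof. by rewrite exprVn. Qed.

(** The cells of a grid of ratio one half approximate the weight within a factor
    [2], and the rounded weights are summed by [mass_grid_le]. *)
Let f_le k : (\int[Lambda]_(y in Rplus) (f k y)%:E <= (2 / sC)%:E)%E.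
Proof.
have p0 : 0 < 2 ^+ k :> R by rewrite exprn_gt0.
have r0 : 0 < 2^-1 :> R by rewrite invr_gt0.
have r01 : 0 < (2^-1 : R) < 1 by rewrite r0 invf_lt1// ltr1n.
have [theta [kt _ no_atom]] := exists_grid_no_atom w_ge0 L_gt0 rho_vague p0 r0.
have theta0 : 0 < theta by apply: lt_trans kt.
have [M gM] : exists M, grid theta 2^-1 M <= 2 ^- k.
  have cv : (fun M => grid theta 2^-1 M) @ \oo --> (0 : R).
    rewrite -[X in _ --> X](mulr0 theta); apply: cvgM; first exact: cvg_cst.
    by apply: cvg_expr; rewrite ger0_norm ?ltW//; have /andP[] := r01.
  have e0 : 0 < 2 ^- k :> R by rewrite invr_gt0.
  have /cvgrPdist_le/(_ _ e0)[M _ /(_ M (leqnn M))] := cv.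
  by rewrite /= sub0r normrN ger0_norm; [exists M|apply/ltW/grid_gt0].
pose cell l := weight_cell theta 2^-1 q l.
have mc l : measurable (cell l) by apply: (measurable_weight_cell w_ge0 L_gt0 rho_vague).
apply: (@le_trans _ _ (\int[Lambda]_(y in Rplus) (\sum_(l <- index_enum 'I_M)
   (grid theta 2^-1 l)%:E * (\1_(cell l) y)%:E))%E).
  apply: ge0_integral_mono => y y0.
    by rewrite lee_fin /f; case: ifP.
  have t0 (l : 'I_M) : (0 <= (grid theta 2^-1 l)%:E * (\1_(cell l) y)%:E)%E.
    by rewrite -EFinM lee_fin mulr_ge0 ?indic_ge0//; apply/ltW/grid_gt0.
  rewrite /f; case: ifP => [/andP[h1 h2]|_]; last by rewrite sume_ge0.
  have h3 : grid theta 2^-1 M < q y <= theta.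
    by rewrite (le_lt_trans gM h1) (le_trans h2 (ltW kt)).
  have [l lM ly] := in_cell_ex h3.
  rewrite (bigD1 (Ordinal lM))//=; apply: (@le_trans _ _ (grid theta 2^-1 l)%:E).
    by rewrite lee_fin; have /andP[] := ly.
  rewrite -[leLHS]adde0; apply: leeD; last by rewrite sume_ge0.
  rewrite indicE mem_set ?mule1//; split=> //.
  by move: y0; rewrite /= in_itv /= andbT.
have gt0 (l : 'I_M) : 0 <= grid theta 2^-1 l :> R by apply/ltW/grid_gt0.
rewrite ge0_integral_sum//; last 2 first.
- move=> l; apply: measurable_funeM; apply/measurable_EFinP; apply: measurable_funTS.
  by apply: measurable_indic; exact: mc.
- by move=> l y _; rewrite -EFinM lee_fin mulr_ge0 ?indic_ge0.
rewrite (eq_bigr (fun l : 'I_M => (sC^-1 * (mass rho_w theta 2^-1 l * grid theta 2^-1 l))%:E)); last first.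
  move=> l _; rewrite ge0_integralZl//.
  - rewrite (@integral_indic _ _ R Lambda Rplus (measurable_itv _) (cell l) (mc l)) setIidl; last first.
      by move=> y [y0 _]; rewrite /= in_itv /= y0.
    have lE := weight_cell_measure w_ge0 L_gt0 rho_vague C0 theta0 r01 l.
    apply: etrans (congr1 (fun z => (grid theta 2^-1 l)%:E * z)%E lE) _.
    by rewrite -EFinM; congr (_%:E); rewrite mulrA mulrC; congr (_ * _); rewrite mulrC.
  - by apply/measurable_EFinP; apply: measurable_funTS; by apply: measurable_indic; exact: mc.
  - by rewrite lee_fin gt0.
rewrite sumEFin lee_fin -mulr_sumr mulrC ler_pM2r ?invr_gt0//.
by apply: le_trans (mass_grid_le w_ge0 L_gt0 rho_vague theta0 r01 no_atom M) _; rewrite invrK.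
Qed.

(** Monotone convergence along the truncations [f]. *)
Lemma integral_vweight_le : (\int[Lambda]_(y in Rplus) (q y)%:E <= (2 / sC)%:E)%E.
Proof.
have mono y : nondecreasing_seq (fun k => (f k y)%:E).
  move=> k l kl; rewrite lee_fin /f; case: ifP => [/andP[h1 h2]|_]; last by case: ifP.
  rewrite (_ : 2 ^- l < q y <= 2 ^+ l)//; apply/andP; split.
    by apply: le_lt_trans h1; rewrite lef_pV2 ?posrE ?exprn_gt0// ler_eXn2l// ltr1n.
  by apply: le_trans h2 _; rewrite ler_eXn2l// ltr1n.
have mfE k : measurable_fun Rplus (fun y => (f k y)%:E).
  by apply/measurable_EFinP; apply: measurable_funTS; exact: mf.
have f0 k y : Rplus y -> (0 <= (f k y)%:E)%E by move=> _; rewrite lee_fin /f; case: ifP.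
have cv := cvg_monotone_convergence (mu := Lambda) (measurable_itv _) mfE f0 (fun y _ => mono y).
have lim y : (q y)%:E = limn (fun k => (f k y)%:E).
  apply/esym/cvg_lim => //; have [q0'|qp] := eqVneq (q y) 0.
    rewrite (_ : (fun k => _) = fun=> (q y)%:E); first exact: cvg_cst.
    by apply/funext => k; rewrite /f q0' if_same.
  have qpos : 0 < q y by rewrite lt_neqAle eq_sym qp q0.
  apply: cvg_near_cst; near=> k.
  rewrite /f (_ : 2 ^- k < q y <= 2 ^+ k)//; apply/andP; split.
    rewrite pow_inv; near: k; apply: (cvgr_lt (0 : R)) => //.
    by apply: cvg_expr; rewrite ger0_norm ?invr_ge0// invf_lt1// ltr1n.
  apply: (@le_trans _ _ k%:R).
    by near: k; exact: nbhs_infty_ger.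
  by rewrite -natrX ler_nat ltnW// ltn_expl.
have -> : (\int[Lambda]_(y in Rplus) (q y)%:E =
    \int[Lambda]_(y in Rplus) limn (fun k => (f k y)%:E))%E.
  by apply: eq_integral => y _; exact: lim.
by apply: (@cvge_to_le _ _ _ _ _ _ _ cv); apply: nearW => k; apply: f_le.
Unshelve. all: by end_near. Qed.

Let K : \bar R := (\int[Lambda]_(y in Rplus) (q y)%:E)%E.

Let Kfin : (K < +oo)%E.
Proof. by apply: le_lt_trans integral_vweight_le _; rewrite ltry. Qed.

Let K0 : (0 <= K)%E.
Proof. by apply: integral_ge0 => y _; rewrite lee_fin. Qed.

Let mqE D : measurable_fun D (fun y => (q y)%:E).
Proof. by apply/measurable_EFinP; apply: measurable_funTS. Qed.

Let Zl (c : R) : 0 <= c -> (\int[Lambda]_(y in Rplus) (c * q y)%:E = c%:E * K)%E.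
Proof.
move=> c0; rewrite -ge0_integralZl//; last by move=> y _; rewrite lee_fin.
  exact: mqE.
Qed.

Local Notation g := (grg_graphex rho_w a C).

Lemma gW_grg x y : gW g x y = if x == y then 0 else wf (q x * q y).
Proof. by []. Qed.

Lemma gW_grg01 x y : 0 <= gW g x y <= 1.
Proof.
by rewrite gW_grg; case: ifP => _; rewrite ?lexx ?ler01// wf_ge0 ?wf_le1 ?mulr_ge0.
Qed.

Lemma gW_grg_le x y : gW g x y <= q x * q y.
Proof. by rewrite gW_grg; case: ifP => _; [rewrite mulr_ge0|rewrite wf_le ?mulr_ge0]. Qed.

Lemma mu_W_grg x : (mu_W (gW g) x <= (q x)%:E * K)%E.
Proof.
rewrite /mu_W -Zl//; apply: ge0_integral_mono => y _; rewrite lee_fin.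
  by have /andP[] := gW_grg01 x y.
exact: gW_grg_le.
Qed.

(** Everything follows from the integrability of the weight, as the edge
    function is at most the product of the weights. *)
Theorem grg_is_graphex : is_graphex g.
Proof.
split.
- split.
    by move=> x y _ _; rewrite gW_grg01 !gW_grg eq_sym mulrC.
  by apply: measurable_funTS; exact: (measurable_grg_W w_ge0 L_gt0 rho_vague a C0).
- split; [|split].
  + by move=> x _; change (0 <= a / sC * q x); rewrite mulr_ge0// divr_ge0// ltW.
  + by apply: measurable_funTS; apply: measurable_funM.
  + by rewrite /= divr_ge0 ?sqr_ge0// mulr_ge0// ltW.
- have ac : 0 <= a / sC by rewrite divr_ge0// ltW.
  apply: (@le_lt_trans _ _ ((a / sC)%:E * K)%E); last by rewrite lte_mul_pinfty// lee_fin.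
  rewrite -Zl//; apply: ge0_integral_mono => y _; rewrite lee_fin.
    rewrite le_min ler01 andbT; change (0 <= a / sC * q y); exact: mulr_ge0.
  by rewrite ge_min lexx.
- have fin x : (mu_W (gW g) x < +oo)%E.
    by apply: le_lt_trans (mu_W_grg x) _; rewrite lte_mul_pinfty// lee_fin.
  split.
    rewrite (_ : _ `&` _ = set0) ?measure0//; apply/seteqP; split => // x [_ /= mx].
    by have := fin x; rewrite mx ltxx.
  pose k : R := fine K + 1.
  have k0 : 0 < k by rewrite ltr_wpDl// fine_ge0.
  have Kk : (K <= k%:E)%E.
    by rewrite /k EFinD fineK ?ge0_fin_numE// leeDl// lee_fin.
  have ik : 0 < k^-1 by rewrite invr_gt0.
  have wt := weight_top_measure w_ge0 L_gt0 rho_vague C0 ik.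
  have mt := measurable_weight_top w_ge0 L_gt0 rho_vague C0 ik.
  apply: (@le_lt_trans _ _ (Lambda (weight_top k^-1 q))); last by rewrite wt ltry.
  apply: le_outer_measure => x [x0 /= mx]; split; first by move: x0; rewrite /= in_itv /= andbT.
  rewrite ltNge; apply/negP => qk; move: mx; rewrite ltNge => /negP; apply.
  apply: le_trans (mu_W_grg x) _.
  apply: (@le_trans _ _ ((k^-1)%:E * k%:E)%E); first by apply: lee_pmul => //; rewrite lee_fin.
  by rewrite -EFinM mulVf// gt_eqF.
- split; last first.
    rewrite (eq_integral (fun=> 0%E)); first by rewrite integral0.
    by move=> x _; rewrite gW_grg eqxx.
  apply: (@le_lt_trans _ _ (\int[Lambda]_(x in Rplus) ((q x)%:E * K))%E).
    set low := \1__; have low01 z : 0 <= low z <= 1 by rewrite /low indicE ler0n lern1 leq_b1.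
    clearbody low.
    have h x y : 0 <= gW g x y * low x * low y <= gW g x y.
      have /andP[g0 g1] := gW_grg01 x y; have /andP[a1 a2] := low01 x; have /andP[b1 b2] := low01 y.
      exact: mulr3_le.
    apply: ge0_integral_mono => x _.
      by apply: integral_ge0 => y _; rewrite lee_fin; have /andP[] := h x y.
    apply: le_trans (mu_W_grg x); apply: ge0_integral_mono => y _; rewrite lee_fin; have /andP[] := h x y => //.
  have -> : (\int[Lambda]_(x in Rplus) ((q x)%:E * K) =
      \int[Lambda]_(x in Rplus) (K * (q x)%:E))%E.
    by apply: eq_integral => x _; rewrite muleC.
  rewrite ge0_integralZl//; last 2 first.
  - exact: mqE.
  - by move=> x _; rewrite lee_fin.
  by rewrite lte_mul_pinfty// ge0_fin_numE.
Qed.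

End graphex.

(** * Reading the hypotheses *)

Lemma limn_esup_lt (R : realType) (u : nat -> \bar R) (c : \bar R) :
  (limn_esup u < c)%E -> \forall n \near \oo, (u n < c)%E.
Proof.
move=> /ereal_inf_lt[_ [V VF <-] sc]; apply: filterS VF => n Vn.
by apply: le_lt_trans sc; apply: ereal_sup_ubound; exists n.
Qed.

Lemma limn_einf_gt (R : realType) (u : nat -> \bar R) (c : \bar R) :
  (c < limn_einf u)%E -> \forall n \near \oo, (c < u n)%E.
Proof.
rewrite -[limn_einf u]/(limf_einf u \oo) limf_einfE => /ereal_sup_gt[_ [V VF <-] sc]; apply: filterS VF => n Vn.
by apply: lt_le_trans sc _; apply: ereal_inf_lbound; exists n.
Qed.

Lemma cvge_near_lt (R : realType) (I : Type) (F : set_system I) (f : I -> \bar R) (l c : \bar R) :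
  f x @[x --> F] --> l -> (l < c)%E -> \forall x \near F, (f x < c)%E.
Proof.
move=> fl lc; have h : nbhs l [set y | (y < c)%E].
  by apply: open_nbhs_nbhs; split; [exact: open_ereal_lt_ereal|].
exact: (fl _ h).
Qed.

Lemma cvge_near_gt (R : realType) (I : Type) (F : set_system I) (f : I -> \bar R) (l c : \bar R) :
  f x @[x --> F] --> l -> (c < l)%E -> \forall x \near F, (c < f x)%E.
Proof.
move=> fl lc; have h : nbhs l [set y | (c < y)%E].
  by apply: open_nbhs_nbhs; split; [exact: open_ereal_gt_ereal|].
exact: (fl _ h).
Qed.

Section hypotheses.
Context (R : realType) (w : nat -> nat -> R).
Hypothesis w_ge0 : forall n i : nat, (i < n)%N -> 0 <= w n i.
Hypothesis L_omega_log : total_weight w n / ln n%:R @[n --> \oo] --> +oo.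

Lemma total_weight_infty (B : R) : \forall n \near \oo, B <= total_weight w n.
Proof.
have l2 : 0 < ln (2 : R) by rewrite ln_gt0// ltr1n.
near=> n; have n2 : (2 <= n)%N by near: n; exact: nbhs_infty_ge.
have ln2 : ln (2 : R) <= ln n%:R.
  by rewrite ler_ln ?posrE ?ltr0n ?ler_nat// ltnW.
have lnn : 0 < ln (n%:R : R) by apply: lt_le_trans ln2.
have h : `|B| / ln 2 <= total_weight w n / ln n%:R.
  by near: n; move/cvgryPge : L_omega_log; apply.
apply: le_trans (ler_norm B) _.
rewrite ler_pdivlMr// in h; apply: le_trans h.
by rewrite -mulrA ler_peMr// ler_pdivlMl ?mulr1.
Unshelve. all: by end_near. Qed.

Lemma total_weight_gt0 : \forall n \near \oo, 0 < total_weight w n.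
Proof. by apply: filterS (total_weight_infty 1) => n; apply: lt_le_trans. Qed.

Lemma sqrt_weight_infty : (Num.sqrt (total_weight w n))^-1 @[n --> \oo] --> (0 : R).
Proof.
apply/cvgrPdist_le => e e0; near=> n; rewrite sub0r normrN ger0_norm ?invr_ge0//.
rewrite -[leRHS]invrK lef_pV2 ?posrE ?invr_gt0//; last first.
  by rewrite sqrtr_gt0; near: n; exact: total_weight_gt0.
have -> : e^-1 = Num.sqrt (e^-1 ^+ 2) by rewrite sqrtr_sqr ger0_norm// invr_ge0 ltW.
by apply: ler_wsqrtr; near: n; exact: total_weight_infty.
Unshelve. all: by end_near. Qed.

Variable a : R.
Hypothesis limsup_small : limn_esup (fun n => \int[rho w n]_(x in `]0%R, eps]) x%:E)%E
     @[eps --> 0^'+] --> a%:E.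
Hypothesis liminf_small : limn_einf (fun n => \int[rho w n]_(x in `]0%R, eps]) x%:E)%E
     @[eps --> 0^'+] --> a%:E.

Lemma small_weights (e : R) : 0 < e -> exists2 del : R, 0 < del &
  forall eps : R, 0 < eps < del -> \forall n \near \oo,
    `|(Num.sqrt (total_weight w n))^-1 *
      (\sum_(i < n | rel_weight w n i <= eps) rel_weight w n i) - a| <= e.
Proof.
move=> e0.
have hs : \forall eps \near (0 : R)^'+,
    (limn_esup (fun n => \int[rho w n]_(x in `]0%R, eps]) x%:E)%E < (a + e)%:E)%E.
  by apply: cvge_near_lt limsup_small _; rewrite lte_fin ltrDl.
have hi : \forall eps \near (0 : R)^'+,
    ((a - e)%:E < limn_einf (fun n => \int[rho w n]_(x in `]0%R, eps]) x%:E)%E)%E.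
  by apply: cvge_near_gt liminf_small _; rewrite lte_fin ltrBlDr ltrDl.
have [del /= del0 hd] : nbhs (0 : R)^'+ _ := filterI hs hi.
exists del => // eps /andP[ep0 ed].
have [|s i] := hd eps _ ep0.
  by rewrite /ball /= sub0r normrN gtr0_norm.
near=> n.
have w0 j : (j < n)%N -> 0 <= w n j by apply: w_ge0.
have : ((\int[rho w n]_(x in `]0%R, eps]) x%:E)%E < (a + e)%:E)%E.
  by near: n; exact: limn_esup_lt.
have : ((a - e)%:E < (\int[rho w n]_(x in `]0%R, eps]) x%:E)%E)%E.
  by near: n; exact: limn_einf_gt.
rewrite rho_mean_small// !lte_fin => h1 h2.
by rewrite ler_distl (ltW h1) (ltW h2).
Unshelve. all: by end_near. Qed.

Lemma small_limit_ge0 : 0 <= a.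
Proof.
rewrite leNgt; apply/negP => a0.
have e0 : 0 < - a / 2 by rewrite divr_gt0// oppr_gt0.
have [del d0 /(_ (del / 2))] := small_weights e0.
rewrite divr_gt0//= gtr_pMr// invf_lt1// ltr1n => /(_ isT) [n _ /(_ n (leqnn n))] /=.
apply/negP; rewrite -ltNge; apply: lt_le_trans (ler_norm _).
have : 0 <= (Num.sqrt (total_weight w n))^-1 *
      (\sum_(i < n | rel_weight w n i <= del / 2) rel_weight w n i).
  rewrite mulr_ge0 ?invr_ge0 ?sqrtr_ge0// sumr_ge0// => i _.
  by apply: rel_weight_ge0 => // j; apply: w_ge0.
lra.
Qed.

Hypothesis liminf_pos : (0 < limn_einf (fun n =>
     \int[rho w n]_(x in `]0%R, +oo[) \int[rho w n]_(y in `]0%R, +oo[)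
       (x * y / (1 + x * y))%:E))%E.

Lemma double_mean_lower : exists2 c : R, 0 < c & \forall n \near \oo, c <= double_mean w n.
Proof.
have [c c0 cl] : exists2 c : R, 0 < c & (c%:E < limn_einf (fun n =>
     \int[rho w n]_(x in `]0%R, +oo[) \int[rho w n]_(y in `]0%R, +oo[)
       (x * y / (1 + x * y))%:E))%E.
  move: liminf_pos; set l := limn_einf _; case: l => [r| |]//.
  - by rewrite lte_fin => r0; exists (r / 2); rewrite ?divr_gt0// lte_fin gtr_pMr// invf_lt1// ltr1n.
  - by move=> _; exists 1; rewrite ?ltry.
exists c => //; near=> n.
have w0 j : (j < n)%N -> 0 <= w n j by apply: w_ge0.
have L0 : 0 < total_weight w n by near: n; exact: total_weight_gt0.
apply/ltW; rewrite -lte_fin -(rho_double_integral w0 L0).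
by near: n; exact: limn_einf_gt.
Unshelve. all: by end_near. Qed.

(** Along a further subsequence twice the number of edges is asymptotic to a
    constant multiple of the total weight; the constant becomes the parameter
    of the limit. *)
Lemma double_mean_subseq (k : nat -> nat) : (forall m, (k m < k m.+1)%N) ->
  exists C : R, exists2 f : nat -> nat, 0 < C /\ (forall j, (f j < f j.+1)%N) &
    double_mean w (k (f j)) @[j --> \oo] --> C.
Proof.
move=> k_incr; have k_ge m : (m <= k m)%N.
  by elim: m => // m IH; apply: leq_trans (k_incr m); rewrite ltnS.
have k_inf : k n @[n --> \oo] --> \oo by apply/cvgnyPge => A; exists A => // n /= /leq_trans; apply.
have [c c0 cl] := double_mean_lower.
pose u m : R := Num.min 1 (Num.max 0 (double_mean w (k m))).
have [f fi fc] : exists2 f : nat -> nat, increasing_seq f & cvgn (u \o f).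
  apply: bolzano_weierstrass; exists 1; split=> // M M1 m _ /=.
  have u0 : 0 <= u m by rewrite le_min ler01 le_max lexx.
  by rewrite ger0_norm//; apply: le_trans (ltW M1); rewrite ge_min lexx.
have f_incr j : (f j < f j.+1)%N by rewrite ltnNge -leEnat fi ltnn.
have f_ge m : (m <= f m)%N.
  by elim: m => // m IH; apply: leq_trans (f_incr m); rewrite ltnS.
have f_inf : k (f n) @[n --> \oo] --> \oo.
  by apply/cvgnyPge => A; exists A => // n /= /leq_trans; apply; apply: leq_trans (k_ge _).
have near_eq : \forall j \near \oo, c <= double_mean w (k (f j)) /\ u (f j) = double_mean w (k (f j)).
  have h1 : \forall j \near \oo, c <= double_mean w (k (f j)) by exact: (f_inf _ cl).
  have h2 : \forall j \near \oo, 0 < total_weight w (k (f j)) by exact: (f_inf _ total_weight_gt0).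
  near=> j; have hc : c <= double_mean w (k (f j)) by near: j.
  split=> //; rewrite /u max_r; last by apply: le_trans hc; apply: ltW.
  by rewrite min_r// double_mean_le1//; near: j.
have cv : double_mean w (k (f j)) @[j --> \oo] --> limn (u \o f).
  apply: cvg_trans fc; apply: near_eq_cvg.
  by apply: filterS near_eq => j [_ /= ->].
exists (limn (u \o f)); exists f => //; split=> //.
apply: lt_le_trans c0 _; apply: (cvgr_to_ge cv).
by apply: filterS near_eq => j [].
Unshelve. all: by end_near. Qed.

End hypotheses.

(** * Laws of unlabeled graphs *)

(** All the values of [unlabel]; [set0], for graphs with infinitely many
    vertices, is the one at [0]. *)
Definition class_enum (n : nat) : ugraph :=
  if n is n'.+1 then
    if unpickle n' : option graph_code is Some c then iso_class (code_graph c) else set0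
  else set0.

Lemma unlabel_enum (V : Type) (adj : V -> V -> Prop) : exists n, unlabel adj = class_enum n.
Proof.
case: (pselect (exists g, unlabel adj g)) => [[g /code_graphP[c cadj]]|none].
  by exists (pickle c).+1; rewrite /class_enum pickleK; exact: unlabel_class.
by exists 0%N; apply/seteqP; split => // g ag; case: none; exists g.
Qed.

(** The law is carried by countably many values, so it is determined by their
    probabilities. *)
Lemma eq_unlabeled_law d (T : measurableType d) (R : realType) (P : probability T R)
    (U V : T -> ugraph) :
  (forall om, exists n, U om = class_enum n) -> (forall om, exists n, V om = class_enum n) ->
  (forall n, measurable [set om | U om = class_enum n]) ->
  (forall n, measurable [set om | V om = class_enum n]) ->
  (forall n, P [set om | U om = class_enum n] = P [set om | V om = class_enum n]) ->
  forall A : set ugraph, P [set om | A (U om)] = P [set om | A (V om)].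
Proof.
move=> Uenum Venum mU mV UV A.
(* Each value is counted at its first occurrence in the enumeration. *)
pose K : set nat := [set n | A (class_enum n) /\
  forall m, (m < n)%N -> class_enum m <> class_enum n].
have first_index (W : T -> ugraph) : (forall om, exists n, W om = class_enum n) ->
    [set om | A (W om)] = \bigcup_(n in K) [set om | W om = class_enum n].
  move=> Wenum; apply/seteqP; split => [om AW|om [n [An _] /= ->//]].
  have ex : exists n, `[< W om = class_enum n >].
    by have [n Wn] := Wenum om; exists n; apply/asboolP.
  exists (ex_minn ex); last by case: ex_minnP => n /asboolP.
  case: ex_minnP => n /asboolP Wn nmin; split; first by rewrite -Wn.
  move=> m mn mE; suff : (n <= m)%N by rewrite leqNgt mn.
    by apply: nmin; apply/asboolP; rewrite Wn mE.
have disj (W : T -> ugraph) : trivIset K (fun n => [set om | W om = class_enum n]).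
  move=> m n [_ Km] [_ Kn] [om [/= -> E]].
  by case: (ltngtP m n) => // h; [case: (Kn _ h)|case: (Km _ h)].
rewrite (first_index _ Uenum) (first_index _ Venum).
rewrite !measure_bigcup//; try exact: disj.
by apply: eq_eseriesr => n _; exact: UV.
Qed.

(** * Almost sure identification of the limit *)

Lemma ae_exists d (T : measurableType d) (R : realType) (P : probability T R) (Q : T -> Prop) :
  {ae P, forall om, Q om} -> exists om, Q om.
Proof.
move=> [N [mN N0 QN]]; case: (pselect (exists om, Q om)) => // none.
have NT : N = setT by apply/seteqP; split => // om _; apply: QN => Qom; case: none; exists om.
have := probability_setT P; rewrite -NT N0 => /eqP.
by rewrite eqe eq_sym oner_eq0.
Qed.

Lemma rational_near (R : realType) (t e : R) : 0 < t -> 0 < e ->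
  exists2 r : rat, 0 < ratr r :> R & `|t ^+ 2 - ratr r ^+ 2| / 2 <= e.
Proof.
move=> t0 e0; pose eta := Num.min 1 (e / (2 * t + 1)).
have d0 : 0 < 2 * t + 1 by rewrite ltr_wpDl// mulr_ge0// ltW.
have eta0 : 0 < eta by rewrite lt_min ltr01 divr_gt0.
have [r] := rat_in_itvoo (ltr_pwDr eta0 (lexx t)).
rewrite in_itv /= => /andP[tr rt].
have r0 : 0 < (ratr r : R) by apply: lt_trans tr.
exists r => //.
have h1 : 0 <= ratr r - t by rewrite subr_ge0 ltW.
have h2 : ratr r - t <= eta by rewrite lerBlDl ltW.
have h3 : ratr r + t <= 2 * t + 1.
  have : eta <= 1 by rewrite ge_min lexx.
  by move: h2; lra.
have h4 : (ratr r - t) * (ratr r + t) <= e.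
  apply: (@le_trans _ _ (eta * (2 * t + 1))); first by rewrite ler_pM// addr_ge0// ltW.
  by rewrite -ler_pdivlMr// ge_min lexx orbT.
rewrite -normrN opprB subr_sqr ger0_norm; last by rewrite mulr_ge0// addr_ge0// ltW.
rewrite ler_pdivrMr//; apply: le_trans h4 _.
by rewrite ler_peMr ?ler1n// ltW.
Qed.

Section identification.
Context (R : realType) (w : nat -> nat -> R) (rho_w : {measure set R -> \bar R}).
Hypothesis w_ge0 : forall n i : nat, (i < n)%N -> 0 <= w n i.
Hypothesis L_gt0 : \forall n \near \oo, 0 < total_weight w n.
Hypothesis rho_vague : vague_cvg (rho w) rho_w.
Hypothesis sqrtL_infty : (Num.sqrt (total_weight w n))^-1 @[n --> \oo] --> (0 : R).
Variables (a C : R).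
Hypothesis a0 : 0 <= a.
Hypothesis low_small : forall e : R, 0 < e -> exists2 del : R, 0 < del &
  forall eps : R, 0 < eps < del -> \forall n \near \oo,
    `|(Num.sqrt (total_weight w n))^-1 *
      (\sum_(i < n | rel_weight w n i <= eps) rel_weight w n i) - a| <= e.
Hypothesis C0 : 0 < C.
Context d (T : measurableType d) (P : probability T R) (G : forall n, T -> rel 'I_n).
Arguments G : clear implicits.
Hypothesis G_grg : grg_sequence P w G.
Variables (k f : nat -> nat).
Hypothesis k_incr : forall m, (k m < k m.+1)%N.
Hypothesis f_incr : forall m, (f m < f m.+1)%N.
Hypothesis double_cvg : double_mean w (k (f j)) @[j --> \oo] --> C.
Hypothesis k_cvg : {ae P, forall om, exists g : graphex_triple R,
  sampling_convergent (fun m => G (k m) om) g}.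
Local Notation N j := (k (f j)).
Local Notation gC := (grg_graphex rho_w a C).
Local Notation x n := (fun i : 'I_n => rel_weight w n i).

Let k_mono m n : (m < n)%N -> (k m < k n)%N.
Proof. exact: (homo_ltn ltn_trans k_incr). Qed.

Let N_incr j : (N j < N j.+1)%N.
Proof. exact: k_mono. Qed.

Let ge_id (h : nat -> nat) : (forall m, (h m < h m.+1)%N) -> forall m, (m <= h m)%N.
Proof. by move=> hi; elim=> // m IH; apply: leq_trans (hi m); rewrite ltnS. Qed.

Let f_infty : f j @[j --> \oo] --> \oo.
Proof. by apply/cvgnyPge => A; exists A => // j /= Aj; apply: leq_trans Aj (ge_id f_incr j). Qed.

Let N_infty : N j @[j --> \oo] --> \oo.
Proof. by apply/cvgnyPge => A; exists A => // j /= Aj; apply: leq_trans Aj (ge_id N_incr j). Qed.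

Let x0 n (i : 'I_n) : 0 <= rel_weight w n i.
Proof. by apply: rel_weight_ge0 => // j; apply: w_ge0. Qed.

Lemma noise_exists (t : R) : 0 < t ->
  exists d' (T' : measurableType d') (P' : probability T' R) (X : gp_noise P' t), True.
Proof.
move=> t0; have [om [g [_ /(_ t t0)[mu [[d' [T' [P' [X _]]]] _]]]]] := ae_exists k_cvg.
by exists d', T', P', X.
Qed.

(** By [limit_lawE] this is the law of the graphex process on any probability
    space; the definition does not refer to one. *)
Definition limit_law (t : R) (A : set ugraph) : R :=
  limn (fun n => annealed (x n) (t / Num.sqrt C / Num.sqrt (total_weight w n)) A).

Lemma limit_lawE d' (T' : measurableType d') (P' : probability T' R) (t : R)
    (X : gp_noise P' t) A : 0 < t -> pr P' (graph_event X gC A) = limit_law t A.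
Proof.
move=> t0; apply/esym/cvg_lim => //.
exact: (annealed_cvg w_ge0 L_gt0 rho_vague C0 sqrtL_infty a0 low_small).
Qed.

Lemma limit_law_ge0 t A : 0 < t -> 0 <= limit_law t A.
Proof.
move=> t0; have [d' [T' [P' [X _]]]] := noise_exists t0.
by rewrite -(limit_lawE X)// pr_ge0.
Qed.

Lemma limit_law_setC t A : 0 < t -> limit_law t (~` A) = 1 - limit_law t A.
Proof.
move=> t0; have [d' [T' [P' [X _]]]] := noise_exists t0.
rewrite -!(limit_lawE X)// -pr_setC//.
exact: (measurable_grg_event w_ge0 L_gt0 rho_vague a C0).
Qed.

Lemma limit_law_cvg t A : 0 < t ->
  emean (x (N j)) (fun e => smpl_at e t A) @[j --> \oo] --> limit_law t A.
Proof.
move=> t0; apply: (emean_cvg w_ge0 L_gt0 sqrtL_infty N_infty C0 t0 double_cvg).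
have [d' [T' [P' [X _]]]] := noise_exists t0.
rewrite -(limit_lawE X)//.
exact: (annealed_cvg w_ge0 L_gt0 rho_vague C0 sqrtL_infty a0 low_small).
Qed.

(** Inherited from the sampling laws by [limit_law_cvg]. *)
Lemma limit_law_lip t t' A : 0 < t -> 0 < t' ->
  `|limit_law t' A - limit_law t A| <= `|t' ^+ 2 - t ^+ 2| / 2.
Proof.
move=> t0 t0'.
have cv : `|emean (x (N j)) (fun e => smpl_at e t' A) - emean (x (N j)) (fun e => smpl_at e t A)|
    @[j --> \oo] --> `|limit_law t' A - limit_law t A|.
  by apply: cvg_norm; apply: cvgB; exact: limit_law_cvg.
apply: (cvgr_to_le cv); apply: nearW => j.
have -> : emean (x (N j)) (fun e => smpl_at e t' A) - emean (x (N j)) (fun e => smpl_at e t A) =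
    emean (x (N j)) (fun e => smpl_at e t' A + -1 * smpl_at e t A).
  by rewrite emeanD emeanZ mulN1r.
apply: le_trans (emean_norm _ _) _; first exact: x0.
rewrite -[leRHS](emean_cst (x (N j))); apply: ler_emean; first exact: x0.
by move=> e se; rewrite mulN1r; apply: smpl_at_lip => //; exact: ltW.
Qed.

Lemma eq_smpl_at n (e e' : rel 'I_n) (t : R) A : e =2 e' -> smpl_at e t A = smpl_at e' t A.
Proof. by move=> ee; have -> : e = e' by apply/funext => i; apply/funext => j. Qed.

Definition class_or_compl n (b : bool) : set ugraph :=
  if b then [set class_enum n] else ~` [set class_enum n].

(** Countably many exceptional events, indexed by a time, a class or its
    complement, a precision and a rank. *)
Definition exceed (z : rat * nat * bool * nat * nat) : set T :=
  let: (r, n, b, p, J) := z in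
  let A := class_or_compl n b in
  if 0 < r then [set om | forall j, (J <= j)%N ->
    limit_law (ratr r) A + p.+1%:R^-1 < smpl_at (G (N j) om) (ratr r) A] else set0.

Lemma measurable_exceed z : measurable (exceed z).
Proof.
case: z => [[[[r n] b] p] J] /=; case: ifP => // _; set A := class_or_compl n b.
apply: (@measurable_forall _ _ _ (fun j => [set om | (J <= j)%N ->
  limit_law (ratr r) A + p.+1%:R^-1 < smpl_at (G (N j) om) (ratr r) A])) => j.
apply: measurable_cond.
apply: (measurable_graph_pred G_grg (S := fun n e => limit_law (ratr r) A + p.+1%:R^-1 < smpl_at e (ratr r) A)).
by move=> m e e' ee; rewrite (eq_smpl_at _ _ ee).
Qed.

Lemma pr_exceed z : pr P (exceed z) = 0.
Proof.
case: z => [[[[r n] b] p] J] /=; case: ifP => [r0|_]; last by rewrite pr_set0.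
have rr0 : 0 < (ratr r : R) by rewrite ltr0q.
set A := class_or_compl n b.
apply: (pr_all_exceed w_ge0 G_grg (N := fun j => N j) (X := fun n e => smpl_at e (ratr r) A)) => //.
- by move=> m e e' ee; exact: eq_smpl_at.
- by move=> m e _; have /andP[] := smpl_law01 e A (smpl_prob01 e (ltW rr0)).
- exact: limit_law_ge0.
- exact: limit_law_cvg.
Qed.

Lemma ae_not_exceed : {ae P, forall om, forall z, ~ exceed z om}.
Proof.
exists [set om | exists z, exceed z om]; split.
- by apply: measurable_exists; exact: measurable_exceed.
- rewrite prE; last by apply: measurable_exists; exact: measurable_exceed.
  by rewrite pr_null_exists//; [exact: measurable_exceed|exact: pr_exceed].
- by move=> om /= /existsNP[z /contrapT]; exists z.
Qed.

Section realization.
Variable om : T.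
Hypothesis not_exceed : forall z, ~ exceed z om.
Variable y : R -> set ugraph -> R.
Hypothesis y_cvg : forall t A, 0 < t -> smpl_at (G (N j) om) t A @[j --> \oo] --> y t A.

Let y_setC t A : 0 < t -> y t (~` A) = 1 - y t A.
Proof.
move=> t0; rewrite -(cvg_lim (@norm_hausdorff _ _) (@y_cvg t (~` A) t0)); apply: cvg_lim => //.
under eq_fun do rewrite /smpl_at smpl_law_setC.
by apply: cvgB; [exact: cvg_cst|exact: y_cvg].
Qed.

Let y_le (r : rat) n (b : bool) : 0 < r ->
  y (ratr r) (class_or_compl n b) <= limit_law (ratr r) (class_or_compl n b).
Proof.
set A := class_or_compl n b => r0; have rr0 : 0 < (ratr r : R) by rewrite ltr0q.
rewrite leNgt; apply/negP => lt.
have [p hp] : exists p : nat, limit_law (ratr r) A + p.+1%:R^-1 < y (ratr r) A.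
  exact: ltr_add_invr.
have [J _ hJ] := cvgr_gt _ (@y_cvg (ratr r) A rr0) _ hp.
apply: (@not_exceed (r, n, b, p, J)); rewrite /= r0 => j Jj; exact: hJ.
Qed.

Let y_rat (r : rat) n : 0 < r ->
  y (ratr r) [set class_enum n] = limit_law (ratr r) [set class_enum n].
Proof.
move=> r0; have rr0 : 0 < (ratr r : R) by rewrite ltr0q.
apply/eqP; rewrite eq_le; have -> /= := y_le n true r0.
by have := y_le n false r0; rewrite /class_or_compl /= y_setC// limit_law_setC// lerD2l lerN2.
Qed.

(** At rational times the limit is at most [limit_law] for the class and for its
    complement, hence equal to it. Both sides are Lipschitz functions of the
    time. *)
Lemma realized_limit t n : 0 < t -> y t [set class_enum n] = limit_law t [set class_enum n].
Proof.
move=> t0; have [_ _ sG] := G_grg; apply/eqP; rewrite -subr_eq0 -normr_eq0 eq_le normr_ge0 andbT.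
apply/ler_addgt0Pl => e e0; rewrite addr0.
have e2 : 0 < e / 2 by rewrite divr_gt0.
have [r r0 tr] := rational_near t0 e2.
set A := [set class_enum n].
have h1 : `|y t A - y (ratr r) A| <= e / 2.
  have cv : `|smpl_at (G (N j) om) t A - smpl_at (G (N j) om) (ratr r) A| @[j --> \oo] -->
      `|y t A - y (ratr r) A|.
    by apply: cvg_norm; apply: cvgB; exact: y_cvg.
  apply: (cvgr_to_le cv); apply: nearW => j; apply: le_trans tr.
  by apply: smpl_at_lip; [have [sg _ _] := G_grg|exact: ltW|exact: ltW].
have h2 : `|limit_law (ratr r) A - limit_law t A| <= e / 2.
  by apply: le_trans tr; rewrite -[X in X / 2]normrN opprB; exact: limit_law_lip.
rewrite -(subrKA (y (ratr r) A)) {2}y_rat; last by rewrite -(ltr0q R).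
by apply: le_trans (ler_normD _ _) _; rewrite [leRHS]splitr lerD.
Qed.

End realization.

(** For a graphex [g] that is the limit of a realization, the laws of its
    process give the same probability as [limit_law] to every class, hence agree
    with those of [gC]. *)
Theorem limit_identified : {ae P, forall om, forall g : graphex_triple R,
  sampling_convergent (fun m => G (k m) om) g -> graphex_equiv g gC}.
Proof.
apply: filterS ae_not_exceed => om not_exceed g [gg conv] t t0.
have [mu [[d' [T' [P' [X muE]]]] mu_cvg]] := conv t t0.
have mgraph d1 (T1 : measurableType d1) (P1 : probability T1 R) s (X1 : gp_noise P1 s) A :
    measurable (graph_event X1 g A).
  by case: gg => [[_ mW] [_ [mS _]] _ _ _]; exact: measurable_graph_event.
have sub d1 (T1 : measurableType d1) (P1 : probability T1 R) s (X1 : gp_noise P1 s) A :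
    (smpl_at (G (k m) om) s A)%:E @[m --> \oo] --> P1 (graph_event X1 g A) ->
    smpl_at (G (N j) om) s A @[j --> \oo] --> pr P1 (graph_event X1 g A).
  rewrite prE; last exact: mgraph.
  by move=> /fine_cvg h; exact: (cvg_comp _ _ f_infty h).
have /choice[y yP] (s : R * set ugraph) : exists y : R, 0 < s.1 ->
    smpl_at (G (N j) om) s.1 s.2 @[j --> \oo] --> y.
  case: s => s A /=; case: (ltP 0 s) => [s0|_]; last by exists 0.
  have [nu [[d1 [T1 [P1 [X1 nuE]]]] nu_cvg]] := conv s s0.
  exists (pr P1 (graph_event X1 g A)) => _; apply: sub.
  by have := nu_cvg A; rewrite nuE.
pose yy s A := y (s, A).
have y_cvg s A : 0 < s -> smpl_at (G (N j) om) s A @[j --> \oo] --> yy s A.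
  by move=> s0; exact: (yP (s, A)).
have mgraphC A : measurable (graph_event X gC A).
  exact: (measurable_grg_event w_ge0 L_gt0 rho_vague a C0).
exists (fun A => P' (graph_event X g A)); split; first by exists d', T', P', X.
exists d', T', P', X => A.
apply: (eq_unlabeled_law (U := fun om' => unlabel (gp_adj X g om'))
   (V := fun om' => unlabel (gp_adj X gC om'))) => [om'|om'|n|n|n].
- exact: unlabel_enum.
- exact: unlabel_enum.
- exact: (mgraph _ _ _ _ X [set class_enum n]).
- exact: (mgraphC [set class_enum n]).
apply: etrans (prE P' (mgraph _ _ _ _ X [set class_enum n])) _.
apply: etrans (esym (prE P' (mgraphC [set class_enum n]))); congr (_%:E).
rewrite limit_lawE// -(realized_limit not_exceed y_cvg _ t0).
rewrite -(cvg_lim (@norm_hausdorff _ _) (y_cvg t [set class_enum n] t0)).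
apply/esym/cvg_lim => //; apply: sub.
by have := mu_cvg [set class_enum n]; rewrite muE.
Qed.

End identification.

Theorem corollary1p8 (R : realType)
  (w : nat -> nat -> R)
  (w_ge0 : forall n i : nat, (i < n)%N -> 0 <= w n i)
  (L_omega_log : total_weight w n / ln n%:R @[n --> \oo] --> +oo)
  (rho_w : {measure set R -> \bar R})
  (rho_w_pos : rho_w `]-oo, 0]%classic = 0%E)
  (rho_vague : vague_cvg (rho w) rho_w)
  (a : R)
  (limsup_small : limn_esup (fun n => \int[rho w n]_(x in `]0%R, eps]) x%:E)%E
     @[eps --> 0^'+] --> a%:E)
  (liminf_small : limn_einf (fun n => \int[rho w n]_(x in `]0%R, eps]) x%:E)%E
     @[eps --> 0^'+] --> a%:E)
  (liminf_pos : (0 < limn_einf (fun n =>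
     \int[rho w n]_(x in `]0%R, +oo[) \int[rho w n]_(y in `]0%R, +oo[)
       (x * y / (1 + x * y))%:E))%E)
  (d : measure_display) (T : measurableType d) (P : probability T R)
  (G : forall n : nat, T -> rel 'I_n)
  (G_grg : grg_sequence P w G)
  (k : nat -> nat)
  (k_incr : forall m : nat, (k m < k m.+1)%N)
  (k_cvg : {ae P, forall omega, exists g : graphex_triple R,
     sampling_convergent (fun m => G (k m) omega) g}) :
  exists C : R, [/\ 0 < C,
    is_graphex (grg_graphex rho_w a C) &
    {ae P, forall omega, forall g : graphex_triple R,
       sampling_convergent (fun m => G (k m) omega) g ->
       graphex_equiv g (grg_graphex rho_w a C)}].
Proof.
have L_gt0 := total_weight_gt0 L_omega_log.
have sqrtL := sqrt_weight_infty L_omega_log.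
have small := small_weights w_ge0 limsup_small liminf_small.
have a0 := small_limit_ge0 w_ge0 limsup_small liminf_small.
have [C [f [C0 f_incr] C_cvg]] := double_mean_subseq w_ge0 L_omega_log liminf_pos k_incr.
exists C; split=> //.
  exact: (grg_is_graphex w_ge0 L_gt0 rho_vague C0 a0).
exact: (limit_identified w_ge0 L_gt0 rho_vague sqrtL a0 small C0 G_grg k_incr f_incr C_cvg k_cvg).
Qed.
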